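(* Let $1\le p\le2$, and suppose that either $q=1$ and $s\ge0$, or $1<q\le p'$ and $s>n/q'$. Let $\mathcal I_F$ be the set of all closed ideals in $\mathcal{F}L^q_s(\mathbb{R}^n)$ and $\mathcal I_M$ the set of all closed ideals in $M^{p,q}_s(\mathbb{R}^n)$. Then the map $\iota:\mathcal I_F\to\mathcal I_M$, $\iota(I_F)=I_F\cap M^{p,q}_s(\mathbb{R}^n)$, is well defined and bijective, with inverse $\iota^{-1}(I_M)=\overline{I_M}$, the closure of $I_M$ in $\mathcal{F}L^q_s(\mathbb{R}^n)$; in particular $\overline{I_M}\cap M^{p,q}_s(\mathbb{R}^n)=I_M$ for every $I_M\in\mathcal I_M$.
   Context: $p',q'$ are conjugate exponents; $\langle x\rangle=(1+|x|^2)^{1/2}$; $\hat f(\xi)=\int f(x)e^{-ix\cdot\xi}dx$. $\mathcal{F}L^q_s(\mathbb{R}^n)$: tempered distributions $f$ with $\|f\|_{\mathcal{F}L^q_s}=\big(\int(\langle\xi\rangle^s|\hat f(\xi)|)^q d\xi\big)^{1/q}<\infty$. Fix $\varphi\in\mathcal S(\mathbb{R}^n)$ with $\operatorname{supp}\varphi\subset[-1,1]^n$ and $\sum_{k\in\mathbb{Z}^n}\varphi(\xi-k)=1$; $\varphi(D-k)f=\mathcal F^{-1}(\varphi(\cdot-k)\hat f)$; $M^{p,q}_s(\mathbb{R}^n)$: tempered distributions $f$ with $\|f\|_{M^{p,q}_s}=\big(\sum_{k}\langle k\rangle^{sq}\|\varphi(D-k)f\|_{L^p}^q\big)^{1/q}<\infty$.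 Under the stated conditions both are Banach algebras of continuous functions under pointwise multiplication and $M^{p,q}_s\subset\mathcal{F}L^q_s$ continuously. An ideal of an algebra $X$ is a linear subspace $I$ with $fg\in I$ for $f\in X$, $g\in I$; a closed ideal is an ideal closed in $X$.
   Formalization: The exponent q is taken finite: for p=1 the range 1<q≤p' would literally allow q=∞, where the norms as written are undefined and, with the supremum convention, the closure of M^{1,∞}_s in FL^∞_s is not all of FL^∞_s, so the claim fails. *)

(* Defs.v *)
From HB Require Import structures.
From mathcomp Require Import all_boot all_order all_algebra.
From mathcomp Require Import all_classical all_reals all_analysis.
From mathcomp Require Import complex.
Set Implicit Arguments.
Unset Strict Implicit.
Unset Printing Implicit Defensive.
Import Order.TTheory GRing.Theory Num.Theory.
Import numFieldNormedType.Exports.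
Local Open Scope classical_set_scope.
Local Open Scope ring_scope.
Local Open Scope complex_scope.

Section FourierDefs.
Variable R : realType.
Local Notation C := R[i].

Definition dotp n (x y : 'rV[R]_n) : R := \sum_(j < n) x ord0 j * y ord0 j.

Definition jbr n (x : 'rV[R]_n) : R := Num.sqrt (1 + \sum_(j < n) x ord0 j ^+ 2).

Definition cabs (z : C) : R := Num.sqrt (complex.Re z ^+ 2 + complex.Im z ^+ 2).

Definition cexpi (t : R) : C := (cos t +i* sin t)%C.

(* Lebesgue integral on R^n of a nonnegative function, computed as the
   iterated one-dimensional Lebesgue integral (equal to the integral w.r.t.
   n-dimensional Lebesgue measure for measurable functions, by Tonelli). *)
Fixpoint intn (n : nat) : ('rV[R]_n -> \bar R) -> \bar R :=
  match n with
  | 0 => fun f => f 0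
  | m.+1 => fun f =>
      (\int[@lebesgue_measure R]_x intn (fun t : 'rV[R]_m =>
                                       f (row_mx (\row_(_ < 1) x) t)))%E
  end.

Definition rint n (f : 'rV[R]_n -> R) : R :=
  fine (intn (fun x => (Num.max (f x) 0)%:E)) -
  fine (intn (fun x => (Num.max (- f x) 0)%:E)).

Definition cint n (f : 'rV[R]_n -> C) : C :=
  (rint (fun x => complex.Re (f x)) +i* rint (fun x => complex.Im (f x)))%C.

(* Borel measurability of a complex function on R^n (via the canonical
   product sigma-algebra on n-tuples of reals) *)
Definition row_of_tuple n (t : n.-tuple R) : 'rV[R]_n := \row_(j < n) tnth t j.
Definition cmeasurable n (g : 'rV[R]_n -> C) : Prop :=
  measurable_fun [set: n.-tuple R] (fun t => complex.Re (g (row_of_tuple t))) /\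
  measurable_fun [set: n.-tuple R] (fun t => complex.Im (g (row_of_tuple t))).

(* inverse Fourier transform (for hat f(xi) = int f(x) e^{-i x.xi} dx) *)
Definition invFT n (g : 'rV[R]_n -> C) : 'rV[R]_n -> C :=
  fun x => ((2 * pi) `^ (- n%:R))%:C * cint (fun xi => g xi * cexpi (dotp x xi)).

Definition FLint n (q s : R) (g : 'rV[R]_n -> C) : \bar R :=
  intn (fun xi => ((jbr xi `^ s * cabs (g xi)) `^ q)%:E).

(* g is (a representative of) the Fourier transform of f, and lies in the
   weighted L^q space; f = F^{-1} g. *)
Definition FLrep n (q s : R) (f g : 'rV[R]_n -> C) : Prop :=
  [/\ cmeasurable g, (FLint q s g < +oo)%E & forall x, f x = invFT g x].

Definition FL n (q s : R) : set ('rV[R]_n -> C) :=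
  [set f | exists g, FLrep q s f g].

Definition FLsmall n (q s : R) (u : 'rV[R]_n -> C) (eps : R) : Prop :=
  exists g, FLrep q s u g /\ (FLint q s g < (eps `^ q)%:E)%E.

Definition epow (x : \bar R) (r : R) : \bar R :=
  match x with EFin y => (y `^ r)%:E | _ => +oo%E end.

Definition intvec n (k : 'rV[int]_n) : 'rV[R]_n := map_mx (fun z : int => z%:~R) k.

(* phi(D - k) f = F^{-1}(phi(. - k) hat f), with hat f = g *)
Definition locFT n (phi : 'rV[R]_n -> C) (g : 'rV[R]_n -> C) (k : 'rV[int]_n) :
  'rV[R]_n -> C := invFT (fun xi => phi (xi - intvec k) * g xi).

Definition Msum n (p q s : R) (phi g : 'rV[R]_n -> C) : \bar R :=
  (\esum_(k in [set: 'rV[int]_n])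
     ((jbr (intvec k) `^ (s * q))%:E *
      epow (intn (fun x => (cabs (locFT phi g k x) `^ p)%:E)) (q / p)))%E.

Definition Mod n (p q s : R) (phi : 'rV[R]_n -> C) : set ('rV[R]_n -> C) :=
  [set f | exists g, FLrep q s f g /\ (Msum p q s phi g < +oo)%E].

Definition Msmall n (p q s : R) (phi : 'rV[R]_n -> C) (u : 'rV[R]_n -> C)
  (eps : R) : Prop :=
  exists g, FLrep q s u g /\ (Msum p q s phi g < (eps `^ q)%:E)%E.

Fixpoint iterD n (vs : seq 'rV[R]_n) (f : 'rV[R]_n -> R) : 'rV[R]_n -> R :=
  match vs with
  | [::] => f
  | v :: vs' => fun x => 'D_v (iterD vs' f) x
  end.
Definition smooth n (f : 'rV[R]_n -> R) : Prop :=
  forall (vs : seq 'rV[R]_n) (x : 'rV[R]_n), differentiable (iterD vs f) x.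

(* admissible window: phi in S(R^n) (smooth, supp phi in [-1,1]^n, hence
   Schwartz) with sum_k phi(xi - k) = 1 (a locally finite sum) *)
Definition window n (phi : 'rV[R]_n -> C) : Prop :=
  [/\ smooth (fun x => complex.Re (phi x)), smooth (fun x => complex.Im (phi x)),
      (forall xi : 'rV[R]_n, (exists j, 1 < `|xi ord0 j|) -> phi xi = 0) &
      (forall xi : 'rV[R]_n,
          (\sum_(k \in [set: 'rV[int]_n]) phi (xi - intvec k)) = 1)].

Definition is_ideal n (X I : set ('rV[R]_n -> C)) : Prop :=
  [/\ I `<=` X, I (fun _ => 0),
      (forall u v, I u -> I v -> I (fun x => u x + v x)),
      (forall (c : C) u, I u -> I (fun x => c * u x)) &
      (forall f g, X f -> I g -> I (fun x => f x * g x))].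

Definition closure_in n (small : ('rV[R]_n -> C) -> R -> Prop)
  (X I : set ('rV[R]_n -> C)) : set ('rV[R]_n -> C) :=
  [set f | X f /\ forall eps : R, 0 < eps ->
                  exists h, I h /\ small (fun x => f x - h x) eps].

Definition closed_ideal n (small : ('rV[R]_n -> C) -> R -> Prop)
  (X I : set ('rV[R]_n -> C)) : Prop :=
  is_ideal X I /\ closure_in small X I `<=` I.

End FourierDefs.

(* Main.v *)
Require Import Defs.
From HB Require Import structures.
From mathcomp Require Import all_boot all_order all_algebra.
From mathcomp Require Import all_classical all_reals all_analysis measurable_realfun.
From mathcomp Require Import complex.
From mathcomp Require Import ring lra zify.
Set Implicit Arguments.
Unset Strict Implicit.
Unset Printing Implicit Defensive.
Import Order.TTheory GRing.Theory Num.Theory.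
Import numFieldNormedType.Exports.
Local Open Scope classical_set_scope.
Local Open Scope ring_scope.

(** Every element [f = invFT g] is handled through [g], so that pointwise products
    become convolutions of transforms. Let [e_N] be the inverse transform of the
    bump [kap N], which shrinks to the origin with total mass one. Multiplication
    by [e_N] sends [f] to functions converging to [f] in the Fourier-Lebesgue norm
    and, if [f] lies in the modulation space, also in the modulation norm. For a
    fixed [N], since [e_N] is a rapidly decreasing function with compactly supported
    transform, multiplication by [e_N] is bounded from the Fourier-Lebesgue norm to
    the modulation norm (near [k] the L^p norm of the product is bounded by the L^1
    norm of [g] on cubes near [k]) and from the modulation norm to the
    Fourier-Lebesgue norm (near [k] the transform of the product is bounded in
    supremum by the L^p norms of the localizations of [f] near [k]); the latter
    replaces the Hausdorff-Young inequality. So if [h] in an ideal is close to [f]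
    in one norm, then [h e_N] is in the same ideal and close to [f e_N] in the other
    one, and [f e_N] is close to [f]. *)

(** * Lebesgue measure on row vectors *)

(** The order of the choices matters. The bounds between the two norms have constants that depend on
    [N], so where the norm changes, [N] is fixed by [f] alone and [h] is taken afterwards. An ideal
    of the modulation space is stable only under multipliers from that space; to multiply its
    closure by an arbitrary [f] of the larger algebra, [f] is replaced by [f e_N], and there [N] is
    chosen after [h]. That [f e_N] lies in the modulation space is an instance of a fact stronger
    than the algebra property: the modulation space is a module over the Fourier-Lebesgue algebra.
    Norms are handled through their [q]-th powers, with a triangle inequality up to the factor
    [2^q]. Smallness is asked of some representative [g], and each estimate exhibits a
    representative of the new function. The convergence of [f e_N] to [f] in the Fourier-Lebesgue
    norm is carried from half-open boxes to all elements by a Dynkin class and truncation. Decay and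
    inversion of the transform are derived for smooth functions of compact support, from finite
    differences and Fubini, with an unevaluated nonzero constant. *)

Definition row_display : measure_display.
Proof. exact: default_measure_display. Qed.

Section RowMeasurable.
Variables (R : realType) (n : nat).

Let mrow : set (set 'rV[R]_n) :=
  [set A | measurable (@row_of_tuple R n @^-1` A)].

Let mrow0 : mrow set0.
Proof. by rewrite /mrow /= preimage_set0. Qed.

Let mrowC A : mrow A -> mrow (~` A).
Proof. by rewrite /mrow /= preimage_setC; exact: measurableC. Qed.

Let mrow_bigcup (F : (set 'rV[R]_n)^nat) :
  (forall i, mrow (F i)) -> mrow (\bigcup_i F i).
Proof.
by move=> mF; rewrite /mrow /= preimage_bigcup; exact: bigcupT_measurable.
Qed.

HB.instance Definition _ := @isMeasurable.Build row_display 'rV[R]_n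
  mrow mrow0 mrowC mrow_bigcup.

End RowMeasurable.

Section RowMeasurableTheory.
Variable R : realType.

Lemma measurable_row_of_tuple n :
  measurable_fun [set: n.-tuple R] (@row_of_tuple R n).
Proof. by move=> _ A mA; rewrite setTI. Qed.

Lemma measurable_coord n (i : 'I_n) :
  measurable_fun [set: 'rV[R]_n] (fun x => x ord0 i).
Proof.
move=> _ A mA; rewrite setTI /measurable /=.
have := @measurable_tnth _ R n i measurableT A mA; rewrite setTI.
by congr measurable; apply/seteqP; split => t /=; rewrite mxE.
Qed.

Lemma measurable_rowP d (T : measurableType d) n (f : T -> 'rV[R]_n) :
  measurable_fun setT f <->
  forall i, measurable_fun setT (fun x => f x ord0 i).
Proof.
split=> [mf i|mf].
  by apply: (@measurableT_comp _ _ _ _ _ _ (fun x : 'rV[R]_n => x ord0 i)) => //;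
    exact: measurable_coord.
have mt : measurable_fun setT (fun x => [tuple f x ord0 i | i < n]).
  apply/measurable_fun_tnthP => i.
  rewrite (_ : _ \o _ = fun x => f x ord0 i)//.
  by apply/funext => x /=; rewrite tnth_mktuple.
have -> : f = @row_of_tuple R n \o (fun x => [tuple f x ord0 i | i < n]).
  by apply/funext => x; apply/rowP => i; rewrite !mxE tnth_mktuple.
by apply: measurableT_comp => //; exact: measurable_row_of_tuple.
Qed.

Lemma measurable_tuple_of_row d (T : measurableType d) n (f : 'rV[R]_n -> T) :
  measurable_fun setT f <-> measurable_fun setT (f \o @row_of_tuple R n).
Proof.
split=> mf; first by apply: measurableT_comp => //; exact: measurable_row_of_tuple.
by move=> _ A mA; have := mf measurableT A mA; rewrite !setTI.
Qed.

Lemma measurable_rowD d (T : measurableType d) n (f g : T -> 'rV[R]_n) :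
  measurable_fun setT f -> measurable_fun setT g ->
  measurable_fun setT (fun x => f x + g x).
Proof.
move=> /measurable_rowP mf /measurable_rowP mg; apply/measurable_rowP => i.
by under eq_fun do rewrite mxE; apply: measurable_realfun.measurable_funD.
Qed.

Lemma measurable_rowN d (T : measurableType d) n (f : T -> 'rV[R]_n) :
  measurable_fun setT f -> measurable_fun setT (fun x => - f x).
Proof.
move=> /measurable_rowP mf; apply/measurable_rowP => i.
by under eq_fun do rewrite mxE; apply: measurableT_comp.
Qed.

Lemma measurable_rowB d (T : measurableType d) n (f g : T -> 'rV[R]_n) :
  measurable_fun setT f -> measurable_fun setT g ->
  measurable_fun setT (fun x => f x - g x).
Proof. by move=> mf mg; apply: measurable_rowD => //; exact: measurable_rowN. Qed.

Lemma measurable_rowZ d (T : measurableType d) n (c : R) (f : T -> 'rV[R]_n) :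
  measurable_fun setT f -> measurable_fun setT (fun x => c *: f x).
Proof.
move=> /measurable_rowP mf; apply/measurable_rowP => i.
by under eq_fun do rewrite mxE; apply: measurable_funM.
Qed.

Lemma measurable_dotp d (T : measurableType d) n (f g : T -> 'rV[R]_n) :
  measurable_fun setT f -> measurable_fun setT g ->
  measurable_fun setT (fun x => dotp (f x) (g x)).
Proof.
move=> /measurable_rowP mf /measurable_rowP mg.
by apply: measurable_sum => i; apply: measurable_funM.
Qed.

Definition rowcons m (p : R * 'rV[R]_m) : 'rV[R]_m.+1 :=
  row_mx (\row_(_ < 1) p.1) p.2.

Lemma measurable_rowcons m :
  measurable_fun [set: measurableTypeR R * 'rV[R]_m] (@rowcons m).
Proof.
apply/measurable_rowP => i.
have [j ij|j ij] := @splitP 1 m i.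
  have -> : (fun x : R * 'rV[R]_m => rowcons x ord0 i) = fst.
    apply/funext => x; have -> : i = lshift m j by exact/val_inj.
    by rewrite /rowcons (@row_mxEl _ 1 1 m) mxE.
  exact: measurable_fst.
have -> : (fun x : R * 'rV[R]_m => rowcons x ord0 i) = (fun x => x.2 ord0 j).
  apply/funext => x; have -> : i = rshift 1 j by exact/val_inj.
  by rewrite /rowcons (@row_mxEr _ 1 1 m).
by apply: (@measurableT_comp _ _ _ _ _ _ (fun x : 'rV[R]_m => x ord0 j)) => //;
  exact: measurable_coord.
Qed.

Definition rowuncons m (x : 'rV[R]_m.+1) : R * 'rV[R]_m :=
  (x ord0 ord0, \row_(j < m) x ord0 (rshift 1 j)).

Lemma measurable_rowuncons m : measurable_fun setT (@rowuncons m).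
Proof.
apply/measurable_fun_pairP; split; first exact: measurable_coord.
apply/measurable_rowP => i; rewrite /comp /rowuncons /=.
by under eq_fun do rewrite mxE; exact: measurable_coord.
Qed.

Lemma rowcons0 m (p : R * 'rV[R]_m) : rowcons p ord0 ord0 = p.1.
Proof.
rewrite /rowcons; have -> : @ord0 m = lshift m (@ord0 0) by exact/val_inj.
by rewrite (@row_mxEl _ 1 1 m) mxE.
Qed.

Lemma rowconsS m (p : R * 'rV[R]_m) (j : 'I_m) :
  rowcons p ord0 (rshift 1 j) = p.2 ord0 j.
Proof. by rewrite /rowcons (@row_mxEr _ 1 1 m). Qed.

Lemma ordS_cases m (i : 'I_m.+1) : i = ord0 \/ exists j : 'I_m, i = rshift 1 j.
Proof.
have [j ij|j ij] := @splitP 1 m i; [left|right; exists j]; apply/val_inj => //=.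
by rewrite ij ord1.
Qed.

Lemma rowconsK m : cancel (@rowcons m) (@rowuncons m).
Proof.
move=> [x t]; rewrite /rowuncons rowcons0; congr pair.
by apply/rowP => j; rewrite mxE rowconsS.
Qed.

Lemma rowunconsK m : cancel (@rowuncons m) (@rowcons m).
Proof.
move=> y; apply/rowP => i; have [->|[j ->]] := ordS_cases i.
  by rewrite rowcons0.
by rewrite rowconsS mxE.
Qed.

End RowMeasurableTheory.

Local Open Scope ereal_scope.

Section SigmaFinitePack.
Context d (T : measurableType d) (R : realType).
Variables (nu : {measure set T -> \bar R}) (nu_sf : sigma_finite setT nu).

(** The proof of sigma-finiteness is made an argument, so that the instance declared below can read
    it off the term itself. *)
Definition sf_pack (_ : sigma_finite setT nu) : set T -> \bar R := nu.
HB.instance Definition _ := Measure.on (sf_pack nu_sf).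
HB.instance Definition _ :=
  Measure_isSigmaFinite.Build _ _ _ (sf_pack nu_sf) nu_sf.

End SigmaFinitePack.

(** Induction on the dimension: the measure in dimension [m + 1] is the image under [rowcons] of the
    product of the one-dimensional Lebesgue measure with the measure in dimension [m], and Tonelli
    unfolds it into the recursion that defines [intn]. Dimension 0 carries the Dirac mass. Having an
    actual measure makes Hoelder, Fubini and dominated convergence available for [intn]. *)
Lemma ex_leb (R : realType) n :
  exists mu : {sigma_finite_measure set 'rV[R]_n -> \bar R},
  forall f : 'rV[R]_n -> \bar R, measurable_fun setT f -> (forall x, 0 <= f x) ->
    intn f = \int[mu]_x f x.
Proof.
elim: n => [|m [mu IH]].
  exists (@dirac _ 'rV[R]_0 0%R R) => f mf f0.
  by rewrite integral_dirac// diracT mul1e.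
have mrc := @measurable_rowcons R m.
pose P : {measure set (measurableTypeR R * 'rV[R]_m)%type -> \bar R} :=
  (@lebesgue_measure R \x mu)%E.
pose nu0 := (pushforward P (@rowcons R m) : {measure set 'rV[R]_m.+1 -> \bar R}).
pose nu : {measure set 'rV[R]_m.+1 -> \bar R} := nu0 mrc.
have sf : sigma_finite setT nu.
  have /sigma_finiteP[F [TF ndF Foo]] := sigma_finiteT (@lebesgue_measure R).
  have /sigma_finiteP[G [TG ndG Goo]] := sigma_finiteT mu.
  exists (fun k => @rowuncons R m @^-1` (F k `*` G k)).
    rewrite -preimage_bigcup (_ : \bigcup_k _ = setT) ?preimage_setT//.
    rewrite -setXTT TF TG predeqE => -[x y]; split.
      by move=> [k _ []/= ? ?]; split; exists k.
    move=> [/= [k _ Fkx] [l _ Gly]]; exists (maxn k l) => //; split.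
    - by move: x Fkx; exact/subsetPset/ndF/leq_maxl.
    - by move: y Gly; exact/subsetPset/ndG/leq_maxr.
  move=> k; have [mFk Fkoo] := Foo k; have [mGk Gkoo] := Goo k.
  have mFG : measurable (F k `*` G k) by exact: measurableX.
  split.
    by rewrite -[X in measurable X]setTI; exact: measurable_rowuncons.
  rewrite /nu /nu0 /= /pushforward -comp_preimage.
  rewrite (_ : _ @^-1` _ = F k `*` G k); last by
    rewrite (_ : _ \o _ = id)//; apply/funext => x; exact: rowconsK.
  by rewrite /P /= product_measure1E// lte_mul_pinfty// ge0_fin_numE.
exists (sf_pack sf) => f mf f0.
rewrite /sf_pack (@ge0_integral_pushforward _ _ _ _ _ _ mrc P)//.
rewrite preimage_setT /P (@fubini_tonelli1 _ _ _ _ _ lebesgue_measure mu)//; last first.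
- by move=> x /=.
- exact: measurableT_comp.
rewrite /fubini_F /=; apply: eq_integral => x _; rewrite IH => [|//|t]; last exact: f0.
- by [].
- apply: (measurableT_comp mf).
  exact: (measurableT_comp mrc (@pair1_measurable _ _ (measurableTypeR R) 'rV[R]_m x)).
Qed.

(* The sigma-finite measure against which the iterated integral [intn] integrates. *)
Definition leb (R : realType) n : {sigma_finite_measure set 'rV[R]_n -> \bar R} :=
  sval (cid (ex_leb R n)).

Lemma intnE (R : realType) n (f : 'rV[R]_n -> \bar R) :
  measurable_fun setT f -> (forall x, 0 <= f x) -> intn f = \int[leb R n]_x f x.
Proof. exact: (svalP (cid (ex_leb R n))). Qed.

Lemma intn_eq (R : realType) n (f g : 'rV[R]_n -> \bar R) :
  f =1 g -> intn f = intn g.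
Proof. by move=> /funext ->. Qed.

Local Close Scope ereal_scope.

(** * Complex-valued integrals *)

Section ComplexModulus.
Variable R : realType.
Implicit Types z w : R[i].

Lemma cabs_normc z : cabs z = ComplexField.Normc.normc z.
Proof. by case: z. Qed.

Lemma cabs_ge0 z : 0 <= cabs z.
Proof. exact: sqrtr_ge0. Qed.

Lemma cabsM z w : cabs (z * w) = cabs z * cabs w.
Proof. by rewrite !cabs_normc ComplexField.Normc.normcM. Qed.

Lemma cabsD z w : cabs (z + w) <= cabs z + cabs w.
Proof. by rewrite !cabs_normc; exact: le_normcD. Qed.

Lemma cabsN z : cabs (- z) = cabs z.
Proof. by case: z => a b; rewrite /cabs /= !sqrrN. Qed.

Lemma cabsB z w : cabs (z - w) <= cabs z + cabs w.
Proof. by rewrite -(cabsN w); exact: cabsD. Qed.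

Lemma cabs0 : cabs (0 : R[i]) = 0.
Proof. by rewrite cabs_normc ComplexField.Normc.normc0. Qed.

Lemma cabs1 : cabs (1 : R[i]) = 1.
Proof. by rewrite cabs_normc ComplexField.Normc.normc1. Qed.

Lemma cabs_eq0 z : cabs z = 0 -> z = 0.
Proof. by rewrite cabs_normc => /ComplexField.Normc.eq0_normc. Qed.

Lemma cabs_real (r : R) : cabs r%:C%C = `|r|.
Proof. by rewrite /cabs /= expr0n addr0 sqrtr_sqr. Qed.

Lemma Re_le_cabs z : `|complex.Re z| <= cabs z.
Proof. by rewrite -sqrtr_sqr ler_wsqrtr// lerDl sqr_ge0. Qed.

Lemma Im_le_cabs z : `|complex.Im z| <= cabs z.
Proof. by rewrite -sqrtr_sqr ler_wsqrtr// lerDr sqr_ge0. Qed.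

Lemma cabs_le z : cabs z <= `|complex.Re z| + `|complex.Im z|.
Proof.
have h : 0 <= `|complex.Re z| + `|complex.Im z| by rewrite addr_ge0.
rewrite /cabs -[leRHS](ger0_norm h) -[leRHS]sqrtr_sqr ler_wsqrtr//.
rewrite sqrrD !real_normK ?num_real// addrAC lerDl.
by rewrite mulrn_wge0// mulr_ge0.
Qed.

Lemma cabs_cexpi (t : R) : cabs (cexpi t) = 1.
Proof. by rewrite /cabs /= cos2Dsin2 sqrtr1. Qed.

Lemma cexpiD (s t : R) : cexpi (s + t) = cexpi s * cexpi t.
Proof. by rewrite /cexpi cosD sinD; simpc; congr (_ +i* _)%C; rewrite addrC. Qed.

Lemma cexpi0 : cexpi (0 : R) = 1.
Proof. by rewrite /cexpi cos0 sin0. Qed.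

Lemma cReM z w : complex.Re (z * w) =
  complex.Re z * complex.Re w - complex.Im z * complex.Im w.
Proof. by case: z => a b; case: w => c d. Qed.

Lemma cImM z w : complex.Im (z * w) =
  complex.Re z * complex.Im w + complex.Im z * complex.Re w.
Proof. by case: z => a b; case: w => c d. Qed.

Lemma complex_eq z w : complex.Re z = complex.Re w ->
  complex.Im z = complex.Im w -> z = w.
Proof. by case: z => a b; case: w => c d /= -> ->. Qed.

End ComplexModulus.

Section RealIntegrals.
Context d (T : measurableType d) (R : realType) (mu : {measure set T -> \bar R}).
Implicit Types h k : T -> R.
Local Open Scope ereal_scope.

Lemma ge0Z c h : measurable_fun setT h -> (forall x, 0 <= h x)%R -> (0 <= c)%R ->
  \int[mu]_x (c * h x)%:E = c%:E * \int[mu]_x (h x)%:E.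
Proof.
move=> mh h0 c0; under eq_integral do rewrite EFinM.
rewrite (@ge0_integralZl _ _ _ mu _ measurableT (EFin \o h))//.
- exact/measurable_EFinP.
- by move=> x _; rewrite lee_fin.
Qed.

Lemma ge0D h k : measurable_fun setT h -> measurable_fun setT k ->
  (forall x, 0 <= h x)%R -> (forall x, 0 <= k x)%R ->
  \int[mu]_x (h x + k x)%:E = \int[mu]_x (h x)%:E + \int[mu]_x (k x)%:E.
Proof.
move=> mh mk h0 k0; under eq_integral do rewrite EFinD.
rewrite (@ge0_integralD _ _ _ mu _ measurableT (EFin \o h) (EFin \o k))//.
- by move=> x _; rewrite lee_fin.
- exact/measurable_EFinP.
- by move=> x _; rewrite lee_fin.
- exact/measurable_EFinP.
Qed.

Lemma ge0le h k : measurable_fun setT h -> measurable_fun setT k ->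
  (forall x, 0 <= h x)%R -> (forall x, h x <= k x)%R ->
  \int[mu]_x (h x)%:E <= \int[mu]_x (k x)%:E.
Proof.
move=> mh mk h0 hk; apply: ge0_le_integral => //.
- by move=> x _; rewrite lee_fin.
- exact/measurable_EFinP.
- exact/measurable_EFinP.
- by move=> x _; rewrite lee_fin.
Qed.

Lemma integral_real_ge0 h : (forall x, 0 <= h x)%R -> 0 <= \int[mu]_x (h x)%:E.
Proof. by move=> h0; apply: integral_ge0 => x _; rewrite lee_fin. Qed.

End RealIntegrals.

Section ComplexIntegral.
Context d (T : measurableType d) (R : realType).
Implicit Types (f g : T -> R[i]) (mu : {measure set T -> \bar R}).

Definition cmeas f := measurable_fun setT (fun x => complex.Re (f x)) /\
  measurable_fun setT (fun x => complex.Im (f x)).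

Definition cinteg mu f := cmeas f /\ (\int[mu]_x (cabs (f x))%:E < +oo)%E.

Definition CI mu f : R[i] :=
  ((\int[mu]_x complex.Re (f x)) +i* (\int[mu]_x complex.Im (f x)))%C.

Lemma cmeas_cst (c : R[i]) : cmeas (fun=> c).
Proof. by split; exact: measurable_cst. Qed.

Lemma cmeasD f g : cmeas f -> cmeas g -> cmeas (fun x => f x + g x).
Proof.
move=> [f1 f2] [g1 g2]; split.
  by under eq_fun do rewrite raddfD /=; exact: measurable_funD.
by under eq_fun do rewrite raddfD /=; exact: measurable_funD.
Qed.

Lemma cmeasN f : cmeas f -> cmeas (fun x => - f x).
Proof.
move=> [f1 f2]; split.
  by under eq_fun do rewrite raddfN /=; exact: measurableT_comp.
by under eq_fun do rewrite raddfN /=; exact: measurableT_comp.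
Qed.

Lemma cmeasB f g : cmeas f -> cmeas g -> cmeas (fun x => f x - g x).
Proof. by move=> mf mg; apply: cmeasD => //; exact: cmeasN. Qed.

Lemma cmeasM f g : cmeas f -> cmeas g -> cmeas (fun x => f x * g x).
Proof.
move=> [f1 f2] [g1 g2]; split.
  by under eq_fun do rewrite cReM; apply: measurable_funB; exact: measurable_funM.
by under eq_fun do rewrite cImM; apply: measurable_funD; exact: measurable_funM.
Qed.

Lemma cmeasZ (c : R[i]) f : cmeas f -> cmeas (fun x => c * f x).
Proof. by move=> mf; apply: cmeasM => //; exact: cmeas_cst. Qed.

Lemma cmeas_real (h : T -> R) : measurable_fun setT h -> cmeas (fun x => (h x)%:C%C).
Proof. by move=> mh; split => //=; exact: measurable_cst. Qed.

Lemma cmeas_cexpi (h : T -> R) :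
  measurable_fun setT h -> cmeas (fun x => cexpi (h x)).
Proof.
move=> mh; split => /=; apply: measurableT_comp => //.
  by apply: continuous_measurable_fun; exact: continuous_cos.
by apply: continuous_measurable_fun; exact: continuous_sin.
Qed.

Lemma measurable_cabs f : cmeas f -> measurable_fun setT (fun x => cabs (f x)).
Proof.
move=> [f1 f2]; apply: measurableT_comp.
  by apply: continuous_measurable_fun; exact: sqrt_continuous.
by apply: measurable_funD; apply: measurable_funX.
Qed.

Lemma emeasurable_cabs f :
  cmeas f -> measurable_fun setT (fun x => (cabs (f x))%:E).
Proof. by move=> mf; apply/measurable_EFinP; exact: measurable_cabs. Qed.

Lemma cinteg_Re mu f : cinteg mu f ->
  mu.-integrable setT (fun x => (complex.Re (f x))%:E).
Proof.
move=> [[f1 f2] foo]; apply/integrableP; split; first exact/measurable_EFinP.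
apply: le_lt_trans foo; apply: ge0_le_integral => //.
- by apply: measurableT_comp => //; exact/measurable_EFinP.
- exact: emeasurable_cabs.
- by move=> x _; rewrite /= lee_fin Re_le_cabs.
Qed.

Lemma cinteg_Im mu f : cinteg mu f ->
  mu.-integrable setT (fun x => (complex.Im (f x))%:E).
Proof.
move=> [[f1 f2] foo]; apply/integrableP; split; first exact/measurable_EFinP.
apply: le_lt_trans foo; apply: ge0_le_integral => //.
- by apply: measurableT_comp => //; exact/measurable_EFinP.
- exact: emeasurable_cabs.
- by move=> x _; rewrite /= lee_fin Im_le_cabs.
Qed.

Lemma cinteg_le mu f (h : T -> R) : cmeas f -> measurable_fun setT h ->
  (forall x, cabs (f x) <= h x) -> (\int[mu]_x (h x)%:E < +oo)%E -> cinteg mu f.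
Proof.
move=> mf mh fh hoo; split => //; apply: le_lt_trans hoo.
apply: ge0_le_integral => //.
- by move=> x _; rewrite lee_fin cabs_ge0.
- exact: emeasurable_cabs.
- exact/measurable_EFinP.
- by move=> x _; rewrite lee_fin.
Qed.

Lemma cintegD mu f g : cinteg mu f -> cinteg mu g ->
  cinteg mu (fun x => f x + g x).
Proof.
move=> [mf foo] [mg goo].
apply: (@cinteg_le _ _ (fun x => cabs (f x) + cabs (g x))).
- exact: cmeasD.
- by apply: measurable_funD; exact: measurable_cabs.
- by move=> x; exact: cabsD.
- under eq_integral do rewrite EFinD.
  rewrite ge0_integralD//; [exact: lte_add_pinfty| | | |].
  + by move=> x _; rewrite lee_fin cabs_ge0.
  + exact: emeasurable_cabs.
  + by move=> x _; rewrite lee_fin cabs_ge0.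
  + exact: emeasurable_cabs.
Qed.

Lemma cintegM_bounded mu f g (C : R) : cmeas f -> cinteg mu g ->
  (forall x, cabs (f x) <= C) -> cinteg mu (fun x => f x * g x).
Proof.
move=> mf [mg goo] fC.
apply: (@cinteg_le _ _ (fun x => C * cabs (g x))).
- exact: cmeasM.
- by apply: measurable_funM => //; exact: measurable_cabs.
- by move=> x; rewrite cabsM ler_wpM2r ?cabs_ge0.
- under eq_integral do rewrite EFinM.
  rewrite ge0_integralZl//.
  + by rewrite lte_mul_pinfty// lee_fin (le_trans (cabs_ge0 (f point)) (fC _)).
  + exact: emeasurable_cabs.
  + by move=> x _; rewrite lee_fin cabs_ge0.
  + by rewrite lee_fin (le_trans (cabs_ge0 (f point)) (fC _)).
Qed.

Lemma cintegZ mu (c : R[i]) f : cinteg mu f -> cinteg mu (fun x => c * f x).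
Proof. by move=> fi; apply: (cintegM_bounded (C := cabs c)) => //; exact: cmeas_cst. Qed.

Lemma cintegN mu f : cinteg mu f -> cinteg mu (fun x => - f x).
Proof. by move=> [mf foo]; split; [exact: cmeasN|under eq_integral do rewrite cabsN]. Qed.

Lemma cintegB mu f g : cinteg mu f -> cinteg mu g ->
  cinteg mu (fun x => f x - g x).
Proof. by move=> fi gi; apply: cintegD => //; exact: cintegN. Qed.

Lemma eq_CI mu f g : f =1 g -> CI mu f = CI mu g.
Proof. by move=> /funext ->. Qed.

Lemma CID mu f g : cinteg mu f -> cinteg mu g ->
  CI mu (fun x => f x + g x) = CI mu f + CI mu g.
Proof.
move=> fi gi; apply: complex_eq => /=.
  rewrite -RintegralD//; [|exact: cinteg_Re..].
  by apply: eq_Rintegral => x _; rewrite raddfD.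
rewrite -RintegralD//; [|exact: cinteg_Im..].
by apply: eq_Rintegral => x _; rewrite raddfD.
Qed.

Lemma CIZ mu (c : R[i]) f : cinteg mu f ->
  CI mu (fun x => c * f x) = c * CI mu f.
Proof.
move=> fi; have iR := cinteg_Re fi; have iI := cinteg_Im fi.
have RZ (r : R) (h : T -> R) : mu.-integrable setT (EFin \o h) ->
    mu.-integrable setT (EFin \o (fun x => r * h x)).
  by move=> hi; apply: eq_integrable (integrableZl measurableT r hi).
apply: complex_eq => /=; last rewrite cImM; first rewrite cReM /=.
- rewrite -!RintegralZl//.
  rewrite -RintegralB//; [|exact: RZ..].
  by apply: eq_Rintegral => x _; rewrite cReM.
- rewrite /= -!RintegralZl//.
  rewrite -RintegralD//; [|exact: RZ..].
  by apply: eq_Rintegral => x _; rewrite cImM.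
Qed.

Lemma CIN mu f : cinteg mu f -> CI mu (fun x => - f x) = - CI mu f.
Proof.
by move=> fi; rewrite -mulN1r -CIZ//; apply: eq_CI => x; rewrite mulN1r.
Qed.

Lemma CIB mu f g : cinteg mu f -> cinteg mu g ->
  CI mu (fun x => f x - g x) = CI mu f - CI mu g.
Proof. by move=> fi gi; rewrite CID ?CIN//; exact: cintegN. Qed.

Lemma CI0 mu : CI mu (fun=> 0) = 0.
Proof. by apply: complex_eq => /=; rewrite Rintegral_cst// mul0r. Qed.

Lemma cinteg0 mu : cinteg mu (fun=> 0).
Proof.
split; first exact: cmeas_cst.
by under eq_integral do rewrite cabs0; rewrite integral0.
Qed.

Lemma cinteg_sum mu I (r : seq I) (P : pred I) (F : I -> T -> R[i]) :
  (forall i, cinteg mu (F i)) -> cinteg mu (fun x => \sum_(i <- r | P i) F i x).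
Proof.
move=> mF; elim: r => [|i r IH].
  by under eq_fun do rewrite big_nil; exact: cinteg0.
under eq_fun do rewrite big_cons; case: (P i) => //; exact: cintegD.
Qed.

Lemma CI_sum mu I (r : seq I) (P : pred I) (F : I -> T -> R[i]) :
  (forall i, cinteg mu (F i)) ->
  CI mu (fun x => \sum_(i <- r | P i) F i x) = \sum_(i <- r | P i) CI mu (F i).
Proof.
move=> mF; elim: r => [|i r IH].
  by under eq_fun do rewrite big_nil; rewrite CI0 big_nil.
under eq_fun do rewrite big_cons; rewrite big_cons; case: (P i) => //.
by rewrite CID ?IH//; exact: cinteg_sum.
Qed.

(** Real and imaginary parts are bounded separately, whence the constant 2 in place of the sharp 1;
    it propagates as the factor [2 * cnorm] in later estimates. *)
Lemma CI_le mu f : cmeas f ->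
  ((cabs (CI mu f))%:E <= 2%:E * \int[mu]_x (cabs (f x))%:E)%E.
Proof.
move=> mf; have [foo|] := ltP (\int[mu]_x (cabs (f x))%:E)%E +oo%E; last first.
  by rewrite leye_eq => /eqP ->; rewrite gt0_muley ?leey.
have fi : cinteg mu f by split.
have H (h : T -> R) : mu.-integrable setT (EFin \o h) ->
    (forall x, `|h x| <= cabs (f x)) ->
    ((`|\int[mu]_x h x|)%:E <= \int[mu]_x (cabs (f x))%:E)%E.
  move=> hi hf; rewrite EFin_normr_Rintegral//.
  have mh := measurable_int _ hi.
  apply: le_trans (le_abse_integral _ _ _) _ => //.
  apply: ge0_le_integral => //.
  + exact: measurableT_comp.
  + exact: emeasurable_cabs.
  + by move=> x _; rewrite /= lee_fin.
apply: (@le_trans _ _ ((`|\int[mu]_x complex.Re (f x)|)%:E +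
    (`|\int[mu]_x complex.Im (f x)|)%:E)%E).
  by rewrite -EFinD lee_fin; exact: cabs_le.
rewrite (_ : 2%:E = 1%:E + 1%:E)%E; last by rewrite -EFinD.
rewrite ge0_muleDl// !mul1e leeD//; apply: H.
- exact: cinteg_Re.
- by move=> x; exact: Re_le_cabs.
- exact: cinteg_Im.
- by move=> x; exact: Im_le_cabs.
Qed.

End ComplexIntegral.

(** * Fubini and Tonelli for real and complex integrands *)

Section ComplexFubini.
Context d1 d2 (T1 : measurableType d1) (T2 : measurableType d2) (R : realType).
Variables (mu : {sigma_finite_measure set T1 -> \bar R})
  (nu : {sigma_finite_measure set T2 -> \bar R}).

(** Tonelli gives measurability of the integrals of the positive and of the negative part; their
    difference is then composed with the measurable map [fine], so infinite values are harmless. *)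
Lemma measurable_Rintegral (h : T1 * T2 -> R) : measurable_fun setT h ->
  measurable_fun setT (fun x => \int[nu]_y h (x, y)).
Proof.
move=> mh; apply: measurableT_comp => //.
under eq_fun do rewrite integralE.
have mE := (measurable_EFinP _ h).2 mh.
apply: emeasurable_funB.
- rewrite (_ : (fun x => _) = fubini_F nu (EFin \o h)^\+%E); last first.
    by apply/funext => x; apply: eq_integral => y _; rewrite !funeposE.
  by apply: measurable_fun_fubini_tonelli_F => //; exact: measurable_funepos.
- rewrite (_ : (fun x => _) = fubini_F nu (EFin \o h)^\-%E); last first.
    by apply/funext => x; apply: eq_integral => y _; rewrite !funenegE.
  by apply: measurable_fun_fubini_tonelli_F => //; exact: measurable_funeneg.
Qed.

Lemma measurable_inner (h : T1 * T2 -> R) : measurable_fun setT h ->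
  (forall z, 0 <= h z) ->
  measurable_fun setT (fun x => \int[nu]_y (h (x, y))%:E)%E.
Proof.
move=> mh h0.
apply: (@measurable_fun_fubini_tonelli_F _ _ _ _ _ nu (EFin \o h)).
  exact/measurable_EFinP.
by move=> z; rewrite lee_fin.
Qed.

Lemma real_tonelli (h : T1 * T2 -> R) : measurable_fun setT h ->
  (forall z, 0 <= h z) ->
  (\int[mu]_x \int[nu]_y (h (x, y))%:E = \int[nu]_y \int[mu]_x (h (x, y))%:E)%E.
Proof.
move=> mh h0; apply: (@fubini_tonelli _ _ _ _ _ mu nu (EFin \o h)).
  exact/measurable_EFinP.
by move=> z; rewrite lee_fin.
Qed.

Lemma cmeas_CI (f : T1 * T2 -> R[i]) : cmeas f ->
  cmeas (fun x => CI nu (fun y => f (x, y))).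
Proof.
move=> [f1 f2]; split => /=.
  exact: (measurable_Rintegral (h := fun z => complex.Re (f z))).
exact: (measurable_Rintegral (h := fun z => complex.Im (f z))).
Qed.

(** The inner integral may be infinite on a null set, where [fine] makes it 0; the almost everywhere
    equality of the integrands absorbs the discrepancy. *)
Lemma Rintegral_iter (h : T1 * T2 -> R) :
  (mu \x nu)%E.-integrable setT (EFin \o h) ->
  (\int[mu]_x (\int[nu]_y h (x, y)))%:E = (\int[mu]_x \int[nu]_y (h (x, y))%:E)%E.
Proof.
move=> hi; have hF := integrable_fubini_F hi.
have aeF := integrable_ae measurableT hF.
rewrite /Rintegral.
have -> : (\int[mu]_x (fine (\int[nu]_y (h (x, y))%:E))%:E =
           \int[mu]_x \int[nu]_y (h (x, y))%:E)%E.
  apply: ae_eq_integral => //.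
  - apply/measurable_EFinP; apply: measurable_Rintegral.
    by case/integrableP: hi => /measurable_EFinP.
  - exact: measurable_int hF.
  - by apply: filterS aeF => x /(_ I) xfin _; rewrite fineK.
by rewrite fineK//; exact: (integrable_fin_num _ hF).
Qed.

End ComplexFubini.

Section ComplexFubini2.
Context d1 d2 (T1 : measurableType d1) (T2 : measurableType d2) (R : realType).
Variables (mu : {sigma_finite_measure set T1 -> \bar R})
  (nu : {sigma_finite_measure set T2 -> \bar R}).

Lemma RFubini (h : T1 * T2 -> R) :
  (mu \x nu)%E.-integrable setT (EFin \o h) ->
  \int[mu]_x (\int[nu]_y h (x, y)) = \int[nu]_y (\int[mu]_x h (x, y)).
Proof.
move=> hi; apply: EFin_inj; rewrite Rintegral_iter//.
pose h' (z : T2 * T1) := h (z.2, z.1).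
have mh : measurable_fun setT h by apply/measurable_EFinP; exact: measurable_int hi.
have hi' : (nu \x mu)%E.-integrable setT (EFin \o h').
  apply/integrable12ltyP.
    apply/measurable_EFinP; apply: (@measurableT_comp _ _ _ _ _ _ h) => //.
    exact: measurable_swap.
  by rewrite /h' /=; apply/(integrable21ltyP mu nu (f := EFin \o h)) => //; exact/measurable_EFinP.
by rewrite (Rintegral_iter (h := h') hi') /h' /=; exact: (Fubini hi).
Qed.

Lemma CI_Fubini (f : T1 * T2 -> R[i]) : cmeas f ->
  (\int[mu]_x \int[nu]_y (cabs (f (x, y)))%:E < +oo)%E ->
  CI mu (fun x => CI nu (fun y => f (x, y))) =
  CI nu (fun y => CI mu (fun x => f (x, y))).
Proof.
move=> mf foo.
have H (h : R[i] -> R) : (forall z, `|h z| <= cabs z) ->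
    measurable_fun setT (fun x => h (f x)) ->
    (mu \x nu)%E.-integrable setT (EFin \o (fun z => h (f z))).
  move=> hc mh; apply/integrable12ltyP; first exact/measurable_EFinP.
  have mf' := emeasurable_cabs mf.
  apply: le_lt_trans foo; apply: ge0_le_integral => //.
  - by move=> x _; apply: integral_ge0.
  - apply: (measurable_fun_fubini_tonelli_F (m2 := nu) (fun z => `|(h (f z))%:E|%E)) => //.
    by apply: measurableT_comp => //; exact/measurable_EFinP.
  - apply: (measurable_fun_fubini_tonelli_F (m2 := nu) (fun z => (cabs (f z))%:E)) => //.
    by move=> z; rewrite lee_fin cabs_ge0.
  - move=> x _; apply: ge0_le_integral => //.
    + apply: measurableT_comp => //; apply/measurable_EFinP.
      exact: (@measurableT_comp _ _ _ _ _ _ (fun z => h (f z))).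
    + exact: (@measurableT_comp _ _ _ _ _ _ (fun z => (cabs (f z))%:E)).
    + by move=> y _; rewrite /= lee_fin.
have HR := RFubini (H _ (@Re_le_cabs R) mf.1).
have HI := RFubini (H _ (@Im_le_cabs R) mf.2).
exact: complex_eq.
Qed.

Lemma ae_CI (f g : T1 -> R[i]) : cmeas f -> cmeas g ->
  {ae mu, forall x, f x = g x} -> CI mu f = CI mu g.
Proof.
move=> mf mg fg; apply: complex_eq; rewrite /= /Rintegral; congr fine.
- apply: ae_eq_integral => //; [exact/measurable_EFinP/mf.1|exact/measurable_EFinP/mg.1|].
  by apply: filterS fg => x -> _.
- apply: ae_eq_integral => //; [exact/measurable_EFinP/mf.2|exact/measurable_EFinP/mg.2|].
  by apply: filterS fg => x -> _.
Qed.

Lemma ae_cinteg (f : T1 * T2 -> R[i]) : cmeas f ->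
  (\int[mu]_x \int[nu]_y (cabs (f (x, y)))%:E < +oo)%E ->
  {ae mu, forall x, cinteg nu (fun y => f (x, y))}.
Proof.
move=> mf foo; have mI := measurable_inner nu (measurable_cabs mf) (fun z => cabs_ge0 _).
have I0 x : (0 <= \int[nu]_y (cabs (f (x, y)))%:E)%E.
  by apply: integral_real_ge0 => y; exact: cabs_ge0.
have Ii : mu.-integrable setT (fun x => \int[nu]_y (cabs (f (x, y)))%:E)%E.
  apply/integrableP; split => //.
  by under eq_integral do rewrite gee0_abs//.
have := integrable_ae measurableT Ii.
apply: filterS => x /(_ I) xfin; split.
  split.
  - exact: (measurableT_comp (f := fun z => complex.Re (f z)) mf.1).
  - exact: (measurableT_comp (f := fun z => complex.Im (f z)) mf.2).
by rewrite -ge0_fin_numE.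
Qed.

(** Linearity of the inner integral is available only where the section is integrable, that is for
    almost every [x]; the outer integral does not see the rest. *)
Lemma CI_CIZ (c : T1 -> R[i]) (f : T1 * T2 -> R[i]) : cmeas c -> cmeas f ->
  (\int[mu]_x \int[nu]_y (cabs (f (x, y)))%:E < +oo)%E ->
  CI mu (fun x => c x * CI nu (fun y => f (x, y))) =
  CI mu (fun x => CI nu (fun y => c x * f (x, y))).
Proof.
move=> mc mf foo; apply: ae_CI.
- by apply: cmeasM => //; exact: cmeas_CI.
- apply: (cmeas_CI nu (f := fun z => c z.1 * f z)); apply: cmeasM => //; split.
  + exact: (measurableT_comp (f := fun x => complex.Re (c x)) mc.1).
  + exact: (measurableT_comp (f := fun x => complex.Im (c x)) mc.2).
- by apply: filterS (ae_cinteg mf foo) => x fi; rewrite CIZ.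
Qed.

End ComplexFubini2.

(** * Changes of variables *)

Section AffineChange.
Variable R : realType.

Lemma measurable_affine (c a : R) :
  measurable_fun [set: measurableTypeR R] (fun x : measurableTypeR R => (c * x + a : measurableTypeR R)).
Proof.
apply: measurable_funD => //; apply: measurable_funM => //.
Qed.

(** The image of Lebesgue measure under [x |-> c x + a], rescaled by [|c|], gives half-open
    intervals their length, so it is Lebesgue measure by uniqueness. *)
Lemma lebesgue_affine (c a : R) (f : R -> \bar R) : c != 0 ->
  measurable_fun setT f -> (forall x, 0 <= f x)%E ->
  (\int[@lebesgue_measure R]_x f (c * x + a)%R =
   (`|c|^-1)%:E * \int[@lebesgue_measure R]_x f x)%E.
Proof.
move=> c0 mf f0.
pose mu0 := (pushforward (@lebesgue_measure R)
  (fun x : measurableTypeR R => c * x + a : measurableTypeR R)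
  : {measure set (measurableTypeR R) -> \bar R}).
pose mu := mu0 (measurable_affine c a).
have nc : 0 < `|c| by rewrite normr_gt0.
pose nu : {measure set (measurableTypeR R) -> \bar R} :=
  mscale (NngNum (ltW nc)) mu.
have nuE : forall A, measurable A -> @lebesgue_measure R A = nu A.
  apply: lebesgue_measure_unique => _ [[u v] _ <-] /=.
  rewrite /nu /= /mscale /= /mu /= /pushforward.
  have [uv|vu] := ltP u v; last first.
    rewrite (_ : _ @^-1` _ = set0) ?measure0 ?mule0.
      by rewrite set_itv_ge ?measure0// bnd_simp -leNgt.
    apply/seteqP; split => x //=; rewrite in_itv /= => /andP[ux xv].
    by move: (lt_le_trans ux xv); rewrite ltNge vu.
  rewrite lebesgue_measure_itv /= lte_fin uv.
  have [cp|cn] := ltP 0 c.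
    rewrite (_ : _ @^-1` _ = `](u - a) / c, (v - a) / c]%classic); last first.
      apply/seteqP; split => x /=;
      by rewrite !in_itv /= ltr_pdivrMr// ler_pdivlMr// ltrBlDr lerBrDr mulrC.
    rewrite lebesgue_measure_itv /= lte_fin ltr_pM2r ?invr_gt0// ltrD2r uv.
    rewrite gtr0_norm// -!EFinB -EFinM -mulrBl mulrCA divff// mulr1.
    by congr EFin; ring.
  have cn' : c < 0 by rewrite lt_neqAle c0.
  (* A negative slope exchanges the endpoints, so the preimage is closed on the left and open on the
     right; its length is the same. *)
  rewrite (_ : _ @^-1` _ = `[(v - a) / c, (u - a) / c[%classic); last first.
    apply/seteqP; split => x /=;
    by rewrite !in_itv /= ler_ndivrMr// ltr_ndivlMr// ltrBlDr lerBrDr (mulrC x) andbC.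
  rewrite lebesgue_measure_itv /= lte_fin ltr_nM2r ?invr_lt0// ltrD2r uv.
  rewrite ltr0_norm// -!EFinB -EFinM -mulrBl mulrCA mulNr divff// mulrN1.
  by congr EFin; ring.
have -> : (\int[@lebesgue_measure R]_x f x = \int[nu]_x f x)%E.
  by apply: eq_measure_integral => A mA _; exact: nuE.
rewrite ge0_integral_mscale//= muleA -EFinM mulVf ?gt_eqF// mul1e.
rewrite (@ge0_integral_pushforward _ _ _ _ _ _ (measurable_affine c a) (@lebesgue_measure R))//.
Qed.

Local Open Scope ereal_scope.

Lemma measurable_row_affine n (c : R) (a : 'rV[R]_n) :
  measurable_fun setT (fun x : 'rV[R]_n => c *: x + a)%R.
Proof. by apply: measurable_rowD => //; exact: measurable_rowZ. Qed.

(** Induction on the dimension; each coordinate contributes one factor [|c|^-1]. *)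
Lemma intn_affine n (c : R) (a : 'rV[R]_n) (f : 'rV[R]_n -> \bar R) :
  c != 0%R -> measurable_fun setT f -> (forall x, 0 <= f x) ->
  intn (fun x => f (c *: x + a)%R) = ((`|c| ^+ n)^-1)%:E * intn f.
Proof.
move=> c0; elim: n a f => [|m IH] a f mf f0.
  by rewrite /= expr0 invr1 mul1e; congr f; apply/rowP; case.
have mfc (x : R) : measurable_fun setT (fun t : 'rV[R]_m => f (rowcons (x, t))).
  apply: measurableT_comp => //.
  exact: (measurableT_comp (@measurable_rowcons R m)
    (@pair1_measurable _ _ (measurableTypeR R) 'rV[R]_m x)).
pose a0 := a ord0 ord0; pose a' := \row_(j < m) a ord0 (rshift 1 j).
have E x (t : 'rV[R]_m) : (c *: rowcons (x, t) + a = rowcons (c * x + a0, c *: t + a'))%R.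
  apply: (can_inj (@rowunconsK R m)).
  rewrite rowconsK /rowuncons; congr pair.
    by rewrite mxE [X in (X + _)%R]mxE rowcons0.
  by apply/rowP => j; rewrite [LHS]mxE [LHS]mxE [X in (X + _)%R]mxE rowconsS !mxE.
transitivity (\int[@lebesgue_measure R]_x
    (((`|c| ^+ m)^-1)%:E * intn (fun t => f (rowcons ((c * x + a0)%R, t)))))%E.
  rewrite /=; apply: eq_integral => x _.
  rewrite -(IH a')//.
  by apply: intn_eq => t; rewrite -E.
have mI : measurable_fun setT (fun x : R => intn (fun t => f (rowcons (x, t)))).
  under eq_fun do rewrite intnE//.
  apply: (measurable_fun_fubini_tonelli_F (m2 := leb R m)
     (T1 := measurableTypeR R) (fun z => f (rowcons z))) => //.
  by apply: measurableT_comp => //; exact: measurable_rowcons.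
have I0 x : 0 <= intn (fun t => f (rowcons (x, t))).
  by rewrite intnE//; apply: integral_ge0.
rewrite ge0_integralZl//.
rewrite (lebesgue_affine a0 c0 mI I0) muleA -EFinM.
  by rewrite -invfM -exprSr.
have mI' : measurable_fun [set: measurableTypeR R]
  (fun x : measurableTypeR R => intn (fun t => f (rowcons (x, t)))) := mI.
exact: (measurableT_comp mI' (measurable_affine c a0)).
Qed.

Lemma integral_affine n (c : R) (a : 'rV[R]_n) (f : 'rV[R]_n -> \bar R) :
  c != 0%R -> measurable_fun setT f -> (forall x, 0 <= f x) ->
  \int[leb R n]_x f (c *: x + a)%R = ((`|c| ^+ n)^-1)%:E * \int[leb R n]_x f x.
Proof.
move=> c0 mf f0; rewrite -!intnE ?intn_affine//.
by apply: measurableT_comp => //; exact: measurable_row_affine.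
Qed.

Lemma integral_shift n (a : 'rV[R]_n) (f : 'rV[R]_n -> \bar R) :
  measurable_fun setT f -> (forall x, 0 <= f x) ->
  \int[leb R n]_x f (x + a)%R = \int[leb R n]_x f x.
Proof.
move=> mf f0; have := integral_affine a (oner_neq0 R) mf f0.
rewrite normr1 expr1n invr1 mul1e => <-.
by apply: eq_integral => x _; rewrite scale1r.
Qed.

Lemma integral_refl n (a : 'rV[R]_n) (f : 'rV[R]_n -> \bar R) :
  measurable_fun setT f -> (forall x, 0 <= f x) ->
  \int[leb R n]_x f (a - x)%R = \int[leb R n]_x f x.
Proof.
move=> mf f0; have N0 : (-1 : R)%R != 0%R by rewrite oppr_eq0 oner_neq0.
have := integral_affine a N0 mf f0.
rewrite normrN normr1 expr1n invr1 mul1e => <-.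
by apply: eq_integral => x _; rewrite scaleN1r addrC.
Qed.

End AffineChange.

Section ComplexAffine.
Variables (R : realType) (n : nat).
Implicit Type f : 'rV[R]_n -> R[i].

Lemma cmeas_comp d (T : measurableType d) (h : T -> 'rV[R]_n) f :
  measurable_fun setT h -> cmeas f -> cmeas (fun x => f (h x)).
Proof.
move=> mh [f1 f2]; split.
- exact: (@measurableT_comp _ _ _ _ _ _ (fun x => complex.Re (f x))).
- exact: (@measurableT_comp _ _ _ _ _ _ (fun x => complex.Im (f x))).
Qed.

Lemma RintE (h : 'rV[R]_n -> R) : (leb R n).-integrable setT (EFin \o h) ->
  rint h = \int[leb R n]_x h x.
Proof.
move=> hi; have mh : measurable_fun setT h.
  by case/integrableP: hi => /measurable_EFinP.
rewrite /rint !intnE; last 4 first.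
- by apply/measurable_EFinP; apply: measurable_maxr => //; exact: measurableT_comp.
- by move=> x; rewrite lee_fin le_max lexx orbT.
- by apply/measurable_EFinP; apply: measurable_maxr.
- by move=> x; rewrite lee_fin le_max lexx orbT.
have fp := integrable_pos_fin_num measurableT hi.
have fn := integrable_neg_fin_num measurableT hi.
rewrite /Rintegral [in RHS]integralE (fineB fp fn).
- congr (fine _ - fine _); apply: eq_integral => x _.
  + by rewrite funeposE EFin_max.
  + by rewrite funenegE EFin_max.
Qed.

Lemma cintE f : cinteg (leb R n) f -> cint f = CI (leb R n) f.
Proof.
by move=> fi; apply: complex_eq; rewrite /= RintE//; [exact: cinteg_Re|exact: cinteg_Im].
Qed.

Lemma Rintegral_affine (c : R) (a : 'rV[R]_n) (h : 'rV[R]_n -> R) : c != 0 ->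
  measurable_fun setT h -> (leb R n).-integrable setT (EFin \o h) ->
  \int[leb R n]_x h (c *: x + a) = (`|c| ^+ n)^-1 * \int[leb R n]_x h x.
Proof.
move=> c0 mh hi; rewrite /Rintegral.
have mE := (measurable_EFinP setT h).2 mh.
rewrite integralE [in RHS]integralE.
have -> : (\int[leb R n]_x ((fun x => (h (c *: x + a))%:E)^\+ x) =
    ((`|c| ^+ n)^-1)%:E * \int[leb R n]_x ((EFin \o h)^\+ x))%E.
  rewrite -(integral_affine a c0 (measurable_funepos mE) (funepos_ge0 _)).
  by apply: eq_integral => x _; rewrite !funeposE.
have -> : (\int[leb R n]_x ((fun x => (h (c *: x + a))%:E)^\- x) =
    ((`|c| ^+ n)^-1)%:E * \int[leb R n]_x ((EFin \o h)^\- x))%E.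
  rewrite -(integral_affine a c0 (measurable_funeneg mE) (funeneg_ge0 _)).
  by apply: eq_integral => x _; rewrite !funenegE.
have fp := integrable_pos_fin_num measurableT hi.
have fn := integrable_neg_fin_num measurableT hi.
rewrite -[X in (_ * X - _)%E]fineK// -[X in (_ - _ * X)%E]fineK//.
rewrite -!EFinM -EFinB [LHS]/= -mulrBr; congr (_ * _).
exact/esym/(fineB fp fn).
Qed.

Lemma CI_affine (c : R) (a : 'rV[R]_n) f : c != 0 -> cinteg (leb R n) f ->
  CI (leb R n) (fun x => f (c *: x + a)) = ((`|c| ^+ n)^-1)%:C%C * CI (leb R n) f.
Proof.
move=> c0 fi; apply: complex_eq; rewrite /= ?cReM ?cImM /= !mul0r ?subr0 ?addr0.
- by rewrite (Rintegral_affine _ c0 fi.1.1 (cinteg_Re fi)).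
- by rewrite (Rintegral_affine _ c0 fi.1.2 (cinteg_Im fi)).
Qed.

Lemma CI_shift (a : 'rV[R]_n) f : cinteg (leb R n) f ->
  CI (leb R n) (fun x => f (x + a)) = CI (leb R n) f.
Proof.
move=> fi; have := CI_affine a (oner_neq0 R) fi.
rewrite normr1 expr1n invr1 mul1r => <-.
by apply: eq_CI => x; rewrite scale1r.
Qed.

Lemma CI_refl (a : 'rV[R]_n) f : cinteg (leb R n) f ->
  CI (leb R n) (fun x => f (a - x)) = CI (leb R n) f.
Proof.
move=> fi; have N0 : (-1 : R) != 0 by rewrite oppr_eq0 oner_neq0.
have := CI_affine a N0 fi.
rewrite normrN normr1 expr1n invr1 mul1r => <-.
by apply: eq_CI => x; rewrite scaleN1r addrC.
Qed.

Lemma cinteg_shift (a : 'rV[R]_n) f : cinteg (leb R n) f ->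
  cinteg (leb R n) (fun x => f (x + a)).
Proof.
move=> [mf foo]; split; first by apply: cmeas_comp => //; exact: measurable_rowD.
rewrite (integral_shift a (f := fun x => (cabs (f x))%:E))//; first exact: emeasurable_cabs.
by move=> x; rewrite lee_fin cabs_ge0.
Qed.

Lemma cinteg_refl (a : 'rV[R]_n) f : cinteg (leb R n) f ->
  cinteg (leb R n) (fun x => f (a - x)).
Proof.
move=> [mf foo]; split; first by apply: cmeas_comp => //; exact: measurable_rowB.
rewrite (integral_refl a (f := fun x => (cabs (f x))%:E))//; first exact: emeasurable_cabs.
by move=> x; rewrite lee_fin cabs_ge0.
Qed.

End ComplexAffine.

Section ProductIntegrals.
Variable R : realType.
Local Open Scope ereal_scope.

Lemma measurable_prod_coord n (F : R -> R) : measurable_fun setT F ->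
  measurable_fun setT (fun x : 'rV[R]_n => \prod_(j < n) F (x ord0 j))%R.
Proof.
move=> mF; apply: measurable_prod => j _.
exact: (measurableT_comp mF (measurable_coord j)).
Qed.

Lemma intn_prod n (F : R -> R) (c : R) : measurable_fun setT F ->
  (forall x, 0 <= F x)%R -> \int[@lebesgue_measure R]_x (F x)%:E = c%:E ->
  intn (fun x : 'rV[R]_n => (\prod_(j < n) F (x ord0 j))%R%:E) = (c ^+ n)%:E.
Proof.
move=> mF F0 Fc; elim: n => [|m IH]; first by rewrite /= big_ord0 expr0.
transitivity (\int[@lebesgue_measure R]_x ((F x)%:E * (c ^+ m)%:E)).
  rewrite /=; apply: eq_integral => x _.
  rewrite -IH !intnE; last 4 first.
  - by apply/measurable_EFinP; exact: measurable_prod_coord.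
  - by move=> t; rewrite lee_fin prodr_ge0.
  - apply/measurable_EFinP.
    apply: (@measurableT_comp _ _ _ _ _ _ (fun y : 'rV[R]_m.+1 => \prod_(j < m.+1) F (y ord0 j))%R).
      exact: measurable_prod_coord.
    exact: (measurableT_comp (@measurable_rowcons R m)
      (@pair1_measurable _ _ (measurableTypeR R) 'rV[R]_m x)).
  - by move=> t; rewrite lee_fin prodr_ge0.
  rewrite -ge0_integralZl_EFin//; last 2 first.
  - by move=> t _; rewrite lee_fin prodr_ge0.
  - by apply/measurable_EFinP; exact: measurable_prod_coord.
  apply: eq_integral => t _; rewrite -EFinM; congr EFin.
  rewrite -[row_mx _ _]/(rowcons (x, t)) big_ord_recl rowcons0; congr (_ * _)%R.
  apply: eq_bigr => j _; rewrite -(rowconsS (x, t)); congr (F (rowcons _ _ _)).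
  exact/val_inj.
rewrite ge0_integralZr//; last 3 first.
- exact/measurable_EFinP.
- by move=> x _; rewrite lee_fin.
- rewrite lee_fin exprn_ge0// -lee_fin -Fc.
  by apply: integral_ge0 => x _; rewrite lee_fin.
by rewrite Fc -EFinM exprS.
Qed.

Lemma integral_prod n (F : R -> R) (c : R) : measurable_fun setT F ->
  (forall x, 0 <= F x)%R -> \int[@lebesgue_measure R]_x (F x)%:E = c%:E ->
  \int[leb R n]_x (\prod_(j < n) F (x ord0 j))%R%:E = (c ^+ n)%:E.
Proof.
move=> mF F0 Fc; rewrite -intnE ?(intn_prod n mF F0 Fc)//.
- by apply/measurable_EFinP; exact: measurable_prod_coord.
- by move=> t; rewrite lee_fin prodr_ge0.
Qed.

End ProductIntegrals.

(** * Unit cubes, and lattice sums as integrals *)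

Section Floor.
Variables (R : realType) (n : nat).

Definition flr (x : 'rV[R]_n) : 'rV[int]_n := map_mx Num.floor x.

Lemma flrD (x : 'rV[R]_n) k : flr (x + intvec R k) = flr x + k.
Proof.
apply/rowP => j; rewrite !mxE.
by rewrite floorDrz ?intrKfloor// intr_int.
Qed.

Lemma measurable_floor_eq (k : int) : measurable [set x : R | Num.floor x = k].
Proof.
rewrite (_ : [set _ | _] = `[k%:~R, (k + 1)%:~R[%classic).
  exact: measurable_itv.
apply/seteqP; split => x /=; rewrite in_itv /=.
  by move=> <-; exact: floor_itv.
by move=> xk; exact: floor_def.
Qed.

Lemma measurable_flr_eq (k : 'rV[int]_n) : measurable [set x | flr x = k].
Proof.
rewrite (_ : [set _ | _] =
    \bigcap_(j in [set: 'I_n]) ((fun x : 'rV[R]_n => x ord0 j) @^-1` [set y | Num.floor y = k ord0 j])).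
  apply: fin_bigcap_measurable => // j _.
  rewrite -[X in measurable X]setTI; apply: measurable_coord => //.
  exact: measurable_floor_eq.
apply/seteqP; split => x /=.
  by move=> <- j _ /=; rewrite mxE.
by move=> H; apply/rowP => j; rewrite mxE; exact: H.
Qed.

(** Unit cubes form a countable measurable partition, so every function of the cube index is
    measurable, whatever its values. *)
Lemma measurable_flr d (T : measurableType d) (F : 'rV[int]_n -> T) :
  measurable_fun setT (fun x => F (flr x)).
Proof.
move=> _ A mA; rewrite setTI.
rewrite (_ : _ @^-1` A = \bigcup_k (if `[< A (F k) >] then [set x | flr x = k] else set0)).
  apply: countable_bigcupT_measurable => // k.
  by case: ifP => // _; exact: measurable_flr_eq.
apply/seteqP; split => x /=.
  by move=> AF; exists (flr x) => //; rewrite (introT (asboolP _)).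
by move=> [k _]; case: ifPn => // /asboolP AF /= ->.
Qed.

Lemma cmeas_flr (F : 'rV[int]_n -> R[i]) : cmeas (fun x => F (flr x)).
Proof.
by split; [exact: (measurable_flr (fun k => complex.Re (F k)))|
  exact: (measurable_flr (fun k => complex.Im (F k)))].
Qed.

Lemma integral_indic01 :
  (\int[@lebesgue_measure R]_x ((Num.floor x == 0)%:R)%:E = (1 : R)%:E)%E.
Proof.
transitivity (\int[@lebesgue_measure R]_x (\1_[set x : R | Num.floor x = 0] x)%:E)%E; last first.
  rewrite integral_indic//; last exact: measurable_floor_eq.
  rewrite setIT (_ : [set _ | _] = `[0, 1[%classic).
    have := @lebesgue_measure_itv R (Interval (BLeft 0) (BLeft 1)).
    by rewrite /= lte_fin ltr01 oppr0 adde0.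
  apply/seteqP; split => x /=; rewrite in_itv /=.
    by move=> fx; have := floor_itv x; rewrite fx.
  by move=> xk; apply: floor_def.
apply: eq_integral => x _; rewrite indicE; congr ((_ : bool)%:R)%:E.
by apply/idP/idP => [/eqP|/[1!inE]/eqP//] ?; rewrite inE.
Qed.

(** After a translation the cube is the one at the origin, and its indicator is a product of
    one-variable indicators of [[0, 1[]. *)
Lemma leb_cube (k : 'rV[int]_n) : leb R n [set x | flr x = k] = 1%E.
Proof.
rewrite -[X in leb _ _ X]setIT -integral_indic//; last exact: measurable_flr_eq.
pose F (x : R) := ((Num.floor x == 0)%:R : R).
have mF : measurable_fun setT F.
  rewrite (_ : F = \1_[set x : R | Num.floor x = 0]).
    by apply: measurable_indic; exact: measurable_floor_eq.
  apply/funext => x; rewrite indicE /F; congr (_ : bool)%:R.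
  by apply/idP/idP => [/eqP|/[1!inE]/eqP//] ?; rewrite inE.
have := integral_prod n mF _ integral_indic01.
rewrite expr1n => <-//.
rewrite -(integral_shift (- intvec R k)); last 2 first.
- by apply/measurable_EFinP; exact: measurable_prod_coord.
- by move=> x; rewrite lee_fin prodr_ge0// => j _; rewrite /F; case: eqP.
apply: eq_integral => x _; congr EFin; rewrite indicE.
have xk : (x \in [set x | flr x = k]) = (flr (x - intvec R k) == 0).
  rewrite -[in RHS](opprK (intvec R k)).
  have -> : - intvec R k = intvec R (- k).
    by apply/rowP => j; rewrite !mxE mulrNz.
  rewrite opprK flrD subr_eq0.
  by apply/idP/idP => [/[1!inE]/eqP//|/eqP ?]; rewrite inE.
rewrite xk; have [E|E] := eqVneq (flr _) 0.
  rewrite big1// => j _; rewrite /F.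
  have : flr (x - intvec R k) ord0 j = 0 by rewrite E mxE.
  by rewrite mxE => ->.
have [j Ej] : exists j, flr (x - intvec R k) ord0 j != 0.
  apply: contrapT => H; move/eqP: E; apply; apply/rowP => j; rewrite [RHS]mxE.
  by apply/eqP; apply/negPn/negP => Ej; apply: H; exists j.
rewrite (bigD1 j)//= /F.
by move: Ej; rewrite mxE => /negbTE ->; rewrite mul0r.
Qed.

(** Lattice sums become integrals of functions constant on unit cubes. Translation, Tonelli,
    comparison and dominated convergence for sequences are then those for integrals. *)
Lemma esum_flr (F : 'rV[int]_n -> \bar R) : (forall k, 0 <= F k)%E ->
  (\esum_(k in [set: 'rV[int]_n]) F k = \int[leb R n]_x F (flr x))%E.
Proof.
move=> F0.
(* The cubes are enumerated through the encoding of the lattice in [nat]; an integer that encodes no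
   lattice point contributes the empty set. *)
pose A (i : nat) : set 'rV[R]_n :=
  if pickle_inv i is Some k then [set x | flr x = k] else set0.
have mA i : measurable (A i).
  by rewrite /A; case: pickle_inv => [k|//]; exact: measurable_flr_eq.
have pk (i : nat) (k : 'rV[int]_n) : pickle_inv i = Some k -> pickle k = i.
  by move=> H; have := @pickle_invK 'rV[int]_n i; rewrite /ocancel H.
have UA : setT = \bigcup_i A i.
  apply/seteqP; split => // x _; exists (pickle (flr x)) => //.
  by rewrite /A pickleK_inv.
have tA : trivIset setT A.
  apply/trivIsetP => i j _ _ ij; apply/eqP/negPn/negP => /set0P[x [Ai Aj]].
  move: Ai Aj; rewrite /A.
  case Hi : (pickle_inv i) => [k|//]; case Hj : (pickle_inv j) => [l|//] /= xk xl.
  by move/eqP: ij; apply; rewrite -(pk _ _ Hi) -(pk _ _ Hj) -xk -xl.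
rewrite UA ge0_integral_bigcup//; last by rewrite -UA; exact: measurable_flr.
pose G (i : nat) : \bar R := if pickle_inv i is Some k then F k else 0%E.
transitivity (\big[+%E/0]_(0 <= i <oo) G i)%E; last first.
  apply: eq_eseriesr => i _; rewrite /G /A.
  case: pickle_inv => [k|]; last by rewrite integral_set0.
  rewrite (eq_integral (cst (F k))); last by move=> x /[1!inE] /= ->.
  rewrite integral_cst; last exact: measurable_flr_eq.
  by rewrite -[LHS]mule1; congr (_ * _)%E; exact/esym/(leb_cube k).
have G0 i : (0 <= G i)%E by rewrite /G; case: pickle_inv.
rewrite nneseries_esumT//.
have -> : \esum_(i in [set: nat]) G i =
    \esum_(i in range (@pickle 'rV[int]_n)) G i.
  rewrite [RHS]esum_mkcond; apply: eq_esum => i _.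
  case: ifPn => // /negP Hi; rewrite /G.
  case Hk : (pickle_inv i) => [k|//]; exfalso; apply: Hi; rewrite inE.
  by exists k => //; exact: pk.
rewrite (reindex_esum [set: 'rV[int]_n] (range (@pickle 'rV[int]_n)) (@pickle _) G).
  by apply: eq_esum => k _; rewrite /G pickleK_inv.
by split => // k l _ _; exact: (pcan_inj pickleK_inv).
Qed.

End Floor.

(** * Weights and Young's inequality *)

Section RealPowers.
Variable R : realType.
Implicit Types x y r : R.

Lemma le_powR r x y : 0 <= r -> 0 <= x -> x <= y -> x `^ r <= y `^ r.
Proof.
by move=> r0 x0 xy; apply: ge0_ler_powR => //; rewrite nnegrE// (le_trans x0).
Qed.

Lemma le_poweR r (x y : \bar R) : 0 <= r -> (0 <= x)%E -> (x <= y)%E ->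
  (x `^ r <= y `^ r)%E.
Proof.
move=> r0 x0 xy; apply: gt0_ler_poweR => //.
- by rewrite in_itv /= x0 leey.
- by rewrite in_itv /= (le_trans x0 xy) leey.
Qed.

(** The larger of the two terms, doubled, dominates the sum. This substitute for the triangle
    inequality lets norms be handled through their [r]-th powers. *)
Lemma powRD_le r x y : 0 <= r -> 0 <= x -> 0 <= y ->
  (x + y) `^ r <= 2 `^ r * (x `^ r + y `^ r).
Proof.
move=> r0 x0 y0; wlog xy : x y x0 y0 / x <= y.
  by move=> H; case/orP: (le_total x y) => h; [exact: H|rewrite addrC (addrC (x `^ r)); exact: H].
apply: (@le_trans _ _ ((2 * y) `^ r)).
  by rewrite le_powR ?addr_ge0// mulr_natl mulr2n lerD2r.
by rewrite powRM// ler_wpM2l ?powR_ge0// lerDr powR_ge0.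
Qed.

Lemma poweRD_le r (x y : \bar R) : 0 <= r -> (0 <= x)%E -> (0 <= y)%E ->
  ((x + y) `^ r <= (2 `^ r)%:E * (x `^ r + y `^ r))%E.
Proof.
move=> r0; have [->|rn0] := eqVneq r 0.
  move=> x0 y0; rewrite !poweRe0 powRr0 mul1e.
  by rewrite -EFinD lee_fin lerDl.
have rp : 0 < r by rewrite lt_neqAle eq_sym rn0.
have K : (0 < (2 `^ r)%:E :> \bar R)%E by rewrite lte_fin powR_gt0.
case: x y => [x| |] [y| |] // x0 y0; last 3 first.
- by rewrite [X in (_ <= _ * X)%E](_ : _ = +oo%E) ?gt0_muley ?leey// poweRyr// addey.
- by rewrite [X in (_ <= _ * X)%E](_ : _ = +oo%E) ?gt0_muley ?leey// poweRyr// addye.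
- by rewrite [X in (_ <= _ * X)%E](_ : _ = +oo%E) ?gt0_muley ?leey// poweRyr// addye.
move: x0 y0; rewrite !lee_fin => x0 y0.
exact: powRD_le.
Qed.

End RealPowers.

Section Jensen.
Context d (T : measurableType d) (R : realType) (mu : {measure set T -> \bar R}).

(** Hoelder's inequality applied to [w^(1/r')] and [w^(1/r) b], for a weight of total mass at most
    [W]. The case [r = 1] is treated apart because [r'] is then infinite. *)
Lemma weighted_jensen (w b : T -> R) (W r : R) :
  measurable_fun setT w -> measurable_fun setT b ->
  (forall x, 0 <= w x) -> (forall x, 0 <= b x) -> 1 <= r -> 0 <= W ->
  (\int[mu]_x (w x)%:E <= W%:E)%E ->
  ((\int[mu]_x (w x * b x)%:E) `^ r <=
    (W `^ (r - 1))%:E * \int[mu]_x (w x * b x `^ r)%:E)%E.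
Proof.
move=> mw mb w0 b0 r1 W0 wW.
move: r1; rewrite le_eqVlt => /predU1P[<-|r1].
  rewrite subrr powRr0 mul1e poweRe1; last first.
    by apply: integral_ge0 => x _; rewrite lee_fin mulr_ge0.
  by under [leRHS]eq_integral do rewrite powRr1//.
have r0 : 0 < r by rewrite (lt_trans _ r1).
have rn0 : r != 0 by rewrite gt_eqF.
have r10 : 0 < r - 1 by rewrite subr_gt0.
pose r' := r / (r - 1).
have r'0 : 0 < r' by rewrite divr_gt0.
have rr' : r'^-1 + r^-1 = 1.
  by rewrite /r' invf_div mulrBl divff// mul1r subrK.
pose f x := w x `^ r'^-1; pose g x := w x `^ r^-1 * b x.
have mf : measurable_fun setT f by exact: (measurableT_comp (measurable_powR _)).
have mg : measurable_fun setT g.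
  by apply: measurable_funM => //; exact: (measurableT_comp (measurable_powR _)).
have := hoelder mu mf mg r'0 r0 rr'.
rewrite Lnorm1 unlock /= => H.
have E1 : (\int[mu]_x (w x * b x)%:E = \int[mu]_x `|((f \* g) x)%:E|)%E.
  apply: eq_integral => x _; rewrite /= /f /g ger0_norm; last first.
    by rewrite !mulr_ge0 ?powR_ge0.
  rewrite mulrA -powRD; last by rewrite rr' oner_eq0.
  by rewrite rr' powRr1.
have E2 : (\int[mu]_x `|(f x)%:E| `^ r' = \int[mu]_x (w x)%:E)%E.
  apply: eq_integral => x _; rewrite /= ger0_norm ?powR_ge0//.
  by rewrite /f -powRrM mulVf ?gt_eqF// powRr1.
have E3 : (\int[mu]_x `|(g x)%:E| `^ r = \int[mu]_x (w x * b x `^ r)%:E)%E.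
  apply: eq_integral => x _; rewrite /= ger0_norm ?mulr_ge0 ?powR_ge0//.
  by rewrite /g powRM ?powR_ge0// -powRrM mulVf// powRr1.
move: H; rewrite -E1 E2 E3 => H.
have I0 : (0 <= \int[mu]_x (w x * b x)%:E)%E.
  by apply: integral_ge0 => x _; rewrite lee_fin mulr_ge0.
have J0 : (0 <= \int[mu]_x (w x * b x `^ r)%:E)%E.
  by apply: integral_ge0 => x _; rewrite lee_fin mulr_ge0 ?powR_ge0.
apply: (le_trans (le_poweR (ltW r0) I0 H)).
rewrite poweRM ?poweR_ge0// -!poweRrM mulVf// (poweRe1 J0).
apply: lee_wpmul2r => //.
have -> : r'^-1 * r = r - 1 by rewrite /r' invf_div -mulrA mulVf// mulr1.
rewrite -poweR_EFin le_poweR ?(ltW r10)//.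
by apply: integral_ge0 => x _; rewrite lee_fin.
Qed.

End Jensen.

Section Weights.
Variables (R : realType) (n : nat).
Implicit Types x y : 'rV[R]_n.

Let sqsum_ge0 x : 0 <= \sum_(j < n) x ord0 j ^+ 2.
Proof. by apply: sumr_ge0 => j _; exact: sqr_ge0. Qed.

Lemma jbr_sqr x : jbr x ^+ 2 = 1 + \sum_(j < n) x ord0 j ^+ 2.
Proof. by rewrite /jbr sqr_sqrtr// addr_ge0. Qed.

Lemma jbr_ge1 x : 1 <= jbr x.
Proof.
by rewrite /jbr -[leLHS]sqrtr1 ler_wsqrtr// lerDl.
Qed.

Lemma jbr_gt0 x : 0 < jbr x.
Proof. exact: lt_le_trans (jbr_ge1 x). Qed.

Lemma jbr_ge0 x : 0 <= jbr x.
Proof. exact/ltW/jbr_gt0. Qed.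

Lemma jbrD_le x y : jbr (x + y) <= 2 * Num.max (jbr x) (jbr y).
Proof.
have m0 : 0 <= Num.max (jbr x) (jbr y) by rewrite le_max jbr_ge0.
have xm : jbr x ^+ 2 <= Num.max (jbr x) (jbr y) ^+ 2.
  by rewrite ler_pXn2r// ?nnegrE ?jbr_ge0// le_max lexx.
have ym : jbr y ^+ 2 <= Num.max (jbr x) (jbr y) ^+ 2.
  by rewrite ler_pXn2r// ?nnegrE ?jbr_ge0// le_max lexx orbT.
rewrite -(@ler_pXn2r _ 2)// ?nnegrE ?jbr_ge0 ?mulr_ge0// exprMn.
apply: (@le_trans _ _ (2 * (jbr x ^+ 2 + jbr y ^+ 2))); last by lra.
rewrite !jbr_sqr.
have : \sum_(j < n) (x + y) ord0 j ^+ 2 <=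
    2 * (\sum_(j < n) x ord0 j ^+ 2 + \sum_(j < n) y ord0 j ^+ 2).
  rewrite -big_split mulr_sumr; apply: ler_sum => j _; rewrite mxE /=.
  by have := sqr_ge0 (x ord0 j - y ord0 j); lra.
by lra.
Qed.

(** The additive form puts the full weight on one factor of a convolution at a time, so that the
    other one may be measured in L^1. *)
Lemma jbr_powD x y s : 0 <= s ->
  jbr (x + y) `^ s <= 2 `^ s * (jbr x `^ s + jbr y `^ s).
Proof.
move=> s0; apply: (@le_trans _ _ ((2 * Num.max (jbr x) (jbr y)) `^ s)).
  by rewrite le_powR ?jbr_ge0// jbrD_le.
rewrite powRM ?le_max ?jbr_ge0// ler_wpM2l ?powR_ge0//.
by case: (leP (jbr x) (jbr y)) => _; [rewrite lerDr|rewrite lerDl]; exact: powR_ge0.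
Qed.

Lemma jbr_pow_ge1 x s : 0 <= s -> 1 <= jbr x `^ s.
Proof. by move=> s0; have := ler_powR (jbr_ge1 x) s0; rewrite powRr0. Qed.

(** The multiplicative form is coarser, and suffices when one of the two points is confined to a
    bounded set. *)
Lemma jbr_powM x y s : 0 <= s ->
  jbr (x + y) `^ s <= 2 `^ s * (jbr x `^ s * jbr y `^ s).
Proof.
move=> s0; apply: (@le_trans _ _ ((2 * Num.max (jbr x) (jbr y)) `^ s)).
  by rewrite le_powR ?jbr_ge0// jbrD_le.
rewrite powRM ?le_max ?jbr_ge0// ler_wpM2l ?powR_ge0//.
case: (leP (jbr x) (jbr y)) => _.
  by rewrite ler_peMl ?powR_ge0//; exact: jbr_pow_ge1.
by rewrite ler_peMr ?powR_ge0//; exact: jbr_pow_ge1.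
Qed.

(** Comparison constant for the weights at two points whose coordinates differ by at most [C]: the
    square root is the largest value of [jbr] on the cube of half-side [C]. *)
Definition boxw (C s : R) : R := 2 `^ s * (Num.sqrt (1 + n%:R * C ^+ 2)) `^ s.

Lemma boxw_ge0 C s : 0 <= boxw C s.
Proof. by rewrite mulr_ge0 ?powR_ge0. Qed.

Lemma jbr_box x C s : 0 <= s -> (forall j, `|x ord0 j| <= C) ->
  jbr x `^ s <= (Num.sqrt (1 + n%:R * C ^+ 2)) `^ s.
Proof.
move=> s0 xC; rewrite le_powR ?jbr_ge0// ler_wsqrtr// lerD2l.
rewrite (_ : n%:R * C ^+ 2 = \sum_(j < n) C ^+ 2); last first.
  by rewrite sumr_const card_ord -[RHS]mulr_natl.
apply: ler_sum => j _; rewrite -real_normK ?num_real// ler_pXn2r// ?nnegrE//.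
by rewrite (le_trans _ (xC j)).
Qed.

Lemma jbr_near x y C s : 0 <= s -> (forall j, `|x ord0 j - y ord0 j| <= C) ->
  jbr x `^ s <= boxw C s * jbr y `^ s.
Proof.
move=> s0 xy; rewrite -[in leLHS](subrK y x).
apply: (le_trans (jbr_powM _ _ s0)); rewrite /boxw -mulrA ler_wpM2l ?powR_ge0//.
by rewrite ler_wpM2r ?powR_ge0// jbr_box// => j; rewrite !mxE.
Qed.

Lemma measurable_jbr_pow s : measurable_fun setT (fun x : 'rV[R]_n => jbr x `^ s).
Proof.
apply: (measurableT_comp (measurable_powR _)).
apply: measurableT_comp.
  by apply: continuous_measurable_fun; exact: sqrt_continuous.
apply: measurable_funD => //; apply: measurable_sum => j.
exact: (measurable_funX _ (measurable_coord j)).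
Qed.

End Weights.

Section Young.
Variables (R : realType) (n : nat).
Local Notation mu := (leb R n).
Implicit Types u v : 'rV[R]_n -> R.

Lemma measurable_conv2 u v :
  measurable_fun setT u -> measurable_fun setT v ->
  measurable_fun setT (fun z : 'rV[R]_n * 'rV[R]_n => u (z.1 - z.2) * v z.2).
Proof.
move=> mX mv; apply: measurable_funM.
  by apply: (measurableT_comp mX); exact: measurable_rowB.
exact: (measurableT_comp mv).
Qed.

(** Jensen in [y] for the weight [v], then Tonelli and translation invariance: the L^1 mass
    contributes [V^(r - 1)] at the first step and [V] at the second. *)
Lemma young u v (V r : R) :
  measurable_fun setT u -> measurable_fun setT v ->
  (forall x, 0 <= u x) -> (forall x, 0 <= v x) -> 1 <= r -> 0 <= V ->
  (\int[mu]_x (v x)%:E <= V%:E)%E ->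
  (\int[mu]_x ((\int[mu]_y (u (x - y) * v y)%:E) `^ r) <=
    (V `^ r)%:E * \int[mu]_x (u x `^ r)%:E)%E.
Proof.
move=> mX mv u0 v0 r1 V0 vV.
have r0 : 0 < r by rewrite (lt_le_trans _ r1).
have mur : measurable_fun setT (fun x => u x `^ r).
  exact: (measurableT_comp (measurable_powR _)).
have ur0 x : 0 <= u x `^ r by exact: powR_ge0.
have Ur0 : (0 <= \int[mu]_x (u x `^ r)%:E)%E.
  by apply: integral_ge0 => x _; rewrite lee_fin.
pose h (z : 'rV[R]_n * 'rV[R]_n) := u (z.1 - z.2) * v z.2.
pose k (z : 'rV[R]_n * 'rV[R]_n) := v z.2 * u (z.1 - z.2) `^ r.
have mh : measurable_fun setT h by exact: measurable_conv2.
have mk : measurable_fun setT k.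
  rewrite (_ : k = fun z => u (z.1 - z.2) `^ r * v z.2).
    exact: measurable_conv2 mur mv.
  by apply/funext => z; rewrite /k mulrC.
have h0 z : 0 <= h z by rewrite mulr_ge0.
have k0 z : 0 <= k z by rewrite mulr_ge0.
have mIk := measurable_inner mu mk k0.
have kx0 (x : 'rV[R]_n) : (0 <= \int[mu]_y (k (x, y))%:E)%E.
  by apply: integral_ge0 => y _; rewrite lee_fin.
have c0 : (0 <= (V `^ (r - 1))%:E)%E by rewrite lee_fin powR_ge0.
have step1 : (\int[mu]_x ((\int[mu]_y (h (x, y))%:E) `^ r) <=
    \int[mu]_x ((V `^ (r - 1))%:E * \int[mu]_y (k (x, y))%:E))%E.
  apply: ge0_le_integral => //.
  - by move=> x _; exact: poweR_ge0.
  - exact: (measurableT_comp (measurable_poweR _) (measurable_inner mu mh h0)).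
  - exact: (measurable_funeM _ mIk).
  - move=> x _; have mx : measurable_fun setT (fun y : 'rV[R]_n => u (x - y)).
      by apply: (measurableT_comp mX); exact: measurable_rowB.
    have := weighted_jensen (mu := mu) mv mx v0 (fun y => u0 _) r1 V0 vV.
    by under eq_integral do rewrite mulrC.
apply: (le_trans step1).
rewrite (ge0_integralZl mu measurableT mIk (fun x _ => kx0 x) c0).
rewrite (real_tonelli mu mu mk k0).
have step2 y : (\int[mu]_x (k (x, y))%:E = (v y)%:E * \int[mu]_x (u x `^ r)%:E)%E.
  have my : measurable_fun setT (fun x : 'rV[R]_n => u (x - y) `^ r).
    by apply: (measurableT_comp mur); exact: measurable_rowB.
  rewrite /k /= (ge0Z mu my (fun x => ur0 _) (v0 y)); congr (_ * _)%E.
  rewrite (integral_shift (- y) (f := fun x => (u x `^ r)%:E))//.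
  exact/measurable_EFinP.
under eq_integral do rewrite step2.
rewrite ge0_integralZr//; last 2 first.
- exact/measurable_EFinP.
- by move=> y _; rewrite lee_fin.
rewrite muleA; apply: lee_wpmul2r => //.
apply: (@le_trans _ _ ((V `^ (r - 1))%:E * V%:E)%E); first exact: lee_wpmul2l.
by rewrite -EFinM lee_fin mulrC mulr_powRB1.
Qed.

Lemma conv_comm u v (x : 'rV[R]_n) :
  measurable_fun setT u -> measurable_fun setT v ->
  (forall x, 0 <= u x) -> (forall x, 0 <= v x) ->
  (\int[mu]_y (u (x - y) * v y)%:E = \int[mu]_y (v (x - y) * u y)%:E)%E.
Proof.
move=> mX mv u0 v0.
have mx : measurable_fun setT (fun y : 'rV[R]_n => v (x - y)).
  by apply: (measurableT_comp mv); exact: measurable_rowB.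
rewrite -(integral_refl x (f := fun y => (v (x - y) * u y)%:E)).
- by apply: eq_integral => y _; rewrite subKr mulrC.
- by apply/measurable_EFinP; exact: measurable_funM.
- by move=> y; rewrite lee_fin mulr_ge0.
Qed.

End Young.

(** * An integrable weight of product form *)

Section Decay.
Variable R : realType.

Let dec (r x : R) : R := (1 + `|x|) `^ (- r).

Let abs1_gt0 (x : R) : 0 < 1 + `|x|.
Proof. by rewrite ltr_pwDl. Qed.

Let continuous_dec r : continuous (dec r).
Proof.
move=> x; have -> : dec r = (fun y => expR (- r * ln (1 + `|y|))).
  by apply/funext => y; rewrite /dec /powR gt_eqF.
apply: (@continuous_comp _ _ _ (fun y => - r * ln (1 + `|y|)) expR); last exact: continuous_expR.
apply: cvgM; first exact: cvg_cst.
apply: (@continuous_comp _ _ _ (fun y : R => 1 + `|y|) (@ln R)).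
  by apply: cvgD; [exact: cvg_cst|exact: norm_continuous].
exact: continuous_ln.
Qed.

(** On the half-line [(1 + x)^(- r)] has the primitive [F], which vanishes at infinity; evenness
    doubles the result. *)
Lemma decay1_int r : 1 < r ->
  exists2 c : R, 0 <= c & (\int[@lebesgue_measure R]_x (dec r x)%:E = c%:E)%E.
Proof.
move=> r1; pose rho := r - 1; have rho0 : 0 < rho by rewrite subr_gt0.
pose F (x : R) := - (rho^-1 * (1 + x) `^ (- rho)).
have d0 x : 0 <= dec r x by exact: powR_ge0.
have is_d (x : R) : -1 < x -> is_derive x 1 F ((1 + x) `^ (- r)).
  move=> x0; have x1 : 0 < x + 1 by rewrite -ltrBlDr sub0r.
  have h1 : is_derive x 1 (fun y : R => y + 1) 1.
    by apply: is_derive_eq; rewrite addr0.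
  have h2 := @is_derive1_comp R ((powR (R:=R))^~ (- rho)) (fun y : R => y + 1) x _ _
    (is_derive1_powR (- rho) x1) h1.
  have h3 : is_derive x 1 (fun y : R => (- rho^-1) *: ((powR (R:=R))^~ (- rho) \o (fun y : R => y + 1)) y)
     ((- rho^-1) *: ((- rho * (x + 1) `^ (- rho - 1)) * 1)) by exact: is_deriveZ.
  have -> : F = (fun y : R => (- rho^-1) *: ((powR (R:=R))^~ (- rho) \o (fun y : R => y + 1)) y).
    by apply/funext => y; rewrite /F /= -mulNr addrC.
  apply: is_derive_eq h3 _.
  rewrite mulr1 /GRing.scale /= mulrA mulrNN mulVf ?gt_eqF// mul1r.
  by rewrite addrC /rho; congr (_ `^ _); ring.
have N0 (x : R) : 0 <= x -> -1 < x by move=> x0; rewrite (lt_le_trans _ x0)// ltrN10.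
have Fcvg : F x @[x --> +oo%R] --> 0.
  rewrite -oppr0; apply: cvgN; rewrite -(mulr0 rho^-1); apply: cvgM; first exact: cvg_cst.
  apply/cvgrPdist_le => e e0; near=> x.
  rewrite sub0r normrN ger0_norm ?powR_ge0// powRN.
  have ye : 0 < e `^ (- rho^-1) by rewrite powR_gt0.
  have xe : e `^ (- rho^-1) <= 1 + x.
    have : e `^ (- rho^-1) <= x by near: x; exact: nbhs_pinfty_ge.
    by move=> h; rewrite (le_trans h)// lerDr.
  have := le_powR (ltW rho0) (ltW ye) xe.
  rewrite -powRrM mulNr mulVf ?gt_eqF// powR_inv1 ?(ltW e0)// => h.
  by rewrite -[leRHS]invrK lef_pV2// posrE ?invr_gt0// powR_gt0// (lt_le_trans ye).
have I0 : (\int[@lebesgue_measure R]_(x in `[0%R, +oo[) (dec r x)%:E = (rho^-1)%:E)%E.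
  rewrite (@ge0_continuous_FTC2y _ (dec r) F 0 0)//.
  - by rewrite /F addr0 powR1 mulr1 -EFinB opprK add0r.
  - exact: continuous_subspaceT.
  - by move=> x /ltW /N0 x0; have [] := is_d x x0.
  - apply: cvg_at_right_filter; apply: differentiable_continuous.
    by apply/derivable1_diffP; have [] := is_d 0 (N0 0 (lexx 0)).
  - move=> x; rewrite in_itv /= andbT => x0.
    rewrite derive1E; have [_ ->] := is_d x (N0 x (ltW x0)).
    by rewrite /dec gtr0_norm.
exists (2 * rho^-1); first by rewrite mulr_ge0// invr_ge0 ltW.
rewrite ge0_symfun_integralT//.
- by rewrite -set_itvcy I0 -EFinM.
- by move=> x; rewrite /dec /= normrN.
Unshelve. all: by end_near. Qed.

(** A product of one-variable weights in place of a power of [jbr]: its integral factors over the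
    coordinates. *)
Definition decay n (r : R) (x : 'rV[R]_n) : R := \prod_(j < n) (1 + `|x ord0 j|) `^ (- r).

Lemma decay_ge0 n r (x : 'rV[R]_n) : 0 <= decay r x.
Proof. by apply: prodr_ge0 => j _; exact: powR_ge0. Qed.

Lemma measurable_decay n r : measurable_fun setT (@decay n r).
Proof.
apply: (measurable_prod_coord (F := dec r)).
exact: continuous_measurable_fun (@continuous_dec r).
Qed.

Lemma decay_int n r : 1 < r ->
  exists2 c : R, 0 <= c & (\int[leb R n]_x (decay r x)%:E = c%:E)%E.
Proof.
move=> r1; have [c c0 hc] := decay1_int r1.
exists (c ^+ n); first exact: exprn_ge0.
apply: (@integral_prod R n (dec r) c) => //.
- exact: continuous_measurable_fun (@continuous_dec r).
- by move=> x; exact: powR_ge0.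
Qed.

Lemma coord_le_jbr n (x : 'rV[R]_n) j : 1 + `|x ord0 j| <= 2 * jbr x.
Proof.
have h : x ord0 j ^+ 2 <= \sum_(i < n) x ord0 i ^+ 2.
  by rewrite (bigD1 j)//= lerDl sumr_ge0// => i _; exact: sqr_ge0.
have J := jbr_sqr x; have J0 := jbr_ge0 x.
rewrite -(@ler_pXn2r _ 2)// ?nnegrE ?mulr_ge0 ?addr_ge0//.
rewrite -(real_normK (num_real (x ord0 j))) in h.
rewrite exprMn J; set a := `|_| in h *; set S := \sum_(_ < _) _ in h *.
by have := sqr_ge0 (a - 1); have := sqr_ge0 a; lra.
Qed.

(** Each factor [1 + |x_j|] is at most [2 jbr x], and the exponent [t] is shared equally by the [n]
    coordinates; the right-hand side is integrable when [t > n]. *)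
Lemma jbr_decay n (t : R) (x : 'rV[R]_n) : (0 < n)%N -> 0 <= t ->
  jbr x `^ (- t) <= 2 `^ t * decay (t / n%:R) x.
Proof.
move=> n0 t0; have n0' : (0 : R) < n%:R by rewrite ltr0n.
rewrite -ler_pdivrMl ?powR_gt0// -powRN.
rewrite -powRM ?jbr_ge0//.
have -> : (2 * jbr x) `^ (- t) = \prod_(j < n) (2 * jbr x) `^ (- (t / n%:R)).
  rewrite prodr_const card_ord -powR_mulrn ?powR_ge0// -powRrM.
  by rewrite mulNr divfK ?gt_eqF.
apply: ler_prod => j _; rewrite powR_ge0 /= !powRN lef_pV2 ?posrE ?powR_gt0 ?mulr_gt0 ?jbr_gt0//.
apply: le_powR; [by rewrite divr_ge0|exact/ltW|exact: coord_le_jbr].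
Qed.

End Decay.

(** * Fourier-Lebesgue norms and convolution *)

Section FourierLebesgue.
Variables (R : realType) (n : nat).
Local Notation mu := (leb R n).
Implicit Types (a b g : 'rV[R]_n -> R[i]) (q s : R).

Lemma cmeasurableP g : cmeasurable g <-> cmeas g.
Proof.
split=> -[g1 g2]; split.
- by apply/measurable_tuple_of_row.
- by apply/measurable_tuple_of_row.
- exact: (measurable_tuple_of_row (fun x => complex.Re (g x))).1.
- exact: (measurable_tuple_of_row (fun x => complex.Im (g x))).1.
Qed.

Definition wabs s g (x : 'rV[R]_n) : R := jbr x `^ s * cabs (g x).

Lemma wabs_ge0 s g x : 0 <= wabs s g x.
Proof. by rewrite mulr_ge0 ?powR_ge0 ?cabs_ge0. Qed.

Lemma measurable_wabs s g : cmeas g -> measurable_fun setT (wabs s g).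
Proof.
move=> mg; apply: measurable_funM; first exact: measurable_jbr_pow.
exact: measurable_cabs.
Qed.

Lemma measurable_wabsX s q g : cmeas g -> measurable_fun setT (fun x => wabs s g x `^ q).
Proof. by move=> mg; exact: (measurableT_comp (measurable_powR _) (measurable_wabs _ mg)). Qed.

Lemma FLintE q s g : cmeas g -> FLint q s g = (\int[mu]_x (wabs s g x `^ q)%:E)%E.
Proof.
move=> mg; rewrite /FLint intnE//.
- by apply/measurable_EFinP; exact: (measurable_wabsX s q mg).
- by move=> x; rewrite lee_fin powR_ge0.
Qed.

Lemma FLint_ge0 q s g : cmeas g -> (0 <= FLint q s g)%E.
Proof. by move=> mg; rewrite FLintE//; apply: integral_real_ge0 => x; exact: powR_ge0. Qed.

Lemma wabsX_ge0 s q g x : 0 <= wabs s g x `^ q.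
Proof. exact: powR_ge0. Qed.

Lemma FLint_le q s a b (K : R) : 0 <= q -> 0 <= K -> cmeas a -> cmeas b ->
  (forall x, cabs (a x) <= K * cabs (b x)) ->
  (FLint q s a <= (K `^ q)%:E * FLint q s b)%E.
Proof.
move=> q0 K0 ma mb ab; rewrite !FLintE//.
rewrite -(ge0Z mu (measurable_wabsX s q mb) (wabsX_ge0 s q b) (powR_ge0 K q)).
apply: ge0le.
- exact: measurable_wabsX.
- by apply: measurable_funM => //; exact: measurable_wabsX.
- exact: wabsX_ge0.
- move=> x; rewrite -powRM ?wabs_ge0//; apply: le_powR => //; first exact: wabs_ge0.
  by rewrite /wabs mulrCA ler_wpM2l ?powR_ge0.
Qed.

Lemma FLint0 q s : 0 < q -> FLint q s (fun _ : 'rV[R]_n => 0 : R[i]) = 0%E.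
Proof.
move=> q0; rewrite FLintE; last exact: cmeas_cst.
under eq_integral do rewrite /wabs cabs0 mulr0 powR0 ?gt_eqF//.
by rewrite integral0.
Qed.

Lemma FLintD q s a b : 0 <= q -> cmeas a -> cmeas b ->
  (FLint q s (fun x => a x + b x)%R <= (2 `^ q)%:E * (FLint q s a + FLint q s b))%E.
Proof.
move=> q0 ma mb; have mab := cmeasD ma mb.
rewrite !FLintE// -(ge0D mu (measurable_wabsX s q ma) (measurable_wabsX s q mb)
  (wabsX_ge0 s q a) (wabsX_ge0 s q b)).
have mS : measurable_fun setT (fun x => wabs s a x `^ q + wabs s b x `^ q).
  by apply: measurable_funD; exact: measurable_wabsX.
have S0 x : 0 <= wabs s a x `^ q + wabs s b x `^ q by rewrite addr_ge0 ?powR_ge0.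
rewrite -(ge0Z mu mS S0 (powR_ge0 2 q)); apply: ge0le.
- exact: measurable_wabsX.
- by apply: measurable_funM.
- exact: wabsX_ge0.
- move=> x; apply: le_trans (powRD_le q0 (wabs_ge0 _ _ _) (wabs_ge0 _ _ _)).
  apply: le_powR => //; first exact: wabs_ge0.
  by rewrite /wabs -mulrDr ler_wpM2l ?powR_ge0// cabsD.
Qed.

Lemma FLintZ q s (c : R[i]) a : 0 <= q -> cmeas a ->
  (FLint q s (fun x => c * a x)%R <= (cabs c `^ q)%:E * FLint q s a)%E.
Proof.
move=> q0 ma; apply: FLint_le => //; [exact: cabs_ge0|exact: cmeasZ|].
by move=> x; rewrite cabsM.
Qed.

Lemma FLintB q s a b : 0 <= q -> cmeas a -> cmeas b ->
  (FLint q s (fun x => a x - b x)%R <= (2 `^ q)%:E * (FLint q s a + FLint q s b))%E.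
Proof.
move=> q0 ma mb; apply: (le_trans (FLintD s q0 ma (cmeasN mb))).
apply: lee_wpmul2l; first by rewrite lee_fin powR_ge0.
apply: leeD2l; apply: le_trans (FLint_le s q0 ler01 (cmeasN mb) mb _) _.
  by move=> x; rewrite cabsN mul1r.
by rewrite powR1 mul1e.
Qed.

(* The only form in which the hypothesis [s > n/q'] enters. *)
Definition embeds_L1 (q s : R) := exists2 K : R, 0 <= K &
  forall g, cmeas g -> ((\int[mu]_x (cabs (g x))%:E) `^ q <= K%:E * FLint q s g)%E.

(** For [q > 1] this is Hoelder's inequality with weight [jbr^(- t)], [t = s q']: the condition
    [s > n / q'] says exactly that [t > n], hence that the weight is integrable. For [q = 1] the
    weight [jbr^s] is at least 1. *)
Lemma embeds_L1P q s : (0 < n)%N ->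
  (q = 1 /\ 0 <= s) \/ (1 < q /\ n%:R * (1 - q^-1) < s) -> embeds_L1 q s.
Proof.
move=> n0 [[-> s0]|[q1 ns]].
  exists 1 => // g mg; rewrite mul1e poweRe1; last first.
    by apply: integral_real_ge0 => x; exact: cabs_ge0.
  rewrite FLintE//; apply: ge0le.
  - exact: measurable_cabs.
  - exact: measurable_wabsX.
  - by move=> x; exact: cabs_ge0.
  - move=> x; rewrite powRr1 ?wabs_ge0// /wabs ler_peMl ?cabs_ge0//.
    exact: jbr_pow_ge1.
have q0 : 0 < q by rewrite (lt_trans _ q1).
have q10 : 0 < q - 1 by rewrite subr_gt0.
have n0' : (0 : R) < n%:R by rewrite ltr0n.
pose t := s * q / (q - 1).
have iq : 1 - q^-1 = (q - 1) / q by rewrite mulrBl divff ?gt_eqF// mul1r.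
have t1 : 1 < t / n%:R.
  rewrite ltr_pdivlMr// mul1r /t ltr_pdivlMr//.
  by rewrite -ltr_pdivrMr// -mulrA -iq.
have s0 : 0 <= s.
  apply/ltW/(le_lt_trans _ ns); rewrite mulr_ge0// subr_ge0 invf_le1// ltW//.
have t0 : 0 <= t by apply: divr_ge0; [apply: mulr_ge0 => //; exact: ltW|exact: ltW].
have [c c0 hc] := decay_int n t1.
pose w (x : 'rV[R]_n) := jbr x `^ (- t).
have mw : measurable_fun setT w by exact: measurable_jbr_pow.
have w0 x : 0 <= w x by exact: powR_ge0.
pose W := 2 `^ t * c.
have W0 : 0 <= W by rewrite mulr_ge0 ?powR_ge0.
have hW : (\int[mu]_x (w x)%:E <= W%:E)%E.
  rewrite EFinM -hc -(ge0Z mu (@measurable_decay R n _) (decay_ge0 _) (powR_ge0 2 t)).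
  apply: ge0le => //.
  - by apply: measurable_funM => //; exact: measurable_decay.
  - by move=> x; exact: jbr_decay.
exists (W `^ (q - 1)); first exact: powR_ge0.
move=> g mg.
pose b (x : 'rV[R]_n) := jbr x `^ t * cabs (g x).
have := weighted_jensen (mu := mu) mw (measurable_wabs t mg) w0 (wabs_ge0 t g) (ltW q1) W0 hW.
have E1 x : w x * wabs t g x = cabs (g x).
  by rewrite /w /wabs powRN mulKf// gt_eqF// powR_gt0// jbr_gt0.
have E2 x : w x * wabs t g x `^ q = wabs s g x `^ q.
  rewrite /wabs !powRM ?powR_ge0 ?cabs_ge0// mulrA; congr (_ * _).
  rewrite /w -!powRrM -powRD; last by apply/implyP => _; rewrite gt_eqF// jbr_gt0.
  congr (_ `^ _); rewrite /t.
  (* The exponents combine to [- t + t q = t (q - 1) = s q]. *)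
  have -> : - (s * q / (q - 1)) + s * q / (q - 1) * q = s * q / (q - 1) * (q - 1).
    by ring.
  by rewrite divfK// gt_eqF.
under eq_integral do rewrite E1.
under [X in (_ <= _ * X)%E -> _]eq_integral do rewrite E2.
by rewrite -FLintE.
Qed.

Definition cnorm : R := (2 * pi) `^ (- n%:R).

Lemma cnorm_gt0 : 0 < cnorm.
Proof. by rewrite powR_gt0// mulr_gt0// pi_gt0. Qed.

(* Normalized so that [invFT (conv a b)] is the pointwise product of the inverse transforms. *)
Definition conv a b (x : 'rV[R]_n) : R[i] :=
  cnorm%:C%C * CI mu (fun y => a (x - y) * b y).

Lemma cmeas_conv2 a b : cmeas a -> cmeas b ->
  cmeas (fun z : 'rV[R]_n * 'rV[R]_n => a (z.1 - z.2) * b z.2).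
Proof.
move=> ma mb; apply: cmeasM.
  by apply: (cmeas_comp (h := fun z : 'rV[R]_n * 'rV[R]_n => z.1 - z.2)) => //; exact: measurable_rowB.
exact: (cmeas_comp (h := snd)).
Qed.

Lemma cmeas_conv a b : cmeas a -> cmeas b -> cmeas (conv a b).
Proof.
move=> ma mb; apply: cmeasZ.
exact: (cmeas_CI mu (cmeas_conv2 ma mb)).
Qed.

Lemma cmeas_subl b (x : 'rV[R]_n) : cmeas b ->
  cmeas (fun y : 'rV[R]_n => b (x - y)).
Proof.
move=> mb; apply: (cmeas_comp (h := fun y : 'rV[R]_n => x - y)) => //.
exact: measurable_rowB.
Qed.

Lemma conv_le a b x : cmeas a -> cmeas b ->
  ((cabs (conv a b x))%:E <=
   (2 * cnorm)%:E * \int[mu]_y (cabs (a (x - y)) * cabs (b y))%:E)%E.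
Proof.
move=> ma mb; rewrite /conv cabsM cabs_real gtr0_norm ?cnorm_gt0// EFinM.
rewrite mulrC EFinM -muleA; apply: lee_wpmul2l; first by rewrite lee_fin ltW// cnorm_gt0.
under [X in (_ * X)%E]eq_integral do rewrite -cabsM.
by apply: CI_le; apply: cmeasM => //; exact: cmeas_subl.
Qed.

(** Young's inequality with the weight distributed over both factors. It is meant for kernels [b] of
    bounded weighted L^1 norm and yields bounds uniform over such kernels. *)
Lemma FLint_conv_weight q s a b (V : R) : 1 <= q -> 0 <= s -> 0 <= V ->
  cmeas a -> cmeas b -> (\int[mu]_x (wabs s b x)%:E <= V%:E)%E ->
  (FLint q s (conv a b) <= ((2 * cnorm * 2 `^ s * V) `^ q)%:E * FLint q s a)%E.
Proof.
move=> q1 s0 V0 ma mb bV; have q0 : 0 < q by rewrite (lt_le_trans _ q1).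
pose K := 2 * cnorm * 2 `^ s.
have K0 : 0 <= K by rewrite !mulr_ge0 ?powR_ge0// ltW ?cnorm_gt0.
have mca := measurable_cabs ma; have mcb := measurable_cabs mb.
have mwa := measurable_wabs s ma; have mwb := measurable_wabs s mb.
pose h (z : 'rV[R]_n * 'rV[R]_n) := wabs s a (z.1 - z.2) * wabs s b z.2.
have mh : measurable_fun setT h by exact: measurable_conv2.
have h0 z : 0 <= h z by rewrite mulr_ge0 ?wabs_ge0.
have mI := measurable_inner mu mh h0.
have I0 (x : 'rV[R]_n) : (0 <= \int[mu]_y (h (x, y))%:E)%E by exact: integral_real_ge0.
have pw x : ((wabs s (conv a b) x)%:E <= K%:E * \int[mu]_y (h (x, y))%:E)%E.
  rewrite /wabs EFinM.
  apply: (@le_trans _ _ ((jbr x `^ s)%:E * ((2 * cnorm)%:E *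
      \int[mu]_y (cabs (a (x - y)) * cabs (b y))%:E))%E).
    by apply: lee_wpmul2l; [rewrite lee_fin powR_ge0|exact: conv_le].
  rewrite muleCA [K%:E](EFinM (2 * cnorm)) -muleA; apply: lee_wpmul2l.
    by rewrite lee_fin mulr_ge0// ltW// cnorm_gt0.
  have m1 : measurable_fun setT (fun y : 'rV[R]_n => cabs (a (x - y)) * cabs (b y)).
    by apply: measurable_funM => //; apply: measurable_cabs; exact: cmeas_subl.
  have n1 y : 0 <= cabs (a (x - y)) * cabs (b y) by rewrite mulr_ge0 ?cabs_ge0.
  have m2 : measurable_fun setT (fun y => h (x, y)).
    exact: (measurableT_comp mh).
  rewrite -(ge0Z mu m1 n1 (powR_ge0 _ _)).
  rewrite -(ge0Z mu m2 (fun y => h0 (x, y)) (powR_ge0 2 s)).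
  apply: ge0le.
  - by apply: measurable_funM.
  - by apply: measurable_funM.
  - by move=> y; rewrite mulr_ge0 ?powR_ge0.
  - move=> y; rewrite /h /wabs /=.
    rewrite [leRHS](_ : _ = (2 `^ s * (jbr (x - y) `^ s * jbr y `^ s)) *
      (cabs (a (x - y)) * cabs (b y))); last by ring.
    by rewrite ler_wpM2r// -[in leLHS](subrK y x) jbr_powM.
rewrite FLintE; last exact: cmeas_conv.
apply: (@le_trans _ _ (\int[mu]_x ((K `^ q)%:E * (\int[mu]_y (h (x, y))%:E) `^ q))%E).
  apply: ge0_le_integral => //.
  - by move=> x _; rewrite lee_fin powR_ge0.
  - by apply/measurable_EFinP; apply: measurable_wabsX; exact: cmeas_conv.
  - by apply: measurable_funeM; exact: (measurableT_comp (measurable_poweR _) mI).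
  - move=> x _; rewrite -!poweR_EFin -poweRM//; apply: le_poweR; [exact/ltW| |exact: pw].
    by rewrite lee_fin wabs_ge0.
rewrite (@ge0_integralZl _ _ _ mu setT measurableT (fun x => (\int[mu]_y (h (x, y))%:E) `^ q)%E); last 3 first.
- exact: (measurableT_comp (measurable_poweR _) mI).
- by move=> x _; exact: poweR_ge0.
- by rewrite lee_fin powR_ge0.
rewrite FLintE// powRM// EFinM -muleA; apply: lee_wpmul2l.
  by rewrite lee_fin powR_ge0.
exact: (young mwa mwb (wabs_ge0 _ _) (wabs_ge0 _ _) q1 V0 bV).
Qed.

End FourierLebesgue.

Section Convolution.
Variables (R : realType) (n : nat).
Local Notation mu := (leb R n).
Local Notation cnorm := (cnorm R n).
Implicit Types (a b g : 'rV[R]_n -> R[i]) (q s : R).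

Let cn0 : 0 <= cnorm. Proof. exact/ltW/cnorm_gt0. Qed.

Lemma cinteg_bound g : cinteg mu g ->
  exists2 V : R, 0 <= V & (\int[mu]_x (cabs (g x))%:E = V%:E)%E.
Proof.
move=> [mg goo]; have g0 : (0 <= \int[mu]_x (cabs (g x))%:E)%E.
  by apply: integral_real_ge0 => x; exact: cabs_ge0.
exists (fine (\int[mu]_x (cabs (g x))%:E)%E); first exact: fine_ge0.
by rewrite fineK// ge0_fin_numE.
Qed.

Lemma embeds_cinteg q s g : 1 <= q -> embeds_L1 n q s -> cmeas g -> (FLint q s g < +oo)%E ->
  cinteg mu g.
Proof.
move=> q1 [K K0 HK] mg goo; split => //.
apply: (@lty_poweRy _ _ q); first by rewrite gt_eqF// (lt_le_trans _ q1).
by apply: (le_lt_trans (HK g mg)); rewrite lte_mul_pinfty// lee_fin.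
Qed.

Lemma conv_absint a b (A B : R) : cmeas a -> cmeas b -> 0 <= B ->
  (\int[mu]_x (cabs (a x))%:E <= A%:E)%E ->
  (\int[mu]_x (cabs (b x))%:E <= B%:E)%E ->
  (\int[mu]_x \int[mu]_y (cabs (a (x - y) * b y))%:E <= (A * B)%:E)%E.
Proof.
move=> ma mb B0 hA hB.
have := young (measurable_cabs ma) (measurable_cabs mb) (fun x => cabs_ge0 _)
  (fun x => cabs_ge0 _) (lexx 1) B0 hB.
under [X in (_ <= _ * X)%E -> _]eq_integral do rewrite powRr1 ?cabs_ge0//.
move=> H; apply: (@le_trans _ _ (B%:E * A%:E)%E); last by rewrite -EFinM mulrC.
rewrite powRr1// in H; apply: le_trans (le_trans H _); last by apply: lee_wpmul2l.
rewrite le_eqVlt; apply/orP; left; apply/eqP; apply: eq_integral => x _.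
rewrite poweRe1.
  by apply: eq_integral => y _; rewrite cabsM.
by apply: integral_real_ge0 => y; rewrite mulr_ge0 ?cabs_ge0.
Qed.

Lemma conv_L1 a b (A B : R) : cmeas a -> cmeas b -> 0 <= B ->
  (\int[mu]_x (cabs (a x))%:E <= A%:E)%E ->
  (\int[mu]_x (cabs (b x))%:E <= B%:E)%E ->
  (\int[mu]_x (cabs (conv a b x))%:E <= (2 * cnorm * (A * B))%:E)%E.
Proof.
move=> ma mb B0 hA hB; have mc2 := cmeas_conv2 ma mb.
have mI := measurable_inner mu (measurable_cabs mc2) (fun z => cabs_ge0 _).
have I0 (x : 'rV[R]_n) : (0 <= \int[mu]_y (cabs (a (x - y) * b y))%:E)%E.
  by apply: integral_real_ge0 => y; exact: cabs_ge0.
have k0 : 0 <= 2 * cnorm by rewrite mulr_ge0.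
apply: (@le_trans _ _ (\int[mu]_x ((2 * cnorm)%:E * \int[mu]_y (cabs (a (x - y) * b y))%:E))%E).
  apply: ge0_le_integral => //.
  - by move=> x _; rewrite lee_fin cabs_ge0.
  - by apply: emeasurable_cabs; exact: cmeas_conv.
  - exact: (measurable_funeM _ mI).
  - move=> x _; apply: le_trans (conv_le x ma mb) _.
    by under [X in (_ <= _ * X)%E]eq_integral do rewrite cabsM.
rewrite (ge0_integralZl mu measurableT mI (fun x _ => I0 x)); last by rewrite lee_fin.
have k0' : (0 <= (2 * cnorm)%:E)%E by rewrite lee_fin.
rewrite (EFinM (2 * cnorm)); exact: (lee_wpmul2l k0' (conv_absint ma mb B0 hA hB)).
Qed.

Lemma conv_cinteg a b : cinteg mu a -> cinteg mu b -> cinteg mu (conv a b).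
Proof.
move=> ai bi; have [A A0 hA] := cinteg_bound ai; have [B B0 hB] := cinteg_bound bi.
split; first exact: cmeas_conv ai.1 bi.1.
apply: (le_lt_trans (conv_L1 ai.1 bi.1 B0 _ _)); rewrite ?hA ?hB ?lexx//.
exact: ltry.
Qed.

(** The algebra property. The additive splitting of the weight leaves two convolutions; in each, one
    factor keeps the weight and the other is bounded in L^1 by the embedding, so Young's inequality
    applies. *)
Lemma FLint_conv q s a b (K : R) : 1 <= q -> 0 <= s -> 0 <= K ->
  (forall g, cmeas g -> ((\int[mu]_x (cabs (g x))%:E) `^ q <= K%:E * FLint q s g)%E) ->
  cmeas a -> cmeas b -> (FLint q s a < +oo)%E -> (FLint q s b < +oo)%E ->
  (FLint q s (conv a b) <=
    ((2 * cnorm * 2 `^ s) `^ q * 2 `^ q * (2 * K))%:E * (FLint q s a * FLint q s b))%E.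
Proof.
move=> q1 s0 K0 HK ma mb aoo boo; have q0 : 0 < q by rewrite (lt_le_trans _ q1).
have ai := embeds_cinteg q1 (ex_intro2 _ _ K K0 HK) ma aoo.
have bi := embeds_cinteg q1 (ex_intro2 _ _ K K0 HK) mb boo.
have [A A0 hA] := cinteg_bound ai; have [B B0 hB] := cinteg_bound bi.
have HA := HK a ma; have HB := HK b mb.
rewrite hA poweR_EFin in HA; rewrite hB poweR_EFin in HB.
pose C := 2 * cnorm * 2 `^ s.
have C0 : 0 <= C by rewrite !mulr_ge0 ?powR_ge0.
have mca := measurable_cabs ma; have mcb := measurable_cabs mb.
have mwa := measurable_wabs s ma; have mwb := measurable_wabs s mb.
have ca0 x : 0 <= cabs (a x) by exact: cabs_ge0.
have cb0 x : 0 <= cabs (b x) by exact: cabs_ge0.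
pose h (z : 'rV[R]_n * 'rV[R]_n) := wabs s a (z.1 - z.2) * cabs (b z.2).
pose k (z : 'rV[R]_n * 'rV[R]_n) := cabs (a (z.1 - z.2)) * wabs s b z.2.
have mh : measurable_fun setT h by exact: measurable_conv2 mwa mcb.
have mk : measurable_fun setT k by exact: measurable_conv2 mca mwb.
have h0 z : 0 <= h z by rewrite mulr_ge0 ?wabs_ge0.
have k0 z : 0 <= k z by rewrite mulr_ge0 ?wabs_ge0.
have mIh := measurable_inner mu mh h0; have mIk := measurable_inner mu mk k0.
have Ih0 (x : 'rV[R]_n) : (0 <= \int[mu]_y (h (x, y))%:E)%E by exact: integral_real_ge0.
have Ik0 (x : 'rV[R]_n) : (0 <= \int[mu]_y (k (x, y))%:E)%E by exact: integral_real_ge0.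
have mx (f : 'rV[R]_n * 'rV[R]_n -> R) (x : 'rV[R]_n) :
    measurable_fun setT f -> measurable_fun setT (fun y => f (x, y)).
  by move=> mf; exact: (measurableT_comp mf).
have pw x : ((wabs s (conv a b) x)%:E <=
    C%:E * (\int[mu]_y (h (x, y))%:E + \int[mu]_y (k (x, y))%:E))%E.
  rewrite /wabs EFinM.
  apply: (@le_trans _ _ ((jbr x `^ s)%:E * ((2 * cnorm)%:E *
      \int[mu]_y (cabs (a (x - y)) * cabs (b y))%:E))%E).
    by apply: lee_wpmul2l; [rewrite lee_fin powR_ge0|exact: conv_le].
  rewrite muleCA [C%:E](EFinM (2 * cnorm)) -muleA; apply: lee_wpmul2l.
    by rewrite lee_fin mulr_ge0.
  have m1 : measurable_fun setT (fun y : 'rV[R]_n => cabs (a (x - y)) * cabs (b y)).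
    exact: (mx (fun z => cabs (a (z.1 - z.2)) * cabs (b z.2)) x (measurable_conv2 mca mcb)).
  have n1 y : 0 <= cabs (a (x - y)) * cabs (b y) by rewrite mulr_ge0.
  rewrite -(ge0D mu (mx _ x mh) (mx _ x mk) (fun y => h0 (x, y)) (fun y => k0 (x, y))).
  rewrite -(ge0Z mu m1 n1 (powR_ge0 _ _)).
  have mhk : measurable_fun setT (fun y => h (x, y) + k (x, y)).
    by apply: measurable_funD; exact: mx.
  have hk0 y : 0 <= h (x, y) + k (x, y) by rewrite addr_ge0.
  rewrite -(ge0Z mu mhk hk0 (powR_ge0 2 s)).
  apply: ge0le.
  - exact: measurable_funM.
  - exact: measurable_funM.
  - by move=> y; rewrite mulr_ge0 ?powR_ge0.
  - move=> y; rewrite /h /k /wabs /=.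
    rewrite [leRHS](_ : _ = (2 `^ s * (jbr (x - y) `^ s + jbr y `^ s)) *
      (cabs (a (x - y)) * cabs (b y))); last by ring.
    by rewrite ler_wpM2r// -[in leLHS](subrK y x) jbr_powD.
rewrite FLintE; last exact: cmeas_conv.
pose Ih x := (\int[mu]_y (h (x, y))%:E)%E; pose Ik x := (\int[mu]_y (k (x, y))%:E)%E.
have mIhq : measurable_fun setT (fun x => Ih x `^ q)%E.
  exact: (measurableT_comp (measurable_poweR _) mIh).
have mIkq : measurable_fun setT (fun x => Ik x `^ q)%E.
  exact: (measurableT_comp (measurable_poweR _) mIk).
pose D := C `^ q * 2 `^ q.
have D0 : 0 <= D by rewrite mulr_ge0 ?powR_ge0.
have step1 : (\int[mu]_x ((wabs s (conv a b) x `^ q)%:E) <=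
    \int[mu]_x (D%:E * (Ih x `^ q + Ik x `^ q)))%E.
  apply: ge0_le_integral => //.
  - by move=> x _; rewrite lee_fin powR_ge0.
  - by apply/measurable_EFinP; apply: measurable_wabsX; exact: cmeas_conv.
  - by apply: measurable_funeM; exact: emeasurable_funD.
  - move=> x _; rewrite -poweR_EFin.
    apply: (le_trans (le_poweR (ltW q0) _ (pw x))); first by rewrite lee_fin wabs_ge0.
    rewrite poweRM//; last exact: adde_ge0.
    have E1 : (C%:E `^ q = (C `^ q)%:E)%E by [].
    have E2 : (D%:E = (C `^ q)%:E * (2 `^ q)%:E)%E by rewrite -EFinM.
    rewrite E1 E2 -muleA.
    by apply: lee_wpmul2l; [rewrite lee_fin powR_ge0|exact: poweRD_le (ltW q0) _ _].
apply: (le_trans step1).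
have Y1 : (\int[mu]_x (Ih x `^ q) <= (B `^ q)%:E * FLint q s a)%E.
  rewrite FLintE//; apply: (young mwa mcb (wabs_ge0 _ _) cb0 q1 B0).
  by rewrite hB.
(* Here the weight sits on the factor that is not translated; commuting the convolution puts it in
   the position that Young's inequality requires. *)
have Y2 : (\int[mu]_x (Ik x `^ q) <= (A `^ q)%:E * FLint q s b)%E.
  rewrite FLintE//.
  under eq_integral => x _.
    rewrite (_ : Ik x = \int[mu]_y (wabs s b (x - y) * cabs (a y))%:E)%E; last first.
      exact: (conv_comm x mca mwb ca0 (wabs_ge0 s b)).
    over.
  by apply: (young mwb mca (wabs_ge0 _ _) ca0 q1 A0); rewrite hA.
have mS : measurable_fun setT (fun x => Ih x `^ q + Ik x `^ q)%E by exact: emeasurable_funD.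
have S0 (x : 'rV[R]_n) : setT x -> (0 <= Ih x `^ q + Ik x `^ q)%E.
  by rewrite adde_ge0 ?poweR_ge0.
have D0' : (0 <= D%:E)%E by rewrite lee_fin.
rewrite (ge0_integralZl mu measurableT mS S0 D0').
rewrite (ge0_integralD mu measurableT (fun x _ => poweR_ge0 _ _) mIhq (fun x _ => poweR_ge0 _ _) mIkq).
rewrite (EFinM D) -muleA; apply: lee_wpmul2l; first by rewrite lee_fin.
have fa0 := FLint_ge0 q s ma; have fb0 := FLint_ge0 q s mb.
have Kab : (K%:E * FLint q s b * FLint q s a = K%:E * (FLint q s a * FLint q s b))%E.
  by rewrite -muleA (muleC (FLint q s b)).
apply: (@le_trans _ _ (K%:E * (FLint q s a * FLint q s b) +
   K%:E * (FLint q s a * FLint q s b))%E).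
  apply: leeD.
  - by apply: (le_trans Y1); rewrite -Kab; exact: lee_wpmul2r.
  - by apply: (le_trans Y2); rewrite muleA; exact: lee_wpmul2r.
rewrite -ge0_muleDl ?lee_fin// -EFinD.
by rewrite (_ : K + K = 2 * K)//; ring.
Qed.

Lemma cinteg_wave g (x : 'rV[R]_n) : cinteg mu g ->
  cinteg mu (fun xi => g xi * cexpi (dotp x xi)).
Proof.
move=> gi; have [mg goo] := gi; split.
  apply: cmeasM => //; apply: cmeas_cexpi.
  exact: (measurable_dotp (f := cst x) (g := id)).
by under eq_integral do rewrite cabsM cabs_cexpi mulr1.
Qed.

Lemma invFTE g x : cinteg mu g ->
  invFT g x = cnorm%:C%C * CI mu (fun xi => g xi * cexpi (dotp x xi)).
Proof. by move=> gi; rewrite /invFT cintE//; exact: cinteg_wave. Qed.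

Lemma invFTD a b x : cinteg mu a -> cinteg mu b ->
  invFT (fun xi => a xi + b xi) x = invFT a x + invFT b x.
Proof.
move=> ai bi; rewrite !invFTE//; last exact: cintegD.
rewrite -mulrDr -CID; [|exact: cinteg_wave..].
by congr (_ * _); apply: eq_CI => xi; rewrite mulrDl.
Qed.

Lemma invFTZ (c : R[i]) a x : cinteg mu a ->
  invFT (fun xi => c * a xi) x = c * invFT a x.
Proof.
move=> ai; rewrite !invFTE//; last exact: cintegZ.
rewrite [RHS]mulrCA -(CIZ c (cinteg_wave x ai)).
by congr (_ * _); apply: eq_CI => xi; rewrite mulrA.
Qed.

Lemma invFTB a b x : cinteg mu a -> cinteg mu b ->
  invFT (fun xi => a xi - b xi) x = invFT a x - invFT b x.
Proof.
move=> ai bi; rewrite !invFTE//; last exact: cintegB.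
rewrite -mulrBr -CIB; [|exact: cinteg_wave..].
by congr (_ * _); apply: eq_CI => xi; rewrite mulrBl.
Qed.

Lemma invFT0 x : invFT (fun _ : 'rV[R]_n => 0) x = 0.
Proof.
rewrite invFTE; last exact: cinteg0.
by under eq_CI do rewrite mul0r; rewrite CI0 mulr0.
Qed.

Lemma invFT_le g x : cinteg mu g ->
  ((cabs (invFT g x))%:E <= (2 * cnorm)%:E * \int[mu]_xi (cabs (g xi))%:E)%E.
Proof.
move=> gi; rewrite invFTE// cabsM cabs_real ger0_norm// mulrC EFinM [in leRHS]EFinM.
rewrite muleC [in leRHS](muleC 2%:E) -muleA; apply: lee_wpmul2l; first by rewrite lee_fin.
apply: le_trans (CI_le _ (cinteg_wave x gi).1) _.
by under eq_integral do rewrite cabsM cabs_cexpi mulr1.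
Qed.

Lemma dotpDr (x y z : 'rV[R]_n) : dotp x (y + z) = dotp x y + dotp x z.
Proof. by rewrite /dotp -big_split; apply: eq_bigr => j _; rewrite mxE mulrDr. Qed.

Lemma dotpNr (x y : 'rV[R]_n) : dotp x (- y) = - dotp x y.
Proof. by rewrite /dotp -sumrN; apply: eq_bigr => j _; rewrite mxE mulrN. Qed.

Lemma dotpC (x y : 'rV[R]_n) : dotp x y = dotp y x.
Proof. by apply: eq_bigr => j _; rewrite mulrC. Qed.

(** Fubini, after the wave at [u] has been factored into the waves at [u - v] and at [v]. The
    constant in [conv] supplies the second normalizing factor. *)
Lemma invFT_conv a b x : cinteg mu a -> cinteg mu b ->
  invFT (conv a b) x = invFT a x * invFT b x.
Proof.
move=> ai bi; have [ma aoo] := ai; have [mb boo] := bi.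
have [A A0 hA] := cinteg_bound ai; have [B B0 hB] := cinteg_bound bi.
pose ea xi := a xi * cexpi (dotp x xi); pose eb xi := b xi * cexpi (dotp x xi).
have eai : cinteg mu ea by exact: cinteg_wave.
have ebi : cinteg mu eb by exact: cinteg_wave.
have mF := cmeas_conv2 ma mb.
have F1 : (\int[mu]_u \int[mu]_v (cabs (a (u - v) * b v))%:E < +oo)%E.
  apply: le_lt_trans (conv_absint ma mb B0 _ _) _; rewrite ?hA ?hB ?lexx//.
  exact: ltry.
pose c xi := cnorm%:C%C * cexpi (dotp x xi).
have me : cmeas (fun xi : 'rV[R]_n => cexpi (dotp x xi)).
  by apply: cmeas_cexpi; exact: (measurable_dotp (f := cst x) (g := id)).
have mc : cmeas c by exact: cmeasZ.
rewrite !invFTE//; last exact: conv_cinteg.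
rewrite mulrACA -mulrA; congr (_ * _).
transitivity (CI mu (fun u => c u * CI mu (fun v => a (u - v) * b v))).
  apply: eq_CI => u; rewrite /conv /c -!mulrA; congr (_ * _).
  by rewrite mulrC.
rewrite (CI_CIZ (f := fun z : 'rV[R]_n * 'rV[R]_n => a (z.1 - z.2) * b z.2) mc mF F1) /=.
pose G (z : 'rV[R]_n * 'rV[R]_n) := c z.1 * (a (z.1 - z.2) * b z.2).
have mG : cmeas G.
  by apply: cmeasM => //; exact: (cmeas_comp (h := fst)).
have Gle z : cabs (G z) = cnorm * cabs (a (z.1 - z.2) * b z.2).
  by rewrite /G /c !cabsM cabs_cexpi mulr1 cabs_real ger0_norm.
rewrite (CI_Fubini (f := G) mG).
  have E v : CI mu (fun u => G (u, v)) = (cnorm%:C%C * CI mu ea) * eb v.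
    have -> : CI mu ea = CI mu (fun u => ea (u - v)) by rewrite CI_shift.
    rewrite -mulrA [_ * eb v]mulrC mulrA -CIZ; last exact: cinteg_shift.
    apply: eq_CI => u; rewrite /G /c /ea /eb /=.
    have -> : cexpi (dotp x u) = cexpi (dotp x (u - v)) * cexpi (dotp x v).
      by rewrite -cexpiD -dotpDr subrK.
    rewrite -[LHS]mulrA -[RHS]mulrA; congr (_ * _).
    by rewrite mulrACA mulrC; congr (_ * _); exact: mulrC.
  under eq_CI do rewrite E.
  by rewrite CIZ// mulrA.
under eq_integral => u _.
  under eq_integral do rewrite Gle.
  rewrite /= (ge0Z mu _ _ cn0); last 2 first.
  - by apply: measurable_cabs; apply: cmeasM => //; exact: cmeas_subl.
  - by move=> v; exact: cabs_ge0.
  over.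
have mI := measurable_inner mu (measurable_cabs mF) (fun z => cabs_ge0 _).
rewrite (ge0_integralZl mu measurableT mI) ?lee_fin//.
- by rewrite lte_mul_pinfty// lee_fin.
- by move=> u _; apply: integral_real_ge0 => v; exact: cabs_ge0.
Qed.

End Convolution.

(** * Smooth windows and the decay of their transforms *)

Section Smooth.
Variables (R : realType) (n : nat).
Local Notation iterD := (@Defs.iterD R n).
Implicit Types (f g : 'rV[R]_n -> R) (x v : 'rV[R]_n) (vs : seq 'rV[R]_n).

Lemma continuous_coord f x (e : R) : {for x, continuous f} -> 0 < e ->
  exists2 d : R, 0 < d & forall y : 'rV[R]_n, (forall j, `|x ord0 j - y ord0 j| < d) ->
    `|f x - f y| < e.
Proof.
move=> /cvgrPdist_lt /(_ e) cf e0; have /nbhs_ballP[d /= d0 H] := cf e0.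
exists d => // y xy; apply: H; split => // i j; rewrite ord1; exact: xy.
Qed.

(** The measurable structure on rows is generated by the coordinates, so a continuous function is
    exhibited as the pointwise limit of its samples on the grids of mesh [1 / (m + 1)], which are
    functions of [flr]. *)
Lemma continuous_measurable_row f : continuous f -> measurable_fun setT f.
Proof.
move=> cf; pose h (m : nat) x := f (m.+1%:R^-1 *: intvec R (flr (m.+1%:R *: x))).
apply: (@measurable_fun_cvg _ _ _ setT h).
  move=> m; pose F (k : 'rV[int]_n) := f (m.+1%:R^-1 *: intvec R k).
  apply: (measurableT_comp (f := fun x => F (flr x)) (measurable_flr F)).
  exact: measurable_rowZ.
move=> x _; apply/cvgrPdist_lt => e e0.
have [d d0 H] := continuous_coord (cf x) e0.
near=> m; apply: H => j; rewrite !mxE.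
have m0 : (0 : R) < m.+1%:R by rewrite ltr0n.
have md : m.+1%:R^-1 < d by near: m; exact: near_infty_natSinv_lt (PosNum d0).
have /andP[h1 h2] := floor_itv (m.+1%:R * x ord0 j).
set k := (Num.floor _)%:~R in h1 h2 *.
have E : x ord0 j - m.+1%:R^-1 * k = m.+1%:R^-1 * (m.+1%:R * x ord0 j - k).
  by rewrite mulrBr mulKf ?gt_eqF.
rewrite E normrM gtr0_norm ?invr_gt0// ger0_norm ?subr_ge0//.
apply: le_lt_trans md; rewrite ler_piMr// ?invr_ge0 ?ltW//.
by rewrite ltrBlDr addrC; move: h2; rewrite intrD.
Unshelve. all: by end_near. Qed.

Lemma smooth_continuous f : smooth f -> continuous f.
Proof. by move=> sf x; apply: differentiable_continuous; exact: (sf [::]). Qed.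

Lemma iterD_cat vs ws f : iterD (vs ++ ws) f = iterD vs (iterD ws f).
Proof. by elim: vs => //= v vs ->. Qed.

Lemma smooth_iterD vs f : smooth f -> smooth (iterD vs f).
Proof. by move=> sf ws x; rewrite -iterD_cat; exact: sf. Qed.

Definition suppin (V : zmodType) (r : R) (F : 'rV[R]_n -> V) :=
  forall x, (exists j, r < `|x ord0 j|) -> F x = 0.

(** Outside the closed cube the function vanishes in a whole neighbourhood, hence so does its
    derivative. *)
Lemma suppin_derive r f v : suppin r f -> suppin r (fun x => 'D_v f x).
Proof.
move=> sf x [j xj].
have -> : 'D_v f x = 'D_v (fun _ : 'rV[R]_n => 0 : R) x.
  apply: near_eq_derive; apply/nbhs_ballP; exists (`|x ord0 j| - r).
    by rewrite /= subr_gt0.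
  move=> y [_ /(_ ord0 j)]; rewrite /ball /= => xy; apply: sf; exists j.
  by have := ler_distD (y ord0 j) (x ord0 j) 0; rewrite !subr0; lra.
exact: derive_cst.
Qed.

Lemma suppin_iterD r f vs : suppin r f -> suppin r (iterD vs f).
Proof. by move=> sf; elim: vs => //= v vs IH; exact: suppin_derive. Qed.

Lemma suppin_bounded r f : continuous f -> suppin r f ->
  exists2 M : R, 0 <= M & forall x, `|f x| <= M.
Proof.
move=> cf sf.
pose A := [set x : 'rV[R]_n | forall i, `[- r, r]%classic (x ord0 i)].
have cA : compact A by apply: (@rV_compact _ _ (fun=> `[- r, r]%classic)) => i; exact: segment_compact.
have cfA : compact (f @` A).
  by apply: continuous_compact => //; exact: continuous_subspaceT.
have [M [_ HM]] := compact_bounded cfA.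
exists (`|M| + 1); first by rewrite addr_ge0.
move=> x; have [Ax|nAx] := pselect (A x).
  by apply: HM; [rewrite (le_lt_trans (ler_norm M))// ltrDl|exists x].
rewrite sf ?normr0 ?addr_ge0//.
apply: contrapT => H; apply: nAx => i; rewrite /= in_itv /= -ler_norml.
by rewrite leNgt; apply/negP => h; apply: H; exists i.
Qed.

Lemma smooth_bounded r f vs : smooth f -> suppin r f ->
  exists2 M : R, 0 <= M & forall x, `|iterD vs f x| <= M.
Proof.
move=> sf Sf; apply: (@suppin_bounded r); last exact: suppin_iterD.
exact/smooth_continuous/smooth_iterD.
Qed.

Lemma derive_line f x v (t : R) : smooth f ->
  is_derive t 1 (fun t => f (x + t *: v)) ('D_v f (x + t *: v)).
Proof.
move=> sf; have df := @diff_derivable _ _ _ f (x + t *: v) v (sf [::] (x + t *: v)).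
have E : (fun h : R => h^-1 *: (((fun t => f (x + t *: v)) \o shift t) (h *: (1 : R)) - f (x + t *: v)))
   = (fun h : R => h^-1 *: ((f \o shift (x + t *: v)) (h *: v) - f (x + t *: v))).
  apply/funext => h /=; congr (_ *: (f _ - _)).
  by rewrite -[h *: 1]/(h * 1) mulr1 scalerDl addrCA.
by split; [rewrite /derivable E|rewrite /derive E].
Qed.

Lemma diff_le f x v (h M : R) : smooth f -> (forall y, `|'D_v f y| <= M) ->
  `|f (x + h *: v) - f x| <= `|h| * M.
Proof.
move=> sf HM.
wlog h0 : h x / 0 <= h.
  move=> W; have [h0|h0] := leP 0 h; first exact: W.
  have := W (- h) (x + h *: v); rewrite oppr_ge0 (ltW h0) => /(_ isT).
  by rewrite -addrA -scalerDl subrr scale0r addr0 normrN distrC.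
have der t := derive_line x v t sf.
have [|c _ E] := @MVT_segment R (fun t => f (x + t *: v)) (fun t => 'D_v f (x + t *: v)) 0 h h0 (fun t _ => der t).
  apply: continuous_subspaceT => t; apply: differentiable_continuous.
  by apply/derivable1_diffP; have [] := der t.
rewrite scale0r addr0 subr0 in E; rewrite E normrM mulrC ler_wpM2l//.
Qed.

Definition dlt (V : zmodType) v (F : 'rV[R]_n -> V) x : V := F (x + v) - F x.

Lemma derive_shift f v w x : 'D_w (fun x => f (x + v)) x = 'D_w f (x + v).
Proof.
rewrite /derive.
suff -> : (fun h : R => h^-1 *: (((fun x => f (x + v)) \o shift x) (h *: w) - f (x + v)))
  = (fun h : R => h^-1 *: ((f \o shift (x + v)) (h *: w) - f (x + v))) by [].
by apply/funext => h /=; rewrite addrA.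
Qed.

Lemma smooth_shift f v : smooth f -> smooth (fun x => f (x + v)).
Proof.
have E ws g : iterD ws (fun x => g (x + v)) = (fun x => iterD ws g (x + v)).
  elim: ws => //= w ws IH; rewrite IH; apply/funext => x.
  exact: derive_shift.
move=> sf ws x; rewrite E.
apply: (@differentiable_comp _ _ _ _ (fun x => x + v) (iterD ws f)); last exact: sf.
by apply: differentiableD => //; exact: differentiable_cst.
Qed.

Lemma iterDB ws f g : smooth f -> smooth g ->
  iterD ws (fun x => f x - g x) = (fun x => iterD ws f x - iterD ws g x).
Proof.
move=> sf sg; elim: ws => //= w ws ->; apply/funext => x.
by rewrite deriveB//; apply: diff_derivable; [exact: sf|exact: sg].
Qed.

Lemma smoothB f g : smooth f -> smooth g -> smooth (fun x => f x - g x).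
Proof.
move=> sf sg ws x; rewrite iterDB//.
by apply: differentiableB; [exact: sf|exact: sg].
Qed.

Lemma smooth_dlt f v : smooth f -> smooth (dlt v f).
Proof. by move=> sf; apply: smoothB => //; exact: smooth_shift. Qed.

Lemma derive_dlt f v w : smooth f -> (fun x => 'D_w (dlt v f) x) = dlt v (fun x => 'D_w f x).
Proof.
move=> sf; apply/funext => x; rewrite /dlt deriveB ?derive_shift//.
- by apply: diff_derivable; exact: (smooth_shift v sf [::]).
- by apply: diff_derivable; exact: (sf [::]).
Qed.

Definition ev (j : 'I_n) : 'rV[R]_n := delta_mx ord0 j.

(** Iterated forward differences along coordinate directions; the step in direction [j] is [h j]
    however often [j] occurs in the list. *)
Definition dlts (V : zmodType) (h : 'I_n -> R) (js : seq 'I_n) (F : 'rV[R]_n -> V) :=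
  foldr (fun j => dlt (h j *: ev j)) F js.

Lemma smooth_dlts h js f : smooth f -> smooth (dlts h js f).
Proof. by move=> sf; elim: js => //= j js; exact: smooth_dlt. Qed.

Lemma derive_dlts h js w f : smooth f ->
  (fun x => 'D_w (dlts h js f) x) = dlts h js (fun x => 'D_w f x).
Proof.
move=> sf; elim: js => //= j js IH.
by rewrite derive_dlt ?IH//; exact: smooth_dlts.
Qed.

(** Differences commute with derivatives, so by induction and the mean value inequality each
    difference costs one derivative and yields a factor [|h j|]. The bound [M] is independent of the
    steps. *)
Lemma dlts_le r f js : smooth f -> suppin r f ->
  exists2 M : R, 0 <= M & forall h x, `|dlts h js f x| <= \prod_(j <- js) `|h j| * M.
Proof.
elim: js f => [|j js IH] f sf Sf.
  have [M M0 HM] := smooth_bounded [::] sf Sf.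
  by exists M => // h x; rewrite big_nil mul1r; exact: HM.
have [M M0 HM] := IH _ (smooth_iterD [:: ev j] sf) (suppin_derive (ev j) Sf).
exists M => // h x; rewrite big_cons -mulrA /=.
apply: diff_le; first exact: smooth_dlts.
by move=> y; have := HM h y; rewrite -derive_dlts.
Qed.

Lemma dlts_supp (V : zmodType) r h js (F : 'rV[R]_n -> V) : suppin r F ->
  suppin (r + \sum_(j <- js) `|h j|) (dlts h js F).
Proof.
move=> SF; elim: js => [|j js IH] /=; first by rewrite big_nil addr0.
rewrite big_cons => x [i xi]; rewrite /dlt !IH ?subr0//.
- by exists i; apply: le_lt_trans xi; rewrite lerD2l lerDr.
- exists i; rewrite !mxE eqxx /=.
  have := ler_distD (x ord0 i + h j * (i == j)%:R) (x ord0 i) 0.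
  rewrite !subr0 opprD addrA subrr sub0r normrN normrM.
  have : `|(i == j)%:R : R| <= 1 by case: (i == j); rewrite ?normr1 ?normr0.
  move=> /(ler_wpM2l (normr_ge0 (h j))); rewrite mulr1.
  by lra.
Qed.

End Smooth.

Section Good.
Variables (R : realType) (n : nat).
Implicit Types (F : 'rV[R]_n -> R[i]) (x v : 'rV[R]_n).
Local Notation mu := (leb R n).

(** The complex test functions [C_c^infty], for which inversion is proved. *)
Definition good F := [/\ smooth (fun x => complex.Re (F x)),
  smooth (fun x => complex.Im (F x)) & exists r : R, suppin r F].

Lemma good_cmeas F : good F -> cmeas F.
Proof.
by move=> [sR sI _]; split; apply: continuous_measurable_row; exact: smooth_continuous.
Qed.

Lemma suppin_Re r F : suppin r F -> suppin r (fun x => complex.Re (F x)).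
Proof. by move=> sF x xr; rewrite sF. Qed.

Lemma suppin_Im r F : suppin r F -> suppin r (fun x => complex.Im (F x)).
Proof. by move=> sF x xr; rewrite sF. Qed.

Lemma suppin_ge0 r F : suppin r F -> exists2 r' : R, 0 <= r' & suppin r' F.
Proof.
move=> sF; exists `|r| => // x [j xj]; apply: sF; exists j.
exact: le_lt_trans (ler_norm r) xj.
Qed.

Lemma exprn_ord (a : R) : a ^+ n = \prod_(j < n) a.
Proof. by rewrite prodr_const card_ord. Qed.

(** On the cube of half-side [r] every factor [(1 + |x_j|)^(-2)] is at least [(1 + r)^(-2)]; this
    compares the function with one fixed integrable weight. *)
Lemma supp_decay F (r M : R) : 0 <= r -> 0 <= M -> suppin r F ->
  (forall x, cabs (F x) <= M) ->
  forall x, cabs (F x) <= M * ((1 + r) ^+ 2) ^+ n * decay 2 x.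
Proof.
move=> r0 M0 sF HM x; rewrite -mulrA.
have [[j xj]|H] := pselect (exists j, r < `|x ord0 j|).
  rewrite sF; last by exists j.
  by rewrite cabs0 !mulr_ge0 ?decay_ge0 ?exprn_ge0// addr_ge0.
apply: le_trans (HM x) _; rewrite ler_peMr//.
rewrite /decay exprn_ord -big_split /=.
have xr j : `|x ord0 j| <= r.
  by rewrite leNgt; apply/negP => h; apply: H; exists j.
elim/big_ind : _ => // [a b a1 b1|j _]; first by rewrite (le_trans a1)// ler_peMr// (le_trans _ a1).
have p : 0 < 1 + `|x ord0 j| by rewrite ltr_wpDr.
suff h : 1 <= (1 + r) ^+ 2 * (1 + `|x ord0 j|) `^ (- 2%:R) by exact: h.
rewrite powRN powR_mulrn ?(ltW p)// ler_pdivlMr ?exprn_gt0// mul1r.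
by rewrite lerXn2r ?nnegrE ?addr_ge0 ?lerD2l.
Qed.

Lemma good_bounded F : good F -> exists2 M : R, 0 <= M & forall x, cabs (F x) <= M.
Proof.
move=> [sR sI [r sF]].
have [A A0 HA] := smooth_bounded [::] sR (suppin_Re sF).
have [B B0 HB] := smooth_bounded [::] sI (suppin_Im sF).
exists (A + B); first exact: addr_ge0.
by move=> x; apply: le_trans (cabs_le _) _; exact: lerD (HA x) (HB x).
Qed.

Lemma good_le_decay F : good F ->
  exists2 M : R, 0 <= M & forall x, cabs (F x) <= M * decay 2 x.
Proof.
move=> gF; have [M M0 HM] := good_bounded gF; have [_ _ [r0 sF0]] := gF.
have [r r_ge0 sF] := suppin_ge0 sF0.
exists (M * ((1 + r) ^+ 2) ^+ n); last exact: supp_decay.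
by rewrite mulr_ge0// !exprn_ge0// addr_ge0.
Qed.

Lemma decay_cinteg F (M r : R) : 1 < r -> 0 <= M -> cmeas F ->
  (forall x, cabs (F x) <= M * decay r x) -> cinteg mu F.
Proof.
move=> r1 M0 mF HM; apply: (cinteg_le (h := fun x => M * decay r x)) => //.
  by apply: measurable_funM => //; exact: measurable_decay.
have [c c0 Hc] := decay_int n r1.
rewrite (ge0Z mu (@measurable_decay R n r) (@decay_ge0 R n r) M0) Hc -EFinM.
exact: ltry.
Qed.

Lemma good_cinteg F : good F -> cinteg mu F.
Proof.
move=> gF; have [M M0 HM] := good_le_decay gF.
by apply: (decay_cinteg _ M0 (good_cmeas gF) HM); rewrite ltr1n.
Qed.

Lemma invFT_shift F v x : cinteg mu F ->
  invFT (fun xi => F (xi + v)) x = cexpi (- dotp x v) * invFT F x.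
Proof.
move=> iF; rewrite !invFTE//; last exact: cinteg_shift.
rewrite mulrCA; congr (_ * _).
rewrite -(CI_shift v (cinteg_wave x iF)) -CIZ; last first.
  exact: (cinteg_shift v (cinteg_wave x iF)).
apply: eq_CI => xi; rewrite mulrCA dotpDr -cexpiD.
by rewrite [dotp x xi + _]addrC addKr.
Qed.

Lemma dltsRe h js F x : complex.Re (dlts h js F x) = dlts h js (fun x => complex.Re (F x)) x.
Proof.
elim: js x => //= j js IH x; rewrite /dlt -!IH.
by case: (dlts h js F (x + _)) => a b; case: (dlts h js F x).
Qed.

Lemma dltsIm h js F x : complex.Im (dlts h js F x) = dlts h js (fun x => complex.Im (F x)) x.
Proof.
elim: js x => //= j js IH x; rewrite /dlt -!IH.
by case: (dlts h js F (x + _)) => a b; case: (dlts h js F x).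
Qed.

Lemma cinteg_dlts h js F : cinteg mu F -> cinteg mu (dlts h js F).
Proof.
by move=> iF; elim: js => //= j js IH; apply: cintegB => //; exact: cinteg_shift.
Qed.

Lemma dotp_ev x (j : 'I_n) (t : R) : dotp x (t *: ev R j) = t * x ord0 j.
Proof.
rewrite /dotp (bigD1 j)//= big1 ?addr0; last first.
  by move=> i ij; rewrite !mxE eqxx (negPf ij) /= !mulr0.
by rewrite !mxE !eqxx /= mulr1 mulrC.
Qed.

(* Translating by [pi / x_j] in the j-th direction flips the sign of the wave. *)
Lemma invFT_dlts F (js : seq 'I_n) x : cinteg mu F -> (forall j, j \in js -> x ord0 j != 0) ->
  cabs (invFT (dlts (fun j => pi / x ord0 j) js F) x) = 2 ^+ size js * cabs (invFT F x).
Proof.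
move=> iF; elim: js => [|j js IH] xj /=; first by rewrite expr0 mul1r.
have ij := cinteg_dlts (fun j => pi / x ord0 j) js iF.
rewrite invFTB//; last exact: cinteg_shift.
rewrite invFT_shift// dotp_ev divfK; last by apply: xj; rewrite inE eqxx.
have -> : cexpi (- pi) = -1 :> R[i].
  by apply: complex_eq; rewrite /= ?cosN ?sinN ?cospi ?sinpi ?oppr0.
rewrite mulN1r -opprD -mulr2n cabsN -[_ *+ 2]mulr_natr cabsM IH; last first.
  by move=> i ijs; apply: xj; rewrite inE ijs orbT.
have -> : cabs (2 : R[i]) = 2.
  by rewrite -[2 : R[i]]/((1 : R[i]) + 1) /cabs /= addr0 expr0n /= addr0 sqrtr_sqr ger0_norm.
by rewrite exprS mulrC mulrA.
Qed.

(** Integration by parts in discrete form. In each coordinate with [|x_j| >= 1], two differences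
    with step [pi / x_j] double the modulus of the transform twice, while they make the function of
    size [1 / x_j^2]. The remaining coordinates are bounded and need no decay. The set [S] of large
    coordinates has finitely many values, and their constants are added up. *)
Lemma invFT_decay F : good F ->
  exists2 M : R, 0 <= M & forall x, cabs (invFT F x) <= M * decay 2 x.
Proof.
move=> gF; have [sR sI [r1 sF1]] := gF; have [r r0 sF] := suppin_ge0 sF1.
have iF := good_cinteg gF.
suff H (S : {set 'I_n}) : exists M : R, 0 <= M /\ forall x,
    (forall j, (j \in S) = (1 <= `|x ord0 j|)) -> cabs (invFT F x) <= M * decay 2 x.
  have [M HM] := choice H.
  exists (\sum_S M S); first by apply: sumr_ge0 => S _; exact: (HM S).1.
  move=> x; pose S := [set j | 1 <= `|x ord0 j|]%SET.
  have := (HM S).2 x (fun j => _); rewrite /S => h.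
  apply: le_trans (h _) _; first by move=> j; rewrite inE.
  apply: ler_wpM2r; first exact: decay_ge0.
  by rewrite (bigD1 [set j | 1 <= `|x ord0 j|]%SET)//= lerDl sumr_ge0// => T _; exact: (HM T).1.
(* Every large coordinate is listed twice, one difference for each power of [1 / |x_j|] wanted. *)
pose js := enum S ++ enum S.
have [A A0 HA] := dlts_le js sR (suppin_Re sF).
have [B B0 HB] := dlts_le js sI (suppin_Im sF).
have [c c0 Hc] : exists2 c : R, 0 <= c & (\int[mu]_x (decay 2 x)%:E = c%:E)%E.
  by apply: decay_int; rewrite ltr1n.
(* The steps have size at most [pi <= 4], so the differences stay supported in a cube that does not
   depend on [x]. *)
pose r' := r + \sum_(j <- js) (4 : R).
have r'0 : 0 <= r' by apply: addr_ge0 => //; apply: sumr_ge0 => j _.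
pose D := 2 * cnorm R n * (A + B) * ((1 + r') ^+ 2) ^+ n * c.
have D0 : 0 <= D.
  rewrite /D !mulr_ge0 ?(ltW (cnorm_gt0 R n))//; first exact: addr_ge0.
  by rewrite !exprn_ge0// (le_trans r'0)// lerDr.
exists (D * 16 ^+ n); split; first by rewrite mulr_ge0 ?exprn_ge0.
move=> x Sx; pose h j := pi / x ord0 j.
have xj j : j \in js -> 1 <= `|x ord0 j|.
  by rewrite mem_cat mem_enum orbb Sx.
have pi4 : pi <= 4 :> R by have := @pihalf_lt2 R; lra.
have hj j : j \in js -> `|h j| <= 4.
  move=> /xj x1; rewrite normrM normfV (gtr0_norm (pi_gt0 R)).
  rewrite ler_pdivrMr; last exact: lt_le_trans x1.
  by apply: le_trans pi4 _; rewrite ler_peMr.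
pose P := \prod_(j <- js) `|h j|.
have P0 : 0 <= P by apply: prodr_ge0.
have dle y : cabs (dlts h js F y) <= P * (A + B) * ((1 + r') ^+ 2) ^+ n * decay 2 y.
  apply: supp_decay => //; first by rewrite mulr_ge0 ?addr_ge0.
    move=> z [j zj]; apply: (dlts_supp (h := h) (js := js) sF); exists j.
    apply: le_lt_trans zj; rewrite lerD2l.
    by rewrite !big_seq; apply: ler_sum => i; exact: hj.
  move=> z; apply: le_trans (cabs_le _) _; rewrite dltsRe dltsIm mulrDr.
  exact: lerD (HA h z) (HB h z).
have iD := cinteg_dlts h js iF.
have I1 : (\int[mu]_y (cabs (dlts h js F y))%:E <= (P * (A + B) * ((1 + r') ^+ 2) ^+ n * c)%:E)%E.
  rewrite EFinM -Hc -ge0Z//; last 3 first.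
  - exact: measurable_decay.
  - exact: decay_ge0.
  - rewrite !mulr_ge0//; first exact: addr_ge0.
    by rewrite !exprn_ge0// (le_trans r'0)// lerDr.
  apply: ge0le => //.
  - exact: measurable_cabs iD.1.
  - by apply: measurable_funM => //; exact: measurable_decay.
  - by move=> y; exact: cabs_ge0.
have I2 : 2 ^+ size js * cabs (invFT F x) <= P * D.
  rewrite -invFT_dlts//; last first.
    by move=> j /xj x1; rewrite -normr_gt0; exact: lt_le_trans x1.
  rewrite -lee_fin; apply: le_trans (invFT_le x iD) _.
  have -> : P * D = 2 * cnorm R n * (P * (A + B) * ((1 + r') ^+ 2) ^+ n * c).
    by rewrite /D; ring.
  rewrite [in leRHS]EFinM; apply: lee_wpmul2l => //.
  by rewrite lee_fin mulr_ge0// ltW// cnorm_gt0.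
(* Per coordinate: [(pi / (2 |x_j|)) (1 + |x_j|) <= 4] when [|x_j| >= 1], and [1 + |x_j| <= 2]
   otherwise; squaring gives at most 16. *)
have I3 : P / 2 ^+ size js <= 16 ^+ n * decay 2 x.
  have -> : P / 2 ^+ size js = \prod_(j in S) (`|h j| / 2) ^+ 2.
    rewrite /P /js size_cat big_cat exprD -big_enum /=.
    rewrite invfM mulrACA; have -> : (2 : R) ^- size (enum S) = \prod_(j <- enum S) 2^-1.
      by rewrite big_const_seq count_predT iter_mulr_1 exprVn.
    by rewrite -big_split -big_split.
  rewrite /decay exprn_ord -big_split /=.
  rewrite big_mkcond; apply: ler_prod => j _.
  have p : 0 < 1 + `|x ord0 j| by rewrite ltr_wpDr.
  case: ifPn => jS; rewrite ?exprn_ge0 ?mulr_ge0 ?ler01//=;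
    rewrite powRN -[2 : R]/(2%:R) powR_mulrn ?(ltW p)// ler_pdivlMr ?exprn_gt0//.
    have x1 : 1 <= `|x ord0 j| by rewrite -Sx.
    rewrite normrM normfV (gtr0_norm (pi_gt0 R)) -exprMn.
    have -> : (16 : R) = 4 ^+ 2 by rewrite expr2 -natrM.
    have u0 : 0 <= pi / `|x ord0 j| / 2 * (1 + `|x ord0 j|).
      by rewrite !mulr_ge0 ?invr_ge0 ?pi_ge0 ?(ltW p).
    rewrite lerXn2r ?nnegrE//.
    rewrite mulrAC ler_pdivrMr// mulrAC ler_pdivrMr; last exact: lt_le_trans x1.
    apply: (@le_trans _ _ (4 * (2 * `|x ord0 j|))); last by lra.
    by apply: ler_pM; rewrite ?pi_ge0 ?(ltW p)//; lra.
  have x1 : `|x ord0 j| < 1 by rewrite ltNge -Sx.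
  rewrite mul1r; apply: (@le_trans _ _ (2 ^+ 2)).
    by rewrite lerXn2r ?nnegrE ?(ltW p)//; lra.
  by rewrite expr2 -natrM ler_nat.
rewrite -mulrA; apply: (@le_trans _ _ (P / 2 ^+ size js * D)).
  by rewrite mulrAC ler_pdivlMr ?exprn_gt0// mulrC.
by rewrite mulrC ler_wpM2l.
Qed.

End Good.

(** * Dominated convergence for real and complex integrands *)

Section Limits.
Local Open Scope ereal_scope.
Variables (R : realType) (d : measure_display) (T : measurableType d).
Variable mu : {measure set T -> \bar R}.

Lemma dct0 (u_ : nat -> T -> R) (h : T -> R) :
  (forall k, measurable_fun setT (u_ k)) -> measurable_fun setT h ->
  (forall k x, (0 <= u_ k x <= h x)%R) -> \int[mu]_x (h x)%:E < +oo ->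
  (forall x, u_ ^~ x @ \oo --> (0 : R)%R) ->
  \int[mu]_x (u_ k x)%:E @[k --> \oo] --> 0.
Proof.
move=> mu_ mh uh hoo u0.
have h0 x : (0 <= h x)%R by have /andP[a b] := uh 0%N x; exact: le_trans a b.
have := @dominated_cvg _ T R mu setT measurableT (fun k x => (u_ k x)%:E) (fun=> 0) (fun x => (h x)%:E).
rewrite integral0; apply.
- by move=> k; apply/measurable_EFinP; exact: mu_.
- by move=> x _; apply: cvg_EFin; [exact: nearW|exact: u0].
- by [].
- apply/integrableP; split; first exact/measurable_EFinP.
  by under eq_integral do rewrite gee0_abs ?lee_fin//.
- by move=> k x _; have /andP[a b] := uh k x; rewrite gee0_abs lee_fin.
Qed.

Lemma cvge0_lt (u : nat -> \bar R) (e : R) : u @ \oo --> 0 -> (0 < e)%R ->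
  exists N, forall k, (N <= k)%N -> u k < e%:E.
Proof.
move=> u0 e0.
have : \forall k \near \oo, u k < e%:E.
  have /fine_cvgP[ufin /cvgrPdist_lt /(_ e e0) ue] := u0.
  near=> k; have uf : u k \is a fin_num by near: k.
  rewrite -(fineK uf) lte_fin; apply: le_lt_trans (ler_norm _) _.
  by rewrite -normrN -sub0r; near: k.
by move=> [N _ HN]; exists N.
Unshelve. all: by end_near. Qed.

Lemma CI_dct (f_ : nat -> T -> R[i]) (f : T -> R[i]) (h : T -> R) :
  (forall k, cmeas (f_ k)) -> cmeas f -> measurable_fun setT h ->
  (forall k x, cabs (f_ k x) <= h x)%R -> (forall x, cabs (f x) <= h x)%R ->
  \int[mu]_x (h x)%:E < +oo ->
  (forall x, (cabs (f_ k x - f x))%R @[k --> \oo] --> (0 : R)%R) ->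
  forall e : R, (0 < e)%R ->
    exists N, forall k, (N <= k)%N -> (cabs (CI mu (f_ k) - CI mu f) < e)%R.
Proof.
move=> mf_ mf mh fh_ fh hoo f0 e e0.
have h0 x : (0 <= h x)%R by apply: le_trans (fh x); exact: cabs_ge0.
have e2 : (0 < e / 2)%R by rewrite divr_gt0.
have mh2 : measurable_fun setT (fun x => 2 * h x)%R by exact: measurable_funM.
have bd k x : (0 <= cabs (f_ k x - f x) <= 2 * h x)%R.
  rewrite cabs_ge0 mulrDl !mul1r (le_trans (cabsB _ _))//.
  exact: lerD.
have h2oo : \int[mu]_x (2 * h x)%:E < +oo.
  by rewrite (ge0Z mu mh h0 (ler0n _ 2)) lte_mul_pinfty.
have := @dct0 (fun k x => cabs (f_ k x - f x)%R) (fun x => 2 * h x)%R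
  (fun k => measurable_cabs (cmeasB (mf_ k) mf)) mh2 bd h2oo f0.
move=> /cvge0_lt /(_ e2)[N HN].
exists N => k Nk; rewrite -CIB; last 2 first.
- exact: (cinteg_le (mf_ k) mh (fh_ k) hoo).
- exact: (cinteg_le mf mh fh hoo).
rewrite -lte_fin; apply: le_lt_trans (CI_le _ (cmeasB (mf_ k) mf)) _.
have -> : e = (2 * (e / 2))%R by rewrite mulrC divfK.
by rewrite EFinM lte_pmul2l// HN.
Qed.

End Limits.

(** * The partition of unity by integer translates of the window *)

Section Window.
Variables (R : realType) (n : nat) (phi : 'rV[R]_n -> R[i]).
Hypothesis wphi : window phi.
Local Notation mu := (leb R n).

Lemma intvecD (k l : 'rV[int]_n) : intvec R (k + l) = intvec R k + intvec R l.
Proof. by apply/rowP => j; rewrite !mxE intrD. Qed.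

Lemma intvecN (k : 'rV[int]_n) : intvec R (- k) = - intvec R k.
Proof. by apply/rowP => j; rewrite !mxE mulrNz. Qed.

Lemma window_supp : suppin 1 phi.
Proof. by case: wphi. Qed.

Lemma window_good : good phi.
Proof. by case: wphi => a b c _; split=> //; exists 1. Qed.

(* Large enough to contain every difference of indices of interacting unit cubes below. *)
Definition nbh : seq 'rV[int]_n :=
  [seq \row_j ((f j : nat)%:Z - 4) | f : {ffun 'I_n -> 'I_9}].

Lemma uniq_nbh : uniq nbh.
Proof.
rewrite map_inj_uniq ?enum_uniq// => f g fg; apply/ffunP => j.
have := congr1 (fun k : 'rV[int]_n => k ord0 j) fg; rewrite !mxE => /addIr [].
exact: val_inj.
Qed.

Lemma mem_nbh (k : 'rV[int]_n) : (forall j, `|k ord0 j| <= 4) -> k \in nbh.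
Proof.
move=> k4; apply/mapP.
exists [ffun j => inord (absz (k ord0 j + 4))]; first by rewrite mem_enum.
apply/rowP => j; rewrite !mxE ffunE inordK; have := k4 j;
  by move: (k ord0 j) => z; lia.
Qed.

Lemma phi_nbh x k : phi (x - intvec R k) != 0 -> flr x - k \in nbh.
Proof.
move=> p0; apply: mem_nbh => j; rewrite !mxE.
have xk : `|x ord0 j - (k ord0 j)%:~R| <= 1.
  rewrite leNgt; apply/negP => h; move/eqP : p0; apply.
  by apply: window_supp; exists j; rewrite !mxE.
have /andP[h1 h2] := floor_itv (x ord0 j); set f := Num.floor _ in h1 h2 *.
have /andP[h3 h4] : -1 <= x ord0 j - (k ord0 j)%:~R <= 1 by rewrite -ler_norml.
have h5 : (f - k ord0 j)%:~R <= (1%:~R : R) by rewrite intrB; lra.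
have h6 : ((-2)%:~R : R) <= (f - k ord0 j)%:~R by move: h2; rewrite intrB intrD; lra.
move: h5 h6; rewrite !ler_int.
by move: {h1 h2} f (k ord0 j) => a b; lia.
Qed.

(** Only windows whose index differs from the cube of [x] by an element of [nbh] can be nonzero at
    [x], so the sum over the lattice becomes a sum over a list independent of [x]. *)
Lemma window_sum x : \sum_(m <- nbh) phi (x - intvec R (flr x - m)) = 1.
Proof.
have [_ _ _ /(_ x) <-] := wphi.
rewrite -(fsbig_widen [set` [seq flr x - m | m <- nbh]] setT)//; last first.
  move=> k [_ /= kn]; apply: contra_notP kn => /eqP /phi_nbh kn; apply/mapP.
  by exists (flr x - k) => //; rewrite subKr.
by rewrite -fsbig_seq ?big_map// map_inj_uniq ?uniq_nbh// => k l /addrI /oppr_inj.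
Qed.

Lemma phi_flr x : phi x = \sum_(m <- nbh) ((flr x == m)%:R : R)%:C%C * phi x.
Proof.
have [xn|xn] := boolP (flr x \in nbh).
  rewrite (bigD1_seq (flr x)) ?uniq_nbh//= eqxx mul1r big1 ?addr0// => m.
  by rewrite eq_sym => /negPf ->; rewrite mul0r.
have -> : phi x = 0.
  apply: contraNeq xn => p0; have := @phi_nbh x 0; rewrite subr0; apply.
  have -> : intvec R 0 = (0 : 'rV[R]_n) by apply/rowP => j; rewrite !mxE.
  by rewrite subr0.
by rewrite big1// => m _; rewrite mulr0.
Qed.

Lemma cmeas_flr_eq (m : 'rV[int]_n) : cmeas (fun x : 'rV[R]_n => ((flr x == m)%:R : R)%:C%C).
Proof. exact: (cmeas_flr (fun k => ((k == m)%:R : R)%:C%C)). Qed.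

Lemma cinteg_flr_eq (F : 'rV[R]_n -> R[i]) m : cinteg mu F ->
  cinteg mu (fun x : 'rV[R]_n => ((flr x == m)%:R : R)%:C%C * F x).
Proof.
move=> iF; apply: (cintegM_bounded (C := 1)) => //; first exact: cmeas_flr_eq.
by move=> x; rewrite cabs_real; case: eqP; rewrite ?normr1 ?normr0.
Qed.

(** Cutting the integral along unit cubes and translating them all to the origin leaves the integral
    over one cube of the sum of the translates, which is 1. *)
Lemma CI_window : CI mu phi = 1.
Proof.
have ip := good_cinteg window_good.
rewrite (eq_CI mu phi_flr) CI_sum; last by move=> m; exact: cinteg_flr_eq.
transitivity (\sum_(m <- nbh) CI mu (fun x => ((flr x == 0)%:R : R)%:C%C * phi (x + intvec R m))).
  apply: eq_bigr => m _; rewrite -(CI_shift (intvec R m)); last exact: cinteg_flr_eq.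
  by apply: eq_CI => x; rewrite flrD -subr_eq0 addrK.
rewrite -CI_sum; last by move=> m; apply: cinteg_flr_eq; exact: cinteg_shift.
transitivity (CI mu (fun x : 'rV[R]_n => ((flr x == 0)%:R : R)%:C%C)).
  apply: eq_CI => x; rewrite -mulr_sumr; have [x0|] := eqVneq (flr x) 0; last by rewrite mul0r.
  rewrite mul1r; apply: (eq_trans _ (window_sum x)).
  by apply: eq_bigr => m _; rewrite x0 sub0r intvecN opprK.
apply: complex_eq => /=; last by rewrite /Rintegral integral0.
rewrite /Rintegral.
transitivity (fine (\int[mu]_x (\1_[set x : 'rV[R]_n | flr x = 0] x)%:E)%E).
  congr fine; apply: eq_integral => x _; rewrite indicE; congr ((nat_of_bool _)%:R%:E).
  by apply/idP/idP => [/eqP h|/set_mem/= ->//]; apply: mem_set.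
rewrite integral_indic ?setIT//; last exact: measurable_flr_eq.
transitivity (fine (1 : \bar R)%E) => //; congr fine; exact: leb_cube.
Qed.

End Window.

(** * Fourier inversion for compactly supported smooth functions *)

Section Inversion.
Variables (R : realType) (n : nat).
Implicit Types (F E : 'rV[R]_n -> R[i]).
Local Notation mu := (leb R n).

Lemma good_cvg F x t : good F ->
  cabs (F (x + (k.+1%:R^-1 : R) *: t) - F x) @[k --> \oo] --> (0 : R).
Proof.
move=> [sR sI _].
have c0 : x + (k.+1%:R^-1 : R) *: t @[k --> \oo] --> x.
  rewrite -[X in _ --> X]addr0 -(scale0r t).
  apply: cvgD; [exact: cvg_cst|apply: cvgZr_tmp; exact: cvg_harmonic].
have H f : smooth f -> `|f (x + (k.+1%:R^-1 : R) *: t) - f x| @[k --> \oo] --> (0 : R).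
  move=> sf; have fx : f y @[y --> x] --> f x by exact: smooth_continuous.
  have cf := cvg_comp _ _ c0 fx.
  rewrite -(normr0 R); apply: cvg_norm; rewrite -(subrr (f x)).
  by apply: cvgB; [exact: cf|exact: cvg_cst].
pose u (f : 'rV[R]_n -> R) (k : nat) : R := `|f (x + (k.+1%:R^-1 : R) *: t) - f x|.
have HS : u (fun x => complex.Re (F x)) k + u (fun x => complex.Im (F x)) k @[k --> \oo] --> (0 : R).
  by rewrite -[X in _ --> X]addr0; apply: cvgD; exact: H.
apply: squeeze_cvgr (cvg_cst 0) HS; apply: nearW => k.
rewrite cabs_ge0 /=; apply: le_trans (cabs_le _) _.
by rewrite /u; case: (F (x + _)) => a b; case: (F x).
Qed.

Lemma CI_dct_mul d (T : measurableType d) (nu : {measure set T -> \bar R})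
  (f_ : nat -> T -> R[i]) (f w : T -> R[i]) (M : R) : 0 <= M ->
  (forall k, cmeas (f_ k)) -> cmeas f -> cinteg nu w ->
  (forall k x, cabs (f_ k x) <= M) -> (forall x, cabs (f x) <= M) ->
  (forall x, cabs (f_ k x - f x) @[k --> \oo] --> (0 : R)) ->
  forall e : R, 0 < e -> exists N, forall k, (N <= k)%N ->
    cabs (CI nu (fun x => w x * f_ k x) - CI nu (fun x => w x * f x)) < e.
Proof.
move=> M0 mf_ mf iw HM_ HM cf.
have mcw := measurable_cabs iw.1.
apply: (CI_dct (h := fun x => M * cabs (w x))).
  - by move=> k; exact: cmeasM iw.1 (mf_ k).
  - exact: cmeasM iw.1 mf.
  - exact: measurable_funM.
  - by move=> k x; rewrite cabsM mulrC ler_wpM2r// cabs_ge0.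
  - by move=> x; rewrite cabsM mulrC ler_wpM2r// cabs_ge0.
  - rewrite (ge0Z nu mcw (fun x => cabs_ge0 _) M0) lte_mul_pinfty//.
    exact: iw.2.
  - move=> x; under eq_fun do rewrite -mulrBr cabsM.
    by rewrite -(mulr0 (cabs (w x))); apply: cvgM => //; exact: cvg_cst.
Qed.

Definition FT g (xi : 'rV[R]_n) : R[i] := CI mu (fun x => g x * cexpi (- dotp x xi)).

Lemma cmeas_dotp : cmeas (fun z : 'rV[R]_n * 'rV[R]_n => cexpi (dotp z.1 z.2)).
Proof. by apply: cmeas_cexpi; exact: (measurable_dotp (f := fst) (g := snd)). Qed.

Lemma cmeas_wave (xi : 'rV[R]_n) : cmeas (fun x : 'rV[R]_n => cexpi (- dotp x xi)).
Proof.
apply: cmeas_cexpi; apply: measurableT_comp => //.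
exact: (measurable_dotp (f := id) (g := cst xi)).
Qed.

Lemma cmeas_invFT F : cinteg mu F -> cmeas (invFT F).
Proof.
move=> iF.
have -> : invFT F = (fun x => (cnorm R n)%:C%C * CI mu (fun xi => F xi * cexpi (dotp x xi))).
  by apply/funext => x; rewrite invFTE.
apply: cmeasZ; apply: (cmeas_CI mu (f := fun z => F z.2 * cexpi (dotp z.1 z.2))).
apply: cmeasM; last exact: cmeas_dotp.
exact: (cmeas_comp (h := snd)) iF.1.
Qed.

Lemma good_invFT F : good F -> cinteg mu (invFT F).
Proof.
move=> gF; have [M M0 HM] := invFT_decay gF.
by apply: (decay_cinteg _ M0 (cmeas_invFT (good_cinteg gF)) HM); rewrite ltr1n.
Qed.

Lemma cinteg_scale F (e : R) : 0 < e -> cinteg mu F -> cinteg mu (fun x => F (e *: x)).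
Proof.
move=> e0 iF; split.
  apply: (cmeas_comp (h := fun x : 'rV[R]_n => e *: x)) iF.1.
  exact: measurable_rowZ.
have F0 x : (0 <= (cabs (F x))%:E)%E by rewrite lee_fin cabs_ge0.
have := integral_affine (0 : 'rV[R]_n) (lt0r_neq0 e0) (emeasurable_cabs iF.1) F0.
move=> H; have -> : (\int[mu]_x (cabs (F (e *: x)))%:E = \int[mu]_x (cabs (F (e *: x + 0)))%:E)%E.
  by apply: eq_integral => x _; rewrite addr0.
rewrite H.
by rewrite lte_mul_pinfty// ?lee_fin ?invr_ge0 ?exprn_ge0//; exact: iF.2.
Qed.

Lemma decay_le1 (x : 'rV[R]_n) : decay 2 x <= 1.
Proof.
rewrite /decay; apply: prodr_ile1 => j _; rewrite powR_ge0 /=.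
set b := 1 + _; have b1 : 1 <= b by rewrite lerDl.
by rewrite -[leRHS](powRr0 b) ler_powR// oppr_le0.
Qed.

(** Fubini's multiplication formula with a dilated test function as convergence factor. As [e] tends
    to 0, the left side tends to [E 0 * FT (invFT F) xi] and the right side to a multiple of
    [F xi]. *)
Lemma FT_scale E F xi (e : R) : 0 < e -> good E -> good F ->
  CI mu (fun x => invFT F x * cexpi (- dotp x xi) * E (e *: x)) =
  CI mu (fun t => F (e *: t + xi) * invFT E t).
Proof.
move=> e0 gE gF; have iE := good_cinteg gE; have iF := good_cinteg gF.
have en0 := lt0r_neq0 e0; have iEe := cinteg_scale e0 iE.
pose c := (cnorm R n)%:C%C.
pose a z := (c * cexpi (- dotp z.1 xi) * E (e *: z.1)) * (F z.2 * cexpi (dotp z.1 z.2)).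
have ma : cmeas a.
  apply: cmeasM.
    apply: (cmeas_comp (h := fst) (f := fun x : 'rV[R]_n => c * cexpi (- dotp x xi) * E (e *: x))) => //.
    apply: cmeasM; last exact: iEe.1.
    by apply: cmeasZ; exact: cmeas_wave.
  apply: cmeasM; last exact: cmeas_dotp.
  exact: (cmeas_comp (h := snd)) iF.1.
have [V V0 HV] := cinteg_bound iF; have [W W0 HW] := cinteg_bound iEe.
have cn0 := ltW (cnorm_gt0 R n).
have aoo : (\int[mu]_x \int[mu]_y (cabs (a (x, y)))%:E < +oo)%E.
  have E1 x : (\int[mu]_y (cabs (a (x, y)))%:E = ((cnorm R n * V) * cabs (E (e *: x)))%:E)%E.
    under eq_integral do rewrite /a !cabsM !cabs_cexpi !mulr1 /= cabs_real ger0_norm//.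
    rewrite (ge0Z mu (measurable_cabs iF.1) (fun x => cabs_ge0 _)); last by rewrite mulr_ge0 ?cabs_ge0.
    by rewrite HV -EFinM mulrAC.
  under eq_integral do rewrite E1.
  rewrite (ge0Z mu (measurable_cabs iEe.1) (fun x => cabs_ge0 _)); last by rewrite mulr_ge0.
  by rewrite HW -EFinM ltry.
transitivity (CI mu (fun x => CI mu (fun y => a (x, y)))).
  apply: eq_CI => x; rewrite invFTE// -/c.
  transitivity (c * cexpi (- dotp x xi) * E (e *: x) * CI mu (fun y => F y * cexpi (dotp x y))).
    by rewrite -!mulrA; congr (_ * _); rewrite mulrC -mulrA.
  by rewrite -(CIZ _ (cinteg_wave x iF)).
rewrite (CI_Fubini ma aoo).
pose G y := F y * invFT E (e^-1 *: (y - xi)).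
have iG : cinteg mu G.
  have [M M0 HM] := invFT_decay gE.
  rewrite /G; have -> : (fun y => F y * invFT E (e^-1 *: (y - xi))) = (fun y => invFT E (e^-1 *: (y - xi)) * F y).
    by apply/funext => y; rewrite mulrC.
  apply: (cintegM_bounded (C := M)) => //.
    apply: (cmeas_comp (h := fun y : 'rV[R]_n => e^-1 *: (y - xi))); last exact: cmeas_invFT.
    by apply: measurable_rowZ; exact: measurable_rowB.
  move=> y; apply: le_trans (HM _) _; rewrite ler_piMr ?decay_le1//.
transitivity (CI mu (fun t => G (e *: t + xi))); last first.
  by apply: eq_CI => t; rewrite /G addrK scalerA mulVf// scale1r.
rewrite (CI_affine xi en0 iG) -(CIZ _ iG); apply: eq_CI => y.
pose H x := E x * cexpi (dotp (e^-1 *: (y - xi)) x).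
have iH : cinteg mu H by exact: cinteg_wave.
transitivity (CI mu (fun x => (c * F y) * H (e *: x + 0))).
  apply: eq_CI => x; rewrite /a /H /= addr0.
  have -> : dotp (e^-1 *: (y - xi)) (e *: x) = - dotp x xi + dotp x y.
    rewrite addrC -dotpNr -dotpDr dotpC; rewrite /dotp; apply: eq_bigr => j _.
    by rewrite !mxE mulrACA mulfV// mul1r.
  rewrite cexpiD -!mulrA; congr (_ * _).
  by rewrite [LHS]mulrCA [cexpi _ * (F y * _)]mulrCA [LHS]mulrCA.
rewrite CIZ; last first.
  under eq_fun do rewrite addr0; exact: cinteg_scale.
rewrite (CI_affine 0 en0 iH) /G invFTE// -/H -/c.
by rewrite mulrCA; congr (_ * _); rewrite -mulrA mulrCA.
Qed.

(** The limit [e -> 0] in [FT_scale], by dominated convergence on both sides. The integral of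
    [invFT E] remains as an unevaluated constant. *)
Lemma inversion_pair E F xi : good E -> good F ->
  E 0 * FT (invFT F) xi = CI mu (invFT E) * F xi.
Proof.
move=> gE gF; have iIF := good_invFT gF; have iIE := good_invFT gE.
have [ME ME0 HE] := good_bounded gE; have [MF MF0 HF] := good_bounded gF.
have iE := good_cinteg gE; have iF := good_cinteg gF.
pose e k : R := k.+1%:R^-1.
have e0 k : 0 < e k by rewrite invr_gt0.
apply/eqP; rewrite -subr_eq0; apply/eqP/cabs_eq0/eqP.
rewrite eq_le cabs_ge0 andbT; apply/ler_addgt0Pr => d d0; rewrite add0r.
have d2 : 0 < d / 2 by rewrite divr_gt0.
pose w := fun x => invFT F x * cexpi (- dotp x xi).
have iw : cinteg mu w.
  rewrite /w; under eq_fun do rewrite mulrC.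
  apply: (cintegM_bounded (C := 1)) => //; first exact: cmeas_wave.
  by move=> x; rewrite cabs_cexpi.
have cE x : cabs (E (e k *: x) - E 0) @[k --> \oo] --> (0 : R).
  by have := good_cvg 0 x gE; under eq_fun do rewrite add0r.
have cF x : cabs (F (e k *: x + xi) - F xi) @[k --> \oo] --> (0 : R).
  by have := good_cvg xi x gF; under eq_fun do rewrite [xi + _]addrC.
have [N1 H1] := CI_dct_mul ME0 (fun k => (cinteg_scale (e0 k) iE).1) (cmeas_cst _ (E 0)) iw
  (fun k x => HE _) (fun x => HE _) cE d2.
have [N2 H2] := CI_dct_mul MF0 (fun k => cmeas_comp (measurable_row_affine (e k) xi) iF.1)
  (cmeas_cst _ (F xi)) iIE (fun k x => HF _) (fun x => HF _) cF d2.
pose k := maxn N1 N2.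
have {}H1 := H1 k (leq_maxl _ _); have {}H2 := H2 k (leq_maxr _ _).
have E1 : CI mu (fun x => w x * E 0) = E 0 * FT (invFT F) xi.
  by rewrite -[RHS](CIZ _ iw); apply: eq_CI => x; rewrite mulrC.
have E2 : CI mu (fun x => invFT E x * F xi) = CI mu (invFT E) * F xi.
  by rewrite [RHS]mulrC -(CIZ _ iIE); apply: eq_CI => x; rewrite mulrC.
have E3 : CI mu (fun x => w x * E (e k *: x)) = CI mu (fun x => invFT E x * F (e k *: x + xi)).
  by rewrite /w FT_scale//; apply: eq_CI => x; rewrite mulrC.
rewrite E1 in H1; rewrite E2 -E3 in H2.
set J := CI _ _ in H1 H2.
have -> : E 0 * FT (invFT F) xi - CI mu (invFT E) * F xi =
  (J - CI mu (invFT E) * F xi) - (J - E 0 * FT (invFT F) xi).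
  by rewrite opprB [RHS]addrC addrA subrK.
apply: le_trans (cabsB _ _) _; rewrite [leRHS]splitr.
by apply: lerD; exact: ltW.
Qed.

End Inversion.

Section InversionConstant.
Variables (R : realType) (n : nat) (phi : 'rV[R]_n -> R[i]).
Hypothesis wphi : window phi.
Local Notation mu := (leb R n).

Lemma lipschitz1 (f df : R -> R) (t : R) : (forall x : R, is_derive x (1 : R) f (df x)) ->
  (forall x, `|df x| <= 1) -> `|f t - f 0| <= `|t|.
Proof.
move=> fd df1.
have cf (a b : R) : {within `[a, b], continuous f}.
  apply: continuous_subspaceT => x; apply: differentiable_continuous.
  by apply/derivable1_diffP; have [] := fd x.
have H (a b : R) : a <= b -> `|f b - f a| <= `|b - a|.
  move=> ab; have [c _ ->] := MVT_segment ab (fun x _ => fd x) (cf a b).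
  by rewrite normrM ler_piMl.
have [t0|t0] := leP 0 t; first by have := H _ _ t0; rewrite subr0.
by rewrite distrC; have := H _ _ (ltW t0); rewrite sub0r normrN.
Qed.

Lemma cexpi_lip (t : R) : cabs (cexpi t - 1) <= 2 * `|t|.
Proof.
apply: le_trans (cabs_le _) _; rewrite mulrDl mul1r /= subr0.
have h1 := @lipschitz1 cos (fun x => - sin x) t (fun x => is_derive_cos x).
have h2 := @lipschitz1 sin cos t (fun x => is_derive_sin x).
rewrite cos0 in h1; rewrite sin0 subr0 in h2; apply: lerD.
  by apply: h1 => x; rewrite normrN ler_norml sin_geN1 sin_le1.
by apply: h2 => x; rewrite ler_norml cos_geN1 cos_le1.
Qed.

(** On the support of [phi] the coordinates of [xi] are at most 1 in modulus, so the wave differs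
    from 1 by at most twice the sum of the [|x_j|]. This keeps [invFT phi] away from 0 near the
    origin. *)
Lemma invFT_lip : exists2 L : R, 0 <= L &
  forall x, cabs (invFT phi x - invFT phi 0) <= L * \sum_(j < n) `|x ord0 j|.
Proof.
have ip := good_cinteg (window_good wphi).
have [V V0 HV] := cinteg_bound ip; have mcp := measurable_cabs ip.1.
have cn0 := ltW (cnorm_gt0 R n).
exists (cnorm R n * (2 * (2 * V))); first by rewrite !mulr_ge0.
move=> x; set S := \sum_(j < n) _; have S0 : 0 <= S by apply: sumr_ge0.
rewrite !invFTE// -mulrBr cabsM cabs_real ger0_norm// -!mulrA ler_wpM2l//.
rewrite -CIB; [|exact: cinteg_wave..].
have mB := cmeasB (cinteg_wave x ip).1 (cinteg_wave 0 ip).1.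
rewrite -lee_fin; apply: le_trans (CI_le _ mB) _.
rewrite [in leRHS]EFinM; apply: lee_wpmul2l; first by rewrite lee_fin.
have -> : ((2 * (V * S))%:E = \int[mu]_xi ((2 * S) * cabs (phi xi))%:E)%E.
  rewrite (ge0Z mu mcp (fun x => cabs_ge0 _)) ?mulr_ge0//.
  by rewrite HV -EFinM mulrAC mulrA.
apply: ge0le; [exact: measurable_cabs|exact: measurable_funM|by move=> xi; exact: cabs_ge0|].
move=> xi; rewrite -mulrBr cabsM mulrC.
have [[j xij]|H] := pselect (exists j, 1 < `|xi ord0 j|).
  by rewrite (window_supp wphi) ?cabs0 ?mulr0//; exists j.
apply: ler_wpM2r; first exact: cabs_ge0.
have -> : dotp 0 xi = 0 by rewrite /dotp big1// => j _; rewrite mxE mul0r.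
rewrite cexpi0; apply: le_trans (cexpi_lip _) _; rewrite ler_wpM2l//.
apply: le_trans (ler_norm_sum _ _ _) _; apply: ler_sum => j _.
rewrite normrM ler_piMr// leNgt; apply/negP => h; apply: H; by exists j.
Qed.

(** At the origin [invFT phi] equals [cnorm], as [phi] has integral 1; by the Lipschitz bound its
    modulus stays above [cnorm / 2] on a small cube, which has positive measure. *)
Lemma window_sq_pos : (0 < \int[mu]_x (cabs (invFT phi x) ^+ 2)%:E)%E.
Proof.
have gp := window_good wphi; have ip := good_cinteg gp.
have [L L0 HL] := invFT_lip; have cn0 := cnorm_gt0 R n.
(* [d] makes the Lipschitz bound [L n d] at most [cnorm / 2]; the added 1 keeps the denominator
   positive. *)
pose d : R := cnorm R n / (2 * (L * n%:R + 1)).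
have D0 : 0 < 2 * (L * n%:R + 1) by rewrite mulr_gt0// ltr_wpDl// mulr_ge0.
have d0 : 0 < d by rewrite divr_gt0.
have a0 : invFT phi 0 = (cnorm R n)%:C%C.
  rewrite invFTE// -[RHS]mulr1 -(CI_window wphi); congr (_ * _).
  apply: eq_CI => xi; have -> : dotp 0 xi = 0 by rewrite /dotp big1// => j _; rewrite mxE mul0r.
  by rewrite cexpi0 mulr1.
pose G (x : 'rV[R]_n) : R := ((flr x == 0)%:R).
have mG : measurable_fun setT G.
  exact: (measurable_flr (fun k => ((k == 0)%:R : R))).
have H x : (cnorm R n / 2) ^+ 2 * G (d^-1 *: x + 0) <= cabs (invFT phi x) ^+ 2.
  rewrite /G addr0; case: eqP => [fx|_]; last by rewrite mulr0 exprn_ge0// cabs_ge0.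
  rewrite mulr1 lerXn2r ?nnegrE ?cabs_ge0 ?divr_ge0 ?(ltW cn0)//.
  have xd j : `|x ord0 j| <= d.
    have /rowP/(_ j) := fx; rewrite !mxE => /eqP.
    rewrite floor_eq.
    rewrite [d^-1 * _]mulrC add0r ler_pdivlMr// ltr_pdivrMr// mul0r mul1r => /andP[x0 xd].
    by rewrite ger0_norm// ltW.
  have Sx : \sum_(j < n) `|x ord0 j| <= n%:R * d.
    apply: (@le_trans _ _ (\sum_(j < n) d)); first by apply: ler_sum.
    by rewrite sumr_const card_ord mulr_natl.
  have E1 : cnorm R n <= cabs (invFT phi x) + cabs (invFT phi x - invFT phi 0).
    have -> : cnorm R n = cabs (invFT phi x - (invFT phi x - invFT phi 0)).
      by rewrite subKr a0 cabs_real gtr0_norm.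
    exact: cabsB.
  have E2 : cabs (invFT phi x - invFT phi 0) <= cnorm R n / 2.
    apply: le_trans (HL x) _; apply: (@le_trans _ _ (L * (n%:R * d))); first exact: ler_wpM2l.
    have e : d * (2 * (L * n%:R + 1)) = cnorm R n by rewrite divfK ?gt_eqF.
    by rewrite -e; lra.
  by lra.
have md : measurable_fun setT (fun x : 'rV[R]_n => G (d^-1 *: x + 0)).
  exact: measurableT_comp mG (measurable_row_affine _ _).
have G0 x : 0 <= G x by rewrite ler0n.
apply: (@lt_le_trans _ _ (\int[mu]_x ((cnorm R n / 2) ^+ 2 * G (d^-1 *: x + 0))%:E)%E); last first.
  apply: ge0le => //.
  - exact: measurable_funM.
  - by apply: measurable_funX; exact: measurable_cabs (cmeas_invFT ip).
  - by move=> x; rewrite mulr_ge0 ?exprn_ge0 ?divr_ge0 ?(ltW cn0).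
rewrite (ge0Z mu md (fun x => G0 _)) ?exprn_ge0 ?divr_ge0 ?(ltW cn0)//.
rewrite mule_gt0 ?lte_fin ?exprn_gt0 ?divr_gt0//.
have mEG : measurable_fun setT (EFin \o G) by exact/measurable_EFinP.
have di0 : d^-1 != 0 by rewrite invr_eq0 gt_eqF.
rewrite (integral_affine 0 di0 mEG) => [|x]; last by rewrite lee_fin.
rewrite mule_gt0 ?lte_fin ?invr_gt0 ?exprn_gt0 ?normr_gt0//.
have -> : (\int[mu]_x (EFin \o G) x = \int[mu]_x (\1_[set x : 'rV[R]_n | flr x = 0] x)%:E)%E.
  apply: eq_integral => x _; rewrite indicE /= /G; congr ((nat_of_bool _)%:R%:E).
  by apply/idP/idP => [/eqP h|/set_mem/= ->//]; apply: mem_set.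
rewrite integral_indic ?setIT//; last exact: measurable_flr_eq.
by apply: (@lt_le_trans _ _ 1%E) => //; rewrite -(leb_cube R (0 : 'rV[int]_n)).
Qed.

Definition cconj (z : R[i]) : R[i] := (complex.Re z -i* complex.Im z)%C.

Lemma cconjM z w : cconj (z * w) = cconj z * cconj w.
Proof. by apply: complex_eq; rewrite /cconj ?cReM ?cImM /= ?cReM ?cImM /=; ring. Qed.

Lemma cconj_cexpi (t : R) : cconj (cexpi t) = cexpi (- t).
Proof. by rewrite /cconj /cexpi /= cosN sinN. Qed.

Lemma cmeas_cconj d (T : measurableType d) (f : T -> R[i]) : cmeas f -> cmeas (fun x => cconj (f x)).
Proof. by move=> [mR mI]; split=> //=; exact: measurableT_comp. Qed.

Lemma cabs_cconj z : cabs (cconj z) = cabs z.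
Proof. by rewrite /cabs /= sqrrN. Qed.

Lemma CI_cconj d (T : measurableType d) (nu : {measure set T -> \bar R}) (f : T -> R[i]) :
  cinteg nu f -> CI nu (fun x => cconj (f x)) = cconj (CI nu f).
Proof.
move=> fi; have := CIN fi; rewrite /CI /cconj /= => h; congr (_ +i* _)%C.
have := congr1 (@complex.Im R) h => /= {h} h; rewrite -h.
by apply: eq_Rintegral => x _; case: (f x).
Qed.

Lemma Re_cconj_sq z : complex.Re (z * cconj z) = cabs z ^+ 2.
Proof.
rewrite cReM /cabs sqr_sqrtr ?addr_ge0 ?sqr_ge0//= mulrN opprK.
by rewrite !expr2.
Qed.

(** The ratio given by [inversion_pair] is the same for all [F] once [E] is fixed. If it were zero,
    [FT (invFT phi)] would vanish, and pairing it with the conjugate of [phi] would make the square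
    integral of [invFT phi] zero, against [window_sq_pos]. *)
Lemma inversion : exists2 c : R[i], c != 0 &
  forall F : 'rV[R]_n -> R[i], good F -> forall xi, FT (invFT F) xi = c * F xi.
Proof.
have gp := window_good wphi; have ip := good_cinteg gp.
have [b pb] : exists b, phi (- b) != 0.
  apply: contrapT => H; have : CI mu phi = 0.
    rewrite -(CI0 mu); apply: eq_CI => x; apply/eqP; apply: contrapT => /negP h.
    by apply: H; exists (- x); rewrite opprK.
  by rewrite CI_window// => /eqP; rewrite oner_eq0.
(* A translate of the window that does not vanish at the origin, so that one may divide by [E 0]. *)
pose E x := phi (x - b).
have gE : good E.
  have [sR sI _] := gp; split.
  - exact: (smooth_shift (- b) sR).
  - exact: (smooth_shift (- b) sI).
  - exists (1 + \sum_j `|b ord0 j|) => x [j xj]; apply: (window_supp wphi).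
    exists j; rewrite !mxE.
    have : `|b ord0 j| <= \sum_j `|b ord0 j|.
      by rewrite (bigD1 j)//= lerDl sumr_ge0.
    by have := ler_distD (b ord0 j) (x ord0 j) 0; rewrite !subr0; lra.
have E0 : E 0 != 0 by rewrite /E sub0r.
have key (F : 'rV[R]_n -> R[i]) xi : good F -> FT (invFT F) xi = (CI mu (invFT E) / E 0) * F xi.
  move=> gF; apply: (mulfI E0); rewrite inversion_pair// mulrA mulrCA mulfV// mulr1.
  by [].
exists (CI mu (invFT E) / E 0); last by move=> F gF xi; exact: key.
apply/eqP => c0; pose a := invFT phi.
have ia : cinteg mu a := good_invFT gp; have ma := ia.1.
have FT0 xi : FT a xi = 0 by rewrite key// c0 mul0r.
pose A z := (a z.1 * cexpi (- dotp z.1 z.2)) * cconj (phi z.2).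
have mA : cmeas A.
  apply: cmeasM.
    apply: cmeasM; first exact: (cmeas_comp (h := fst)).
    apply: cmeas_cexpi; apply: measurableT_comp => //.
    exact: (measurable_dotp (f := fst) (g := snd)).
  exact: (cmeas_comp (h := snd) (f := fun y => cconj (phi y)) measurable_snd (cmeas_cconj ip.1)).
have [V V0 HV] := cinteg_bound ip; have [W W0 HW] := cinteg_bound ia.
have Aoo : (\int[mu]_x \int[mu]_y (cabs (A (x, y)))%:E < +oo)%E.
  have E1 x : (\int[mu]_y (cabs (A (x, y)))%:E = (V * cabs (a x))%:E)%E.
    under eq_integral do rewrite /A 2!cabsM cabs_cexpi cabs_cconj mulr1 /=.
    by rewrite (ge0Z mu (measurable_cabs ip.1) (fun x => cabs_ge0 _) (cabs_ge0 _)) HV -EFinM mulrC.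
  under eq_integral do rewrite E1.
  by rewrite (ge0Z mu (measurable_cabs ia.1) (fun x => cabs_ge0 _) V0) HW -EFinM ltry.
(* Writing the conjugate factor as an integral of waves and exchanging the integrals brings out
   [FT a], which is zero. *)
have Z : CI mu (fun x => a x * cconj (a x)) = 0.
  transitivity (CI mu (fun x => (cnorm R n)%:C%C * CI mu (fun y => A (x, y)))).
    apply: eq_CI => x; rewrite {2}/a invFTE// cconjM -CI_cconj; last exact: cinteg_wave.
    have -> : cconj (cnorm R n)%:C%C = (cnorm R n)%:C%C by rewrite /cconj /= oppr0.
    rewrite mulrCA; congr (_ * _); rewrite -CIZ; last first.
      have iw := cinteg_wave x ip; split; first exact: cmeas_cconj iw.1.
      by under eq_integral do rewrite cabs_cconj; exact: iw.2.
    by apply: eq_CI => y; rewrite cconjM cconj_cexpi /A /= [cconj _ * _]mulrC mulrA.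
  have iC : cinteg mu (fun x => CI mu (fun y => A (x, y))).
    split; first exact: cmeas_CI.
    apply: (@le_lt_trans _ _ (\int[mu]_x (2 * (V * cabs (a x)))%:E)%E).
      apply: ge0le.
      - exact: measurable_cabs (cmeas_CI mu mA).
      - by apply: measurable_funM => //; apply: measurable_funM => //; exact: measurable_cabs.
      - by move=> x; exact: cabs_ge0.
      - move=> x; rewrite -lee_fin; apply: le_trans (CI_le _ _) _.
          by split; [exact: measurableT_comp mA.1 (pair1_measurable x)|exact: measurableT_comp mA.2 (pair1_measurable x)].
        under eq_integral do rewrite /A 2!cabsM cabs_cexpi cabs_cconj mulr1 /=.
        by rewrite (ge0Z mu (measurable_cabs ip.1) (fun x => cabs_ge0 _) (cabs_ge0 _)) HV -!EFinM [V * _]mulrC.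
    under eq_integral do rewrite mulrA.
    rewrite (ge0Z mu (measurable_cabs ia.1) (fun x => cabs_ge0 _)); last by rewrite mulr_ge0.
    by rewrite HW -EFinM ltry.
  rewrite (CIZ _ iC) (CI_Fubini mA Aoo).
  have -> : CI mu (fun y => CI mu (fun x => A (x, y))) = CI mu (fun=> 0).
    apply: eq_CI => y; rewrite /A /=.
    transitivity (cconj (phi y) * FT a y); last by rewrite FT0 mulr0.
    rewrite /FT -CIZ; first by apply: eq_CI => x; rewrite mulrC.
    split; first by apply: cmeasM => //; exact: cmeas_wave.
    by under eq_integral do rewrite cabsM cabs_cexpi mulr1; exact: ia.2.
  by rewrite CI0 mulr0.
have I0 : fine (\int[mu]_x (cabs (a x) ^+ 2)%:E)%E = 0.
  transitivity (complex.Re (CI mu (fun x => a x * cconj (a x)))); last by rewrite Z.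
  by apply: (congr1 fine); apply: eq_integral => x _; rewrite Re_cconj_sq.
have [M M0 HM] := invFT_decay gp.
have foo : (\int[mu]_x (cabs (a x) ^+ 2)%:E < +oo)%E.
  apply: (@le_lt_trans _ _ (\int[mu]_x (M * cabs (a x))%:E)%E); last first.
    by rewrite (ge0Z mu (measurable_cabs ma) (fun x => cabs_ge0 _) M0) HW -EFinM ltry.
  apply: ge0le.
  - by apply: measurable_funX; exact: measurable_cabs.
  - by apply: measurable_funM => //; exact: measurable_cabs.
  - by move=> x; rewrite exprn_ge0 ?cabs_ge0.
  - move=> x; rewrite expr2 ler_wpM2r ?cabs_ge0//; apply: le_trans (HM x) _.
    by rewrite ler_piMr// decay_le1.
have := window_sq_pos; rewrite -/a -[X in (0 < X)%E]fineK; last first.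
  rewrite ge0_fin_numE//; apply: integral_real_ge0 => x; rewrite exprn_ge0 ?cabs_ge0//.
by rewrite I0 ltxx.
Qed.

End InversionConstant.

Lemma cvg_powR0 (R : realType) (w : nat -> R) (r : R) : 0 < r -> (forall k, 0 <= w k) ->
  w @ \oo --> (0 : R) -> (fun k => w k `^ r) @ \oo --> (0 : R).
Proof.
move=> r0 w0 /cvgrPdist_lt wc; apply/cvgrPdist_lt => e e0.
have e'0 : 0 < e `^ r^-1 by exact: powR_gt0.
near=> k; rewrite sub0r normrN ger0_norm ?powR_ge0//.
have -> : e = (e `^ r^-1) `^ r by rewrite -powRrM mulVf ?gt_eqF// powRr1// ltW.
rewrite gt0_ltr_powR ?nnegrE ?(ltW e'0)//.
by rewrite -[w k]ger0_norm// -normrN -sub0r; near: k; exact: wc.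
Unshelve. all: by end_near. Qed.

(** * Modulation norms *)

Section Nrm.
Local Open Scope ereal_scope.
Variables (R : realType) (n : nat) (p : R).
Hypothesis p1 : (1 <= p)%R.
Implicit Types (u v : 'rV[R]_n -> R).
Local Notation mu := (leb R n).

Definition nrm u : \bar R := (\int[mu]_x (u x `^ p)%:E) `^ p^-1.

Let p0 : (0 < p)%R. Proof. exact: lt_le_trans p1. Qed.

Let pV0 : (0 <= p^-1)%R. Proof. by rewrite invr_ge0 ltW. Qed.

Lemma int_powR_ge0 u : 0 <= \int[mu]_x (u x `^ p)%:E.
Proof. by apply: integral_real_ge0 => x; exact: powR_ge0. Qed.

Lemma nrm_ge0 u : 0 <= nrm u.
Proof. exact: poweR_ge0. Qed.

Lemma measurable_powRp u : measurable_fun setT u -> measurable_fun setT (fun x => u x `^ p)%R.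
Proof. by move=> mu_; exact: (measurableT_comp (measurable_powR _) mu_). Qed.

Lemma nrm_le u v : measurable_fun setT u -> measurable_fun setT v ->
  (forall x, 0 <= u x <= v x)%R -> nrm u <= nrm v.
Proof.
move=> mu_ mv uv; apply: le_poweR; [exact: pV0|exact: int_powR_ge0|].
apply: ge0le; [exact: measurable_powRp..|by move=> x; exact: powR_ge0|].
by move=> x; have /andP[a b] := uv x; exact: (le_powR (ltW p0)).
Qed.

Lemma nrm_poweR u : nrm u `^ p = \int[mu]_x (u x `^ p)%:E.
Proof.
by rewrite /nrm -poweRrM mulVf ?gt_eqF// poweRe1// int_powR_ge0.
Qed.

Lemma nrm_lty u : (nrm u < +oo) = (\int[mu]_x (u x `^ p)%:E < +oo).
Proof.
apply/idP/idP => h; last exact: poweR_lty.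
by rewrite -nrm_poweR; exact: poweR_lty.
Qed.

Lemma nrmD u v : measurable_fun setT u -> measurable_fun setT v ->
  (forall x, 0 <= u x)%R -> (forall x, 0 <= v x)%R ->
  nrm (fun x => u x + v x)%R <= nrm u + nrm v.
Proof.
move=> mu_ mv u0 v0; have := minkowski_EFin mu mu_ mv p1; rewrite unlock.
have E (w : 'rV[R]_n -> R) : (forall x, 0 <= w x)%R ->
    (\int[mu]_x (`|(EFin \o w) x| `^ p)) `^ p^-1 = nrm w.
  move=> w0; apply: (congr1 (fun z => z `^ p^-1)); apply: eq_integral => x _.
  have -> : `|(EFin \o w) x| = (w x)%:E by rewrite gee0_abs ?lee_fin.
  by rewrite poweR_EFin.
have uv0 x : (0 <= u x + v x)%R by exact: addr_ge0.
by rewrite -(E u u0) -(E v v0) -(E _ uv0).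
Qed.

Lemma nrmZ (c : R) u : measurable_fun setT u -> (forall x, 0 <= u x)%R -> (0 <= c)%R ->
  nrm (fun x => c * u x)%R = c%:E * nrm u.
Proof.
move=> mu_ u0 c0; rewrite /nrm.
under eq_integral do rewrite powRM//.
rewrite (ge0Z mu (measurable_powRp mu_) (fun x => powR_ge0 _ _) (powR_ge0 _ _)).
rewrite poweRM ?lee_fin ?powR_ge0// ?int_powR_ge0//; congr (_ * _).
by rewrite poweR_EFin -powRrM mulfV ?gt_eqF// powRr1.
Qed.

Lemma nrm0 : nrm (fun=> 0)%R = 0.
Proof.
rewrite /nrm; under eq_integral do rewrite powR0 ?gt_eqF//.
by rewrite integral0 poweR0r// gt_eqF// invr_gt0.
Qed.

Lemma nrm_sum (I : Type) (r : seq I) (f : I -> 'rV[R]_n -> R) :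
  (forall i, measurable_fun setT (f i)) -> (forall i x, 0 <= f i x)%R ->
  nrm (fun x => \sum_(i <- r) f i x)%R <= \sum_(i <- r) nrm (f i).
Proof.
move=> mf f0; elim: r => [|i r IH].
  under [X in nrm X]eq_fun do rewrite big_nil; by rewrite nrm0 big_nil.
under [X in nrm X]eq_fun do rewrite big_cons.
rewrite big_cons; apply: le_trans (leeD2l _ IH); apply: nrmD => //.
- exact: measurable_sum.
- by move=> x; apply: sumr_ge0.
Qed.

Lemma nrm_young (h u v : 'rV[R]_n -> R) (V : R) : measurable_fun setT h -> measurable_fun setT u ->
  measurable_fun setT v -> (forall x, 0 <= h x)%R -> (forall x, 0 <= u x)%R ->
  (forall x, 0 <= v x)%R -> (0 <= V)%R -> \int[mu]_x (v x)%:E <= V%:E ->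
  (forall x, (h x)%:E <= \int[mu]_y (u (x - y) * v y)%:E) ->
  nrm h <= V%:E * nrm u.
Proof.
move=> mh mu_ mv h0 u0 v0 V0 vV hle.
have -> : V%:E * nrm u = ((V `^ p)%:E * \int[mu]_x (u x `^ p)%:E) `^ p^-1.
  rewrite poweRM ?lee_fin ?powR_ge0// ?int_powR_ge0//; congr (_ * _).
  by rewrite poweR_EFin -powRrM mulfV ?gt_eqF// powRr1.
apply: le_poweR => //; first exact: int_powR_ge0.
apply: le_trans (young mu_ mv u0 v0 p1 V0 vV).
have mI := measurable_inner mu (measurable_conv2 mu_ mv) (fun z => mulr_ge0 (u0 _) (v0 _)).
apply: ge0_le_integral => //.
- by move=> x _; rewrite lee_fin powR_ge0.
- by apply/measurable_EFinP; exact: measurable_powRp.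
- by apply: (measurableT_comp (measurable_poweR _)); exact: mI.
- by move=> x _; rewrite -poweR_EFin; apply: le_poweR; rewrite ?lee_fin ?(ltW p0).
Qed.

(** Jensen for the finite measure [decay 2 dx], then [decay 2 <= 1]. It plays the role of Hoelder
    against the dual norm of [decay 2], without a separate case [p = 1]. *)
Lemma decay_nrm : exists2 C : R, (0 <= C)%R & forall u, measurable_fun setT u ->
  (forall x, 0 <= u x)%R -> \int[mu]_x (decay 2 x * u x)%:E <= C%:E * nrm u.
Proof.
have [c c0 Hc] : exists2 c : R, (0 <= c)%R & (\int[mu]_x (decay 2 x)%:E = c%:E)%E.
  by apply: decay_int; rewrite ltr1n.
exists ((c `^ (p - 1)) `^ p^-1)%R; first exact: powR_ge0.
move=> u mu_ u0; have md := @measurable_decay R n 2.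
have d0 := @decay_ge0 R n 2.
have Hc' : \int[mu]_x (decay 2 x)%:E <= c%:E by rewrite Hc.
have J := weighted_jensen md mu_ d0 u0 p1 c0 Hc'.
have -> : (((c `^ (p - 1)) `^ p^-1)%R%:E * nrm u = ((c `^ (p - 1))%:E * \int[mu]_x (u x `^ p)%:E) `^ p^-1).
  by rewrite poweRM ?lee_fin ?powR_ge0// ?int_powR_ge0// poweR_EFin.
have I0 : 0 <= \int[mu]_x (decay 2 x * u x)%:E.
  by apply: integral_real_ge0 => x; rewrite mulr_ge0.
apply: (@le_trans _ _ (((\int[mu]_x (decay 2 x * u x)%:E) `^ p) `^ p^-1)).
  by rewrite -poweRrM mulfV ?gt_eqF// poweRe1.
apply: le_poweR => //; first exact: poweR_ge0.
apply: le_trans J _; apply: lee_wpmul2l; first by rewrite lee_fin powR_ge0.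
have mup := measurable_powRp mu_.
apply: ge0le => //; first exact: measurable_funM.
- by move=> x; rewrite mulr_ge0 ?powR_ge0.
- by move=> x; rewrite ler_piMl ?powR_ge0// decay_le1.
Qed.

Lemma nrm_dct (u_ : nat -> 'rV[R]_n -> R) u :
  (forall k, measurable_fun setT (u_ k)) -> measurable_fun setT u ->
  (forall k x, 0 <= u_ k x <= u x)%R -> nrm u < +oo ->
  (forall x, u_ ^~ x @ \oo --> (0 : R)%R) ->
  (fun k => fine (nrm (u_ k))) @ \oo --> (0 : R)%R.
Proof.
move=> mu_ mu0 uu uoo uc.
have D := @dct0 R _ _ mu (fun k x => u_ k x `^ p)%R (fun x => u x `^ p)%R
  (fun k => measurable_powRp (mu_ k)) (measurable_powRp mu0).
have {}D := D _ _ _; rewrite nrm_lty in uoo.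
have D1 : \int[mu]_x (u_ k x `^ p)%:E @[k --> \oo] --> 0.
  apply: D => //.
  - move=> k x; have /andP[a b] := uu k x; rewrite powR_ge0.
    by rewrite (le_powR (ltW p0)).
  - by move=> x; apply: cvg_powR0 => // k; have /andP[] := uu k x.
have -> : (fun k => fine (nrm (u_ k))) = (fun k => fine (\int[mu]_x (u_ k x `^ p)%:E) `^ p^-1)%R.
  by apply/funext => k; rewrite /nrm fine_poweR.
apply: cvg_powR0; first by rewrite invr_gt0.
  by move=> k; rewrite fine_ge0// int_powR_ge0.
exact: fine_cvg D1.
Qed.

End Nrm.

Section ErealIntegrals.
Local Open Scope ereal_scope.
Variables (d : measure_display) (T : measurableType d) (R : realType).
Variable mu : {measure set T -> \bar R}.
Implicit Types (f g : T -> \bar R).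

Lemma ege0Z (c : R) f : measurable_fun setT f -> (forall x, 0 <= f x) -> (0 <= c)%R ->
  \int[mu]_x (c%:E * f x) = c%:E * \int[mu]_x f x.
Proof. by move=> mf f0 c0; apply: ge0_integralZl_EFin. Qed.

Lemma ege0D f g : measurable_fun setT f -> measurable_fun setT g ->
  (forall x, 0 <= f x) -> (forall x, 0 <= g x) ->
  \int[mu]_x (f x + g x) = \int[mu]_x f x + \int[mu]_x g x.
Proof. by move=> mf mg f0 g0; apply: ge0_integralD. Qed.

Lemma ege0le f g : measurable_fun setT f -> measurable_fun setT g ->
  (forall x, 0 <= f x) -> (forall x, f x <= g x) ->
  \int[mu]_x f x <= \int[mu]_x g x.
Proof. by move=> mf mg f0 fg; apply: ge0_le_integral. Qed.

End ErealIntegrals.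

(** * Weighted sums over the integer lattice *)

Section SeqSum.
Local Open Scope ereal_scope.
Variables (R : realType) (n : nat) (q s : R).
Hypothesis (q0 : (0 < q)%R) (s0 : (0 <= s)%R).
Implicit Types (F G : 'rV[int]_n -> \bar R).
Local Notation mu := (leb R n).

Definition wS (k : 'rV[int]_n) : R := jbr (intvec R k) `^ (s * q).

(** The [q]-th power of a weighted [l^q] norm, for sequences with extended values since a local norm
    may be infinite. *)
Definition SS F : \bar R := \esum_(k in [set: 'rV[int]_n]) ((wS k)%:E * F k `^ q).

Lemma wS_ge0 k : (0 <= wS k)%R. Proof. exact: powR_ge0. Qed.

Lemma wS_gt0 k : (0 < wS k)%R. Proof. by rewrite powR_gt0// jbr_gt0. Qed.

Lemma SS_term_ge0 F k : 0 <= (wS k)%:E * F k `^ q.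
Proof. by rewrite mule_ge0 ?poweR_ge0// lee_fin wS_ge0. Qed.

Lemma SSE F : SS F = \int[mu]_x ((wS (flr x))%:E * F (flr x) `^ q).
Proof. exact: (esum_flr (SS_term_ge0 F)). Qed.

Lemma SS_ge0 F : 0 <= SS F.
Proof. by rewrite SSE integral_ge0// => x _; exact: SS_term_ge0. Qed.

Lemma measurable_SS F : measurable_fun setT (fun x : 'rV[R]_n => (wS (flr x))%:E * F (flr x) `^ q).
Proof. exact: (measurable_flr (fun k => (wS k)%:E * F k `^ q)). Qed.

Lemma SS_le F G : (forall k, 0 <= F k) -> (forall k, F k <= G k) -> SS F <= SS G.
Proof.
move=> F0 FG; rewrite !SSE; apply: ge0_le_integral => //.
- by move=> x _; exact: SS_term_ge0.
- exact: measurable_SS.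
- exact: measurable_SS.
- move=> x _; apply: lee_wpmul2l; first by rewrite lee_fin wS_ge0.
  exact: (le_poweR (ltW q0) (F0 _) (FG _)).
Qed.

Lemma SSD F G : (forall k, 0 <= F k) -> (forall k, 0 <= G k) ->
  SS (fun k => F k + G k) <= (2 `^ q)%:E * (SS F + SS G).
Proof.
move=> F0 G0; rewrite !SSE.
rewrite -(ege0D mu (@measurable_SS F) (@measurable_SS G)
  (fun x => SS_term_ge0 F (flr x)) (fun x => SS_term_ge0 G (flr x))).
have mFG := emeasurable_funD (@measurable_SS F) (@measurable_SS G).
have FG0 x := adde_ge0 (SS_term_ge0 F (@flr R n x)) (SS_term_ge0 G (flr x)).
rewrite -(ege0Z mu mFG FG0 (powR_ge0 _ _)).
apply: ege0le.
- exact: (@measurable_SS (fun k => F k + G k)).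
- exact: (emeasurable_funM (measurable_cst _) mFG).
- by move=> x; exact: (SS_term_ge0 (fun k => F k + G k)).
- move=> x; have w0 : 0 <= (wS (flr x))%:E by rewrite lee_fin wS_ge0.
  rewrite -ge0_muleDr ?poweR_ge0// muleCA; apply: lee_wpmul2l => //.
  exact: (poweRD_le (ltW q0) (F0 _) (G0 _)).
Qed.

Lemma SSZ (c : R) F : (0 <= c)%R -> (forall k, 0 <= F k) ->
  SS (fun k => c%:E * F k) = (c `^ q)%:E * SS F.
Proof.
move=> c0 F0; rewrite (SSE F) (SSE (fun k => c%:E * F k)).
rewrite -(ege0Z mu (@measurable_SS F) (fun x => SS_term_ge0 F (flr x)) (powR_ge0 _ _)).
apply: eq_integral => x _; rewrite poweRM ?lee_fin// poweR_EFin.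
by rewrite muleCA.
Qed.

Lemma SS0 : SS (fun=> 0) = 0.
Proof.
rewrite SSE; under eq_integral do rewrite poweR0r ?gt_eqF// mule0.
by rewrite integral0.
Qed.

Lemma wSD k l : (wS (k + l) <= (2 `^ s * jbr (intvec R l) `^ s) `^ q * wS k)%R.
Proof.
have E m : wS m = ((jbr (intvec R m) `^ s) `^ q)%R by rewrite /wS powRrM.
rewrite !E -powRM ?mulr_ge0 ?powR_ge0//; apply: (le_powR (ltW q0)); first exact: powR_ge0.
by rewrite intvecD -mulrA [X in (_ * X)%R]mulrC jbr_powM.
Qed.

Lemma SS_shift (m : 'rV[int]_n) : exists2 C : R, (0 <= C)%R &
  forall F, (forall k, 0 <= F k) -> SS (fun k => F (k - m)%R) <= C%:E * SS F.
Proof.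
exists ((2 `^ s * jbr (intvec R m) `^ s) `^ q)%R; first exact: powR_ge0.
move=> F F0; rewrite SSE.
rewrite -(integral_shift (intvec R m) (@measurable_SS (fun k => F (k - m)%R))
  (fun x => SS_term_ge0 (fun k => F (k - m)%R) (flr x))).
rewrite SSE -(ege0Z mu (@measurable_SS F) (fun x => SS_term_ge0 F (flr x)) (powR_ge0 _ _)).
apply: ege0le.
- apply: (measurableT_comp (measurable_SS (fun k => F (k - m)%R))).
  exact: measurable_rowD.
- exact: (emeasurable_funM (measurable_cst _) (@measurable_SS F)).
- by move=> x; exact: (SS_term_ge0 (fun k => F (k - m)%R)).
- move=> x; rewrite flrD addrK muleA; apply: lee_wpmul2r; first exact: poweR_ge0.
  by rewrite -EFinM lee_fin wSD.
Qed.

(** Absorbs the finite overlap of windows: a local quantity bounded by those of neighbouring indices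
    has a weighted sum bounded by theirs up to a constant, because a fixed shift changes the weight
    by a bounded factor. *)
Lemma SS_sum_shift (r : seq 'rV[int]_n) : exists2 C : R, (0 <= C)%R &
  forall F, (forall k, 0 <= F k) -> SS (fun k => \sum_(m <- r) F (k - m)%R) <= C%:E * SS F.
Proof.
elim: r => [|m r [C C0 HC]].
  by exists 0%R => // F F0; under [X in SS X]eq_fun do rewrite big_nil; rewrite SS0 mul0e.
have [D D0 HD] := SS_shift m.
exists (2 `^ q * (D + C))%R; first by rewrite mulr_ge0 ?powR_ge0// addr_ge0.
move=> F F0; under [X in SS X]eq_fun do rewrite big_cons.
apply: le_trans (SSD _ _) _ => //; first by move=> k; exact: sume_ge0.
rewrite EFinM -muleA; apply: lee_wpmul2l; first by rewrite lee_fin powR_ge0.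
by rewrite EFinD ge0_muleDl ?lee_fin//; apply: leeD; [exact: HD|exact: HC].
Qed.

Lemma SS_term_le F k : (forall k, 0 <= F k) -> (wS k)%:E * F k `^ q <= SS F.
Proof.
move=> F0; rewrite /SS (@esumID _ _ [set k])//; last by move=> i _; exact: SS_term_ge0.
rewrite setTI esum_set1; last exact: SS_term_ge0.
by rewrite leeDl// esum_ge0// => i _; exact: SS_term_ge0.
Qed.

Lemma SS_lty F k : (forall k, 0 <= F k) -> SS F < +oo -> F k < +oo.
Proof.
move=> F0 Foo; apply: (@lty_poweRy _ _ q); first by rewrite gt_eqF.
have := le_lt_trans (SS_term_le k F0) Foo; rewrite !ltey; apply: contra => /eqP ->.
by rewrite gt0_muley// lte_fin wS_gt0.
Qed.

(** Dominated convergence for sequences, through functions constant on unit cubes. *)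
Lemma SS_dct (u_ : nat -> 'rV[int]_n -> R) (u : 'rV[int]_n -> R) :
  (forall k m, 0 <= u_ k m <= u m)%R -> SS (fun m => (u m)%:E) < +oo ->
  (forall m, u_ ^~ m @ \oo --> (0 : R)%R) ->
  SS (fun m => (u_ k m)%:E) @[k --> \oo] --> 0.
Proof.
move=> uu uoo uc.
have D := @dct0 R _ _ mu (fun k x => wS (flr x) * u_ k (flr x) `^ q)%R
  (fun x => wS (flr x) * u (flr x) `^ q)%R
  (fun k => measurable_flr (fun m => wS m * u_ k m `^ q)%R)
  (measurable_flr (fun m => wS m * u m `^ q)%R).
have E (v : 'rV[int]_n -> R) : SS (fun m => (v m)%:E) = \int[mu]_x (wS (flr x) * v (flr x) `^ q)%:E.
  by rewrite SSE; apply: eq_integral => x _; rewrite poweR_EFin.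
rewrite E in uoo; under eq_fun do rewrite E; apply: D => //.
- move=> k x; have /andP[a b] := uu k (flr x).
  by rewrite mulr_ge0 ?powR_ge0 ?wS_ge0//= ler_wpM2l ?wS_ge0// (le_powR (ltW q0)).
- move=> x; rewrite -(mulr0 (wS (flr x))); apply: cvgM; first exact: cvg_cst.
  by apply: cvg_powR0 => // k; have /andP[] := uu k (flr x).
Qed.

End SeqSum.

(** * Frequency localization as convolution *)

Section Multiplier.
Variables (R : realType) (n : nat).
Implicit Types (F G w : 'rV[R]_n -> R[i]).
Local Notation mu := (leb R n).

Lemma good_shift F v : good F -> good (fun x => F (x + v)).
Proof.
move=> [sR sI [r sF]]; split.
- exact: (smooth_shift v sR).
- exact: (smooth_shift v sI).
- exists (r + \sum_j `|v ord0 j|) => x [j xj]; apply: sF.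
  exists j; rewrite !mxE.
  have : `|v ord0 j| <= \sum_j `|v ord0 j| by rewrite (bigD1 j)//= lerDl sumr_ge0.
  by have := ler_normB (x ord0 j + v ord0 j) (v ord0 j); rewrite addrK; lra.
Qed.

(** The factor [F] is written as the transform of [G] up to [c], and Fubini then leaves the inverse
    transform of [w] at [x - y]. Keeping [G] abstract covers both the translated windows and, at a
    fixed frequency, the reflected kernel. *)
Lemma invFT_mul F G w (c : R[i]) x : c != 0 -> cinteg mu G -> cinteg mu w ->
  cinteg mu (fun xi => F xi * w xi) -> (forall xi, FT G xi = c * F xi) ->
  invFT (fun xi => F xi * w xi) x = c^-1 * CI mu (fun y => G y * invFT w (x - y)).
Proof.
move=> c0 iG iw iFw HG; apply: (mulfI c0); rewrite mulVKf//.
pose A z := (G z.2 * cexpi (- dotp z.2 z.1)) * (w z.1 * cexpi (dotp x z.1)).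
have iwx := cinteg_wave x iw.
have mA : cmeas A.
  apply: cmeasM.
    apply: cmeasM; first exact: (cmeas_comp (h := snd) measurable_snd iG.1).
    apply: cmeas_cexpi; apply: measurableT_comp => //.
    exact: (measurable_dotp (f := snd) (g := fst)).
  exact: (cmeas_comp (h := fst) (f := fun y => w y * cexpi (dotp x y)) measurable_fst iwx.1).
have [V V0 HV] := cinteg_bound iw; have [W W0 HW] := cinteg_bound iG.
have Aoo : (\int[mu]_x \int[mu]_y (cabs (A (x, y)))%:E < +oo)%E.
  have E1 y : (\int[mu]_z (cabs (A (y, z)))%:E = (W * cabs (w y))%:E)%E.
    under eq_integral do rewrite /A !cabsM !cabs_cexpi !mulr1 /= mulrC.
    by rewrite (ge0Z mu (measurable_cabs iG.1) (fun x => cabs_ge0 _) (cabs_ge0 _)) HW -EFinM mulrC.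
  under eq_integral do rewrite E1.
  by rewrite (ge0Z mu (measurable_cabs iw.1) (fun x => cabs_ge0 _) W0) HV -EFinM ltry.
have iGx xi : cinteg mu (fun y => G y * cexpi (- dotp y xi)).
  split; first by apply: cmeasM iG.1 _; exact: cmeas_wave.
  by under eq_integral do rewrite cabsM cabs_cexpi mulr1; exact: iG.2.
have iFwx := cinteg_wave x iFw.
rewrite invFTE// mulrCA -(CIZ c iFwx).
transitivity ((cnorm R n)%:C%C * CI mu (fun xi => CI mu (fun y => A (xi, y)))).
  congr (_ * _); apply: eq_CI => xi; rewrite -mulrA mulrA -HG /FT mulrC -(CIZ _ (iGx xi)).
  by apply: eq_CI => y; rewrite mulrC.
rewrite (CI_Fubini mA Aoo) -CIZ; last first.
  have mAs : cmeas (fun z => A (z.2, z.1)).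
    have ms := measurable_fun_pair (@measurable_snd _ _ 'rV[R]_n 'rV[R]_n) measurable_fst.
    by split; [exact: measurableT_comp mA.1 ms|exact: measurableT_comp mA.2 ms].
  split; first exact: (cmeas_CI mu mAs).
  apply: (@le_lt_trans _ _ (\int[mu]_y (2 * (V * cabs (G y)))%:E)%E); last first.
    under eq_integral do rewrite mulrA.
    rewrite (ge0Z mu (measurable_cabs iG.1) (fun x => cabs_ge0 _)) ?mulr_ge0//.
    by rewrite HW -EFinM ltry.
  apply: ge0le.
  - exact: measurable_cabs (cmeas_CI mu mAs).
  - by apply: measurable_funM => //; apply: measurable_funM => //; exact: measurable_cabs iG.1.
  - by move=> y; exact: cabs_ge0.
  - move=> y; rewrite -lee_fin; apply: le_trans (CI_le _ _) _.
      by split; [exact: measurableT_comp mAs.1 (pair1_measurable y)|exact: measurableT_comp mAs.2 (pair1_measurable y)].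
    under eq_integral do rewrite /A !cabsM !cabs_cexpi !mulr1 /=.
    by rewrite (ge0Z mu (measurable_cabs iw.1) (fun x => cabs_ge0 _) (cabs_ge0 _)) HV -!EFinM [V * _]mulrC.
apply: eq_CI => y; rewrite invFTE// mulrCA; congr (_ * _).
rewrite -(CIZ _ (cinteg_wave (x - y) iw)); apply: eq_CI => xi.
rewrite /A /=; have -> : dotp (x - y) xi = dotp x xi - dotp y xi.
  by rewrite dotpC dotpDr dotpNr dotpC [dotp xi y]dotpC.
by rewrite cexpiD -mulrA; congr (_ * _); rewrite mulrCA [X in _ * X]mulrC.
Qed.

End Multiplier.

Section Localized.
Variables (R : realType) (n : nat) (p q s : R) (phi : 'rV[R]_n -> R[i]).
Hypotheses (wphi : window phi) (p1 : 1 <= p) (q0 : 0 < q) (s0 : 0 <= s).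
Implicit Types (F g w : 'rV[R]_n -> R[i]) (k : 'rV[int]_n).
Local Notation mu := (leb R n).

Definition phik k (xi : 'rV[R]_n) : R[i] := phi (xi - intvec R k).

Definition Tk g k : \bar R := nrm p (fun x => cabs (locFT phi g k x)).

Lemma good_phik k : good (phik k).
Proof. exact: good_shift (window_good wphi). Qed.

Lemma cinteg_mul_good F w : good F -> cinteg mu w -> cinteg mu (fun xi => F xi * w xi).
Proof.
move=> gF iw; have [M M0 HM] := good_bounded gF.
exact: (cintegM_bounded (good_cmeas gF) iw HM).
Qed.

Lemma cinteg_loc k g : cinteg mu g -> cinteg mu (fun xi => phik k xi * g xi).
Proof. exact: cinteg_mul_good (good_phik k). Qed.

(** Translating [F] in frequency multiplies its inverse transform by a unimodular wave, so one
    envelope [C * decay 2] serves for every index [k]. *)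
Lemma good_mul_le F : good F -> exists2 C : R, 0 <= C & forall k w x, cinteg mu w ->
  ((cabs (invFT (fun xi : 'rV[R]_n => F (xi - intvec R k) * w xi) x))%:E <=
   \int[mu]_y (cabs (invFT w (x - y)) * (C * decay 2 y))%:E)%E.
Proof.
move=> gF; have [c c0 Hc] := inversion wphi.
have [M M0 HM] := invFT_decay gF.
have ci0 : 0 <= cabs c^-1 := cabs_ge0 _.
exists (2 * (cabs c^-1 * M)); first by rewrite !mulr_ge0.
move=> k w x iw; have gk := good_shift (- intvec R k) gF.
rewrite (invFT_mul x c0 (good_invFT gk) iw (cinteg_mul_good gk iw) (Hc _ gk)) cabsM.
have mi := cmeas_invFT iw.
have mix : cmeas (fun y : 'rV[R]_n => invFT w (x - y)) by exact: cmeas_subl.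
have mm : cmeas (fun y => invFT (fun xi : 'rV[R]_n => F (xi + - intvec R k)) y * invFT w (x - y)).
  by apply: cmeasM => //; exact: cmeas_invFT (good_cinteg gk).
have md : measurable_fun setT (fun y : 'rV[R]_n => M * (cabs (invFT w (x - y)) * decay 2 y)).
  apply: measurable_funM => //; apply: measurable_funM; first exact: measurable_cabs.
  exact: measurable_decay.
apply: (@le_trans _ _ ((2 * cabs c^-1)%:E * \int[mu]_y (M * (cabs (invFT w (x - y)) * decay 2 y))%:E)%E); last first.
  rewrite -(ge0Z mu md); last 2 first.
  - by move=> y; rewrite !mulr_ge0 ?cabs_ge0 ?decay_ge0.
  - by rewrite mulr_ge0.
  rewrite le_eqVlt; apply/orP; left; apply/eqP; apply: eq_integral => y _; congr (_%:E).
  by move: (cabs c^-1) (cabs _) (decay 2 y) => r1 r2 r3; ring.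
rewrite EFinM [(2 * _)%R]mulrC [X in (_ <= X * _)%E]EFinM -muleA; apply: lee_wpmul2l => //.
apply: le_trans (CI_le _ mm) _; apply: lee_wpmul2l => //.
apply: ge0le => //; first exact: measurable_cabs.
  by move=> y; exact: cabs_ge0.
move=> y; rewrite cabsM mulrC [leRHS]mulrCA ler_wpM2l ?cabs_ge0//.
by rewrite (invFT_shift _ _ (good_cinteg gF)) cabsM cabs_cexpi mul1r.
Qed.

(** Young's inequality in L^p with the envelope of [good_mul_le]: frequency localization is bounded
    on L^p uniformly in its centre. *)
Lemma good_mul_nrm F : good F -> exists2 C : R, 0 <= C & forall k w, cinteg mu w ->
  (nrm p (fun x => cabs (invFT (fun xi : 'rV[R]_n => (F (xi - intvec R k) * w xi)%R) x)) <=
   C%:E * nrm p (fun x => cabs (invFT w x)))%E.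
Proof.
move=> gF; have [C C0 HC] := good_mul_le gF.
have [c c0 Hc] : exists2 c : R, 0 <= c & (\int[mu]_x (decay 2 x)%:E = c%:E)%E.
  by apply: decay_int; rewrite ltr1n.
exists (C * c); first exact: mulr_ge0.
move=> k w iw; have gk := good_shift (- intvec R k) gF.
have md := @measurable_decay R n 2; have d0 := @decay_ge0 R n 2.
apply: (@nrm_young R n p p1 _ _ (fun y => C * decay 2 y)).
- exact: measurable_cabs (cmeas_invFT (cinteg_mul_good gk iw)).
- exact: measurable_cabs (cmeas_invFT iw).
- exact: measurable_funM.
- by move=> x; exact: cabs_ge0.
- by move=> x; exact: cabs_ge0.
- by move=> x; rewrite mulr_ge0.
- by rewrite mulr_ge0.
- by rewrite (ge0Z mu md d0 C0) Hc.
- by move=> x; exact: HC.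
Qed.

Lemma cmeas_locFT g k : cinteg mu g -> cmeas (locFT phi g k).
Proof. by move=> ig; exact: cmeas_invFT (cinteg_loc k ig). Qed.

Lemma Tk_ge0 g k : (0 <= Tk g k)%E. Proof. exact: nrm_ge0. Qed.

Lemma Msum_SS g : cinteg mu g -> Msum p q s phi g = SS q s (Tk g).
Proof.
move=> ig; rewrite /Msum /SS; apply: eq_esum => k _; congr (_ * _)%E.
have mk := measurable_cabs (cmeas_locFT k ig).
rewrite intnE; last 2 first.
- by apply/measurable_EFinP; exact: (measurable_powRp p mk).
- by move=> x; rewrite lee_fin powR_ge0.
have p0 : 0 < p by exact: lt_le_trans p1.
rewrite /Tk /nrm -poweRrM mulrC.
(* A nonzero exponent makes both kinds of power send infinity to infinity. *)
have qp : p^-1 * q != 0 by rewrite mulf_neq0 ?invr_eq0 ?gt_eqF.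
have := int_powR_ge0 p (fun x => cabs (locFT phi g k x)).
by case: (\int[mu]_x _)%E => [r| |] _ //=; rewrite (negbTE qp).
Qed.

Lemma TkD a b k : cinteg mu a -> cinteg mu b ->
  (Tk (fun xi => a xi + b xi)%R k <= Tk a k + Tk b k)%E.
Proof.
move=> ia ib.
have ma := measurable_cabs (cmeas_locFT k ia); have mb := measurable_cabs (cmeas_locFT k ib).
apply: le_trans (nrmD p1 ma mb (fun x => cabs_ge0 _) (fun x => cabs_ge0 _)).
apply: (nrm_le p1).
- exact: measurable_cabs (cmeas_locFT k (cintegD ia ib)).
- exact: measurable_funD.
- move=> x; rewrite cabs_ge0 /=.
  have -> : locFT phi (fun xi => a xi + b xi) k x = locFT phi a k x + locFT phi b k x.
    rewrite /locFT -(invFTD x (cinteg_loc k ia) (cinteg_loc k ib)).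
    by congr (invFT _ x); apply/funext => xi; rewrite mulrDr.
  exact: cabsD.
Qed.

Lemma MsumD a b : cinteg mu a -> cinteg mu b ->
  (Msum p q s phi (fun xi => a xi + b xi)%R <=
    (2 `^ q)%:E * (Msum p q s phi a + Msum p q s phi b))%E.
Proof.
move=> ia ib; rewrite !Msum_SS//; last exact: cintegD.
apply: le_trans (SSD s q0 (Tk_ge0 a) (Tk_ge0 b)).
by apply: SS_le => // k; [exact: Tk_ge0|exact: TkD].
Qed.

Lemma MsumZ (c : R[i]) a : cinteg mu a ->
  (Msum p q s phi (fun xi => c * a xi)%R <= (cabs c `^ q)%:E * Msum p q s phi a)%E.
Proof.
move=> ia; rewrite !Msum_SS//; last exact: cintegZ.
rewrite -(SSZ q s (cabs_ge0 c) (Tk_ge0 a)).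
apply: SS_le => // k; first exact: Tk_ge0.
have ma := measurable_cabs (cmeas_locFT k ia).
rewrite /Tk -(nrmZ p1 ma (fun x => cabs_ge0 _) (cabs_ge0 c)).
apply: (nrm_le p1).
- exact: measurable_cabs (cmeas_locFT k (cintegZ c ia)).
- exact: measurable_funM.
- move=> x; rewrite cabs_ge0 /= -cabsM.
  suff -> : locFT phi (fun xi => c * a xi) k x = c * locFT phi a k x by [].
  rewrite /locFT -(invFTZ c x (cinteg_loc k ia)).
  by congr (invFT _ x); apply/funext => xi; rewrite mulrCA.
Qed.

(** The finite form of the partition of unity, around any centre [k] whose neighbourhood contains
    all windows alive at [x]. *)
Lemma window_sum_near x k : (forall m, phi (x - intvec R m) != 0 -> k - m \in nbh n) ->
  \sum_(j <- nbh n) phik (k - j) x = 1.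
Proof.
move=> H; have [_ _ _ /(_ x) <-] := wphi.
rewrite -(fsbig_widen [set` [seq k - m | m <- nbh n]] setT)//; last first.
  move=> m [_ /= kn]; apply: contra_notP kn => /eqP /H kn; apply/mapP.
  by exists (k - m) => //; rewrite subKr.
by rewrite -fsbig_seq ?big_map// map_inj_uniq ?uniq_nbh// => l m /addrI /oppr_inj.
Qed.

End Localized.

(** * The approximate unit *)

Section Kernel.
Variables (R : realType) (n : nat) (phi : 'rV[R]_n -> R[i]).
Hypothesis wphi : window phi.
Implicit Types (m : R) (x xi : 'rV[R]_n).
Local Notation mu := (leb R n).
Local Notation cn := (cnorm R n).

Definition one_row : 'rV[R]_n := const_mx 1.

(* The constant gives the kernel of [conv a (kap m)] total mass one. Shifting the bump into the
   positive orthant makes convergence at [xi] depend only on the values of [a] to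
   the left of [xi], which suits half-open boxes. *)
Definition kap m xi : R[i] := (cn^-1 * m ^+ n)%:C%C * phi (m *: xi - one_row).

Let gp := window_good wphi.
Let ip := good_cinteg gp.
Let cn0 := cnorm_gt0 R n.

Lemma kap_supp m xi : 1 <= m -> kap m xi != 0 -> forall j, 0 <= xi ord0 j <= 2.
Proof.
move=> m1 k0 j; have m0 : 0 < m by exact: lt_le_trans m1.
have h : `|m * xi ord0 j - 1| <= 1.
  rewrite leNgt; apply/negP => h; move/eqP: k0; apply; rewrite /kap (window_supp wphi) ?mulr0//.
  by exists j; rewrite !mxE.
have /andP[h1 h2] : -1 <= m * xi ord0 j - 1 <= 1 by rewrite -ler_norml.
have h3 : 0 <= m * xi ord0 j by lra.
have x0 : 0 <= xi ord0 j by rewrite -(pmulr_rge0 _ m0).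
rewrite x0 /=; apply: (@le_trans _ _ (m * xi ord0 j)); last by lra.
by rewrite ler_peMl.
Qed.

Lemma cinteg_kap m : 0 < m -> cinteg mu (kap m).
Proof.
move=> m0; apply: cintegZ.
by have := cinteg_scale m0 (cinteg_shift (- one_row) ip).
Qed.

Lemma kap_bounded m : 0 < m -> exists2 M : R, 0 <= M & forall xi, cabs (kap m xi) <= M.
Proof.
move=> m0; have [M M0 HM] := good_bounded gp.
exists (`|cn^-1 * m ^+ n| * M); first by rewrite mulr_ge0.
by move=> xi; rewrite /kap cabsM cabs_real ler_wpM2l.
Qed.

(** The factor [m ^+ n] compensates the dilation, so the L^1 norm does not depend on [m]; bounds
    uniform in [N] come from this. *)
Lemma kap_absint m : 0 < m -> (\int[mu]_xi (cabs (kap m xi))%:E =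
  (cn^-1)%:E * \int[mu]_xi (cabs (phi xi))%:E)%E.
Proof.
move=> m0; have mn0 : 0 < m ^+ n by rewrite exprn_gt0.
have E xi : cabs (kap m xi) = cn^-1 * m ^+ n * cabs (phi (m *: xi + - one_row)).
  by rewrite /kap cabsM cabs_real ger0_norm// mulr_ge0 ?invr_ge0 ?ltW.
have m' := measurable_cabs (cmeas_comp (measurable_row_affine m (- one_row)) ip.1).
under eq_integral do rewrite E.
rewrite (ge0Z mu m' (fun x => cabs_ge0 _)); last by rewrite mulr_ge0 ?invr_ge0 ?ltW.
rewrite EFinM -muleA; congr (_ * _)%E.
have F0 x : (0 <= (cabs (phi x))%:E)%E by rewrite lee_fin cabs_ge0.
rewrite (integral_affine (- one_row) (lt0r_neq0 m0) (emeasurable_cabs ip.1) F0).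
rewrite muleA -EFinM gtr0_norm// mulfV ?gt_eqF// mul1e //.
Qed.

Definition ker m : 'rV[R]_n -> R[i] := invFT (kap m).

(** The inverse transform of the dilated bump is a fixed profile evaluated at [m^-1 x], so it is
    bounded independently of [m] but spreads as [m] grows. *)
Lemma kerE m x : 0 < m ->
  ker m x = (cn^-1)%:C%C * invFT (fun xi => phi (xi - one_row)) (m^-1 *: x).
Proof.
move=> m0; have i1 := cinteg_shift (- one_row) ip.
have iw := cinteg_wave (m^-1 *: x) i1.
rewrite /ker (invFTE _ (cinteg_kap m0)) (invFTE _ i1) mulrCA; congr (_ * _).
have mn : m != 0 by rewrite gt_eqF.
transitivity (CI mu (fun xi => (cn^-1 * m ^+ n)%:C%C * (phi (m *: xi + 0 - one_row) * cexpi (dotp (m^-1 *: x) (m *: xi + 0))))).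
  apply: eq_CI => xi; rewrite addr0 /kap mulrA; congr (_ * cexpi _).
  by apply: eq_bigr => j _; rewrite !mxE mulrACA mulVf// mul1r.
rewrite CIZ; last first.
  have := cinteg_scale m0 iw; congr (cinteg _ _); apply/funext => y; by rewrite addr0.
rewrite (CI_affine 0 mn iw) mulrA -rmorphM /= gtr0_norm// mulfK//.
by rewrite expf_neq0.
Qed.

Lemma ker_bounded : exists2 C : R, 0 <= C & forall m x, 0 < m -> cabs (ker m x) <= C.
Proof.
have [M M0 HM] := invFT_decay (good_shift (- one_row) gp).
exists (cabs (cn^-1)%:C%C * M); first by rewrite mulr_ge0 ?cabs_ge0.
move=> m x m0; rewrite kerE// cabsM ler_wpM2l ?cabs_ge0//.
by apply: le_trans (HM _) _; rewrite ler_piMr// decay_le1.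
Qed.

(** From [1 + |x_j| <= m (1 + |x_j| / m)]; the constant obtained grows with [m]. *)
Lemma ker_decay m : 1 <= m -> exists2 C : R, 0 <= C &
  forall x, cabs (ker m x) <= C * decay 2 x.
Proof.
move=> m1; have m0 : 0 < m by exact: lt_le_trans m1.
have [M M0 HM] := invFT_decay (good_shift (- one_row) gp).
exists (cabs (cn^-1)%:C%C * M * (m ^+ 2) ^+ n).
  by rewrite !mulr_ge0 ?cabs_ge0// !exprn_ge0// ltW.
move=> x; rewrite kerE// cabsM -!mulrA ler_wpM2l ?cabs_ge0//.
apply: le_trans (HM _) _; rewrite ler_wpM2l//.
rewrite /decay exprn_ord -big_split /=; apply: ler_prod => j _; rewrite powR_ge0 /=.
have a0 : 0 < 1 + `|x ord0 j| by rewrite ltr_wpDr.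
have b0 : 0 < 1 + `|(m^-1 *: x) ord0 j| by rewrite ltr_wpDr.
rewrite !powRN -[2 : R]/(2%:R) !powR_mulrn ?(ltW a0) ?(ltW b0)//.
rewrite ler_pdivlMr ?exprn_gt0// mulrC ler_pdivrMr ?exprn_gt0// -exprMn.
rewrite lerXn2r ?nnegrE ?(ltW a0) ?mulr_ge0 ?(ltW b0) ?(ltW m0)//.
rewrite mulrDr mulr1 mxE normrM gtr0_norm ?invr_gt0// mulrA mulfV ?gt_eqF// mul1r.
by rewrite lerD2r.
Qed.

(** The substitution [y = m^-1 (t + one_row)] undoes the dilation, and [cn] cancels the constant in
    [kap]. *)
Lemma CI_kap m (g : 'rV[R]_n -> R[i]) : 0 < m -> cinteg mu (fun y => kap m y * g y) ->
  cn%:C%C * CI mu (fun y => kap m y * g y) =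
  CI mu (fun t => phi t * g (m^-1 *: t + m^-1 *: one_row)).
Proof.
move=> m0 iF; pose F y := kap m y * g y.
have mV0 : 0 < m^-1 by rewrite invr_gt0.
have mn0 : m ^+ n != 0 by rewrite expf_neq0// gt_eqF.
have iFa : cinteg mu (fun t => F (m^-1 *: t + m^-1 *: one_row)).
  exact: (cinteg_scale mV0 (cinteg_shift (m^-1 *: one_row) iF)).
transitivity (CI mu (fun t => (cn / m ^+ n)%:C%C * F (m^-1 *: t + m^-1 *: one_row))); last first.
  apply: eq_CI => t; rewrite /F /kap mulrA mulrA -rmorphM /=.
  have -> : m *: (m^-1 *: t + m^-1 *: one_row) - one_row = t.
    by rewrite scalerDr !scalerA mulfV ?gt_eqF// !scale1r addrK.
  have -> : cn / m ^+ n * (cn^-1 * m ^+ n) = 1 by rewrite mulrACA mulfV ?gt_eqF// mulVf// mulr1.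
  by rewrite mul1r.
rewrite (CIZ _ iFa) (CI_affine _ (lt0r_neq0 mV0) iF) mulrA -rmorphM /=.
by rewrite gtr0_norm// exprVn invrK divfK.
Qed.

(** The frequencies in the support of the bump shrink to 0, so after rescaling the wave tends to 1
    under an integral of total mass 1. *)
Lemma ker_cvg x : cabs (ker k.+1%:R x - 1) @[k --> \oo] --> (0 : R).
Proof.
have m0 k : (0 : R) < k.+1%:R by rewrite ltr0n.
pose f (k : nat) y := cexpi (dotp x ((k.+1%:R^-1 : R) *: y + k.+1%:R^-1 *: one_row)).
have E k : ker k.+1%:R x = CI mu (fun y => phi y * f k y).
  have iw := cinteg_wave x (cinteg_kap (m0 k)).
  by rewrite /ker (invFTE _ (cinteg_kap (m0 k))) CI_kap.
have E1 : 1 = CI mu (fun y => phi y * 1).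
  by rewrite -[LHS](CI_window wphi); apply: eq_CI => y; rewrite mulr1.
under eq_fun do rewrite E {1}E1.
have mf k : cmeas (f k).
  apply: cmeas_cexpi.
  exact: (measurable_dotp (f := cst x) (measurable_cst _) (measurable_row_affine _ _)).
have H := CI_dct_mul ler01 mf (cmeas_cst _ 1) ip (fun k y => _) (fun y => _) _.
apply/cvgrPdist_lt => e e0.
have [|||N HN] := H _ _ _ e e0.
- by move=> k y; rewrite cabs_cexpi.
- by move=> y; rewrite cabs1.
- move=> y; pose c : R := 2 * `|dotp x (y + one_row)|.
  have cc : harmonic k * c @[k --> \oo] --> (0 : R).
    by rewrite -(mul0r c); apply: cvgM; [exact: cvg_harmonic|exact: cvg_cst].
  apply: (squeeze_cvgr _ (cvg_cst 0) cc); apply: nearW => k.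
  rewrite cabs_ge0 /=; apply: le_trans (cexpi_lip _) _.
  rewrite -scalerDr dotpC.
  have -> : dotp ((k.+1%:R^-1 : R) *: (y + one_row)) x = k.+1%:R^-1 * dotp x (y + one_row).
    by rewrite dotpC /dotp mulr_sumr; apply: eq_bigr => j _; rewrite !mxE mulrCA.
  by rewrite normrM gtr0_norm ?invr_gt0// /c mulrCA.
- near=> k; rewrite sub0r normrN ger0_norm ?cabs_ge0//; apply: HN.
  by near: k; exact: nbhs_infty_ge.
Unshelve. all: by end_near. Qed.

Lemma FT_ker m : 0 < m -> exists2 c : R[i], c != 0 & forall xi, FT (ker m) xi = c * kap m xi.
Proof.
move=> m0; have [c c0 Hc] := inversion wphi; exists c => // xi.
have gs := good_shift (- one_row) gp; have iG := good_invFT gs.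
pose G := invFT (fun xi => phi (xi - one_row)).
pose H y := G y * cexpi (- dotp y (m *: xi)).
have iH : cinteg mu H.
  split; first by apply: cmeasM iG.1 _; exact: cmeas_wave.
  by under eq_integral do rewrite /H cabsM cabs_cexpi mulr1; exact: iG.2.
have mV0 : 0 < m^-1 by rewrite invr_gt0.
transitivity (CI mu (fun x => (cn^-1)%:C%C * H (m^-1 *: x + 0))).
  apply: eq_CI => x; rewrite addr0 kerE// -mulrA; congr (_ * (_ * cexpi (- _))).
  by apply: eq_bigr => j _; rewrite !mxE mulrACA mulVf ?gt_eqF// mul1r.
have iHs : cinteg mu (fun x => H (m^-1 *: x + 0)).
  exact: (cinteg_scale mV0 (cinteg_shift 0 iH)).
rewrite (CIZ _ iHs) (CI_affine 0 (lt0r_neq0 mV0) iH).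
have -> : CI mu H = c * phi (m *: xi - one_row) by exact: (Hc _ gs (m *: xi)).
by rewrite gtr0_norm// exprVn invrK mulrA -rmorphM mulrCA.
Qed.

Lemma cinteg_ker m : 1 <= m -> cinteg mu (ker m).
Proof.
move=> m1; have [C C0 HC] := ker_decay m1.
have m0 : 0 < m by exact: lt_le_trans m1.
by apply: (decay_cinteg _ C0 (cmeas_invFT (cinteg_kap m0)) HC); rewrite ltr1n.
Qed.

End Kernel.

(** * Local L^1 norms over unit cubes *)

Section CubeAverages.
Variables (R : realType) (n : nat) (q s : R).
Hypotheses (q1 : 1 <= q) (s0 : 0 <= s).
Implicit Types (a d : 'rV[R]_n -> R[i]) (k l : 'rV[int]_n).
Local Notation mu := (leb R n).

Let q0 : 0 < q. Proof. exact: lt_le_trans q1. Qed.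

(** The weighted [l^q] sum of these local norms is controlled by the Fourier-Lebesgue norm, and it
    is through them that the bounds into the modulation space see [a]. *)
Definition cubeL1 a l : \bar R := (\int[mu]_x (((flr x == l)%:R : R) * cabs (a x))%:E)%E.

Lemma measurable_flr_eqR l : measurable_fun setT (fun x : 'rV[R]_n => (flr x == l)%:R : R).
Proof. exact: (measurable_flr (fun k => (k == l)%:R : R)). Qed.

Lemma integral_flr_eq l : (\int[mu]_x ((flr x == l)%:R : R)%:E = 1)%E.
Proof.
have -> : (\int[mu]_x ((flr x == l)%:R : R)%:E = \int[mu]_x (\1_[set x : 'rV[R]_n | flr x = l] x)%:E)%E.
  apply: eq_integral => x _; rewrite indicE; congr ((nat_of_bool _)%:R%:E).
  by apply/idP/idP => [/eqP h|/set_mem/= ->//]; apply: mem_set.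
rewrite integral_indic ?setIT//; last exact: measurable_flr_eq.
exact: leb_cube.
Qed.

Lemma cubeL1_ge0 a l : (0 <= cubeL1 a l)%E.
Proof. by apply: integral_real_ge0 => x; rewrite mulr_ge0 ?ler0n ?cabs_ge0. Qed.

(** Jensen on a cube, of measure one, bounds the [q]-th power of the local L^1 norm by the local
    integral of [|a|^q], and the weight varies by a bounded factor on a cube. *)
Lemma SS_cubeL1 : exists2 C : R, 0 <= C & forall a, cmeas a ->
  (SS q s (cubeL1 a) <= C%:E * FLint q s a)%E.
Proof.
exists ((boxw n 1 s) `^ q); first exact: powR_ge0.
move=> a ma; rewrite SSE FLintE//.
have mab := measurable_cabs ma.
(* [K (x, y)] couples an index point [x] and an integration point [y] of the same cube, so that
   Tonelli can integrate out [x] and leave the weight evaluated near [y]. *)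
pose K (z : 'rV[R]_n * 'rV[R]_n) : R :=
  wS q s (flr z.1) * ((flr z.2 == flr z.1)%:R * cabs (a z.2) `^ q).
have mE : measurable_fun setT (fun z : 'rV[R]_n * 'rV[R]_n => (flr z.2 == flr z.1)%:R : R).
  have -> : (fun z : 'rV[R]_n * 'rV[R]_n => (flr z.2 == flr z.1)%:R : R) =
     \1_(\bigcup_(k : 'rV[int]_n) ((fun z : 'rV[R]_n * 'rV[R]_n => flr z.2) @^-1` [set k] `&`
        (fun z : 'rV[R]_n * 'rV[R]_n => flr z.1) @^-1` [set k])).
    apply/funext => z; rewrite indicE; congr ((nat_of_bool _)%:R).
    apply/idP/idP => [/eqP h|/set_mem/=[k _ [/= -> ->]]//]; apply: mem_set.
    by exists (flr z.1).
  apply: measurable_indic; apply: countable_bigcupT_measurable; first exact: countableP.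
  move=> k; apply: measurableI.
    have := @measurable_snd _ _ 'rV[R]_n 'rV[R]_n measurableT _ (measurable_flr_eq k).
    by rewrite setTI.
  have := @measurable_fst _ _ 'rV[R]_n 'rV[R]_n measurableT _ (measurable_flr_eq k).
  by rewrite setTI.
have mK : measurable_fun setT K.
  apply: measurable_funM.
    exact: (measurableT_comp (f := fun x => wS q s (flr x)) (measurable_flr (wS q s))).
  apply: measurable_funM => //; apply: (measurableT_comp (measurable_powR _)).
  exact: (measurableT_comp mab).
have K0 z : 0 <= K z by rewrite mulr_ge0 ?wS_ge0 // mulr_ge0 ?powR_ge0 ?ler0n.
apply: (@le_trans _ _ (\int[mu]_x \int[mu]_y (K (x, y))%:E)%E).
  apply: ege0le.
  - exact: measurable_SS.
  - exact: (measurable_inner mu mK K0).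
  - by move=> x; exact: SS_term_ge0.
  - move=> x; have mx := measurable_flr_eqR (flr x).
    have mq : measurable_fun setT (fun y => (flr y == flr x)%:R * cabs (a y) `^ q).
      apply: measurable_funM => //; exact: (measurableT_comp (measurable_powR _) mab).
    rewrite /K /= (ge0Z mu mq) ?wS_ge0//; last by move=> y; rewrite mulr_ge0 ?powR_ge0 ?ler0n.
    apply: lee_wpmul2l; first by rewrite lee_fin wS_ge0.
    have J := weighted_jensen mx mab (fun x => ler0n _ _) (fun x => cabs_ge0 _) q1 ler01.
    have I1 : (\int[mu]_y ((flr y == flr x)%:R : R)%:E <= 1)%E by rewrite integral_flr_eq.
    by have := J mu I1; rewrite powR1 mul1e.
rewrite (real_tonelli mu mu mK K0).
have mw := measurable_wabsX s q ma.
rewrite -(ge0Z mu mw (fun x => powR_ge0 _ _) (powR_ge0 _ _)).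
apply: ege0le.
- exact: (measurable_inner mu (h := fun z => K (z.2, z.1)) (measurableT_comp mK (measurable_fun_pair measurable_snd measurable_fst)) (fun z => K0 _)).
- by apply/measurable_EFinP; exact: measurable_funM.
- by move=> y; apply: integral_real_ge0 => x; exact: K0.
- move=> y; have E x : K (x, y) = wS q s (flr y) * cabs (a y) `^ q * (flr x == flr y)%:R.
    rewrite /K [(x, y).1]/= [(x, y).2]/=; have [->|xy] := eqVneq (flr y) (flr x); first by rewrite mul1r mulr1.
    by rewrite [X in _ * X = _]mul0r [in LHS]mulr0 [in RHS]mulr0.
  under eq_integral do rewrite E.
  rewrite (ge0Z mu (measurable_flr_eqR (flr y)) (fun x => ler0n _ _)); last first.
    by rewrite mulr_ge0 ?wS_ge0 ?powR_ge0.
  rewrite integral_flr_eq mule1 lee_fin /wabs -!powRM ?mulr_ge0 ?powR_ge0 ?cabs_ge0 ?boxw_ge0//.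
  rewrite /wS powRrM -powRM ?powR_ge0 ?cabs_ge0//; apply: (le_powR (ltW q0)).
    by rewrite mulr_ge0 ?powR_ge0 ?cabs_ge0.
  rewrite mulrA ler_wpM2r ?cabs_ge0//; apply: jbr_near => // j; rewrite !mxE.
  have /andP[h1 h2] := floor_itv (y ord0 j); move: h2; rewrite intrD => h2.
  by rewrite distrC ger0_norm ?subr_ge0//; lra.
Qed.

(** The sharp cut-off along cubes is harmless, since the result is measured in L^1. *)
Definition restr k a (x : 'rV[R]_n) : R[i] := ((k - flr x \in nbh n)%:R : R)%:C%C * a x.

Lemma cinteg_restr k a : cinteg mu a -> cinteg mu (restr k a).
Proof.
move=> ia; apply: (cintegM_bounded (C := 1)) => //.
  exact: (cmeas_flr (fun l => ((k - l \in nbh n)%:R : R)%:C%C)).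
by move=> x; rewrite cabs_real; case: (_ \in _); rewrite ?normr1 ?normr0.
Qed.

Lemma restr_absint k a : cinteg mu a ->
  (\int[mu]_x (cabs (restr k a x))%:E = \sum_(j <- nbh n) cubeL1 a (k - j))%E.
Proof.
move=> ia; have mab := measurable_cabs ia.1.
rewrite /cubeL1 -ge0_integral_sum//; last 2 first.
- by move=> j; apply/measurable_EFinP; apply: measurable_funM => //; exact: measurable_flr_eqR.
- by move=> j x _; rewrite lee_fin mulr_ge0 ?ler0n ?cabs_ge0.
apply: eq_integral => x _; rewrite /restr cabsM cabs_real ger0_norm ?ler0n//.
rewrite sumEFin -mulr_suml; congr (_ * _)%:E.
have [kn|kn] := boolP (k - flr x \in nbh n).
  rewrite (bigD1_seq (k - flr x)) ?uniq_nbh//= subKr eqxx big1 ?addr0// => m mk.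
  case: eqP => // h; move/eqP: mk; case; by rewrite h subKr.
rewrite big_seq big1// => m mn; case: eqP => // h.
by move: kn; rewrite h subKr mn.
Qed.

End CubeAverages.

Lemma nbh_flr (R : realType) (n : nat) (x : 'rV[R]_n) (k : 'rV[int]_n) : (forall j, -3 <= x ord0 j - (k ord0 j)%:~R <= 3) ->
  k - flr x \in nbh n.
Proof.
move=> H; apply: mem_nbh => j; rewrite !mxE.
have /andP[h1 h2] := floor_itv (x ord0 j); set f := Num.floor _ in h1 h2 *.
have /andP[h3 h4] := H j.
have h5 : (f - k ord0 j)%:~R <= (3%:~R : R) by rewrite intrB; lra.
have h6 : ((-4)%:~R : R) <= (f - k ord0 j)%:~R by move: h2; rewrite intrB intrD; lra.
move: h5 h6; rewrite !ler_int.
by move: {h1 h2} f (k ord0 j) => a b; lia.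
Qed.

Lemma nbh_int (R : realType) (n : nat) (k l : 'rV[int]_n) : (forall j, -4 <= ((k ord0 j)%:~R - (l ord0 j)%:~R : R) <= 4) ->
  k - l \in nbh n.
Proof.
move=> H; apply: mem_nbh => j; rewrite !mxE; have /andP[h3 h4] := H j.
have h5 : (k ord0 j - l ord0 j)%:~R <= (4%:~R : R) by rewrite intrB; lra.
have h6 : ((-4)%:~R : R) <= (k ord0 j - l ord0 j)%:~R by rewrite intrB; lra.
move: h5 h6; rewrite !ler_int.
by move: (l ord0 j) (k ord0 j) => a b; lia.
Qed.

(** * From the Fourier-Lebesgue norm to the modulation norm *)

Section KernelBounds.
Variables (R : realType) (n : nat) (p q s : R) (phi : 'rV[R]_n -> R[i]).
Hypotheses (wphi : window phi) (p1 : 1 <= p) (q1 : 1 <= q) (s0 : 0 <= s).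
Implicit Types (a b d h : 'rV[R]_n -> R[i]) (k : 'rV[int]_n) (m : R).
Local Notation mu := (leb R n).
Local Notation kap := (kap phi).
Local Notation ker := (ker phi).
Local Notation phik := (phik phi).
Local Notation Tk := (Tk p phi).

Let q0 : 0 < q. Proof. exact: lt_le_trans q1. Qed.
Let p0 : 0 < p. Proof. exact: lt_le_trans p1. Qed.

(** Interpolation between L^1 and the sup bound: [u^p <= B^(p - 1) u]. *)
Lemma nrm_bounded_lty (u : 'rV[R]_n -> R) (B : R) : measurable_fun setT u ->
  (forall x, 0 <= u x <= B) -> (\int[mu]_x (u x)%:E < +oo)%E -> (nrm p u < +oo)%E.
Proof.
move=> mu_ uB uoo; rewrite (nrm_lty p1).
have u0 x : 0 <= u x by have /andP[] := uB x.
apply: (@le_lt_trans _ _ (\int[mu]_x (B `^ (p - 1) * u x)%:E)%E).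
  apply: ge0le.
  - exact: measurable_powRp.
  - exact: measurable_funM.
  - by move=> x; exact: powR_ge0.
  - move=> x; have /andP[a0 aB] := uB x.
    rewrite -(mulr_powRB1 a0 p0) mulrC ler_wpM2r//.
    by rewrite le_powR ?subr_ge0.
by rewrite (ge0Z mu mu_ u0 (powR_ge0 _ _)) lte_mul_pinfty ?lee_fin ?powR_ge0.
Qed.

Lemma nrm_ker_lty m : 1 <= m -> (nrm p (fun x => cabs (ker m x)) < +oo)%E.
Proof.
move=> m1; have [C C0 HC] := ker_bounded wphi; have [mk koo] := cinteg_ker wphi m1.
apply: (@nrm_bounded_lty _ C) => //; first exact: measurable_cabs.
by move=> x; rewrite cabs_ge0 HC// (lt_le_trans _ m1).
Qed.

Lemma phik_near k xi : phik k xi != 0 -> forall j, -1 <= xi ord0 j - (k ord0 j)%:~R <= 1.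
Proof.
move=> h j; rewrite -ler_norml leNgt; apply/negP => h1; move/eqP: h; apply.
by apply: (window_supp wphi); exists j; rewrite !mxE.
Qed.

Lemma eq_conv_kap a b m xi : (forall eta, kap m eta != 0 -> a (xi - eta) = b (xi - eta)) ->
  conv a (kap m) xi = conv b (kap m) xi.
Proof.
move=> H; rewrite /conv; congr (_ * _); apply: eq_CI => eta.
by have [->|/H ->//] := eqVneq (kap m eta) 0; rewrite !mulr0.
Qed.

(** [kap m] moves frequencies by at most 2 in each coordinate, so under window [k] the convolution
    sees [d] only on cubes near [k]. *)
Lemma locFT_conv_kap d m k : 1 <= m ->
  locFT phi (conv d (kap m)) k = locFT phi (conv (restr k d) (kap m)) k.
Proof.
move=> m1; rewrite /locFT; congr invFT; apply/funext => xi.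
have [->|pk] := eqVneq (phi (xi - intvec R k)) 0; first by rewrite !mul0r.
congr (_ * _); apply: eq_conv_kap => eta /(kap_supp wphi m1) ke.
rewrite /restr nbh_flr ?mul1r// => j; rewrite !mxE.
have /andP[h1 h2] := phik_near pk j; have /andP[h3 h4] := ke j.
by apply/andP; split; lra.
Qed.

(** The sup norm falls on the part coming from [d] and the L^p norm on the fixed factor [ker m];
    this is where the constant acquires its dependence on [m]. *)
Lemma Msum_conv_kap m : 1 <= m -> exists2 C : R, 0 <= C & forall d, cinteg mu d ->
  (Msum p q s phi (conv d (kap m)) <= C%:E * FLint q s d)%E.
Proof.
move=> m1; have m0 : 0 < m by exact: lt_le_trans m1.
have ik := cinteg_kap wphi m0.
have [C C0 HC] := good_mul_nrm wphi p1 (window_good wphi).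
have [D D0 HD] := SS_sum_shift q0 s0 (nbh n).
have [E E0 HE] := @SS_cubeL1 R n q s q1 s0.
pose V := fine (nrm p (fun x => cabs (ker m x))).
have VE : nrm p (fun x => cabs (ker m x)) = V%:E.
  by rewrite fineK// ge0_fin_numE ?nrm_ge0// nrm_ker_lty.
have V0 : 0 <= V by rewrite fine_ge0 ?nrm_ge0.
have cn0 := ltW (cnorm_gt0 R n).
(* Localization costs [C], the sup of an inverse transform costs [2 * cnorm] times the L^1 norm, and
   [V] is the L^p norm of the kernel. *)
pose K := C * (2 * cnorm R n) * V.
have K0 : 0 <= K by rewrite !mulr_ge0.
exists (K `^ q * (D * E)); first by rewrite !mulr_ge0 ?powR_ge0.
move=> d id; rewrite (Msum_SS s wphi p1 q0 (conv_cinteg id ik)).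
have Q0 k : (0 <= \sum_(j <- nbh n) cubeL1 d (k - j))%E.
  by apply: sume_ge0 => j _; exact: cubeL1_ge0.
apply: (@le_trans _ _ (SS q s (fun k => K%:E * \sum_(j <- nbh n) cubeL1 d (k - j)))%E); last first.
  rewrite (SSZ q s K0 Q0) EFinM -muleA; apply: lee_wpmul2l; first by rewrite lee_fin powR_ge0.
  apply: le_trans (HD _ (cubeL1_ge0 d)) _; rewrite EFinM -muleA.
  by apply: lee_wpmul2l; [rewrite lee_fin|exact: HE id.1].
apply: SS_le => // k; first exact: Tk_ge0.
have ir := cinteg_restr k id; have irk := conv_cinteg ir ik.
rewrite /Tk locFT_conv_kap//; apply: le_trans (HC k _ irk) _.
rewrite -(restr_absint k id); set I := (\int[mu]_x _)%E.
have I0 : (0 <= I)%E by apply: integral_real_ge0 => x; exact: cabs_ge0.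
have [W W0 HW] := cinteg_bound ir.
have -> : I = W%:E by exact: HW.
have -> : (K%:E * W%:E = C%:E * (2 * cnorm R n * W * V)%:E)%E.
  by rewrite -!EFinM /K; congr (_%:E); ring.
apply: lee_wpmul2l => //.
have mk := cinteg_ker wphi m1.
have mkc := measurable_cabs mk.1.
apply: (@le_trans _ _ (nrm p (fun x => (2 * cnorm R n * W) * cabs (ker m x)))%R).
  apply: (nrm_le p1).
  - exact: measurable_cabs (cmeas_invFT irk).
  - exact: measurable_funM.
  - move=> x; rewrite cabs_ge0 /= invFT_conv// cabsM ler_wpM2r ?cabs_ge0//.
    by rewrite -lee_fin; apply: le_trans (invFT_le x ir) _; rewrite HW -EFinM.
rewrite (nrmZ p1 mkc (fun x => cabs_ge0 _)) ?mulr_ge0// VE -EFinM; exact: lexx.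
Qed.

End KernelBounds.

(** * Convergence of the approximate unit in the modulation norm *)

Section ApproxModulation.
Variables (R : realType) (n : nat) (p q s : R) (phi : 'rV[R]_n -> R[i]).
Hypotheses (wphi : window phi) (p1 : 1 <= p) (q1 : 1 <= q) (s0 : 0 <= s).
Implicit Types (a b d h : 'rV[R]_n -> R[i]) (k : 'rV[int]_n) (m : R).
Local Notation mu := (leb R n).
Local Notation kap := (kap phi).
Local Notation ker := (ker phi).
Local Notation phik := (phik phi).
Local Notation Tk := (Tk p phi).

Let q0 : 0 < q. Proof. exact: lt_le_trans q1. Qed.
Let p0 : 0 < p. Proof. exact: lt_le_trans p1. Qed.

Lemma invFT_sum (I : Type) (r : seq I) (f : I -> 'rV[R]_n -> R[i]) x :
  (forall i, cinteg mu (f i)) ->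
  invFT (fun xi => \sum_(i <- r) f i xi) x = \sum_(i <- r) invFT (f i) x.
Proof.
move=> fi; rewrite invFTE; last exact: cinteg_sum.
under eq_CI do rewrite mulr_suml.
rewrite CI_sum; last by move=> i; exact: cinteg_wave.
by rewrite mulr_sumr; apply: eq_bigr => i _; rewrite invFTE.
Qed.

Lemma cabs_sum (I : Type) (r : seq I) (z : I -> R[i]) :
  cabs (\sum_(i <- r) z i) <= \sum_(i <- r) cabs (z i).
Proof.
elim: r => [|i r IH]; first by rewrite !big_nil cabs0.
by rewrite !big_cons; apply: le_trans (cabsD _ _) _; rewrite lerD2l.
Qed.

Definition piece b k xi : R[i] := phik k xi * b xi.

Lemma cinteg_piece b k : cinteg mu b -> cinteg mu (piece b k).
Proof. exact: cinteg_loc. Qed.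

Lemma near_split_self b k xi : phik k xi != 0 ->
  b xi = \sum_(j <- nbh n) piece b (k - j) xi.
Proof.
move=> pk; rewrite -mulr_suml (window_sum_near wphi) ?mul1r// => l pl.
apply: (@nbh_int R) => j; have /andP[h1 h2] := phik_near wphi pk j.
by have /andP[h3 h4] := phik_near wphi pl j; apply/andP; split; lra.
Qed.

(** The partition of unity is inserted under the convolution integral. The centre [k] is abstract
    because the splitting is used both around a window and around the cube of [xi]. *)
Lemma conv_kap_split b k m xi : 1 <= m -> cinteg mu b ->
  (forall eta : 'rV[R]_n, kap m eta != 0 -> forall l, phi (xi - eta - intvec R l) != 0 ->
     k - l \in nbh n) ->
  conv b (kap m) xi = \sum_(j <- nbh n) conv (piece b (k - j)) (kap m) xi.
Proof.
move=> m1 ib H; have m0 : 0 < m by exact: lt_le_trans m1.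
have [M M0 HM] := kap_bounded wphi m0; have ik := cinteg_kap wphi m0.
rewrite /conv -mulr_sumr -CI_sum; last first.
  move=> j; under eq_fun do rewrite mulrC.
  by apply: (cintegM_bounded ik.1 _ HM); apply: cinteg_refl; exact: cinteg_piece.
congr (_ * _); apply: eq_CI => eta; rewrite -mulr_suml.
have [->|ke] := eqVneq (kap m eta) 0; first by rewrite !mulr0.
by congr (_ * _); rewrite -mulr_suml (window_sum_near wphi (H eta ke)) mul1r.
Qed.

Lemma conv_kap_split_near b k m xi : 1 <= m -> cinteg mu b -> phik k xi != 0 ->
  conv b (kap m) xi = \sum_(j <- nbh n) conv (piece b (k - j)) (kap m) xi.
Proof.
move=> m1 ib pk; apply: conv_kap_split => // eta /(kap_supp wphi m1) ke l pl.
apply: (@nbh_int R) => j; have /andP[h1 h2] := phik_near wphi pk j.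
have /andP[h5 h6] := ke j.
have /andP[] := phik_near wphi pl j; rewrite !mxE => h3 h4.
by apply/andP; split; lra.
Qed.

(** On window [k] only the pieces of [b] near [k] count, and on each piece subtracting the
    convolution multiplies the inverse transform by [1 - ker m]. The outer localization is removed
    by its uniform bound; the factor [ker m - 1] that is left tends to 0 pointwise. *)
Lemma Tk_diff_le : exists2 C : R, 0 <= C & forall b m k, 1 <= m -> cinteg mu b ->
  (Tk (fun xi => b xi - conv b (kap m) xi)%R k <=
   C%:E * \sum_(j <- nbh n)
     nrm p (fun x => (cabs (locFT phi b (k - j)%R x) * cabs (ker m x - 1))%R))%E.
Proof.
have [C C0 HC] := good_mul_nrm wphi p1 (window_good wphi).
exists C => // b m k m1 ib; have m0 : 0 < m by exact: lt_le_trans m1.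
have ik := cinteg_kap wphi m0.
pose w j xi := piece b (k - j) xi - conv (piece b (k - j)) (kap m) xi.
have iw j : cinteg mu (w j).
  by apply: cintegB; [exact: cinteg_piece|apply: conv_cinteg => //; exact: cinteg_piece].
have iv j : cinteg mu (fun xi => phik k xi * w j xi) by exact: cinteg_loc.
have E x : locFT phi (fun xi => b xi - conv b (kap m) xi) k x =
    \sum_(j <- nbh n) invFT (fun xi => phik k xi * w j xi) x.
  rewrite -invFT_sum// /locFT; congr (invFT _ x); apply/funext => xi.
  rewrite -mulr_sumr; have [pk|pk] := eqVneq (phik k xi) 0.
    by rewrite -/(phik k xi) pk !mul0r.
  congr (_ * _); rewrite {1}(near_split_self b pk) (conv_kap_split_near m1 ib pk).
  by rewrite sumrB.
have mv j := measurable_cabs (cmeas_invFT (iv j)).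
apply: (@le_trans _ _ (nrm p (fun x => \sum_(j <- nbh n) cabs (invFT (fun xi => phik k xi * w j xi) x))%R)).
  apply: (nrm_le p1).
  - apply: measurable_cabs; apply: cmeas_locFT => //.
    by apply: cintegB => //; exact: conv_cinteg.
  - by apply: measurable_sum => j; exact: mv.
  - by move=> x; rewrite cabs_ge0 E cabs_sum.
apply: le_trans (nrm_sum p1 _ mv (fun j x => cabs_ge0 _)) _.
rewrite ge0_sume_distrr; last by move=> j _; exact: nrm_ge0.
apply: lee_sum => j _; apply: le_trans (HC k _ (iw j)) _.
apply: lee_wpmul2l; first by rewrite lee_fin.
rewrite le_eqVlt; apply/orP; left; apply/eqP; congr nrm; apply/funext => x.
have ip := cinteg_piece (k - j) ib.
rewrite invFTB//; last exact: conv_cinteg.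
rewrite invFT_conv// -[in LHS](mulr1 (invFT (piece b _) x)) -mulrA mul1r -mulrBr cabsM.
have -> : 1 - invFT (kap m) x = - (ker m x - 1) by rewrite opprB.
by rewrite cabsN.
Qed.

(** Dominated convergence twice: in [x] for each lattice index, under a multiple of the localization
    of [b], and then in the index, under the sequence of the L^p norms of these majorants, whose
    weighted sum is finite. *)
Lemma Msum_approx b (e : R) : cinteg mu b -> (Msum p q s phi b < +oo)%E -> 0 < e ->
  exists N, forall k : nat, (N <= k)%N ->
    (Msum p q s phi (fun xi => b xi - conv b (kap k.+1%:R) xi)%R < e%:E)%E.
Proof.
move=> ib boo e0; rewrite (Msum_SS s wphi p1 q0 ib) in boo.
have [C C0 HC] := Tk_diff_le.
have [D D0 HD] := SS_sum_shift q0 s0 (nbh n).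
have [B B0 HB] := ker_bounded wphi.
have m1 (N : nat) : (1 : R) <= N.+1%:R by rewrite ler1n.
have m0 (N : nat) : (0 : R) < N.+1%:R by rewrite ltr0n.
pose u N l x := cabs (locFT phi b l x) * cabs (ker N.+1%:R x - 1).
have mL l := measurable_cabs (cmeas_locFT wphi l ib).
have mu_ N l : measurable_fun setT (u N l).
  apply: measurable_funM => //; apply: measurable_cabs; apply: cmeasB.
    exact: cmeas_invFT (cinteg_kap wphi (m0 N)).
  exact: cmeas_cst.
have u0 N l x : 0 <= u N l x by rewrite mulr_ge0 ?cabs_ge0.
(* The modulus of [ker - 1] is at most [B + 1], uniformly in [N] and [x]. *)
pose U l x := (B + 1) * cabs (locFT phi b l x).
have B1 : 0 <= B + 1 by rewrite addr_ge0.
have uU N l x : 0 <= u N l x <= U l x.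
  rewrite u0 /= /u /U mulrC ler_wpM2r ?cabs_ge0//.
  by apply: le_trans (cabsB _ _) _; rewrite cabs1 lerD2r HB.
have mU l : measurable_fun setT (U l) by exact: measurable_funM.
have UE l : nrm p (U l) = ((B + 1)%:E * Tk b l)%E.
  by rewrite /U (nrmZ p1 (mL l) (fun x => cabs_ge0 _) B1).
have Too l : (Tk b l < +oo)%E by exact: (SS_lty q0 l (Tk_ge0 p phi b) boo).
have Uoo l : (nrm p (U l) < +oo)%E by rewrite UE lte_mul_pinfty.
have uoo N l : (nrm p (u N l) < +oo)%E.
  by apply: le_lt_trans (Uoo l); apply: (nrm_le p1).
have [v Ev] : exists v : nat -> 'rV[int]_n -> R, forall N l, nrm p (u N l) = (v N l)%:E.
  by exists (fun N l => fine (nrm p (u N l))) => N l; rewrite fineK// ge0_fin_numE ?nrm_ge0.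
have [vU EU] : exists v : 'rV[int]_n -> R, forall l, nrm p (U l) = (v l)%:E.
  by exists (fun l => fine (nrm p (U l))) => l; rewrite fineK// ge0_fin_numE ?nrm_ge0.
have v0 N l : 0 <= v N l by rewrite -lee_fin -Ev nrm_ge0.
have vle N l : 0 <= v N l <= vU l.
  by rewrite v0 /= -lee_fin -Ev -EU; apply: (nrm_le p1).
have SSU : (SS q s (fun l => (vU l)%:E) < +oo)%E.
  have -> : (fun l => (vU l)%:E) = (fun l => ((B + 1)%:E * Tk b l)%E).
    by apply/funext => l; rewrite -EU UE.
  by rewrite (SSZ q s B1 (Tk_ge0 p phi b)) lte_mul_pinfty ?lee_fin ?powR_ge0.
have cv : SS q s (fun l => (v N l)%:E) @[N --> \oo] --> (0 : \bar R)%E.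
  apply: (SS_dct q0 vle SSU) => l.
  have -> : v ^~ l = (fun N => fine (nrm p (u N l))) by apply/funext => N; rewrite Ev.
  apply: (nrm_dct p1 (mu_ ^~ l) (mU l) (fun N x => uU N l x) (Uoo l)) => x.
  rewrite -(mulr0 (cabs (locFT phi b l x))); apply: cvgM; first exact: cvg_cst.
  exact: ker_cvg.
pose K := C `^ q * D; have K0 : 0 <= K by rewrite mulr_ge0 ?powR_ge0.
have e' : 0 < e / (K + 1) by rewrite divr_gt0// ltr_wpDl.
have [N HN] := cvge0_lt cv e'; exists N => k Nk.
have id : cinteg mu (fun xi => b xi - conv b (kap k.+1%:R) xi).
  exact: (cintegB ib (conv_cinteg ib (cinteg_kap wphi (m0 k)))).
rewrite (Msum_SS s wphi p1 q0 id).
have n0 l : (0 <= nrm p (u k l))%E by exact: nrm_ge0.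
apply: (@le_lt_trans _ _ (K%:E * SS q s (fun l => nrm p (u k l)))%E).
  have Q0 l : (0 <= \sum_(j <- nbh n) nrm p (u k (l - j)%R))%E.
    by apply: sume_ge0 => j _; exact: nrm_ge0.
  apply: (@le_trans _ _ (SS q s (fun l => C%:E * \sum_(j <- nbh n) nrm p (u k (l - j)%R)))%E).
    apply: (SS_le s q0 (Tk_ge0 p phi _)) => l.
    exact: HC (m1 k) ib.
  rewrite (SSZ q s C0 Q0) /K EFinM -muleA; apply: lee_wpmul2l; first by rewrite lee_fin powR_ge0.
  exact: HD.
have -> : (fun l => nrm p (u k l)) = (fun l => (v k l)%:E).
  by apply/funext => l; exact: Ev.
have F0 : (0 <= SS q s (fun l => (v k l)%:E))%E by exact: SS_ge0.
apply: (@le_lt_trans _ _ ((K + 1)%:E * SS q s (fun l => (v k l)%:E))%E).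
  by apply: lee_wpmul2r => //; rewrite lee_fin lerDl.
have -> : e = (K + 1) * (e / (K + 1)) by rewrite mulrC divfK// gt_eqF// ltr_wpDl.
by rewrite EFinM lte_pmul2l ?lte_fin ?ltr_wpDl// HN.
Qed.

End ApproxModulation.

(** * From the modulation norm to the Fourier-Lebesgue norm *)

Section KernelFL.
Variables (R : realType) (n : nat) (p q s : R) (phi : 'rV[R]_n -> R[i]).
Hypotheses (wphi : window phi) (p1 : 1 <= p) (q1 : 1 <= q) (s0 : 0 <= s).
Implicit Types (a b d h : 'rV[R]_n -> R[i]) (k : 'rV[int]_n) (m : R).
Local Notation mu := (leb R n).
Local Notation kap := (kap phi).
Local Notation ker := (ker phi).
Local Notation Tk := (Tk p phi).

Let q0 : 0 < q. Proof. exact: lt_le_trans q1. Qed.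

(* The sup bound that makes the Hausdorff-Young inequality unnecessary. *)
Lemma conv_kap_le m : 1 <= m -> exists2 C : R, 0 <= C & forall h xi, cinteg mu h ->
  ((cabs (conv h (kap m) xi))%:E <= C%:E * nrm p (fun x => cabs (invFT h x)))%E.
Proof.
move=> m1; have m0 : 0 < m by exact: lt_le_trans m1.
have ik := cinteg_kap wphi m0; have iK := cinteg_ker wphi m1.
have [c c0 Hc] := FT_ker wphi m0.
have [M M0 HM] := kap_bounded wphi m0.
have [D D0 HD] := ker_decay wphi m1.
have [E E0 HE] := decay_nrm n p1.
have ci0 : 0 <= cabs c^-1 := cabs_ge0 _.
exists (cabs c^-1 * (2 * (D * E))); first by rewrite !mulr_ge0.
move=> h xi ih; pose F y := kap m (xi - y).
have mF : cmeas F by exact: cmeas_subl ik.1.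
have iFh : cinteg mu (fun y => F y * h y) by exact: (cintegM_bounded mF ih (fun y => HM _)).
(* The reflected kernel modulated by the wave at [xi]: up to the constant [c], its transform is
   [F]. *)
pose G y := ker m (- y) * cexpi (dotp y xi).
have iKr : cinteg mu (fun y : 'rV[R]_n => ker m (- y)).
  by have := cinteg_refl 0 iK; under eq_fun do rewrite sub0r.
have iG : cinteg mu G.
  split.
    apply: cmeasM iKr.1 _; apply: cmeas_cexpi.
    exact: (measurable_dotp (f := id) (g := cst xi)).
  by under eq_integral do rewrite /G cabsM cabs_cexpi mulr1; exact: iKr.2.
have FG z : FT G z = c * F z.
  rewrite /F -Hc /FT; pose f y := ker m y * cexpi (- dotp y (xi - z)).
  have i_f : cinteg mu f.
    split; first by apply: cmeasM iK.1 _; exact: cmeas_wave.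
    by under eq_integral do rewrite /f cabsM cabs_cexpi mulr1; exact: iK.2.
  rewrite -/f -(CI_refl 0 i_f); apply: eq_CI => y.
  rewrite /f sub0r /G -mulrA -cexpiD; congr (_ * cexpi _).
  by rewrite dotpDr dotpNr -[dotp (- y) xi]dotpC -[dotp (- y) z]dotpC !dotpNr ![dotp _ y]dotpC; ring.
(* The convolution at [xi] is an inverse transform evaluated at the origin, so [invFT_mul] turns it
   into an integral of [invFT h] against a decaying kernel. *)
have E1 : conv h (kap m) xi = invFT (fun y => F y * h y) 0.
  rewrite invFTE// /conv; congr (_ * _).
  have iw := cinteg_wave 0 iFh.
  rewrite -(CI_refl xi iw); apply: eq_CI => y.
  have -> : dotp 0 (xi - y) = 0 by rewrite /dotp big1// => j _; rewrite mxE mul0r.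
  by rewrite cexpi0 mulr1 /F subKr mulrC.
rewrite E1 (invFT_mul 0 c0 iG ih iFh FG) cabsM.
rewrite EFinM [X in (_ <= X * _)%E]EFinM -muleA; apply: lee_wpmul2l => //.
have mh := cmeas_invFT ih.
have mhr : cmeas (fun y : 'rV[R]_n => invFT h (0 - y)) by exact: cmeas_subl.
apply: le_trans (CI_le _ (cmeasM iG.1 mhr)) _.
rewrite EFinM -muleA; apply: lee_wpmul2l => //.
pose f y := cabs (ker m y) * cabs (invFT h y).
have mf : measurable_fun setT f.
  by apply: measurable_funM; apply: measurable_cabs => //; exact: iK.1.
have -> : (\int[mu]_y (cabs (G y * invFT h (0 - y)))%:E = \int[mu]_y (EFin \o f) (0 - y)%R)%E.
  apply: eq_integral => y _; rewrite /f /= /G !cabsM cabs_cexpi mulr1 sub0r //.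
rewrite integral_refl; last 2 first.
- exact/measurable_EFinP.
- by move=> y; rewrite lee_fin mulr_ge0 ?cabs_ge0.
have mc := measurable_cabs mh.
have md := measurable_funM (@measurable_decay R n 2) mc.
apply: (@le_trans _ _ (\int[mu]_y (D * (decay 2 y * cabs (invFT h y)))%:E)%E).
  apply: ge0le => //; first exact: measurable_funM.
    by move=> y; rewrite mulr_ge0 ?cabs_ge0.
  by move=> y; rewrite mulrA ler_wpM2r ?cabs_ge0.
rewrite (ge0Z mu md) //; last by move=> y; rewrite mulr_ge0 ?decay_ge0 ?cabs_ge0.
rewrite EFinM -muleA; apply: lee_wpmul2l => //.
by apply: HE => // y; exact: cabs_ge0.
Qed.

(** On the cube of [xi] only neighbouring pieces of [d] contribute to the convolution, so it is
    dominated by a function of [flr xi]; its weighted integral is then a lattice sum, handled by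
    [SS_sum_shift]. *)
Lemma FLint_conv_kap m : 1 <= m -> exists2 C : R, 0 <= C & forall d, cinteg mu d ->
  (FLint q s (conv d (kap m)) <= C%:E * Msum p q s phi d)%E.
Proof.
move=> m1; have m0 : 0 < m by exact: lt_le_trans m1.
have ik := cinteg_kap wphi m0.
have [C C0 HC] := conv_kap_le m1.
have [D D0 HD] := SS_sum_shift q0 s0 (nbh n).
exists (boxw n 1 s `^ q * (C `^ q * D)); first by rewrite !mulr_ge0 ?powR_ge0.
move=> d id; rewrite (Msum_SS s wphi p1 q0 id).
pose Q k : \bar R := (\sum_(j <- nbh n) Tk d (k - j)%R)%E.
have Q0 k : (0 <= Q k)%E by apply: sume_ge0 => j _; exact: Tk_ge0.
have CQ0 k : (0 <= C%:E * Q k)%E by rewrite mule_ge0.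
have md := (conv_cinteg id ik).1.
have bd xi : ((cabs (conv d (kap m) xi))%:E <= C%:E * Q (flr xi))%E.
  have Hs : forall eta : 'rV[R]_n, kap m eta != 0 -> forall l, phi (xi - eta - intvec R l) != 0 ->
      flr xi - l \in nbh n.
    move=> eta /(kap_supp wphi m1) ke l pl; apply: (@nbh_int R) => j; rewrite !mxE.
    have /andP[h1 h2] := floor_itv (xi ord0 j); move: h2; rewrite intrD => h2.
    have /andP[h5 h6] := ke j.
    have /andP[] := phik_near wphi pl j; rewrite !mxE => h3 h4.
    by apply/andP; split; lra.
  rewrite (conv_kap_split wphi m1 id Hs).
  apply: (@le_trans _ _ (\sum_(j <- nbh n) (cabs (conv (piece phi d (flr xi - j)) (kap m) xi))%:E)%E).
    by rewrite sumEFin lee_fin cabs_sum.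
  rewrite /Q ge0_sume_distrr; last by move=> j _; exact: Tk_ge0.
  apply: lee_sum => j _; apply: HC; exact: cinteg_piece.
rewrite FLintE//.
apply: (@le_trans _ _ (\int[mu]_xi ((boxw n 1 s `^ q)%:E * ((wS q s (flr xi))%:E * (C%:E * Q (flr xi)) `^ q)))%E).
  apply: ege0le.
  - by apply/measurable_EFinP; exact: (measurable_wabsX s q md).
  - exact: (emeasurable_funM (measurable_cst _) (measurable_SS q s (fun k => C%:E * Q k)%E)).
  - by move=> x; rewrite lee_fin powR_ge0.
  - move=> x; rewrite muleA -EFinM /wabs powRM ?powR_ge0 ?cabs_ge0// [in leLHS]EFinM.
    apply: lee_pmul; rewrite ?lee_fin ?powR_ge0//.
      rewrite /wS powRrM -powRM ?powR_ge0 ?boxw_ge0//; apply: (le_powR (ltW q0)); first exact: powR_ge0.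
      apply: jbr_near => // j; rewrite !mxE.
      have /andP[h1 h2] := floor_itv (x ord0 j); move: h2; rewrite intrD => h2.
      by rewrite ger0_norm ?subr_ge0//; lra.
    rewrite -poweR_EFin; apply: (le_poweR (ltW q0)) (bd x).
    by rewrite lee_fin cabs_ge0.
rewrite (ege0Z mu (measurable_SS q s (fun k => C%:E * Q k)%E)); last 2 first.
- by move=> x; exact: (SS_term_ge0 q s (fun k => C%:E * Q k)%E).
- exact: powR_ge0.
rewrite -(SSE q s (fun k => C%:E * Q k)%E) (SSZ q s C0 Q0) [in leRHS]EFinM -muleA; apply: lee_wpmul2l.
  by rewrite lee_fin powR_ge0.
rewrite EFinM -muleA; apply: lee_wpmul2l; first by rewrite lee_fin powR_ge0.
exact: HD _ (Tk_ge0 p phi d).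
Qed.

Lemma Msum_kap m : 1 <= m -> (Msum p q s phi (kap m) < +oo)%E.
Proof.
move=> m1; have m0 : 0 < m by exact: lt_le_trans m1.
have ik := cinteg_kap wphi m0.
have [C C0 HC] := good_mul_nrm wphi p1 (window_good wphi).
have [D D0 HD] := SS_sum_shift q0 s0 (nbh n).
have n0 : (0 <= nrm p (fun x => cabs (ker m x)))%E by exact: nrm_ge0.
have [V EV] : exists V : R, nrm p (fun x => cabs (ker m x)) = V%:E.
  exists (fine (nrm p (fun x => cabs (ker m x)))).
  by rewrite fineK// ge0_fin_numE// nrm_ker_lty.
have V0 : 0 <= V by rewrite -lee_fin -EV.
(* A spike at the origin: its shifts over [nbh] add up to a sequence equal to [C V] on the finitely
   many indices whose window may meet the support of [kap m]. *)
pose F (k : 'rV[int]_n) : \bar R := if k == 0 then (C * V)%:E else 0%E.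
have F0 k : (0 <= F k)%E by rewrite /F; case: ifP => // _; rewrite lee_fin mulr_ge0.
rewrite (Msum_SS s wphi p1 q0 ik).
apply: (@le_lt_trans _ _ (SS q s (fun k => \sum_(j <- nbh n) F (k - j)%R))%E).
  apply: (SS_le s q0 (Tk_ge0 p phi (kap m))) => k.
  have [kn|kn] := boolP (k \in nbh n).
    rewrite (bigD1_seq k) ?uniq_nbh//= {1}/F subrr eqxx.
    apply: (@le_trans _ _ (C * V)%:E).
      by rewrite EFinM -EV; exact: HC.
    by rewrite leeDl//; apply: sume_ge0 => j _; exact: F0.
  have -> : Tk (kap m) k = 0%E.
    rewrite -[RHS](nrm0 n p1); congr nrm; apply/funext => x.
    rewrite /locFT; have -> : (fun xi => phi (xi - intvec R k) * kap m xi) = (fun=> 0).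
      apply/funext => xi; apply/eqP; rewrite mulf_eq0; apply: contraNT kn.
      rewrite negb_or => /andP[pk /(kap_supp wphi m1) kk].
      rewrite -[k]subr0; apply: (@nbh_int R) => j; rewrite !mxE.
      have /andP[h1 h2] := phik_near wphi pk j; have /andP[h3 h4] := kk j.
      by apply/andP; split; lra.
    by rewrite invFT0 cabs0.
  by apply: sume_ge0 => j _; exact: F0.
apply: (le_lt_trans (HD _ F0)); rewrite lte_mul_pinfty ?lee_fin//.
rewrite /SS (esumID [set 0])//; last by move=> k _; exact: SS_term_ge0.
rewrite setTI esum_set1; last exact: SS_term_ge0.
rewrite esum1 ?adde0; last first.
  move=> k [_ /= k0]; rewrite /F; case: eqP => [/k0//|_].
  by rewrite poweR0r ?gt_eqF// mule0.
by rewrite /F eqxx poweR_EFin -EFinM ltry.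
Qed.

End KernelFL.

(** * Products in the modulation space *)

Section FatouBound.
Variables (R : realType) (d : measure_display) (T : measurableType d).
Variable mu : {measure set T -> \bar R}.

Lemma cvg_powR (w : nat -> R) (l r : R) : 0 < r -> (forall k, 0 <= w k) -> 0 <= l ->
  w @ \oo --> l -> w k `^ r @[k --> \oo] --> l `^ r.
Proof.
move=> r0 w0; rewrite le_eqVlt => /predU1P[<-|l0] wl.
  by rewrite powR0 ?gt_eqF//; exact: cvg_powR0.
have dp : derivable (fun x : R => x `^ r) l 1 by have [] := is_derive1_powR r l0.
have cp : (fun x : R => x `^ r) x @[x --> l] --> l `^ r.
  have cc : {for l, continuous (fun x : R => x `^ r)}.
    by apply: differentiable_continuous; exact/derivable1_diffP.
  exact: cc.
exact: cvg_comp wl cp.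
Qed.

Lemma fatou_le (u_ : nat -> T -> R) (u : T -> R) (K : \bar R) :
  (forall k, measurable_fun setT (u_ k)) -> (forall k x, 0 <= u_ k x) ->
  (forall x, u_ ^~ x @ \oo --> u x) ->
  (forall k, (\int[mu]_x (u_ k x)%:E <= K)%E) -> (\int[mu]_x (u x)%:E <= K)%E.
Proof.
move=> mu_ u0 uu uK.
have mE k : measurable_fun setT (fun x => (u_ k x)%:E) by exact/measurable_EFinP.
have u0' k x : setT x -> (0 <= (u_ k x)%:E)%E by move=> _; rewrite lee_fin.
have F := fatou mu measurableT mE u0'.
have E : (\int[mu]_x (u x)%:E = \int[mu]_x limn_einf (fun k => (u_ k x)%:E))%E.
  apply: eq_integral => x _; apply/esym.
  have cx : (u_ k x)%:E @[k --> \oo] --> (u x)%:E by apply: cvg_EFin; [exact: nearW|exact: uu].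
  by have [] := cvg_limn_einf_sup cx.
rewrite E; apply: le_trans F _; rewrite limn_einf_lim.
apply: lime_le; first exact: is_cvg_einfs.
apply: nearW => k; apply: le_trans (uK k).
by apply: ereal_inf_lbound; exists k => /=.
Qed.

End FatouBound.

Section BoxOffsets.
Variable n : nat.

Definition boxN (N : nat) : seq 'rV[int]_n :=
  [seq \row_j ((f j : nat)%:Z - N%:Z) | f : {ffun 'I_n -> 'I_(N + N).+1}].

Lemma uniq_boxN N : uniq (boxN N).
Proof.
rewrite map_inj_uniq ?enum_uniq// => f g fg; apply/ffunP => j.
have := congr1 (fun k : 'rV[int]_n => k ord0 j) fg; rewrite !mxE => /addIr [].
exact: val_inj.
Qed.

Lemma mem_boxN N (k : 'rV[int]_n) : (forall j, `|k ord0 j| <= N%:Z) -> k \in boxN N.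
Proof.
move=> k4; apply/mapP.
exists [ffun j => inord (absz (k ord0 j + N%:Z))]; first by rewrite mem_enum.
apply/rowP => j; rewrite !mxE ffunE inordK; have := k4 j;
  by move: (k ord0 j) => z; lia.
Qed.

End BoxOffsets.

Section ModulationProduct.
Variables (R : realType) (n : nat) (p q s : R) (phi : 'rV[R]_n -> R[i]).
Hypotheses (wphi : window phi) (p1 : 1 <= p) (q1 : 1 <= q) (s0 : 0 <= s).
Implicit Types (a b d h w : 'rV[R]_n -> R[i]) (k l : 'rV[int]_n) (N : nat).
Local Notation mu := (leb R n).
Local Notation phik := (phik phi).
Local Notation Tk := (Tk p phi).
Local Notation piece := (piece phi).

Let q0 : 0 < q. Proof. exact: lt_le_trans q1. Qed.
Let p0 : 0 < p. Proof. exact: lt_le_trans p1. Qed.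

(** By inversion, localizing is a convolution of the inverse transform with a fixed function, hence
    depends on that inverse transform only. Equalities between localized convolutions may thus be
    checked after [invFT], where they concern pointwise products. *)
Lemma locFT_ext w w' k : cinteg mu w -> cinteg mu w' -> invFT w =1 invFT w' ->
  locFT phi w k =1 locFT phi w' k.
Proof.
move=> iw iw' ww' x; have [c c0 Hc] := inversion wphi; have gk := good_phik wphi k.
rewrite /locFT.
rewrite (invFT_mul x c0 (good_invFT gk) iw (cinteg_mul_good gk iw) (Hc _ gk)).
rewrite (invFT_mul x c0 (good_invFT gk) iw' (cinteg_mul_good gk iw') (Hc _ gk)).
by congr (_ * _); apply: eq_CI => y; rewrite ww'.
Qed.

Definition trunc N b xi : R[i] := \sum_(l <- boxN n N) piece b l xi.

Lemma cinteg_trunc N b : cinteg mu b -> cinteg mu (trunc N b).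
Proof. by move=> ib; apply: cinteg_sum => l; exact: cinteg_piece. Qed.

(** A window alive at [xi] has its index within 1 of [xi] in each coordinate, hence in the box once
    [N] is large compared with [xi]. *)
Lemma trunc_eq b xi : exists N0, forall N, (N0 <= N)%N -> trunc N b xi = b xi.
Proof.
pose S := \sum_(j < n) `|xi ord0 j|.
have S0 : 0 <= S by apply: sumr_ge0.
exists (Num.trunc (S + 1)).+1 => N NN.
have SN : S + 1 < N%:R.
  have := truncnS_gt (S + 1); move=> /lt_le_trans; apply; by rewrite ler_nat.
rewrite /trunc -mulr_suml; suff -> : \sum_(l <- boxN n N) phik l xi = 1 by rewrite mul1r.
have [_ _ _ /(_ xi) <-] := wphi.
rewrite -(fsbig_widen [set` boxN n N] setT)//; last first.
  move=> l [_ /= lN]; apply: contra_notP lN => /eqP pl; apply: mem_boxN => j.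
  have /andP[h1 h2] := phik_near wphi pl j.
  have xS : `|xi ord0 j| <= S by rewrite /S (bigD1 j)//= lerDl sumr_ge0.
  have h3 := ler_norm (xi ord0 j); have h4 := ler_norm (- xi ord0 j); rewrite normrN in h4.
  rewrite ler_norml -!(ler_int R) rmorphN /=; apply/andP; split; rewrite -?pmulrn; lra.
by rewrite -fsbig_seq// uniq_boxN.
Qed.

Lemma sum_count (r : seq 'rV[int]_n) (P : pred 'rV[int]_n) :
  \sum_(l <- r) ((P l)%:R : R) = (count P r)%:R.
Proof. by elim: r => [|l r IH]; rewrite ?big_nil// big_cons IH /= natrD. Qed.

(** At a given point at most [size nbh] windows are alive, so the truncations are dominated
    uniformly in [N]. *)
Lemma trunc_le : exists2 C : R, 0 <= C & forall N b xi, cabs (trunc N b xi) <= C * cabs (b xi).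
Proof.
have [M M0 HM] := good_bounded (window_good wphi).
exists (M * (size (nbh n))%:R); first by rewrite mulr_ge0.
move=> N b xi; rewrite /trunc -mulr_suml cabsM ler_wpM2r ?cabs_ge0//.
apply: le_trans (cabs_sum _ _) _.
apply: (@le_trans _ _ (\sum_(l <- boxN n N) M * ((flr xi - l \in nbh n)%:R))).
  apply: ler_sum => l _; have [pl|pl] := eqVneq (phik l xi) 0.
    by rewrite pl cabs0 mulr_ge0.
  by rewrite (phi_nbh wphi pl) mulr1; exact: HM.
rewrite -mulr_sumr ler_wpM2l// sum_count ler_nat -size_filter.
rewrite -(size_map (fun m => flr xi - m) (nbh n)); apply: uniq_leq_size.
  by rewrite filter_uniq// uniq_boxN.
move=> l; rewrite mem_filter => /andP[ln _]; apply/mapP; exists (flr xi - l) => //.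
by rewrite subKr.
Qed.

Lemma trunc_L1 b (e : R) : cinteg mu b -> 0 < e -> exists N0, forall N, (N0 <= N)%N ->
  (\int[mu]_xi (cabs (b xi - trunc N b xi))%:E < e%:E)%E.
Proof.
move=> ib e0; have [C C0 HC] := trunc_le.
have mb := measurable_cabs ib.1.
have D := @dct0 R _ _ mu (fun N xi => cabs (b xi - trunc N b xi))
  (fun xi => (1 + C) * cabs (b xi))
  (fun N => measurable_cabs (cintegB ib (cinteg_trunc N ib)).1)
  (measurable_funM (measurable_cst _) mb).
apply: (cvge0_lt (D _ _ _) e0).
- move=> N xi; rewrite cabs_ge0 /=; apply: le_trans (cabsB _ _) _.
  by rewrite mulrDl mul1r lerD2l.
- rewrite (ge0Z mu mb (fun x => cabs_ge0 _)) ?addr_ge0//.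
  by rewrite lte_mul_pinfty ?lee_fin ?addr_ge0//; exact: ib.2.
- move=> xi; have [N0 HN0] := trunc_eq b xi.
  apply/cvgrPdist_lt => r r0; near=> N; rewrite HN0 ?subrr ?cabs0 ?subr0 ?normr0//.
  by near: N; exact: nbhs_infty_ge.
Unshelve. all: by end_near. Qed.

Lemma locFT_conv_piece a b k l :
  locFT phi (conv a (piece b l)) k = locFT phi (conv (restr (k - l) a) (piece b l)) k.
Proof.
rewrite /locFT; congr invFT; apply/funext => xi.
have [->|pk] := eqVneq (phi (xi - intvec R k)) 0; first by rewrite !mul0r.
congr (_ * _); rewrite /conv; congr (_ * _); apply: eq_CI => eta.
have [e0|pl] := eqVneq (phik l eta) 0; first by rewrite /piece e0 mul0r !mulr0.
rewrite /restr nbh_flr ?mul1r// => j; rewrite !mxE.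
have /andP[h1 h2] := phik_near wphi pk j; have /andP[h3 h4] := phik_near wphi pl j.
by rewrite rmorphB /=; apply/andP; split; lra.
Qed.

(** A window at [k] and a piece at [l] see [a] only near [k - l]; the corresponding inverse
    transform is bounded by local L^1 norms, which produces the kernel of a discrete convolution. *)
Lemma nrm_conv_piece : exists2 C : R, 0 <= C & forall a b k l, cinteg mu a -> cinteg mu b ->
  (nrm p (fun x => cabs (locFT phi (conv a (piece b l)) k x)) <=
   C%:E * ((\sum_(j <- nbh n) cubeL1 a (k - l - j)%R) * Tk b l))%E.
Proof.
have [C C0 HC] := good_mul_nrm wphi p1 (window_good wphi).
have cn0 := ltW (cnorm_gt0 R n).
exists (C * (2 * cnorm R n)); first by rewrite !mulr_ge0.
move=> a b k l ia ib; have ir := cinteg_restr (k - l) ia; have ip := cinteg_piece wphi l ib.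
have irp := conv_cinteg ir ip.
rewrite locFT_conv_piece; apply: le_trans (HC k _ irp) _.
rewrite -(restr_absint (k - l) ia); have [W W0 HW] := cinteg_bound ir.
have -> : (\int[mu]_x (cabs (restr (k - l) a x))%:E = W%:E)%E by exact: HW.
rewrite [in leRHS]EFinM -muleA; apply: lee_wpmul2l => //.
have mL := measurable_cabs (cmeas_invFT ip).
rewrite muleA -EFinM; rewrite -[Tk b l]/(nrm p (fun x => cabs (invFT (piece b l) x))).
rewrite -(nrmZ p1 mL (fun x => cabs_ge0 _)); last by rewrite !mulr_ge0.
apply: (nrm_le p1).
- exact: measurable_cabs (cmeas_invFT irp).
- exact: measurable_funM.
- move=> x; rewrite cabs_ge0 /= invFT_conv// cabsM ler_wpM2r ?cabs_ge0//.
  by rewrite -lee_fin; apply: le_trans (invFT_le x ir) _; rewrite HW -EFinM.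
Qed.

(** At a given frequency a convolution distributes over the sum only where the integrals converge;
    the identity is therefore checked on inverse transforms, where it is distributivity of
    products. *)
Lemma locFT_conv_trunc a b k N x : cinteg mu a -> cinteg mu b ->
  locFT phi (conv a (trunc N b)) k x =
  \sum_(l <- boxN n N) locFT phi (conv a (piece b l)) k x.
Proof.
move=> ia ib; have it := cinteg_trunc N ib.
have ip l := conv_cinteg ia (cinteg_piece wphi l ib).
have is_ : cinteg mu (fun xi => \sum_(l <- boxN n N) conv a (piece b l) xi) by exact: cinteg_sum.
rewrite (locFT_ext k (conv_cinteg ia it) is_).
  rewrite /locFT -invFT_sum => [|l]; last exact: cinteg_loc.
  by congr (invFT _ x); apply/funext => xi; rewrite mulr_sumr.
move=> y; have Et : invFT (trunc N b) y = \sum_(l <- boxN n N) invFT (piece b l) y.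
  by apply: invFT_sum => l; exact: cinteg_piece.
rewrite (invFT_conv y ia it) Et [RHS]invFT_sum//.
rewrite mulr_sumr; apply: eq_bigr => l _; rewrite invFT_conv//; exact: cinteg_piece.
Qed.

(** The remainder of the truncation tends to 0 in L^1, hence the inverse transform of its
    convolution with [a] tends to 0 uniformly, and localization preserves this. *)
Lemma locFT_conv_cvg a b k x : cinteg mu a -> cinteg mu b ->
  cabs (locFT phi (conv a (trunc N b)) k x) @[N --> \oo] --> cabs (locFT phi (conv a b) k x).
Proof.
move=> ia ib; have [C C0 HC] := good_mul_le wphi (window_good wphi).
have [A A0 HA] := cinteg_bound ia; have cn0 := ltW (cnorm_gt0 R n).
have [c c0 Hc] : exists2 c : R, 0 <= c & (\int[mu]_x (decay 2 x)%:E = c%:E)%E.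
  by apply: decay_int; rewrite ltr1n.
have md := @measurable_decay R n 2; have d0 := @decay_ge0 R n 2.
(* The sup bound of [invFT a], the sup bound of the remainder per unit of L^1 norm, and the integral
   of the localization envelope. *)
pose K := 2 * cnorm R n * A * (2 * cnorm R n) * (C * c).
have K0 : 0 <= K by rewrite !mulr_ge0.
apply/cvgrPdist_lt => e e0.
have e1 : 0 < e / (K + 1) by rewrite divr_gt0// ltr_wpDl.
have [N0 HN] := trunc_L1 ib e1.
near=> N; have it := cinteg_trunc N ib; have idf := cintegB ib it.
have [D D0 HD] := cinteg_bound idf.
have De : D < e / (K + 1).
  by rewrite -lte_fin -HD; apply: HN; near: N; exact: nbhs_infty_ge.
have iab := conv_cinteg ia ib; have iat := conv_cinteg ia it; have iad := conv_cinteg ia idf.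
have E1 : locFT phi (conv a b) k x - locFT phi (conv a (trunc N b)) k x =
    locFT phi (conv a (fun xi => b xi - trunc N b xi)) k x.
  rewrite /locFT -(invFTB x (cinteg_loc wphi k iab) (cinteg_loc wphi k iat)).
  transitivity (locFT phi (fun xi => conv a b xi - conv a (trunc N b) xi) k x).
    by congr (invFT _ x); apply/funext => xi; rewrite mulrBr.
  apply: locFT_ext => [||y]; [exact: cintegB|by []|].
  by rewrite invFTB// !invFT_conv// invFTB// mulrBr.
have E2 : cabs (locFT phi (conv a (fun xi => b xi - trunc N b xi)) k x) <= K * D.
  rewrite -lee_fin; apply: le_trans (HC k _ x iad) _.
  pose B := (2 * cnorm R n * A) * (2 * cnorm R n * D).
  have B0 : 0 <= B by rewrite !mulr_ge0.
  apply: (@le_trans _ _ (\int[mu]_y ((B * C) * decay 2 y)%:E)%E); last first.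
    rewrite (ge0Z mu md d0) ?mulr_ge0// Hc -EFinM lee_fin /B /K.
    by rewrite le_eqVlt; apply/orP; left; apply/eqP; ring.
  have mi : cmeas (fun y : 'rV[R]_n => invFT (conv a (fun xi => b xi - trunc N b xi)) (x - y)).
    by apply: cmeas_subl; exact: cmeas_invFT.
  apply: ge0le.
  - by apply: measurable_funM; [exact: measurable_cabs|exact: measurable_funM].
  - exact: measurable_funM.
  - by move=> y; rewrite !mulr_ge0 ?cabs_ge0.
  - move=> y; rewrite mulrA ler_wpM2r// ler_wpM2r// invFT_conv// cabsM.
    apply: ler_pM; rewrite ?cabs_ge0//.
      by rewrite -lee_fin; apply: le_trans (invFT_le _ ia) _; rewrite HA -EFinM.
    by rewrite -lee_fin; apply: le_trans (invFT_le _ idf) _; rewrite HD -EFinM.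
have E3 (z1 z2 : R[i]) : `|cabs z1 - cabs z2| <= cabs (z1 - z2).
  have a1 := cabsD (z1 - z2) z2; have a2 := cabsD (z2 - z1) z1; rewrite !subrK in a1 a2.
  have a3 : cabs (z2 - z1) = cabs (z1 - z2) by rewrite -cabsN opprB.
  by rewrite ler_norml; apply/andP; split; lra.
apply: le_lt_trans (E3 _ _) _; rewrite E1; apply: le_lt_trans E2 _.
apply: (@le_lt_trans _ _ ((K + 1) * D)); first by rewrite ler_wpM2r// lerDl.
by rewrite mulrC -ltr_pdivlMr// ltr_wpDl.
Unshelve. all: by end_near. Qed.

End ModulationProduct.

Lemma flr_sub_nbh (R : realType) (n : nat) (x y : 'rV[R]_n) :
  flr (x - y) - (flr x - flr y) \in nbh n.
Proof.
have H (a b c : int) : a - (b - c) <= 4 -> -4 <= a - (b - c) -> `|a - (b - c)| <= 4 by lia.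
apply: mem_nbh => i; rewrite !mxE.
have /andP[h1 h2] := floor_itv (x ord0 i); have /andP[h3 h4] := floor_itv (y ord0 i).
have /andP[h5 h6] := floor_itv (x ord0 i - y ord0 i).
rewrite intrD in h2; rewrite intrD in h4; rewrite intrD in h6.
apply: H; rewrite -(ler_int R) !intrB; lra.
Qed.

(** * The modulation space as a module over the Fourier-Lebesgue algebra *)

Section ModulationModule.
Variables (R : realType) (n : nat) (p q s : R) (phi : 'rV[R]_n -> R[i]).
Hypotheses (wphi : window phi) (p1 : 1 <= p) (q1 : 1 <= q) (s0 : 0 <= s).
Implicit Types (a b d h w : 'rV[R]_n -> R[i]) (k l : 'rV[int]_n) (N : nat).
Local Notation mu := (leb R n).
Local Notation Tk := (Tk p phi).
Local Notation piece := (piece phi).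
Local Notation trunc := (trunc phi).

Let q0 : 0 < q. Proof. exact: lt_le_trans q1. Qed.
Let p0 : 0 < p. Proof. exact: lt_le_trans p1. Qed.

Lemma sum_le_esum (r : seq 'rV[int]_n) (F : 'rV[int]_n -> \bar R) : uniq r ->
  (forall l, 0 <= F l)%E -> (\sum_(l <- r) F l <= \esum_(l in [set: 'rV[int]_n]) F l)%E.
Proof.
move=> ur F0; apply: esum_ge; exists [set` r]; last by rewrite fsbig_seq.
by split => //; exact: finite_seq.
Qed.

Definition cubes a l : \bar R := (\sum_(j <- nbh n) cubeL1 a (l - j)%R)%E.

Definition dconv (A B : 'rV[int]_n -> \bar R) k : \bar R :=
  (\esum_(l in [set: 'rV[int]_n]) (A (k - l)%R * B l))%E.

(** Minkowski over the finitely many pieces of a truncation, then Fatou as the truncation is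
    removed. *)
Lemma Tk_conv_le : exists2 C : R, 0 <= C & forall a b k, cinteg mu a -> cinteg mu b ->
  (Tk (conv a b) k <= C%:E * dconv (cubes a) (Tk b) k)%E.
Proof.
have [C C0 HC] := nrm_conv_piece wphi p1.
exists C => // a b k ia ib.
have c0 l : (0 <= cubes a l)%E by apply: sume_ge0 => j _; exact: cubeL1_ge0.
have cT0 l : (0 <= cubes a (k - l)%R * Tk b l)%E by rewrite mule_ge0// Tk_ge0.
have D0 : (0 <= dconv (cubes a) (Tk b) k)%E by apply: esum_ge0 => l _; exact: cT0.
have iab := conv_cinteg ia ib.
pose u N x := cabs (locFT phi (conv a (trunc N b)) k x).
have it N := cinteg_trunc wphi N ib; have iat N := conv_cinteg ia (it N).
have ip l := conv_cinteg ia (cinteg_piece wphi l ib).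
have mL l := measurable_cabs (cmeas_locFT wphi k (ip l)).
have mu_ N : measurable_fun setT (u N).
  exact: measurable_cabs (cmeas_locFT wphi k (iat N)).
have u0 N x : 0 <= u N x by exact: cabs_ge0.
have nu N : (nrm p (u N) <= C%:E * dconv (cubes a) (Tk b) k)%E.
  have E x : u N x <= \sum_(l <- boxN n N) cabs (locFT phi (conv a (piece b l)) k x).
    rewrite /u (locFT_conv_trunc wphi k N x ia ib); exact: cabs_sum.
  apply: (@le_trans _ _ (nrm p (fun x => \sum_(l <- boxN n N) cabs (locFT phi (conv a (piece b l)) k x))%R)).
    apply: (nrm_le p1 (mu_ N)); first exact: measurable_sum.
    by move=> x; rewrite u0 E.
  apply: le_trans (nrm_sum p1 _ mL (fun l x => cabs_ge0 _)) _.
  apply: (@le_trans _ _ (C%:E * \sum_(l <- boxN n N) (cubes a (k - l)%R * Tk b l))%E).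
    rewrite ge0_sume_distrr; last by move=> l _; exact: cT0.
    by apply: lee_sum => l _; exact: HC.
  by apply: lee_wpmul2l => //; apply: sum_le_esum => //; exact: uniq_boxN.
have H : (\int[mu]_x (cabs (locFT phi (conv a b) k x) `^ p)%:E <= (C%:E * dconv (cubes a) (Tk b) k) `^ p)%E.
  apply: (fatou_le (u_ := fun N x => u N x `^ p)).
  - by move=> N; exact: measurable_powRp.
  - by move=> N x; exact: powR_ge0.
  - move=> x; apply: cvg_powR => //; first exact: cabs_ge0.
    exact: locFT_conv_cvg.
  - move=> N; rewrite -(nrm_poweR p1); apply: le_poweR (nu N); first exact: ltW.
    exact: nrm_ge0.
rewrite /Tk /nrm; set X := (C%:E * _)%E in H *.
have X0 : (0 <= X)%E by rewrite mule_ge0.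
apply: (@le_trans _ _ ((X `^ p) `^ p^-1)%E).
  by apply: le_poweR => //; [rewrite invr_ge0 ltW|exact: int_powR_ge0].
by rewrite -poweRrM mulfV ?gt_eqF// poweRe1.
Qed.

Definition cflr (F : 'rV[int]_n -> R) (x : 'rV[R]_n) : R[i] := (F (flr x))%:C%C.

Lemma wabs_flr (x : 'rV[R]_n) : (jbr x `^ s) `^ q <= boxw n 1 s `^ q * wS q s (flr x) :> R.
Proof.
rewrite /wS powRrM -powRM ?powR_ge0 ?boxw_ge0//; apply: (le_powR (ltW q0)); first exact: powR_ge0.
apply: jbr_near => // j; rewrite !mxE.
have /andP[h1 h2] := floor_itv (x ord0 j); move: h2; rewrite intrD => h2.
by rewrite ger0_norm ?subr_ge0//; lra.
Qed.

Lemma wS_le (x : 'rV[R]_n) : wS q s (flr x) <= boxw n 1 s `^ q * (jbr x `^ s) `^ q :> R.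
Proof.
rewrite /wS powRrM -powRM ?powR_ge0 ?boxw_ge0//; apply: (le_powR (ltW q0)); first exact: powR_ge0.
apply: jbr_near => // j; rewrite !mxE.
have /andP[h1 h2] := floor_itv (x ord0 j); move: h2; rewrite intrD => h2.
by rewrite distrC ger0_norm ?subr_ge0//; lra.
Qed.

Lemma FLint_cflr (F : 'rV[int]_n -> R) : (forall l, 0 <= F l) ->
  (FLint q s (cflr F) <= (boxw n 1 s `^ q)%:E * SS q s (fun l => (F l)%:E))%E.
Proof.
move=> F0; have mF : cmeas (cflr F) by exact: (cmeas_flr (fun l => (F l)%:C%C)).
rewrite FLintE// SSE.
rewrite -(ege0Z mu (measurable_SS q s (fun l => (F l)%:E))); last 2 first.
- by move=> x; exact: (SS_term_ge0 q s (fun l => (F l)%:E)).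
- exact: powR_ge0.
apply: ege0le.
- by apply/measurable_EFinP; exact: (measurable_wabsX s q mF).
- exact: (emeasurable_funM (measurable_cst _) (measurable_SS q s (fun l => (F l)%:E))).
- by move=> x; rewrite lee_fin powR_ge0.
- move=> x; rewrite poweR_EFin muleA -!EFinM lee_fin /wabs /cflr cabs_real ger0_norm//.
  by rewrite powRM ?powR_ge0// ler_wpM2r ?powR_ge0// wabs_flr.
Qed.

Lemma CI_real (f : 'rV[R]_n -> R) (V : R) : (forall x, 0 <= f x) ->
  (\int[mu]_x (f x)%:E = V%:E)%E -> CI mu (fun x => (f x)%:C%C) = V%:C%C.
Proof.
move=> f0 fV; apply: complex_eq => /=; last by rewrite /Rintegral integral0.
by rewrite /Rintegral fV.
Qed.

(** The discrete convolution is dominated by a convolution of functions constant on cubes, to which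
    the algebra property of the Fourier-Lebesgue space applies. *)
Lemma dconv_finite (A B : 'rV[int]_n -> R) : embeds_L1 n q s ->
  (forall l, 0 <= A l) -> (forall l, 0 <= B l) ->
  (SS q s (fun l => (A l)%:E) < +oo)%E -> (SS q s (fun l => (B l)%:E) < +oo)%E ->
  (SS q s (dconv (fun l => (A l)%:E) (fun l => (B l)%:E)) < +oo)%E.
Proof.
move=> emb A0 B0 Aoo Boo.
(* The index of the cube of [x - y] differs from the difference of the indices by an element of
   [nbh]; spreading [A] over [nbh] compensates for this. *)
pose A' l := \sum_(j <- nbh n) A (l - j).
have A'0 l : 0 <= A' l by apply: sumr_ge0.
have [D D0 HD] := SS_sum_shift q0 s0 (nbh n).
have A'oo : (SS q s (fun l => (A' l)%:E) < +oo)%E.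
  have -> : (fun l => (A' l)%:E) = (fun l => \sum_(j <- nbh n) (A (l - j)%R)%:E)%E.
    by apply/funext => l; rewrite sumEFin.
  have Ae0 l : (0 <= (A l)%:E)%E by rewrite lee_fin.
  apply: le_lt_trans (HD _ Ae0) _.
  by rewrite lte_mul_pinfty ?lee_fin.
have FA : (FLint q s (cflr A') < +oo)%E.
  by apply: le_lt_trans (FLint_cflr A'0) _; rewrite lte_mul_pinfty ?lee_fin ?powR_ge0.
have FB : (FLint q s (cflr B) < +oo)%E.
  by apply: le_lt_trans (FLint_cflr B0) _; rewrite lte_mul_pinfty ?lee_fin ?powR_ge0.
have mA : cmeas (cflr A') by exact: (cmeas_flr (fun l => (A' l)%:C%C)).
have mB : cmeas (cflr B) by exact: (cmeas_flr (fun l => (B l)%:C%C)).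
have iA := embeds_cinteg q1 emb mA FA.
have [V V0 HV] := cinteg_bound iA.
(* The weights are at least 1, so a finite weighted sum bounds every entry. *)
have [Z Z0 BZ] : exists2 Z : R, 0 <= Z & forall l, B l <= Z.
  pose W := fine (SS q s (fun l => (B l)%:E)).
  have WE : SS q s (fun l => (B l)%:E) = W%:E by rewrite fineK// ge0_fin_numE// SS_ge0.
  exists (W `^ q^-1); first exact: powR_ge0.
  move=> l; have := SS_term_le q s l (fun l => B0 l : (0 <= (B l)%:E)%E).
  rewrite WE poweR_EFin -EFinM lee_fin => h.
  have w1 : 1 <= wS q s l.
    by rewrite /wS -(powRr0 (jbr (intvec R l))) ler_powR ?jbr_ge1 ?mulr_ge0 ?(ltW q0).
  have h2 : B l `^ q <= W by apply: le_trans h; rewrite ler_peMl ?powR_ge0.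
  have -> : B l = (B l `^ q) `^ q^-1 by rewrite -powRrM mulfV ?gt_eqF// powRr1.
  by apply: le_powR; rewrite ?invr_ge0 ?(ltW q0) ?powR_ge0.
have cn0 := cnorm_gt0 R n.
have K := emb; have [E E0 HE] := K.
pose I (xi : 'rV[R]_n) := (\int[mu]_y (A' (flr (xi - y)) * B (flr y))%:E)%E.
have mI (xi : 'rV[R]_n) : measurable_fun setT (fun y : 'rV[R]_n => A' (flr (xi - y)) * B (flr y)).
  apply: measurable_funM; last exact: (measurable_flr B).
  apply: (measurableT_comp (measurable_flr A')); exact: measurable_rowB.
have I0 xi : (0 <= I xi)%E by apply: integral_real_ge0 => y; rewrite mulr_ge0.
(* Finiteness at every point is required because [conv] turns a divergent integral into 0, which
   would break the comparison with [I]. *)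
have Ifin xi : exists v : R, I xi = v%:E.
  exists (fine (I xi)); rewrite fineK// ge0_fin_numE//.
  apply: (@le_lt_trans _ _ (\int[mu]_y (Z * A' (flr (xi - y)))%:E)%E).
    apply: ege0le.
    - by apply/measurable_EFinP.
    - apply/measurable_EFinP; apply: measurable_funM => //.
      by apply: (measurableT_comp (measurable_flr A')); exact: measurable_rowB.
    - by move=> y; rewrite lee_fin mulr_ge0.
    - by move=> y; rewrite lee_fin mulrC ler_wpM2r.
  have mAx : measurable_fun setT (fun y : 'rV[R]_n => A' (flr (xi - y))).
    by apply: (measurableT_comp (measurable_flr A')); exact: measurable_rowB.
  rewrite (ge0Z mu mAx (fun y => A'0 _) Z0) lte_mul_pinfty//.
  have -> : (\int[mu]_y (A' (flr (xi - y)))%:E = \int[mu]_y (cabs (cflr A' (xi - y)%R))%:E)%E.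
    by apply: eq_integral => y _; rewrite /cflr cabs_real ger0_norm.
  have F0 x : (0 <= (cabs (cflr A' x))%:E)%E by rewrite lee_fin cabs_ge0.
  by rewrite (integral_refl xi (emeasurable_cabs mA) F0) HV ltry.
have convE xi : (cabs (conv (cflr A') (cflr B) xi))%:E = ((cnorm R n)%:E * I xi)%E.
  have [v Ev] := Ifin xi; have v0 : 0 <= v by rewrite -lee_fin -Ev.
  rewrite /conv cabsM cabs_real (gtr0_norm cn0) Ev -EFinM; congr (_ * _)%:E.
  have -> : CI mu (fun y => cflr A' (xi - y) * cflr B y) = v%:C%C.
    rewrite -(CI_real _ Ev) => [|y]; last exact: mulr_ge0.
    by apply: eq_CI => y; rewrite /cflr rmorphM.
  by rewrite cabs_real ger0_norm.
have dI xi : (dconv (fun l => (A l)%:E) (fun l => (B l)%:E) (flr xi) <= I xi)%E.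
  rewrite /dconv esum_flr; last by move=> l; rewrite -EFinM lee_fin mulr_ge0.
  apply: ege0le.
  - exact: (measurable_flr (fun l => ((A (flr xi - l)%R)%:E * (B l)%:E)%E)).
  - exact/measurable_EFinP.
  - by move=> y; rewrite -EFinM lee_fin mulr_ge0.
  - move=> y; rewrite -EFinM lee_fin ler_wpM2r//.
    pose j := flr (xi - y) - (flr xi - flr y).
    have jn : j \in nbh n by exact: flr_sub_nbh.
    rewrite /A' (bigD1_seq j) ?uniq_nbh//= /j subKr lerDl.
    exact: sumr_ge0.
have convoo : (FLint q s (conv (cflr A') (cflr B)) < +oo)%E.
  apply: le_lt_trans (FLint_conv q1 s0 E0 HE mA mB FA FB) _.
  rewrite lte_mul_pinfty ?lee_fin//; last first.
    have F0 := FLint_ge0 q s mA.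
    apply: lte_mul_pinfty; [exact: F0|by rewrite (ge0_fin_numE F0); exact: FA|exact: FB].
  by rewrite !mulr_ge0 ?powR_ge0.
have mc := cmeas_conv mA mB.
set G := dconv _ _ in dI *.
have G0 k : (0 <= G k)%E by apply: esum_ge0 => l _; rewrite -EFinM lee_fin mulr_ge0.
pose c := boxw n 1 s `^ q * ((cnorm R n)^-1) `^ q.
have c0 : 0 <= c by rewrite mulr_ge0 ?powR_ge0.
apply: (@le_lt_trans _ _ (c%:E * FLint q s (conv (cflr A') (cflr B)))%E); last first.
  by rewrite lte_mul_pinfty ?lee_fin.
rewrite SSE FLintE// -(ge0Z mu (measurable_wabsX s q mc) (fun x => powR_ge0 _ _) c0).
apply: ege0le.
- exact: measurable_SS.
- apply/measurable_EFinP; apply: measurable_funM => //; exact: (measurable_wabsX s q mc).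
- by move=> x; exact: SS_term_ge0.
- move=> x; have [v Ev] := Ifin x; have v0 : 0 <= v by rewrite -lee_fin -Ev.
  have cE : cabs (conv (cflr A') (cflr B) x) = cnorm R n * v.
    by apply: EFin_inj; rewrite convE Ev.
  apply: (@le_trans _ _ ((wS q s (flr x))%:E * (v `^ q)%:E)%E).
    apply: lee_wpmul2l; first by rewrite lee_fin wS_ge0.
    rewrite -poweR_EFin -Ev; apply: (le_poweR (ltW q0)) => //; exact: dI.
  rewrite -EFinM lee_fin /wabs cE !powRM ?powR_ge0 ?mulr_ge0 ?(ltW cn0)// /c.
  have H5 (a1 a2 a3 a4 a5 : R) : a1 * a2 * (a3 * (a4 * a5)) = (a1 * a3) * a5 * (a2 * a4) by ring.
  rewrite H5.
  rewrite -[X in _ <= _ * X]powRM ?invr_ge0 ?(ltW cn0)// mulVf ?gt_eqF// powR1 mulr1.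
  by rewrite ler_wpM2r ?powR_ge0// wS_le.
Qed.

(** The factor [a] enters through its local L^1 norms, whose weighted [l^q] sum is finite as soon as
    its Fourier-Lebesgue norm is; together with the local norms of [b] this reduces to a discrete
    convolution. *)
Lemma Msum_conv_lty a b : embeds_L1 n q s -> cinteg mu a -> cinteg mu b ->
  (FLint q s a < +oo)%E -> (Msum p q s phi b < +oo)%E ->
  (Msum p q s phi (conv a b) < +oo)%E.
Proof.
move=> emb ia ib aoo boo.
rewrite (Msum_SS s wphi p1 q0 ib) in boo.
rewrite (Msum_SS s wphi p1 q0 (conv_cinteg ia ib)).
have [C C0 HC] := Tk_conv_le.
have [D D0 HD] := SS_sum_shift q0 s0 (nbh n).
have [E E0 HE] := @SS_cubeL1 R n q s q1 s0.
have ca0 l : (0 <= cubes a l)%E by apply: sume_ge0 => j _; exact: cubeL1_ge0.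
have caoo : (SS q s (cubes a) < +oo)%E.
  apply: le_lt_trans (HD _ (cubeL1_ge0 a)) _; rewrite lte_mul_pinfty ?lee_fin// ?SS_ge0//.
  by apply: le_lt_trans (HE a ia.1) _; rewrite lte_mul_pinfty ?lee_fin.
have [A EA] : exists A : 'rV[int]_n -> R, cubes a = (fun l => (A l)%:E).
  exists (fun l => fine (cubes a l)); apply/funext => l.
  by rewrite fineK// ge0_fin_numE//; exact: (SS_lty q0 l ca0 caoo).
have [B EB] : exists B : 'rV[int]_n -> R, Tk b = (fun l => (B l)%:E).
  exists (fun l => fine (Tk b l)); apply/funext => l.
  by rewrite fineK// ge0_fin_numE ?Tk_ge0//; exact: (SS_lty q0 l (Tk_ge0 p phi b) boo).
have A0 l : 0 <= A l by rewrite -lee_fin -[(A l)%:E]/((fun l => (A l)%:E) l) -EA.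
have B0 l : 0 <= B l by rewrite -lee_fin -[(B l)%:E]/((fun l => (B l)%:E) l) -EB Tk_ge0.
have G0 k : (0 <= dconv (cubes a) (Tk b) k)%E.
  by apply: esum_ge0 => l _; rewrite mule_ge0// Tk_ge0.
apply: (@le_lt_trans _ _ (SS q s (fun k => C%:E * dconv (cubes a) (Tk b) k))%E).
  by apply: (SS_le s q0 (Tk_ge0 p phi _)) => k; exact: HC.
rewrite (SSZ q s C0 G0) lte_mul_pinfty ?lee_fin ?powR_ge0//.
by rewrite EA EB; apply: dconv_finite => //; [rewrite -EA|rewrite -EB].
Qed.

End ModulationModule.

(** * Approximation in the Fourier-Lebesgue norm *)

Lemma quasi_add_lty (R : realType) (c : R) (x y z : \bar R) : 0 <= c ->
  (z <= c%:E * (x + y))%E -> (x < +oo)%E -> (y < +oo)%E -> (z < +oo)%E.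
Proof.
move=> c0 zxy xoo yoo; apply: le_lt_trans zxy _.
by apply: lte_mul_pinfty; rewrite ?lee_fin// lte_add_pinfty.
Qed.

Section ApproxFourierLebesgue.
Variables (R : realType) (n : nat) (q s : R) (phi : 'rV[R]_n -> R[i]).
Hypotheses (wphi : window phi) (q1 : 1 <= q) (s0 : 0 <= s) (emb : embeds_L1 n q s).
Implicit Types (a b : 'rV[R]_n -> R[i]) (S : set 'rV[R]_n) (N : nat).
Local Notation mu := (leb R n).
Local Notation kap := (kap phi).

Let q0 : 0 < q. Proof. exact: lt_le_trans q1. Qed.

Lemma kap_supp_small m (xi : 'rV[R]_n) : 0 < m -> kap m xi != 0 -> forall j, 0 <= xi ord0 j <= 2 / m.
Proof.
move=> m0 k0 j.
have h : `|m * xi ord0 j - 1| <= 1.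
  rewrite leNgt; apply/negP => h; move/eqP: k0; apply; rewrite /kap (window_supp wphi) ?mulr0//.
  by exists j; rewrite !mxE.
have /andP[h1 h2] : -1 <= m * xi ord0 j - 1 <= 1 by rewrite -ler_norml.
rewrite -(pmulr_rge0 _ m0) ler_pdivlMr//; apply/andP; split; first by lra.
by rewrite mulrC; lra.
Qed.

Lemma cinteg_conv_kap m a xi : 0 < m -> cinteg mu a ->
  cinteg mu (fun eta => a (xi - eta) * kap m eta).
Proof.
move=> m0 ia; have [M M0 HM] := kap_bounded wphi m0; have ik := cinteg_kap wphi m0.
under eq_fun do rewrite mulrC.
by apply: (cintegM_bounded ik.1 _ HM); exact: cinteg_refl.
Qed.

Lemma conv_kapD m a b xi : 0 < m -> cinteg mu a -> cinteg mu b ->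
  conv (fun x => a x + b x) (kap m) xi = conv a (kap m) xi + conv b (kap m) xi.
Proof.
move=> m0 ia ib; rewrite /conv -mulrDr -CID; [|exact: cinteg_conv_kap..].
by congr (_ * _); apply: eq_CI => eta; rewrite mulrDl.
Qed.

Lemma conv_kapZ m (c : R[i]) a xi : 0 < m -> cinteg mu a ->
  conv (fun x => c * a x) (kap m) xi = c * conv a (kap m) xi.
Proof.
move=> m0 ia; rewrite /conv mulrCA -(CIZ c (cinteg_conv_kap xi m0 ia)).
by congr (_ * _); apply: eq_CI => eta; rewrite mulrA.
Qed.

Let sm0 N : (0 : R) < N.+1%:R. Proof. by rewrite ltr0n. Qed.
Let sm1 N : (1 : R) <= N.+1%:R. Proof. by rewrite ler1n. Qed.

Definition apdiff a N xi : R[i] := a xi - conv a (kap N.+1%:R) xi.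

Lemma cinteg_apdiff a N : cinteg mu a -> cinteg mu (apdiff a N).
Proof. by move=> ia; exact: (cintegB ia (conv_cinteg ia (cinteg_kap wphi (sm0 N)))). Qed.

(** The bound is uniform in [N]: the kernels share their L^1 norm and are supported in [[0, 2]^n],
    where the weight is at most [B]. *)
Lemma FLint_conv_kap_le : exists2 C : R, 0 <= C & forall N a, cmeas a ->
  (FLint q s (conv a (kap N.+1%:R)) <= C%:E * FLint q s a)%E.
Proof.
have ip := good_cinteg (window_good wphi).
have [W W0 HW] := cinteg_bound ip; have cn0 := ltW (cnorm_gt0 R n).
pose B := Num.sqrt (1 + n%:R * 2 ^+ 2) `^ s.
have B0 : 0 <= B by exact: powR_ge0.
pose V := B * ((cnorm R n)^-1 * W).
have V0 : 0 <= V by rewrite !mulr_ge0 ?invr_ge0.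
exists ((2 * cnorm R n * 2 `^ s * V) `^ q); first exact: powR_ge0.
move=> N a ma; have ik := cinteg_kap wphi (sm0 N).
apply: FLint_conv_weight => //; first exact: ik.1.
have mk := measurable_cabs ik.1.
rewrite /V EFinM EFinM -HW -(kap_absint wphi (sm0 N)) -(ge0Z mu mk (fun x => cabs_ge0 _) B0).
apply: ge0le.
- exact: measurable_wabs ik.1.
- exact: measurable_funM.
- exact: wabs_ge0.
- move=> x; rewrite /wabs; have [->|kx] := eqVneq (kap N.+1%:R x) 0; first by rewrite cabs0 !mulr0.
  rewrite ler_wpM2r ?cabs_ge0//; apply: jbr_box => // j.
  by have /andP[h1 h2] := kap_supp wphi (sm1 N) kx j; rewrite ger0_norm.
Qed.

(** The transforms along which the approximate unit converges. This class is shown to be linear and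
    closed, and then to contain enough indicators to be everything. *)
Definition apx a := [/\ cinteg mu a, (FLint q s a < +oo)%E & forall e : R, 0 < e ->
  exists N0, forall N, (N0 <= N)%N -> (FLint q s (apdiff a N) < e%:E)%E].

Lemma apxD a b : apx a -> apx b -> apx (fun x => a x + b x).
Proof.
move=> [ia aoo Ha] [ib boo Hb]; have c0 : 0 < 2 `^ q :> R by rewrite powR_gt0.
split; first exact: cintegD.
  exact: quasi_add_lty (ltW c0) (FLintD s (ltW q0) ia.1 ib.1) aoo boo.
move=> e e0; have e1 : 0 < e / (2 `^ q) / 2 by rewrite !divr_gt0.
have [N1 H1] := Ha _ e1; have [N2 H2] := Hb _ e1.
exists (maxn N1 N2) => N; rewrite geq_max => /andP[n1 n2].
have -> : apdiff (fun x => a x + b x) N = (fun x => apdiff a N x + apdiff b N x).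
  by apply/funext => x; rewrite /apdiff conv_kapD// opprD addrACA.
apply: le_lt_trans (FLintD s (ltW q0) (cinteg_apdiff N ia).1 (cinteg_apdiff N ib).1) _.
have -> : e = 2 `^ q * (e / (2 `^ q) / 2 + e / (2 `^ q) / 2).
  by rewrite -splitr mulrC divfK// gt_eqF.
by rewrite EFinM lte_pmul2l ?lte_fin// EFinD; apply: lteD; [exact: H1|exact: H2].
Qed.

Lemma apxZ (c : R[i]) a : apx a -> apx (fun x => c * a x).
Proof.
move=> [ia aoo Ha]; have c0 : 0 <= cabs c `^ q by exact: powR_ge0.
split; first exact: cintegZ.
  by apply: le_lt_trans (FLintZ s c (ltW q0) ia.1) _; rewrite lte_mul_pinfty ?lee_fin ?FLint_ge0// ia.1.
move=> e e0; have e1 : 0 < e / (cabs c `^ q + 1) by rewrite divr_gt0// ltr_wpDl.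
have [N1 H1] := Ha _ e1; exists N1 => N n1; have id := (cinteg_apdiff N ia).1.
have -> : apdiff (fun x => c * a x) N = (fun x => c * apdiff a N x).
  by apply/funext => x; rewrite /apdiff conv_kapZ// mulrBr.
apply: le_lt_trans (FLintZ s c (ltW q0) id) _.
apply: (@le_lt_trans _ _ ((cabs c `^ q + 1)%:E * FLint q s (apdiff a N))%E).
  by apply: lee_wpmul2r; rewrite ?FLint_ge0 ?lee_fin ?lerDl.
have -> : e = (cabs c `^ q + 1) * (e / (cabs c `^ q + 1)).
  by rewrite mulrC divfK// gt_eqF// ltr_wpDl.
by rewrite EFinM lte_pmul2l ?lte_fin ?ltr_wpDl// H1.
Qed.

Lemma apxB a b : apx a -> apx b -> apx (fun x => a x - b x).
Proof.
move=> Ga Gb; have -> : (fun x => a x - b x) = (fun x => a x + -1 * b x).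
  by apply/funext => x; rewrite mulN1r.
exact: (apxD Ga (apxZ (-1) Gb)).
Qed.

Lemma apx_sum (I : Type) (r : seq I) (f : I -> 'rV[R]_n -> R[i]) :
  (forall i, apx (f i)) -> apx (fun x => \sum_(i <- r) f i x).
Proof.
move=> Hf; elim: r => [|i r IH].
  have -> : (fun x => \sum_(i <- [::]) f i x) = (fun=> 0) by apply/funext => x; rewrite big_nil.
  split; first exact: cinteg0.
    by rewrite FLint0// ltry.
  move=> e e0; exists 0%N => N _.
  have -> : apdiff (fun=> 0) N = (fun=> 0).
    apply/funext => x; rewrite /apdiff /conv sub0r.
    by under eq_CI do rewrite mul0r; rewrite CI0 mulr0 oppr0.
  by rewrite FLint0// lte_fin.
have -> : (fun x => \sum_(j <- i :: r) f j x) = (fun x => f i x + \sum_(j <- r) f j x).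
  by apply/funext => x; rewrite big_cons.
exact: (apxD (Hf i) IH).
Qed.

(** The usual argument with three errors, using that convolution with the kernels is bounded
    uniformly in [N]. *)
Lemma apx_lim a : cinteg mu a -> (FLint q s a < +oo)%E ->
  (forall e : R, 0 < e -> exists2 b, apx b & (FLint q s (fun x => a x - b x)%R < e%:E)%E) -> apx a.
Proof.
move=> ia aoo H; split => // e e0; have [C C0 HC] := FLint_conv_kap_le.
have c0 : 0 < 2 `^ q :> R by rewrite powR_gt0.
(* [K] collects two nested quasi-triangle inequalities: two errors of size [e / K], and a third one
   multiplied by [C]. *)
pose K := 2 `^ q * (2 `^ q * (2 + C)).
have K0 : 0 < K by rewrite !mulr_gt0// ltr_wpDr.
have e1 : 0 < e / K by rewrite divr_gt0.
have [b [ib boo Hb] ab] := H _ e1; have [N0 HN] := Hb _ e1.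
exists N0 => N /HN bN; have iab := cintegB ia ib; have idb := cinteg_apdiff N ib.
have ikab := conv_cinteg iab (cinteg_kap wphi (sm0 N)).
have -> : apdiff a N = (fun x => ((a x - b x) + apdiff b N x) - conv (fun x => a x - b x) (kap N.+1%:R) x).
  apply/funext => x; rewrite /apdiff.
  have -> : conv (fun x => a x - b x) (kap N.+1%:R) x = conv a (kap N.+1%:R) x - conv b (kap N.+1%:R) x.
    have -> : (fun x => a x - b x) = (fun x => a x + -1 * b x).
      by apply/funext => y; rewrite mulN1r.
    by rewrite (conv_kapD x (sm0 N) ia (cintegZ (-1) ib)) (conv_kapZ (-1) x (sm0 N) ib) mulN1r.
  by rewrite addrA subrK opprB addrA subrK.
apply: le_lt_trans (FLintB s (ltW q0) (cintegD iab idb).1 ikab.1) _.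
have -> : e = 2 `^ q * (2 `^ q * ((e / K) + (e / K)) + 2 `^ q * (C * (e / K))).
  have H5 (x y z : R) : x * (x * (z + z) + x * (y * z)) = (x * (x * (2 + y))) * z by ring.
  by rewrite H5 -/K mulrC divfK// gt_eqF.
rewrite EFinM lte_pmul2l ?lte_fin// EFinD; apply: lte_leD.
- have F0 := FLint_ge0 q s ikab.1; have F1 := FLint_ge0 q s iab.1.
  rewrite ge0_fin_numE; last exact: F0.
  apply: le_lt_trans (HC N _ iab.1) _; apply: lte_mul_pinfty; [by rewrite lee_fin|by []|].
  exact: lt_trans ab (ltry _).
- apply: le_lt_trans (FLintD s (ltW q0) iab.1 idb.1) _.
  by rewrite EFinM lte_pmul2l ?lte_fin// EFinD; apply: lteD; [exact: ab|exact: bN].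
- apply: le_trans (HC N _ iab.1) _.
  have c1 : 1 <= 2 `^ q :> R by have := @ler_powR R 2 (ler1n _ 2) 0 q (ltW q0); rewrite powRr0.
  apply: (@le_trans _ _ (C * (e / K))%:E).
    by rewrite EFinM; apply: lee_wpmul2l; [rewrite lee_fin|exact: ltW ab].
  by rewrite lee_fin ler_peMl// mulr_ge0// ltW.
Qed.

End ApproxFourierLebesgue.

(** Only the level equal to [z] survives. Levels are indexed by ordinals, hence the shift by [L];
    the identity writes a rounded function as a combination of indicators of its level sets. *)
Lemma sum_floor (R : realType) (z : int) (L : nat) : `|z| <= L%:Z -> \sum_(i < (L + L).+1)
  ((i : nat)%:R - L%:R) * ((z == (i : nat)%:Z - L%:Z)%:R) = z%:~R :> R.
Proof.
move=> zL; have iL : (absz (z + L%:Z)%R < (L + L).+1)%N by lia.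
have iE : (Ordinal iL : nat)%:Z - L%:Z = z by rewrite /=; lia.
rewrite (bigD1 (Ordinal iL))//= big1 ?addr0.
  have -> : (z == (absz (z + L%:Z)%R)%:Z - L%:Z) by apply/eqP; exact/esym.
  by rewrite mulr1 -[in RHS]iE rmorphB.
move=> i ik; case: eqP => [zE|_]; last by rewrite mulr0.
exfalso; move/eqP: ik; apply; apply: val_inj => /=; move: zE; move: (i : nat) => i'; lia.
Qed.

(** * From half-open boxes to all elements of the space *)

Section Density.
Variables (R : realType) (n : nat) (q s : R) (phi : 'rV[R]_n -> R[i]).
Hypotheses (wphi : window phi) (q1 : 1 <= q) (s0 : 0 <= s) (emb : embeds_L1 n q s).
Implicit Types (a b : 'rV[R]_n -> R[i]) (S : set 'rV[R]_n) (N : nat).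
Local Notation mu := (leb R n).
Local Notation kap := (kap phi).
Local Notation apx := (apx q s phi).
Local Notation apdiff := (apdiff phi).

Let q0 : 0 < q. Proof. exact: lt_le_trans q1. Qed.
Let sm0 N : (0 : R) < N.+1%:R. Proof. by rewrite ltr0n. Qed.
Let sm1 N : (1 : R) <= N.+1%:R. Proof. by rewrite ler1n. Qed.

(* For such [a], bounded of compact support, [conv a (kap N)] is eventually equal to
   [a] at every point, and the indicators of half-open boxes are of this kind. *)
Definition leftcts (T : Type) (f : 'rV[R]_n -> T) := forall xi : 'rV[R]_n,
  exists2 d : R, 0 < d & forall y : 'rV[R]_n,
    (forall j, 0 <= xi ord0 j - y ord0 j < d) -> f y = f xi.

(** A single integrable majorant for all functions with a given bound and support, as dominated
    convergence asks of a sequence. *)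
Lemma wabsX_supp (r M : R) : 0 <= r -> 0 <= M -> exists2 K : R, 0 <= K & forall a,
  (forall x, cabs (a x) <= M) -> suppin r a -> forall x, wabs s a x `^ q <= K * decay 2 x.
Proof.
move=> r0 M0; pose B := Num.sqrt (1 + n%:R * r ^+ 2) `^ s.
have B0 : 0 <= B by exact: powR_ge0.
exists ((B * M) `^ q * ((1 + r) ^+ 2) ^+ n).
  by rewrite mulr_ge0 ?powR_ge0// !exprn_ge0// addr_ge0.
move=> a aM sa x.
pose F y := (wabs s a y `^ q)%:C%C : R[i].
have w0 y : 0 <= wabs s a y `^ q by exact: powR_ge0.
have cF y : cabs (F y) = wabs s a y `^ q by rewrite /F cabs_real ger0_norm.
have sz (y : 'rV[R]_n) : (exists j, r < `|y ord0 j|) -> wabs s a y `^ q = 0.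
  by move=> h; rewrite /wabs (sa _ h) cabs0 mulr0 powR0 ?gt_eqF.
rewrite -cF; apply: (@supp_decay R n F r) => //.
- exact: powR_ge0.
- by move=> y h; rewrite /F sz.
- move=> y; rewrite cF; have [h|h] := pselect (exists j, r < `|y ord0 j|).
    by rewrite sz// powR_ge0.
  apply: (le_powR (ltW q0)); first exact: wabs_ge0.
  apply: ler_pM; rewrite ?powR_ge0 ?cabs_ge0//; apply: jbr_box => // j.
  by rewrite leNgt; apply/negP => h1; apply: h; exists j.
Qed.

Lemma decay_lty (K : R) : 0 <= K -> (\int[mu]_x (K * decay 2 x)%:E < +oo)%E.
Proof.
move=> K0; have [c c0 Hc] : exists2 c : R, 0 <= c & (\int[mu]_x (decay 2 x)%:E = c%:E)%E.
  by apply: decay_int; rewrite ltr1n.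
by rewrite (ge0Z mu (@measurable_decay R n 2) (@decay_ge0 R n 2) K0) Hc -EFinM ltry.
Qed.

Lemma bounded_supp_FL a (r M : R) : 0 <= r -> 0 <= M -> cmeas a ->
  (forall x, cabs (a x) <= M) -> suppin r a -> cinteg mu a /\ (FLint q s a < +oo)%E.
Proof.
move=> r0 M0 ma aM sa; split.
  have K0 : 0 <= M * ((1 + r) ^+ 2) ^+ n by rewrite mulr_ge0// !exprn_ge0// addr_ge0.
  by apply: (decay_cinteg _ K0 ma (supp_decay r0 M0 sa aM)); rewrite ltr1n.
have [K K0 HK] := wabsX_supp r0 M0.
rewrite FLintE//; apply: le_lt_trans (decay_lty K0).
apply: ge0le.
- exact: measurable_wabsX.
- by apply: measurable_funM => //; exact: measurable_decay.
- by move=> x; exact: powR_ge0.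
- exact: HK.
Qed.

Lemma conv_kap1 N a xi : cinteg mu a -> (forall eta, kap N.+1%:R eta != 0 -> a (xi - eta) = a xi) ->
  conv a (kap N.+1%:R) xi = a xi.
Proof.
move=> ia H; have ik := cinteg_kap wphi (sm0 N).
rewrite /conv; have -> : CI mu (fun y => a (xi - y) * kap N.+1%:R y) = CI mu (fun y => a xi * kap N.+1%:R y).
  by apply: eq_CI => y; have [->|/H ->//] := eqVneq (kap N.+1%:R y) 0; rewrite !mulr0.
rewrite (CIZ _ ik) mulrCA.
have E : CI mu (kap N.+1%:R) = CI mu (fun y => kap N.+1%:R y * 1).
  by apply: eq_CI => y; rewrite mulr1.
have i1 : cinteg mu (fun y => kap N.+1%:R y * 1).
  by under eq_fun do rewrite mulr1; exact: ik.
rewrite E (CI_kap (sm0 N) i1).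
have -> : CI mu (fun t => phi t * 1) = 1.
  by rewrite -[RHS](CI_window wphi); apply: eq_CI => t; rewrite mulr1.
by rewrite mulr1.
Qed.

Lemma apdiff_bounded (M : R) : 0 <= M -> exists2 M' : R, 0 <= M' & forall a N,
  cmeas a -> (forall x, cabs (a x) <= M) -> forall x, cabs (apdiff a N x) <= M'.
Proof.
move=> M0; have ip := good_cinteg (window_good wphi); have [W W0 HW] := cinteg_bound ip.
have cn0 := ltW (cnorm_gt0 R n).
exists (M + 2 * cnorm R n * (M * ((cnorm R n)^-1 * W))).
  by rewrite addr_ge0// !mulr_ge0// invr_ge0.
move=> a N ma aM x; apply: le_trans (cabsB _ _) _; apply: lerD; first exact: aM.
have ik := cinteg_kap wphi (sm0 N); have mk := measurable_cabs ik.1.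
rewrite -lee_fin; apply: le_trans (conv_le x ma ik.1) _.
rewrite [in leRHS]EFinM; apply: lee_wpmul2l; first by rewrite lee_fin mulr_ge0.
rewrite EFinM EFinM -HW -(kap_absint wphi (sm0 N)) -(ge0Z mu mk (fun x => cabs_ge0 _) M0).
apply: ge0le.
- apply: measurable_funM => //; apply: measurable_cabs; exact: cmeas_subl.
- exact: measurable_funM.
- by move=> y; rewrite mulr_ge0 ?cabs_ge0.
- by move=> y; rewrite ler_wpM2r ?cabs_ge0.
Qed.

Lemma suppin_apdiff a N (r : R) : suppin r a -> suppin (r + 2) (apdiff a N).
Proof.
move=> sa x [j xj]; have ax y : kap N.+1%:R y != 0 -> a (x - y) = 0.
  move=> ky; apply: sa; exists j; rewrite !mxE.
  have /andP[h1 h2] := kap_supp wphi (sm1 N) ky j.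
  have := ler_normB (x ord0 j - y ord0 j) (- y ord0 j); rewrite opprK subrK normrN.
  by rewrite (ger0_norm h1); lra.
rewrite /apdiff sa ?sub0r; last by exists j; lra.
rewrite /conv; have -> : CI mu (fun y => a (x - y) * kap N.+1%:R y) = CI mu (fun=> 0).
  by apply: eq_CI => y; have [->|/ax ->] := eqVneq (kap N.+1%:R y) 0; rewrite ?mulr0 ?mul0r.
by rewrite CI0 mulr0 oppr0.
Qed.

(** The error vanishes at each point for large [N], while its size and support are controlled
    uniformly in [N], so dominated convergence applies. *)
Lemma apx_leftcts a (r M : R) : 0 <= r -> 0 <= M -> cmeas a ->
  (forall x, cabs (a x) <= M) -> suppin r a -> leftcts a -> apx a.
Proof.
move=> r0 M0 ma aM sa la; have [ia aoo] := bounded_supp_FL r0 M0 ma aM sa.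
split => // e e0; have [M' M'0 HM'] := apdiff_bounded M0.
have r2 : 0 <= r + 2 by rewrite addr_ge0.
have [K K0 HK] := wabsX_supp r2 M'0.
have md N := (cinteg_apdiff wphi N ia).1.
have mW N := measurable_wabsX s q (md N).
have mK : measurable_fun setT (fun x : 'rV[R]_n => K * decay 2 x).
  by apply: measurable_funM => //; exact: measurable_decay.
have bd N x : 0 <= wabs s (apdiff a N) x `^ q <= K * decay 2 x.
  rewrite powR_ge0 /=; apply: HK; last exact: suppin_apdiff.
  exact: HM' ma aM.
have cv x : wabs s (apdiff a N) x `^ q @[N --> \oo] --> (0 : R).
  have [d d0 Hd] := la x.
  (* The kernel lives in [[0, 2 / (N + 1)]^n], so [1 / (N + 1) < d / 2] keeps [x - y] within the
     left neighbourhood where [a] is constant. *)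
  have d2 : 0 < d / 2 by rewrite divr_gt0.
  apply/cvgrPdist_lt => e' e'0; near=> N.
  have nd : N.+1%:R^-1 < d / 2 :> R.
    by near: N; exact: near_infty_natSinv_lt (PosNum d2).
  have z0 : apdiff a N x = 0; last first.
    by rewrite /wabs z0 cabs0 mulr0 powR0 ?gt_eqF// subr0 normr0.
  rewrite /apdiff conv_kap1 ?subrr//.
  move=> y /(kap_supp_small wphi (sm0 N)) ky; apply: Hd => j; rewrite !mxE opprB addrC subrK.
  have /andP[-> h2] := ky j => /=; apply: le_lt_trans h2 _.
  by rewrite mulrC -ltr_pdivlMr.
have D := dct0 mW mK bd (decay_lty K0) cv.
have [N0 HN] := cvge0_lt D e0; exists N0 => N n0.
by rewrite FLintE//; exact: HN.
Unshelve. all: by end_near. Qed.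

Definition ind S (x : 'rV[R]_n) : R[i] := (\1_S x)%:C%C.

Definition hbox (r : R) : set 'rV[R]_n := [set x | forall j, - r < x ord0 j <= r].

Lemma leftcts_hbox (r : R) : leftcts (fun x => hbox r x).
Proof.
move=> x; have [hx|hx] := pselect (hbox r x).
  pose dj j := x ord0 j + r.
  exists (\big[Num.min/1]_j dj j).
    elim/big_ind : _ => [|u v u0 v0|j _]; [exact: ltr01|by rewrite lt_min u0|].
    by have /andP[h _] := hx j; rewrite /dj; lra.
  move=> y yx; apply/propext; split => // _ j; have /andP[h1 h2] := yx j.
  have h3 : \big[Num.min/1]_j dj j <= dj j by exact: bigmin_le_cond.
  by have /andP[h4 h5] := hx j; rewrite /dj in h3; apply/andP; split; lra.
have [j xj] : exists j, ~ (- r < x ord0 j <= r).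
  by apply: contrapT => h; apply: hx => j; apply: contrapT => hj; apply: h; exists j.
have [h|h] := leP (x ord0 j) (- r).
  exists 1 => // y yx; apply/propext; split => // hy.
  have /andP[h1 h2] := yx j; have /andP[h3 h4] := hy j; lra.
have xr : r < x ord0 j by rewrite ltNge; apply/negP => xr; apply: xj; rewrite h.
exists (x ord0 j - r); first by rewrite subr_gt0.
move=> y yx; apply/propext; split => // hy.
by have /andP[h1 h2] := yx j; have /andP[h3 h4] := hy j; lra.
Qed.

Lemma measurable_hbox (r : R) : measurable (hbox r).
Proof.
have -> : hbox r = \bigcap_(j in [set: 'I_n]) ((fun x : 'rV[R]_n => x ord0 j) @^-1` `]- r, r]%classic).
  apply/seteqP; split => x /= h j; first by move=> _ /=; rewrite in_itv /=; exact: h.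
  by have := h j Logic.I; rewrite /= in_itv.
apply: fin_bigcap_measurable => // j _; rewrite -[X in measurable X]setTI.
exact: measurable_coord.
Qed.

Lemma leftctsI S1 S2 : leftcts (fun x => S1 x) -> leftcts (fun x => S2 x) ->
  leftcts (fun x => (S1 `&` S2) x).
Proof.
move=> l1 l2 x; have [d1 d10 H1] := l1 x; have [d2 d20 H2] := l2 x.
exists (Num.min d1 d2); first by rewrite lt_min d10.
move=> y yx; rewrite /setI /= H1 ?H2// => j; have /andP[-> h] := yx j => /=;
  by move: h; rewrite lt_min => /andP[].
Qed.

Lemma cmeas_ind S : measurable S -> cmeas (ind S).
Proof. by move=> mS; apply: cmeas_real; exact: measurable_indic. Qed.

Lemma cabs_ind S x : cabs (ind S x) <= 1.
Proof. by rewrite /ind cabs_real indicE; case: (_ \in _); rewrite ?normr1 ?normr0. Qed.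

Lemma suppin_hbox (V : zmodType) (f : 'rV[R]_n -> V) (r : R) :
  (forall x, ~ hbox r x -> f x = 0) -> suppin r f.
Proof.
move=> H x [j xj]; apply: H => /(_ j) /andP[h1 h2].
by have : `|x ord0 j| <= r; [rewrite ler_norml h2 ltW|rewrite leNgt xj].
Qed.

Lemma suppin_ind S (r : R) : suppin r (ind (S `&` hbox r)).
Proof.
apply: suppin_hbox => x hx; rewrite /ind indicE memNset ?mulr0n//.
by case.
Qed.

Definition leftsets : set (set 'rV[R]_n) := [set S | measurable S /\ leftcts (fun x => S x)].

(** Membership in an open half-space [x_j > c] is unaffected by small moves to the left, and these
    half-spaces generate the measurable sets. *)
Lemma measurable_leftsets : @measurable _ 'rV[R]_n = <<s leftsets >>.
Proof.
apply/seteqP; split; last first.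
  apply: smallest_sub; first exact: sigma_algebra_measurable.
  by move=> S [].
move=> S mS.
have mid : measurable_fun setT (fun x : g_sigma_algebraType leftsets => (x : 'rV[R]_n)).
  apply/measurable_rowP => j.
  apply: (measurability _ (RGenOInfty.measurableE R)) => //.
  move=> _ [_ [x ->] <-]; apply: measurableI => //.
  apply: sub_sigma_algebra; split.
    by rewrite -[X in measurable X]setTI; exact: (measurable_coord j).
  move=> y; have [h|h] := ltP x (y ord0 j).
    exists (y ord0 j - x); first by rewrite subr_gt0.
    move=> z /(_ j)/andP[h1 h2]; apply/propext; rewrite /= !in_itv /= !andbT.
    by split=> _ //; lra.
  exists 1 => // z /(_ j)/andP[h1 h2]; apply/propext; rewrite /= !in_itv /= !andbT.
  by split=> ?; lra.
by have := mid measurableT S mS; rewrite setTI.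
Qed.

Lemma indicI_mul (A B : set 'rV[R]_n) x : \1_(A `&` B) x = \1_A x * \1_B x :> R.
Proof. by rewrite indicI. Qed.

(** Dynkin's pi-lambda theorem on the class of sets whose indicator, cut off by a box, is in [apx]:
    the left-continuous measurable sets form a generating family stable under intersection,
    complements are differences, and disjoint unions are limits. *)
Lemma apx_ind (r : R) S : 0 <= r -> measurable S -> apx (ind (S `&` hbox r)).
Proof.
move=> r0; rewrite measurable_leftsets => mS.
have mB := measurable_hbox r.
have apxL T : leftsets T -> apx (ind (T `&` hbox r)).
  move=> [mT lT]; apply: (apx_leftcts r0 ler01).
  - by apply: cmeas_ind; exact: measurableI.
  - by move=> x; exact: cabs_ind.
  - exact: suppin_ind.
  - move=> x; have [d d0 Hd] := leftctsI lT (@leftcts_hbox r) x.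
    exists d => // y /Hd yx; rewrite /ind !indicE; congr ((nat_of_bool _)%:R%:C)%C.
    by apply/idP/idP => /set_mem h; apply: mem_set; [rewrite -yx|rewrite yx].
apply: (@dynkin_induction _ _ leftsets (fun S => apx (ind (S `&` hbox r))) measurable_leftsets) mS.
- move=> S1 S2 [m1 l1] [m2 l2]; split; first exact: measurableI.
  exact: leftctsI.
- by apply: apxL; split; [exact: measurableT|move=> x; exists 1].
- exact: apxL.
- move=> T mT aT.
  have -> : ind (~` T `&` hbox r) = (fun x => ind (setT `&` hbox r) x - ind (T `&` hbox r) x).
    apply/funext => x; rewrite /ind -rmorphB /= !indicI_mul -mulrBl; congr (_ * _)%:C%C.
    rewrite !indicE in_setT in_setC; case: (x \in T) => /=; first by rewrite subrr.
    by rewrite subr0.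
  have aT' : apx (ind (setT `&` hbox r)).
    by apply: apxL; split; [exact: measurableT|move=> x; exists 1].
  exact: (apxB wphi q1 aT' aT).
- move=> F mF tF aF; pose U := \bigcup_k F k.
  have mU : measurable (U `&` hbox r) by apply: measurableI => //; exact: bigcupT_measurable.
  have [iU Uoo] := bounded_supp_FL r0 ler01 (cmeas_ind mU) (cabs_ind _) (@suppin_ind _ r).
  apply: (apx_lim wphi q1 s0 iU Uoo) => e e0.
  pose b N x := \sum_(k < N) ind (F k `&` hbox r) x.
  have ab N : apx (b N) by apply: (apx_sum wphi q1) => k; exact: aF.
  (* By disjointness at most one term of the partial sum is nonzero, so the error is the indicator
     of the part of [U] not yet covered. *)
  have E N x : ind (U `&` hbox r) x - b N x =
      ind (U `&` hbox r) x * ((~~ [exists k : 'I_N, x \in F k])%:R : R)%:C%C.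
    have [/existsP[k xk]|] := boolP [exists k : 'I_N, x \in F k].
      rewrite mulr0 /b (bigD1 k)//= big1 ?addr0.
        rewrite /ind !indicI_mul !indicE xk (mem_set (A := U)) ?mul1r ?subrr//.
        by exists k => //; exact: set_mem.
      move=> l lk; rewrite /ind indicI_mul indicE; case: (boolP (x \in F l)) => [xl|]; last by rewrite mul0r.
      have := tF l k Logic.I Logic.I; move=> H; exfalso; move/eqP: lk; apply.
      by apply: val_inj; apply: H; exists x; split; exact: set_mem.
    move=> /existsPn h; rewrite /b big1 ?subr0 ?mulr1// => k _.
    by rewrite /ind indicI_mul indicE (negPf (h k)) mul0r.
  have md N := (cintegB iU (let: And3 i _ _ := ab N in i)).1.
  have [K K0 HK] := wabsX_supp r0 ler01.
  have bd N x : 0 <= wabs s (fun x => ind (U `&` hbox r) x - b N x) x `^ q <= K * decay 2 x.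
    rewrite powR_ge0 /=; apply: HK => [y|y yr].
      rewrite E cabsM cabs_real; apply: mulr_ile1; rewrite ?cabs_ge0 ?cabs_ind//.
      by case: (~~ _); rewrite ?normr1 ?normr0.
    by rewrite E suppin_ind ?mul0r.
  have cv x : wabs s (fun x => ind (U `&` hbox r) x - b N x) x `^ q @[N --> \oo] --> (0 : R).
    apply/cvgrPdist_lt => e' e'0; have [[k _ xk]|nU] := pselect (U x).
      near=> N; rewrite /wabs E.
      have -> : [exists k : 'I_N, x \in F k].
        have kN : (k < N)%N by near: N; exact: nbhs_infty_gt.
        by apply/existsP; exists (Ordinal kN); exact: mem_set.
      by rewrite mulr0 cabs0 mulr0 powR0 ?gt_eqF// subr0 normr0.
    apply: nearW => N; rewrite /wabs E.
    have -> : ind (U `&` hbox r) x = 0 by rewrite /ind indicE memNset// => -[].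
    by rewrite mul0r cabs0 mulr0 powR0 ?gt_eqF// subr0 normr0.
  have D := dct0 (fun N => measurable_wabsX s q (md N))
    (measurable_funM (measurable_cst _) (@measurable_decay R n 2)) bd (decay_lty K0) cv.
  have [N HN] := cvge0_lt D e0; exists (b N) => //.
  by rewrite FLintE//; exact: HN.
Unshelve. all: by end_near. Qed.

(** Rounding [f] down to multiples of [1 / m] gives a combination of indicators of level sets, with
    error at most [1 / m] on the box. *)
Lemma apx_real (f : 'rV[R]_n -> R) (r K : R) : measurable_fun setT f -> 0 <= r -> 0 <= K ->
  (forall x, `|f x| <= K) -> apx (fun x => (f x * \1_(hbox r) x)%:C%C).
Proof.
move=> mf r0 K0 fK; have mB := measurable_hbox r.
have sB : suppin r (fun x => (f x * \1_(hbox r) x)%:C%C : R[i]).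
  by apply: suppin_hbox => x hx; rewrite indicE memNset// mulr0.
have m1 : cmeas (fun x => (f x * \1_(hbox r) x)%:C%C : R[i]).
  by apply: cmeas_real; apply: measurable_funM => //; exact: measurable_indic.
have b1 x : cabs ((f x * \1_(hbox r) x)%:C%C : R[i]) <= K.
  rewrite cabs_real normrM indicE; case: (_ \in _); first by rewrite normr1 mulr1.
  by rewrite normr0 mulr0.
have [i1 oo1] := bounded_supp_FL r0 K0 m1 b1 sB.
apply: (apx_lim wphi q1 s0 i1 oo1) => e e0.
have [iB Boo] := bounded_supp_FL r0 ler01 (cmeas_ind (measurableI _ _ measurableT mB)) (cabs_ind _) (@suppin_ind setT r).
have F0 := FLint_ge0 q s iB.1.
have [V EV] : exists V : R, FLint q s (ind (setT `&` hbox r)) = V%:E.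
  by exists (fine (FLint q s (ind (setT `&` hbox r)))); rewrite fineK// ge0_fin_numE.
have V0 : 0 <= V by rewrite -lee_fin -EV.
(* Chosen so that [V / m < e]; the error is bounded by [m^(- q) V], and [m^(- q) <= m^(-1)] as
   [q >= 1]. *)
pose m : R := (Num.trunc (V / e)).+1%:R.
have m0 : 0 < m by rewrite ltr0n.
have mV : m^-1 * V < e.
  rewrite mulrC ltr_pdivrMr// mulrC -ltr_pdivrMr//; exact: truncnS_gt.
have mq : m^-1 `^ q <= m^-1.
  have mi0 : 0 <= m^-1 by rewrite invr_ge0 ltW.
  have m1' : 1 <= m by rewrite ler1n.
  by rewrite -(powR_inv1 (ltW m0)) -powRrM mulN1r ler_powR// lerN2.
(* One unit more than what exceeds [m K], since rounding down can pass below [- m K]. *)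
pose L := (Num.trunc (m * K)).+2.
pose A (i : 'I_(L + L).+1) : set 'rV[R]_n := [set x | Num.floor (m * f x) = (i : nat)%:Z - L%:Z].
have mA i : measurable (A i).
  have mmf : measurable_fun setT (fun x => m * f x) by exact: measurable_funM.
  have := mmf measurableT _ (measurable_floor_eq ((i : nat)%:Z - L%:Z)).
  by rewrite setTI.
pose b x := \sum_(i < (L + L).+1) ((((i : nat)%:R - L%:R) / m : R)%:C%C * ind (A i `&` hbox r) x).
have ab : apx b.
  apply: (apx_sum wphi q1) => i; apply: (apxZ wphi q1); exact: apx_ind.
exists b => //.
have bE x : b x = ((Num.floor (m * f x))%:~R / m * \1_(hbox r) x)%:C%C.
  have zL : `|Num.floor (m * f x)| <= L%:Z.
    have /andP[h1 h2] := floor_itv (m * f x); rewrite intrD in h2.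
    have h3 := truncnS_gt (m * K).
    have h4 : `|m * f x| <= m * K by rewrite normrM gtr0_norm// ler_wpM2l// ltW.
    have /andP[h5 h6] : - (m * K) <= m * f x <= m * K by rewrite -ler_norml.
    have LE : L%:R = (Num.trunc (m * K)).+1%:R + 1 :> R by rewrite /L -natr1.
    rewrite ler_norml -!(ler_int R) rmorphN /= -[(L%:Z)%:~R]/(L%:R) LE; apply/andP; split; lra.
  rewrite /b -(sum_floor R zL) !mulr_suml rmorph_sum; apply: eq_bigr => i _ /=.
  rewrite /ind indicI_mul -rmorphM /=; congr (_%:C)%C.
  have -> : \1_(A i) x = (Num.floor (m * f x) == (i : nat)%:Z - L%:Z)%:R :> R.
    rewrite indicE; congr ((nat_of_bool _)%:R).
    by apply/idP/eqP => [/set_mem//|h]; exact: mem_set.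
  by rewrite mulrACA mulrA.
have ib : cinteg mu b by case: ab.
have bd x : cabs ((f x * \1_(hbox r) x)%:C%C - b x) <= m^-1 * cabs (ind (setT `&` hbox r) x).
  rewrite bE -rmorphB /= /ind !cabs_real indicI_mul indicT /cst /= mul1r -mulrBl normrM.
  apply: ler_wpM2r => //.
  have -> : f x = (m * f x) / m by rewrite mulrC mulKf// gt_eqF.
  rewrite -mulrBl normrM [`|m^-1|]gtr0_norm ?invr_gt0// ler_piMl ?invr_ge0 ?(ltW m0)//.
  have -> : m * (m * f x / m) = m * f x by rewrite mulrC divfK// gt_eqF.
  have /andP[h1 h2] := floor_itv (m * f x); rewrite intrD in h2.
  by rewrite ger0_norm ?subr_ge0//; lra.
have mi0 : 0 <= m^-1 by rewrite invr_ge0 ltW.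
apply: le_lt_trans (FLint_le s (ltW q0) mi0 (cintegB i1 ib).1 iB.1 bd) _.
rewrite EV -EFinM lte_fin; apply: le_lt_trans mV.
by rewrite ler_wpM2r.
Qed.

(** Real and imaginary parts are truncated both in size and to a box; the error is dominated by [a]
    itself and vanishes at each point for large [N]. *)
Lemma apx_all a : cmeas a -> (FLint q s a < +oo)%E -> apx a.
Proof.
move=> ma aoo; have ia := embeds_cinteg q1 emb ma aoo; have mca := measurable_cabs ma.
apply: (apx_lim wphi q1 s0 ia aoo) => e e0.
pose g N x : R := ((cabs (a x) <= N%:R)%R)%:R.
have mg N : measurable_fun setT (g N).
  have -> : g N = \1_[set x | cabs (a x) <= N%:R].
    apply/funext => x; rewrite indicE; congr ((nat_of_bool _)%:R).
    by apply/idP/idP => [h|/set_mem//]; exact: mem_set.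
  apply: measurable_indic; have := mca measurableT _ (measurable_itv `]-oo, N%:R]).
  by rewrite setTI; congr measurable; apply/seteqP; split => x /=; rewrite in_itv.
pose b N x := (complex.Re (a x) * g N x * \1_(hbox N%:R) x)%:C%C +
  (0 +i* 1)%C * (complex.Im (a x) * g N x * \1_(hbox N%:R) x)%:C%C.
have ab N : apx (b N).
  have bnd (h : R) x : `|h| <= cabs (a x) -> `|h * g N x| <= N%:R.
    rewrite normrM /g; case: (leP (cabs (a x)) N%:R) => [h1 h2|_ _].
      by rewrite normr1 mulr1 (le_trans h2).
    by rewrite normr0 mulr0.
  apply: (apxD wphi q1).
    apply: (@apx_real _ N%:R N%:R) => //; first by apply: measurable_funM => //; exact: ma.1.
    by move=> x; apply: bnd; exact: Re_le_cabs.
  apply: (apxZ wphi q1).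
  apply: (@apx_real _ N%:R N%:R) => //; first by apply: measurable_funM => //; exact: ma.2.
  by move=> x; apply: bnd; exact: Im_le_cabs.
have bE N x : b N x = (g N x * \1_(hbox N%:R) x)%:C%C * a x.
  rewrite /b; case: (a x) => u v /=; apply: complex_eq => /=; ring.
have E N x : a x - b N x = (1 - g N x * \1_(hbox N%:R) x)%:C%C * a x.
  by rewrite bE rmorphB /= mulrBl mul1r.
have le1 N x : `|1 - g N x * \1_(hbox N%:R) x| <= 1.
  rewrite /g indicE; case: (cabs (a x) <= _); case: (x \in _); rewrite ?mulr1 ?mulr0 ?mul0r ?subrr ?subr0 ?normr0 ?normr1//.
have bd N x : 0 <= wabs s (fun x => a x - b N x) x `^ q <= wabs s a x `^ q.
  rewrite powR_ge0 /=; apply: (le_powR (ltW q0)); first exact: wabs_ge0.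
  rewrite /wabs ler_wpM2l ?powR_ge0// E cabsM cabs_real ler_piMl ?cabs_ge0//.
have cv x : wabs s (fun x => a x - b N x) x `^ q @[N --> \oo] --> (0 : R).
  pose S := cabs (a x) + \sum_(j < n) `|x ord0 j| + 1.
  apply/cvgrPdist_lt => e' e'0; near=> N.
  have SN : S < N%:R.
    have NN : ((Num.trunc S).+1 <= N)%N by near: N; exact: nbhs_infty_ge.
    by apply: (lt_le_trans (truncnS_gt S)); rewrite ler_nat.
  have sx : 0 <= \sum_(j < n) `|x ord0 j| by apply: sumr_ge0.
  have c0 := cabs_ge0 (a x); rewrite /S in SN.
  have g1 : g N x = 1 by rewrite /g; have -> : cabs (a x) <= N%:R by lra.
  have h1 : hbox N%:R x.
    move=> j; have xS : `|x ord0 j| <= \sum_(j < n) `|x ord0 j| by rewrite (bigD1 j)//= lerDl sumr_ge0.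
    have : `|x ord0 j| < N%:R by lra.
    by rewrite ltr_norml => /andP[-> /ltW ->].
  by rewrite /wabs E g1 indicE mem_set// mulr1 subrr mul0r cabs0 mulr0 powR0 ?gt_eqF// subr0 normr0.
have ib N : cinteg mu (b N) by case: (ab N).
have aoo' : (\int[mu]_x (wabs s a x `^ q)%:E < +oo)%E by rewrite -FLintE.
have D := dct0 (fun N => measurable_wabsX s q (cintegB ia (ib N)).1)
  (measurable_wabsX s q ma) bd aoo' cv.
have [N HN] := cvge0_lt D e0; exists (b N); first exact: ab.
by rewrite FLintE; [exact: HN|exact: (cintegB ia (ib N)).1].
Unshelve. all: by end_near. Qed.

End Density.

(** * Closed ideals *)

Section ClosedIdeals.
Variables (R : realType) (n : nat) (p q s : R) (phi : 'rV[R]_n -> R[i]).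
Hypotheses (wphi : window phi) (p1 : 1 <= p) (q1 : 1 <= q) (s0 : 0 <= s).
Hypothesis emb : embeds_L1 n q s.
Implicit Types (a b d g : 'rV[R]_n -> R[i]) (f u v h : 'rV[R]_n -> R[i]) (N : nat).
Implicit Types (t : R) (I X : set ('rV[R]_n -> R[i])) (Phi : ('rV[R]_n -> R[i]) -> \bar R).
Local Notation mu := (leb R n).
Local Notation kap := (kap phi).
Local Notation apdiff := (apdiff phi).
Local Notation FLrep := (FLrep q s).
Local Notation FL := (@FL R n q s).
Local Notation Mod := (Mod p q s phi).
Local Notation FLint := (FLint q s).
Local Notation Msum := (Msum p q s phi).

Let q0 : 0 < q. Proof. exact: lt_le_trans q1. Qed.
Let sm0 N : (0 : R) < N.+1%:R. Proof. by rewrite ltr0n. Qed.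
Let sm1 N : (1 : R) <= N.+1%:R. Proof. by rewrite ler1n. Qed.

Lemma FLrep_cinteg f a : FLrep f a -> cinteg mu a.
Proof. by move=> [/cmeasurableP ma aoo _]; exact: embeds_cinteg q1 emb ma aoo. Qed.

Lemma FLrep_lty f a : FLrep f a -> (FLint a < +oo)%E. Proof. by case. Qed.

Lemma FLrepP f a : cinteg mu a -> (FLint a < +oo)%E -> (forall x, f x = invFT a x) -> FLrep f a.
Proof. by move=> ia aoo fa; split => //; apply/cmeasurableP; exact: ia.1. Qed.

Lemma FLrepE f a : FLrep f a -> forall x, f x = invFT a x. Proof. by case. Qed.

Lemma FLrepD f g a b : FLrep f a -> FLrep g b -> FLrep (fun x => f x + g x) (fun x => a x + b x).
Proof.
move=> Fa Fb; have ia := FLrep_cinteg Fa; have ib := FLrep_cinteg Fb.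
apply: FLrepP; first exact: cintegD.
  exact: quasi_add_lty (powR_ge0 _ _) (FLintD s (ltW q0) ia.1 ib.1) (FLrep_lty Fa) (FLrep_lty Fb).
by move=> x; rewrite invFTD// (FLrepE Fa) (FLrepE Fb).
Qed.

Lemma FLrepZ (c : R[i]) f a : FLrep f a -> FLrep (fun x => c * f x) (fun x => c * a x).
Proof.
move=> Fa; have ia := FLrep_cinteg Fa.
apply: FLrepP; first exact: cintegZ.
  apply: le_lt_trans (FLintZ s c (ltW q0) ia.1) _.
  apply: lte_mul_pinfty; [by rewrite lee_fin powR_ge0|by []|exact: (FLrep_lty Fa)].
by move=> x; rewrite invFTZ// (FLrepE Fa).
Qed.

Lemma FLrepB f g a b : FLrep f a -> FLrep g b -> FLrep (fun x => f x - g x) (fun x => a x - b x).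
Proof.
move=> Fa Fb.
have E (h k : 'rV[R]_n -> R[i]) : (fun x => h x - k x) = (fun x => h x + -1 * k x).
  by apply/funext => x; rewrite mulN1r.
by rewrite !E; apply: FLrepD => //; exact: FLrepZ.
Qed.

Lemma FLint_conv_ex : exists2 C : R, 0 <= C & forall a b, cmeas a -> cmeas b ->
  (FLint a < +oo)%E -> (FLint b < +oo)%E -> (FLint (conv a b) <= C%:E * (FLint a * FLint b))%E.
Proof.
have [K K0 HK] := emb.
exists ((2 * cnorm R n * 2 `^ s) `^ q * 2 `^ q * (2 * K)).
  by rewrite !mulr_ge0 ?powR_ge0.
by move=> a b ma mb aoo boo; exact: (FLint_conv q1 s0 K0 HK ma mb aoo boo).
Qed.

Lemma FLrepM f g a b : FLrep f a -> FLrep g b -> FLrep (fun x => f x * g x) (conv a b).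
Proof.
move=> Fa Fb; have ia := FLrep_cinteg Fa; have ib := FLrep_cinteg Fb.
have aoo := FLrep_lty Fa; have boo := FLrep_lty Fb.
apply: FLrepP; first exact: conv_cinteg.
  have [C C0 HC] := FLint_conv_ex; apply: le_lt_trans (HC _ _ ia.1 ib.1 aoo boo) _.
  apply: lte_mul_pinfty; [by rewrite lee_fin|by []|].
  have F0 := FLint_ge0 q s ia.1; apply: lte_mul_pinfty; [exact: F0| |exact: boo].
  by rewrite ge0_fin_numE; [exact: aoo|exact: F0].
by move=> x; rewrite (invFT_conv x ia ib) (FLrepE Fa) (FLrepE Fb).
Qed.

Lemma FLrep0 : FLrep (fun=> 0 : R[i]) (fun _ : 'rV[R]_n => 0).
Proof.
apply: FLrepP; first exact: cinteg0.
  by rewrite (FLint0 n s q0) ltry.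
by move=> x; rewrite invFT0.
Qed.

(* A bounded approximate identity for multiplication in both algebras. *)
Definition aid N := invFT (kap N.+1%:R) : 'rV[R]_n -> R[i].

Lemma FLrep_aid N : FLrep (aid N) (kap N.+1%:R).
Proof.
have [M M0 HM] := kap_bounded wphi (sm0 N); have ik := cinteg_kap wphi (sm0 N).
apply: FLrepP => //; apply: (bounded_supp_FL q1 s0 (ler0n R 2) M0 ik.1 HM _).2.
move=> x [j xj]; apply: contrapT => /eqP kx.
have /andP[h1 h2] := kap_supp wphi (sm1 N) kx j.
by move: xj; rewrite ger0_norm// ltNge h2.
Qed.

Lemma Msum0 : Msum (fun=> 0) = 0%E.
Proof.
have -> : (fun=> 0) = (fun x : 'rV[R]_n => 0 * kap 1 x) by apply/funext => x; rewrite mul0r.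
have ik := cinteg_kap wphi ltr01; apply/eqP; rewrite eq_le; apply/andP; split.
  apply: le_trans (MsumZ s wphi p1 q0 0 ik) _.
  by rewrite cabs0 powR0 ?gt_eqF// mul0e.
by rewrite (Msum_SS s wphi p1 q0 (cintegZ 0 ik)); exact: SS_ge0.
Qed.

(** The tolerance [eps^q] is renamed [t], which can be split additively. The functional [Phi] is a
    parameter because the statement is used for both norms. *)
Lemma closureP Phi X I f :
  closure_in (fun u eps => exists g, FLrep u g /\ (Phi g < (eps `^ q)%:E)%E) X I f <->
  X f /\ forall t, 0 < t -> exists h g, [/\ I h, FLrep (fun x => f x - h x) g & (Phi g < t%:E)%E].
Proof.
split=> -[Xf H]; split => // t t0.
  have [h [Ih [g [Fg gt]]]] := H (t `^ q^-1) (powR_gt0 _ t0).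
  by exists h, g; split => //; move: gt; rewrite -powRrM mulVf ?gt_eqF// powRr1// ltW.
by have [h [g [Ih Fg gt]]] := H (t `^ q) (powR_gt0 _ t0); exists h; split => //; exists g.
Qed.

Lemma FL_FLrep f a : FLrep f a -> FL f. Proof. by exists a. Qed.

Lemma Mod_FL : Mod `<=` FL. Proof. by move=> f [g [Fg _]]; exact: FL_FLrep Fg. Qed.

Lemma ModM f g : FL f -> Mod g -> Mod (fun x => f x * g x).
Proof.
move=> [a Fa] [b [Fb boo]]; exists (conv a b); split; first exact: FLrepM.
exact: (Msum_conv_lty wphi p1 q1 s0 emb (FLrep_cinteg Fa) (FLrep_cinteg Fb) (FLrep_lty Fa) boo).
Qed.

Lemma Mod_aid N : Mod (aid N).
Proof. by exists (kap N.+1%:R); split; [exact: FLrep_aid|exact: (Msum_kap wphi p1 q1 s0 (sm1 N))]. Qed.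

Lemma Mod0 : Mod (fun=> 0).
Proof. by exists (fun=> 0); split; [exact: FLrep0|rewrite Msum0 ltry]. Qed.

Lemma ModD f g : Mod f -> Mod g -> Mod (fun x => f x + g x).
Proof.
move=> [a [Fa aoo]] [b [Fb boo]]; exists (fun x => a x + b x); split; first exact: FLrepD.
have H := MsumD s wphi p1 q0 (FLrep_cinteg Fa) (FLrep_cinteg Fb).
exact: quasi_add_lty (powR_ge0 _ _) H aoo boo.
Qed.

Lemma ModZ (c : R[i]) f : Mod f -> Mod (fun x => c * f x).
Proof.
move=> [a [Fa aoo]]; exists (fun x => c * a x); split; first exact: FLrepZ.
apply: le_lt_trans (MsumZ s wphi p1 q0 c (FLrep_cinteg Fa)) _.
by apply: lte_mul_pinfty; [rewrite lee_fin powR_ge0|by []|].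
Qed.

Lemma quasi_add_lt Phi a b t :
  (Phi (fun x => a x + b x)%R <= (2 `^ q)%:E * (Phi a + Phi b))%E ->
  (Phi a < (t / 2 `^ q / 2)%:E)%E -> (Phi b < (t / 2 `^ q / 2)%:E)%E ->
  (Phi (fun x => a x + b x)%R < t%:E)%E.
Proof.
move=> H at_ bt; have c0 : 0 < 2 `^ q :> R by rewrite powR_gt0.
apply: le_lt_trans H _.
have -> : t = 2 `^ q * (t / (2 `^ q) / 2 + t / (2 `^ q) / 2).
  by rewrite -splitr mulrC divfK// gt_eqF.
by rewrite EFinM lte_pmul2l ?lte_fin// EFinD; exact: lteD.
Qed.

Lemma scaled_lt (C t : R) (x y : \bar R) : 0 <= C -> 0 < t -> (x <= C%:E * y)%E ->
  (y < (t / (C + 1))%:E)%E -> (x < t%:E)%E.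
Proof.
move=> C0 t0 xy yt; have D0 : 0 < C + 1 by rewrite ltr_wpDl.
apply: le_lt_trans xy _; apply: (@le_lt_trans _ _ (C * (t / (C + 1)))%:E).
  by rewrite EFinM; apply: lee_wpmul2l; rewrite ?lee_fin// ltW.
by rewrite lte_fin mulrA ltr_pdivrMr// mulrC ltr_pM2l// ltrDl.
Qed.

Let half t : 0 < t -> 0 < t / 2 `^ q / 2.
Proof. by move=> t0; rewrite !divr_gt0// powR_gt0. Qed.

(** Two errors: that of the approximate unit on [f], and [f - h] measured after multiplication by
    [aid N]. *)
Lemma aid_split f h N :
  (fun x => f x - h x * aid N x) = (fun x => (f x - f x * aid N x) + (f x - h x) * aid N x).
Proof. by apply/funext => x; rewrite mulrBl addrA subrK. Qed.

Lemma FLrep_sub_aid f a N : FLrep f a -> FLrep (fun x => f x - f x * aid N x) (apdiff a N).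
Proof. by move=> Fa; apply: FLrepB => //; exact: FLrepM Fa (FLrep_aid N). Qed.

Lemma FLrep_split f h a d N : FLrep f a -> FLrep (fun x => f x - h x) d ->
  FLrep (fun x => f x - h x * aid N x) (fun x => apdiff a N x + conv d (kap N.+1%:R) x).
Proof.
move=> Fa Fd; rewrite aid_split; apply: FLrepD; first exact: FLrep_sub_aid.
exact: FLrepM Fd (FLrep_aid N).
Qed.

Lemma mul_aidC h N : (fun x => h x * aid N x) = (fun x => aid N x * h x).
Proof. by apply/funext => x; rewrite mulrC. Qed.

Lemma FL_aid N : FL (aid N). Proof. exact: FL_FLrep (FLrep_aid N). Qed.

Lemma FLint_apdiff_lt f a t : FLrep f a -> 0 < t -> exists N, (FLint (apdiff a N) < t%:E)%E.
Proof.
move=> Fa t0; have [_ _ H] := apx_all wphi q1 s0 emb (FLrep_cinteg Fa).1 (FLrep_lty Fa).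
by have [N HN] := H _ t0; exists N; exact: HN.
Qed.

Lemma closed_ideal_setI_Mod I : closed_ideal (FLsmall q s) FL I ->
  closed_ideal (Msmall p q s phi) Mod (I `&` Mod).
Proof.
move=> [[sI I0 ID IZ IM] cI]; split; first split.
- by move=> f [].
- by split; [exact: I0|exact: Mod0].
- by move=> u v [Iu Mu] [Iv Mv]; split; [exact: ID|exact: ModD].
- by move=> c u [Iu Mu]; split; [exact: IZ|exact: ModZ].
- by move=> f g Mf [Ig Mg]; split; [apply: IM => //; exact: Mod_FL|apply: ModM => //; exact: Mod_FL].
move=> f /(@closureP Msum) [Mf H]; split => //.
apply: cI; apply/(@closureP FLint); split; first exact: Mod_FL.
move=> t t0; have [a Fa] := Mod_FL Mf.
(* The index [N] is fixed by [f] alone; the tolerance for [h] then takes into account the constant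
   [C], which depends on [N]. *)
have [N HN] := FLint_apdiff_lt Fa (half t0).
have [C C0 HC] := FLint_conv_kap wphi p1 q1 s0 (sm1 N).
have D0 : 0 < C + 1 by rewrite ltr_wpDl.
have [h [d [[Ih Mh] Fd dt]]] := H _ (divr_gt0 (half t0) D0).
exists (fun x => h x * aid N x), (fun x => apdiff a N x + conv d (kap N.+1%:R) x); split.
- by rewrite mul_aidC; apply: IM => //; exact: FL_aid.
- exact: FLrep_split.
have id := FLrep_cinteg Fd; have ik := cinteg_kap wphi (sm0 N).
apply: quasi_add_lt; [|exact: HN|].
  apply: (FLintD s (ltW q0) (cinteg_apdiff wphi N (FLrep_cinteg Fa)).1 _).
  exact: (conv_cinteg id ik).1.
exact: scaled_lt C0 (half t0) (HC d id) dt.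
Qed.

(** The products of [f] with [aid N] are the approximating elements: they stay in the ideal, and lie
    in the modulation space because it is a module over the larger algebra. *)
Lemma closure_setI_Mod I : closed_ideal (FLsmall q s) FL I ->
  closure_in (FLsmall q s) FL (I `&` Mod) = I.
Proof.
move=> [[sI I0 ID IZ IM] cI]; apply/seteqP; split => f.
  move=> [Ff H]; apply: cI; split => // e e0.
  by have [h [[Ih _] sh]] := H e e0; exists h.
move=> If; have Ff := sI _ If; apply/(@closureP FLint); split => // t t0.
have [a Fa] := Ff; have [N HN] := FLint_apdiff_lt Fa t0.
exists (fun x => f x * aid N x), (apdiff a N); split => //; last exact: FLrep_sub_aid.
by split; [rewrite mul_aidC; apply: IM => //; exact: FL_aid|apply: ModM => //; exact: Mod_aid].
Qed.

Lemma closed_ideal_closure I : is_ideal Mod I ->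
  closed_ideal (FLsmall q s) FL (closure_in (FLsmall q s) FL I).
Proof.
move=> [sI I0 ID IZ IM].
split; first split.
- by move=> f [].
- apply/(@closureP FLint); split; first exact: FL_FLrep FLrep0.
  move=> t t0; exists (fun=> 0), (fun=> 0); split => //.
    by rewrite (_ : (fun=> _) = fun=> 0) ?subr0//; exact: FLrep0.
  by rewrite (FLint0 n s q0) lte_fin.
- move=> u v /(@closureP FLint) [[a Fa] Hu] /(@closureP FLint) [[b Fb] Hv].
  apply/(@closureP FLint); split; first exact: FL_FLrep (FLrepD Fa Fb).
  move=> t /half t0; have [h [d [Ih Fd dt]]] := Hu _ t0; have [k [d' [Ik Fd' dt']]] := Hv _ t0.
  exists (fun x => h x + k x), (fun x => d x + d' x); split; first exact: ID.
    have -> : (fun x => u x + v x - (h x + k x)) = (fun x => (u x - h x) + (v x - k x)).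
      by apply/funext => x; rewrite opprD addrACA.
    exact: FLrepD.
  apply: quasi_add_lt; [|exact: dt|exact: dt'].
  exact: (FLintD s (ltW q0) (FLrep_cinteg Fd).1 (FLrep_cinteg Fd').1).
- move=> c u /(@closureP FLint) [[a Fa] Hu].
  apply/(@closureP FLint); split; first exact: FL_FLrep (FLrepZ c Fa).
  move=> t t0; have C0 : 0 <= cabs c `^ q by exact: powR_ge0.
  have D0 : 0 < cabs c `^ q + 1 by rewrite ltr_wpDl.
  have [h [d [Ih Fd dt]]] := Hu _ (divr_gt0 t0 D0).
  exists (fun x => c * h x), (fun x => c * d x); split; first exact: IZ.
    have -> : (fun x => c * u x - c * h x) = (fun x => c * (u x - h x)).
      by apply/funext => x; rewrite mulrBr.
    exact: FLrepZ.
  exact: scaled_lt C0 t0 (FLintZ s c (ltW q0) (FLrep_cinteg Fd).1) dt.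
(* The clause where stability under the smaller algebra is upgraded: [f h] need not lie in [I], but
   [(f * aid N) h] does, since [f * aid N] lies in the modulation space. *)
- move=> f u [a Fa] /(@closureP FLint) [[b Fb] Hu].
  apply/(@closureP FLint); split; first exact: FL_FLrep (FLrepM Fa Fb).
  move=> t /half t0; have [K K0 HK] := FLint_conv_ex; have ia := FLrep_cinteg Fa.
  have [A EA] : exists A : R, FLint a = A%:E.
    have F0 := FLint_ge0 q s ia.1; have aoo := FLrep_lty Fa.
    by exists (fine (FLint a)); rewrite fineK// ge0_fin_numE.
  have A0 : 0 <= A by rewrite -lee_fin -EA; exact: FLint_ge0 ia.1.
  have C0 : 0 <= K * A by rewrite mulr_ge0.
  have D0 : 0 < K * A + 1 by rewrite ltr_wpDl.
  have [h [d [Ih Fd dt]]] := Hu _ (divr_gt0 t0 D0).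
  have [c Fc] : FL h by apply: Mod_FL; exact: sI.
  (* [N] may depend on [h] here: it only serves to bring [f h * aid N] close to [f h], within a
     single norm. *)
  have Fac := FLrepM Fa Fc; have [N HN] := FLint_apdiff_lt Fac t0.
  exists (fun x => (f x * aid N x) * h x), (fun x => conv a d x + apdiff (conv a c) N x); split.
  + by apply: IM => //; apply: ModM; [exact: FL_FLrep Fa|exact: Mod_aid].
  + have -> : (fun x => f x * u x - f x * aid N x * h x) =
        (fun x => f x * (u x - h x) + (f x * h x - f x * h x * aid N x)).
      by apply/funext => x; rewrite mulrBr addrA subrK mulrAC.
    by apply: FLrepD; [exact: FLrepM|exact: FLrep_sub_aid].
  have id := FLrep_cinteg Fd.
  apply: quasi_add_lt; [| |exact: HN].
    apply: (FLintD s (ltW q0) (conv_cinteg ia id).1 _).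
    exact: (cinteg_apdiff wphi N (FLrep_cinteg Fac)).1.
  apply: scaled_lt C0 t0 _ dt; rewrite EFinM -muleA -EA.
  exact: (HK _ _ ia.1 id.1 (FLrep_lty Fa) (FLrep_lty Fd)).
- move=> f /(@closureP FLint) [Ff H]; apply/(@closureP FLint); split => // t /half t0.
  have [u [d [/(@closureP FLint) [_ Hu] Fd dt]]] := H _ t0; have [h [d' [Ih Fd' dt']]] := Hu _ t0.
  exists h, (fun x => d x + d' x); split => //.
    have -> : (fun x => f x - h x) = (fun x => (f x - u x) + (u x - h x)).
      by apply/funext => x; rewrite addrA subrK.
    exact: FLrepD.
  apply: quasi_add_lt; [|exact: dt|exact: dt'].
  exact: (FLintD s (ltW q0) (FLrep_cinteg Fd).1 (FLrep_cinteg Fd').1).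
Qed.

Lemma setI_closure_Mod I : closed_ideal (Msmall p q s phi) Mod I ->
  closure_in (FLsmall q s) FL I `&` Mod = I.
Proof.
move=> [[sI I0 ID IZ IM] cI]; apply/seteqP; split => f; last first.
  move=> If; split; last exact: sI; apply/(@closureP FLint); split; first exact/Mod_FL/sI.
  move=> t t0; exists f, (fun=> 0); split => //.
    have -> : (fun x => f x - f x) = (fun=> 0) by apply/funext => x; rewrite subrr.
    exact: FLrep0.
  by rewrite (FLint0 n s q0) lte_fin.
move=> [/(@closureP FLint) [_ H] Mf]; apply: cI; apply/(@closureP Msum); split => // t t0.
have [a [Fa aoo]] := Mf; have ia := FLrep_cinteg Fa.
have [N HN] := Msum_approx wphi p1 q1 s0 ia aoo (half t0).
have [C C0 HC] := Msum_conv_kap wphi p1 q1 s0 (sm1 N).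
have D0 : 0 < C + 1 by rewrite ltr_wpDl.
(* [h] is close to [f] in the Fourier-Lebesgue norm only; after multiplication by the fixed [aid N]
   the difference is small in the modulation norm. *)
have [h [d [Ih Fd dt]]] := H _ (divr_gt0 (half t0) D0).
exists (fun x => h x * aid N x), (fun x => apdiff a N x + conv d (kap N.+1%:R) x); split.
- by rewrite mul_aidC; apply: IM => //; exact: Mod_aid.
- exact: FLrep_split.
have id := FLrep_cinteg Fd; have ik := cinteg_kap wphi (sm0 N).
apply: quasi_add_lt; last exact: scaled_lt C0 (half t0) (HC d id) dt.
  exact: (MsumD s wphi p1 q0 (cinteg_apdiff wphi N ia) (conv_cinteg id ik)).
exact: HN.
Qed.

End ClosedIdeals.

Theorem mainTheorem17 (R : realType) (n : nat) (p q s : R)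
    (phi : 'rV[R]_n -> R[i]) :
  (0 < n)%N ->
  window phi ->
  1 <= p <= 2 ->
  (q = 1 /\ 0 <= s) \/ [/\ 1 < q, 1 <= p^-1 + q^-1 & n%:R * (1 - q^-1) < s] ->
  (forall IF, closed_ideal (FLsmall q s) (FL q s) IF ->
     closed_ideal (Msmall p q s phi) (Mod p q s phi) (IF `&` Mod p q s phi)) /\
  (forall IF, closed_ideal (FLsmall q s) (FL q s) IF ->
     closure_in (FLsmall q s) (FL q s) (IF `&` Mod p q s phi) = IF) /\
  (forall IM, closed_ideal (Msmall p q s phi) (Mod p q s phi) IM ->
     closed_ideal (FLsmall q s) (FL q s) (closure_in (FLsmall q s) (FL q s) IM) /\
     closure_in (FLsmall q s) (FL q s) IM `&` Mod p q s phi = IM).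
Proof.
move=> n0 wphi /andP[p1 _] H.
have q1 : 1 <= q by case: H => [[-> _]|[/ltW]].
have s0 : 0 <= s.
  case: H => [[]//|[lq _ /ltW]]; apply: le_trans.
  by rewrite mulr_ge0// subr_ge0 invf_le1// (lt_trans ltr01).
have emb : embeds_L1 n q s by apply: embeds_L1P => //; case: H => [|[? ? ?]]; [left|right].
split; last split.
- by move=> IF; exact: closed_ideal_setI_Mod.
- by move=> IF; exact: closure_setI_Mod.
- move=> IM HIM; split; last exact: setI_closure_Mod.
  by apply: (closed_ideal_closure wphi p1 q1 s0 emb (proj1 HIM)).
Qed.
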